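(* Let $\tau\geq 0$ and let $\Omega\subseteq\mathbb{R}^d$ be an open set of finite volume such that some eigenfunction corresponding to the first eigenvalue $\Gamma(\Omega,\tau)$ of $S_\tau=\Delta^2-\tau\Delta$ over $\Omega$ (with Dirichlet boundary conditions) does not change sign. Then $$\Gamma(\Omega,\tau)\geq\Gamma(B,\tau),$$ where $B\subset\mathbb{R}^d$ is a ball of the same volume as $\Omega$.
   Context: For $\tau\in\mathbb{R}$ and an open set $\Omega\subset\mathbb{R}^d$ of finite volume, $S_\tau=\Delta^2-\tau\Delta$ acts with Dirichlet boundary conditions: $\Gamma\in\mathbb{R}$ is an eigenvalue with eigenfunction $u\in H_0^2(\Omega)$, $u\neq0$, if $\int_\Omega\Delta u\,\Delta v+\tau\int_\Omega\nabla u\cdot\nabla v=\Gamma\int_\Omega uv$ for all $v\in H_0^2(\Omega)$. Here $H_0^2(\Omega)$ is the closure of $C_c^\infty(\Omega)$ in $H^2(\Omega)$. The first (smallest) eigenvalue is $$\Gamma(\Omega,\tau)=\min_{v\in H_0^2(\Omega),\,v\neq0}\frac{\int_\Omega(\Delta v)^2+\tau\int_\Omega|\nabla v|^2}{\int_\Omega v^2},$$ and its minimisers are exactly the eigenfunctions associated with $\Gamma(\Omega,\tau)$. *)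

(* Defs.v *)
From HB Require Import structures.
From mathcomp Require Import all_boot all_order all_algebra.
From mathcomp Require Import all_classical all_reals all_analysis.
Set Implicit Arguments.
Unset Strict Implicit.
Unset Printing Implicit Defensive.
Import Order.TTheory GRing.Theory Num.Theory.
Import numFieldNormedType.Exports.
Local Open Scope classical_set_scope.
Local Open Scope ring_scope.

(* The measurable structure on R^d is the sigma-algebra generated by the
   coordinate maps. This is the Borel sigma-algebra (the nontrivial inclusion is
   [open_measurable_rV] below).                                               *)
Definition rV_display : measure_display -> measure_display.
Proof. exact. Qed.

Section measurable_rV.
Variables (R : realType) (d : nat).

Let coor (i : 'I_d) (x : 'rV[R]_d) : measurableTypeR R := x ord0 i.

Let rV_set0 : g_sigma_preimage coor set0.
Proof. exact: sigma_algebra0. Qed.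

Let rV_setC A : g_sigma_preimage coor A -> g_sigma_preimage coor (~` A).
Proof. exact: sigma_algebraC. Qed.

Let rV_bigcup (F : (set 'rV[R]_d)^nat) :
  (forall i, g_sigma_preimage coor (F i)) ->
  g_sigma_preimage coor (\bigcup_i (F i)).
Proof. exact: sigma_algebra_bigcup. Qed.

HB.instance Definition _ :=
  @isMeasurable.Build (rV_display default_measure_display) 'rV[R]_d
    (g_sigma_preimage coor) rV_set0 rV_setC rV_bigcup.

End measurable_rV.

Lemma measurable_coord (R : realType) d (i : 'I_d) :
  measurable_fun [set: 'rV[R]_d] (fun x => x ord0 i : measurableTypeR R).
Proof.
move=> _ Y mY; rewrite setTI; apply: sub_sigma_algebra => /=.
rewrite -bigcup_seq/=; exists i => /=; first by rewrite mem_index_enum.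
by exists Y => //; rewrite setTI.
Qed.

Lemma measurable_fun_coordP (R : realType) d d1 (T1 : measurableType d1)
    (f : T1 -> 'rV[R]_d) :
  (forall i, measurable_fun [set: T1] (fun x => f x ord0 i : measurableTypeR R)) ->
  measurable_fun [set: T1] f.
Proof.
move=> mf _ A mA; rewrite setTI.
pose coor (i : 'I_d) (x : 'rV[R]_d) : measurableTypeR R := x ord0 i.
have := @g_sigma_preimage_comp _ (measurableTypeR R) d _ coor _ f.
move/seteqP => [_ /(_ (f @^-1` A))] H.
have {}H : g_sigma_preimage (fun i => coor i \o f) (f @^-1` A).
  by apply: H; exists A => //; rewrite setTI.
move: H; apply: smallest_sub; first exact: sigma_algebra_measurable.
rewrite -bigcup_seq => B [i _ [C mC <-]].
exact: mf.
Qed.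

Section consrv.
Variables (R : realType) (d : nat).

Definition rVcons (p : measurableTypeR R * 'rV[R]_d) : 'rV[R]_d.+1 :=
  \row_i oapp (fun j => p.2 ord0 j) p.1 (unlift ord0 i).

Definition rVuncons (x : 'rV[R]_d.+1) : measurableTypeR R * 'rV[R]_d :=
  (x ord0 ord0, \row_i x ord0 (lift ord0 i)).

Lemma rVconsE0 p : rVcons p ord0 ord0 = p.1.
Proof. by rewrite mxE unlift_none. Qed.

Lemma rVconsES p i : rVcons p ord0 (lift ord0 i) = p.2 ord0 i.
Proof. by rewrite mxE liftK. Qed.

Lemma rVconsK : cancel rVcons rVuncons.
Proof.
move=> [a v]; congr pair; first by rewrite rVconsE0.
by apply/rowP => i; rewrite mxE rVconsES.
Qed.

Lemma measurable_rVcons : measurable_fun [set: _] rVcons.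
Proof.
apply: measurable_fun_coordP => i.
case: (unliftP ord0 i) => [j|] ->.
  rewrite (_ : (fun _ => _) =
    (fun x : 'rV[R]_d => x ord0 j : measurableTypeR R) \o snd); last first.
    by apply/funext => p /=; rewrite rVconsES.
  by apply: measurableT_comp => //; exact: measurable_coord.
rewrite (_ : (fun _ => _) = fst) //.
by apply/funext => p /=; rewrite rVconsE0.
Qed.

Lemma measurable_rVuncons : measurable_fun [set: _] rVuncons.
Proof.
apply/measurable_fun_pair; first exact: measurable_coord.
apply: measurable_fun_coordP => i.
rewrite (_ : (fun _ => _) =
  fun x : 'rV[R]_d.+1 => x ord0 (lift ord0 i) : measurableTypeR R).
  exact: measurable_coord.
by apply/funext => p /=; rewrite mxE.
Qed.

Variable m : {sigma_finite_measure set 'rV[R]_d -> \bar R}.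

Definition vol_succ : set 'rV[R]_d.+1 -> \bar R :=
  pushforward (@lebesgue_measure R \x m)%E rVcons.

Let vol_succ_measure : {measure set 'rV[R]_d.+1 -> \bar R}.
Proof.
pose p : {measure set _ -> \bar R} := (@lebesgue_measure R \x m)%E.
by refine (pushforward p rVcons : {measure set _ -> \bar R}); exact: measurable_rVcons.
Defined.

HB.instance Definition _ := Measure.copy vol_succ vol_succ_measure.

Let vol_succ_sigma_finite : sigma_finite setT vol_succ.
Proof.
have /sigma_finiteP[F [TF ndF Foo]] := sigma_finiteT (@lebesgue_measure R).
have /sigma_finiteP[G [TG ndG Goo]] := sigma_finiteT m.
exists (fun n => rVuncons @^-1` (F n `*` G n)).
  rewrite -preimage_bigcup; apply/esym/seteqP; split=> // x _ /=.
  have [k _ Fk] : (\bigcup_i F i) (rVuncons x).1 by rewrite -TF.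
  have [l _ Gl] : (\bigcup_i G i) (rVuncons x).2 by rewrite -TG.
  exists (maxn k l) => //; split.
  - by move: Fk; exact/subsetPset/ndF/leq_maxl.
  - by move: Gl; exact/subsetPset/ndG/leq_maxr.
move=> n; have [mFn Fnoo] := Foo n; have [mGn Gnoo] := Goo n; split.
  rewrite -[X in measurable X]setTI; apply: measurable_rVuncons => //.
  exact: measurableX.
rewrite /vol_succ /pushforward -comp_preimage.
rewrite (_ : rVuncons \o rVcons = id); last by apply/funext; exact: rVconsK.
by rewrite preimage_id product_measure1E// lte_mul_pinfty// ge0_fin_numE.
Qed.

HB.instance Definition _ := Measure_isSigmaFinite.Build _ _ _ vol_succ
  vol_succ_sigma_finite.

End consrv.

(* d-dimensional Lebesgue measure on the Borel sets, as an iterated product of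
   one-dimensional ones; see [vol_box].                                       *)
Fixpoint vol (R : realType) (d : nat) :
    {sigma_finite_measure set 'rV[R]_d -> \bar R} :=
  match d with
  | 0 => \d_(0 : 'rV[R]_0)
  | d'.+1 => vol_succ (vol R d')
  end.
Arguments vol {R d}.

Lemma measurable_box (R : realType) d (A : 'I_d -> set (measurableTypeR R)) :
  (forall i, measurable (A i)) ->
  measurable [set x : 'rV[R]_d | forall i, A i (x ord0 i)].
Proof.
move=> mA.
rewrite (_ : mkset _ = \bigcap_(i in [set: 'I_d]) ((fun x : 'rV[R]_d => x ord0 i) @^-1` A i)); last first.
  by apply/seteqP; split => x /= Ax i; [move=> _|]; exact: Ax.
apply: fin_bigcap_measurable => // i _.
by rewrite -[X in measurable X]setTI; exact: measurable_coord.
Qed.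

Lemma vol_box (R : realType) d (A : 'I_d -> set (measurableTypeR R)) :
  (forall i, measurable (A i)) ->
  vol [set x : 'rV[R]_d | forall i, A i (x ord0 i)]
  = (\prod_(i < d) (@lebesgue_measure R) (A i))%E.
Proof.
elim: d A => [|d IH] A mA.
  by rewrite big_ord0 /vol/= diracE mem_set// => -[].
rewrite big_ord_recl /= /vol_succ /pushforward.
rewrite (_ : @rVcons R d @^-1` _ = A ord0 `*` [set x : 'rV[R]_d | forall i, A (lift ord0 i) (x ord0 i)]).
  rewrite product_measure1E.
  - by rewrite (IH (fun i => A (lift ord0 i))).
  - exact: mA.
  - exact: (@measurable_box R d (fun i => A (lift ord0 i))).
apply/seteqP; split => [[a v]/= H|[a v]/= [H1 H2] i].
  split; first by have := H ord0; rewrite rVconsE0.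
  by move=> i; have := H (lift ord0 i); rewrite rVconsES.
case: (unliftP ord0 i) => [j|] ->; last by rewrite rVconsE0.
by rewrite rVconsES; exact: H2.
Qed.

Lemma open_measurable_rV (R : realType) d (A : set 'rV[R]_d) :
  open A -> measurable A.
Proof.
move=> oA.
pose B (p : 'rV[rat]_d * nat) : set 'rV[R]_d :=
  [set x | forall i, ball (ratr (p.1 ord0 i) : R) p.2.+1%:R^-1 (x ord0 i)].
pose F k := if unpickle k is Some p then
  (if `[< B p `<=` A >] then B p else set0) else set0.
rewrite (_ : A = \bigcup_k F k).
  apply: bigcup_measurable => k _; rewrite /F.
  case: unpickle => [p|]; last exact: measurable0.
  case: asboolP => _; last exact: measurable0.
  apply: (@measurable_box R d (fun i => ball (ratr (p.1 ord0 i) : R) p.2.+1%:R^-1)).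
  by move=> i; rewrite ball_itv; exact: measurable_itv.
apply/seteqP; split=> [x Ax|x [k _]]; last first.
  by rewrite /F; case: unpickle => // p; case: asboolP => // + Bx; exact.
have /nbhs_ballP[e /= e0 xeA] := open_nbhs_nbhs (conj oA Ax).
have [n ne] : exists n, n.+1%:R^-1 < e / 2.
  have e20 : 0 < e / 2 by rewrite divr_gt0.
  have [N _ /(_ _ (leqnn _))] := near_infty_natSinv_lt (PosNum e20).
  by exists N.
have n0 : 0 < n.+1%:R^-1 :> R by rewrite invr_gt0.
have q_ i : exists q : rat, ball (x ord0 i) n.+1%:R^-1 (ratr q).
  have [q] := @rat_in_itvoo R (x ord0 i - n.+1%:R^-1) (x ord0 i + n.+1%:R^-1)
    ltac:(by rewrite ltrBlDr -addrA ltrDl addr_gt0).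
  by rewrite in_itv/= => qi; exists q; rewrite /ball/= ltr_distlC.
have [q qP] := choice q_.
pose p := (\row_i q i, n).
exists (pickle p) => //; rewrite /F pickleK.
have Bx : B p x by move=> i; rewrite /= mxE; apply: ball_sym; exact: qP.
case: asboolP => // -[] y By; apply: xeA; split => // i j; rewrite ord1.
apply: (@ball_split _ _ (ratr (q j) : R)).
  by apply: (le_ball (ltW ne)); exact: qP.
by apply: (le_ball (ltW ne)); have := By j; rewrite /= mxE.
Qed.

Section sobolev.
Variables (R : realType) (d : nat).
Implicit Types (Omega : set 'rV[R]_d) (u v g phi : 'rV[R]_d -> R) (i : 'I_d).
Implicit Types (tau Gam : R).

(* The norm of 'rV[R]_d in the library is the sup norm. *)
Definition eball (c : 'rV[R]_d) (r : R) : set 'rV[R]_d :=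
  [set x | Num.sqrt (\sum_i (x ord0 i - c ord0 i) ^+ 2) < r].

Definition partial i phi : 'rV[R]_d -> R := 'D_(delta_mx ord0 i) phi.

(* All iterated partial derivatives are differentiable, hence continuous. *)
Definition smooth phi :=
  forall (s : seq 'I_d) (x : 'rV[R]_d), differentiable (foldr partial phi s) x.

(* C_c^infty(Omega), extended by 0 to R^d *)
Definition test_function Omega phi :=
  [/\ smooth phi, compact (closure [set x | phi x != 0])
    & closure [set x | phi x != 0] `<=` Omega].

(* Functions on Omega are represented by functions on R^d whose values outside
   Omega are irrelevant.                                                      *)
Definition L2 Omega u := u \_ Omega \in Lfun vol 2%:E.

Definition is_wpartial Omega i u g :=
  L2 Omega g /\ forall phi, test_function Omega phi ->
    \int[vol]_(x in Omega) (u x * partial i phi x)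
    = - \int[vol]_(x in Omega) (g x * phi x).

(* A representative of the weak i-th partial derivative of u in L^2(Omega); the
   derivative is unique up to a negligible set when it exists.                *)
Definition wpartial Omega i u : 'rV[R]_d -> R :=
  get [set g | is_wpartial Omega i u g].

Definition has_wpartial Omega i u := exists g, is_wpartial Omega i u g.

Definition H2 Omega u :=
  [/\ L2 Omega u, forall i, has_wpartial Omega i u
    & forall i j, has_wpartial Omega j (wpartial Omega i u)].

Definition H2norm Omega u : R :=
  Num.sqrt (\int[vol]_(x in Omega) u x ^+ 2
    + \sum_i \int[vol]_(x in Omega) wpartial Omega i u x ^+ 2
    + \sum_i \sum_j
        \int[vol]_(x in Omega) wpartial Omega j (wpartial Omega i u) x ^+ 2).

Definition H20 Omega u := H2 Omega u /\
  forall e : R, 0 < e ->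
    exists2 phi, test_function Omega phi & H2norm Omega (u \- phi) < e.

Definition wlaplacian Omega u x : R :=
  \sum_i wpartial Omega i (wpartial Omega i u) x.

Definition wgrad_dot Omega u v x : R :=
  \sum_i wpartial Omega i u x * wpartial Omega i v x.

Definition ae_zero Omega u := {ae vol, forall x, Omega x -> u x = 0}.

Definition is_eigenfunction Omega tau Gam u :=
  [/\ H20 Omega u, ~ ae_zero Omega u
    & forall v, H20 Omega v ->
      \int[vol]_(x in Omega) (wlaplacian Omega u x * wlaplacian Omega v x)
      + tau * \int[vol]_(x in Omega) wgrad_dot Omega u v x
      = Gam * \int[vol]_(x in Omega) (u x * v x)].

Definition rayleigh Omega tau v : R :=
  (\int[vol]_(x in Omega) wlaplacian Omega v x ^+ 2
   + tau * \int[vol]_(x in Omega) wgrad_dot Omega v v x)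
  / \int[vol]_(x in Omega) v x ^+ 2.

(* The infimum is attained when Omega is nonempty, open, of finite volume. *)
Definition first_eigenvalue Omega tau : R :=
  inf [set rayleigh Omega tau v | v in [set v | H20 Omega v /\ ~ ae_zero Omega v]].

Definition no_sign_change Omega u :=
  {ae vol, forall x, Omega x -> 0 <= u x} \/
  {ae vol, forall x, Omega x -> u x <= 0}.

End sobolev.

(* Main.v *)
(* Let [tau' > tau], [c = tau' / 2] and [L = - Delta + c]. On test functions the energy of
   [S_tau'] plus [c^2 |phi|^2] is [|L phi|^2], and it is enough to show that a lower bound
   [Lam |psi|^2 <= |L psi|^2] for test functions on the ball [B] implies
   [Lam |phi^+|^2 <= |L phi|^2] for test functions on [Omega], whatever the sign of [phi]: then
   [+-phi] tends to the eigenfunction of constant sign, whose positive part is itself, and [tau']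
   tends to [tau].
   Let [F] and [u] be the symmetric decreasing rearrangements of [L phi] and [phi^+]. Talenti's
   method (isoperimetric inequality, Cauchy-Schwarz and Hardy-Littlewood on the level sets) bounds
   the decrease of [u] by the integrals of [F - c u] over balls. Let [v] solve [L v = F] in a ball
   of radius [r1 <= r] with [v = v' = 0] at [r1] ([r1 = r] and only [v = 0] are imposed a priori if
   no such radius exists), and extend it by 0. A maximum principle for the integrals of [u - v]
   over balls gives [int_{B_s} u <= int_{B_s} v] for all [s]; as [u] is decreasing, [|u| <= |v|].
   Finally [v] is a limit of test functions on [B], so that
   [Lam |phi^+|^2 = Lam |u|^2 <= Lam |v|^2 <= |L v|^2 <= |F|^2 = |L phi|^2]. *)
From HB Require Import structures.
From mathcomp Require Import all_boot all_order all_algebra.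
From mathcomp Require Import all_classical all_reals all_analysis.
From mathcomp Require Import measurable_realfun.
From mathcomp Require Import ring lra.
Require Import Defs.
Set Implicit Arguments.
Unset Strict Implicit.
Unset Printing Implicit Defensive.
Import Order.TTheory GRing.Theory Num.Theory.
Import numFieldNormedType.Exports.
Local Open Scope classical_set_scope.
Local Open Scope ring_scope.

(** * Layer-cake estimates *)

(** Working with test functions [phi] avoids any regularity theory for the eigenfunction, but [phi]
    need not keep the sign of its limit; hence an inequality for [phi^+] against the energy of all
    of [phi]. Factoring through [L] turns the fourth-order problem into a second-order comparison.
    The price is that [v] must vanish at the boundary together with its derivative: with [v = 0]
    alone the first eigenvalue of the ball says nothing about it. The missing condition comes from
    [phi]: the integral of its Laplacian is 0, so that of [F - c u] over the whole ball is at most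
    0, and if [r1 = r] the comparison of [u] with [v] then forces the flux of [v] at [r] to vanish.
    The maximum principle needs [c > 0] strictly, which [tau = 0] would not give; hence
    [tau' > tau]. The sets [{phi > t}] may have irregular boundaries, so perimeters never appear:
    isoperimetry enters through volumes of neighbourhoods and integrals of [|grad|]. *)

Section staircase.
Context {R : realType}.
Implicit Types (y : R) (n : nat).

(** The sum counts the integers of [[1, n)] below [y], so up to an error of 1 it is [y] itself when
    [y <= n]; [stair_ge] is the other half. *)
Lemma stair_le n y : 0 <= y -> \sum_(1 <= j < n) (if j%:R < y then 1 else 0) <= y.
Proof.
move=> y0; case: n => [|n]; first by rewrite big_geq.
elim: n => [|n IH]; first by rewrite big_geq.
rewrite big_nat_recr//=; case: ifPn => [ny|_]; last by rewrite addr0.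
apply: (@le_trans _ _ (\sum_(1 <= j < n.+1) 1 + 1)).
  by rewrite lerD2r; apply: ler_sum => j _; case: ifP.
rewrite big_const_nat iter_addr_0 subn1/= -natr1 in ny *.
by rewrite (le_trans _ (ltW ny)).
Qed.

Lemma stair_ge n y : y <= n%:R -> y <= 1 + \sum_(1 <= j < n) (if j%:R < y then 1 else 0).
Proof.
case: n => [|n]; first by move=> y0; rewrite big_geq// addr0 (le_trans y0).
elim: n => [|n IH] yn; first by rewrite big_geq// addr0.
rewrite big_nat_recr//=; case: ifPn => [ny|]; last first.
  by rewrite -leNgt addr0; exact: IH.
rewrite (eq_big_nat _ _ (F2 := fun=> 1)); last first.
  by move=> j /andP[_ jn]; rewrite ifT// (le_lt_trans _ ny)// ler_nat ltnW.
by rewrite big_const_nat iter_addr_0 subn1/= natr1 addrC natr1.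
Qed.

End staircase.

Section bounded_integrals.
Context d {T : measurableType d} {R : realType} (mu : {measure set T -> \bar R}).
Variable D : set T.
Hypotheses (mD : measurable D) (finD : (mu D < +oo)%E).
Implicit Types f g w : T -> R.

Lemma bounded_integrable f (M : R) : measurable_fun D f ->
  (forall x, D x -> `|f x| <= M) -> mu.-integrable D (EFin \o f).
Proof.
move=> mf fM; apply: measurable_bounded_integrable => //.
rewrite /bounded_near; near=> A => x /= Dx; rewrite (le_trans (fM _ Dx))//.
Unshelve. all: by end_near. Qed.

Lemma measurable_gt f (a : R) : measurable_fun D f -> measurable (D `&` [set x | a < f x]).
Proof.
move=> mf; rewrite (_ : [set x | a < f x] = f @^-1` `]a, +oo[%classic); last first.
  by apply/seteqP; split => x /=; rewrite in_itv/= ?andbT.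
exact: mf.
Qed.

Lemma fin_meas_sub A : measurable A -> A `<=` D -> (mu A \is a fin_num)%E.
Proof.
move=> mA AD; rewrite ge0_fin_numE// (le_lt_trans _ finD)// le_measure ?inE//.
Qed.

(** A lower Riemann sum of step [1 / n] for the layer-cake formula: a function with values in
    [[0, 1]] is the integral over [t] in [[0, 1]] of the indicators of [{t < f}]. *)
Definition stair n f x : R := n%:R^-1 * \sum_(1 <= j < n) (if j%:R / n%:R < f x then 1 else 0).

Lemma stair_le1 n f x : (0 < n)%N -> 0 <= f x -> stair n f x <= f x.
Proof.
move=> n0 f0; have n0' : 0 < n%:R :> R by rewrite ltr0n.
rewrite /stair ler_pdivrMl//.
rewrite (eq_bigr (fun j => if j%:R < n%:R * f x then 1 else 0)).
  by apply: stair_le; rewrite mulr_ge0.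
by move=> j _; rewrite ltr_pdivrMr// mulrC.
Qed.

Lemma stair_ge0 n f x : 0 <= stair n f x.
Proof. by rewrite mulr_ge0 ?invr_ge0// sumr_ge0// => j _; case: ifP. Qed.

Lemma stair_ge1 n f x : (0 < n)%N -> f x <= 1 -> f x <= n%:R^-1 + stair n f x.
Proof.
move=> n0 f0; have n0' : 0 < n%:R :> R by rewrite ltr0n.
rewrite /stair -[X in _ <= X + _]mulr1 -mulrDr ler_pdivlMl//.
rewrite (eq_bigr (fun j => if j%:R < n%:R * f x then 1 else 0)).
  by apply: stair_ge; rewrite ger_pMr.
by move=> j _; rewrite ltr_pdivrMr// mulrC.
Qed.

Lemma measurable_step f (a : R) : measurable_fun D f ->
  measurable_fun D (fun x => if a < f x then 1 else 0 : R).
Proof.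
move=> mf; apply: measurable_fun_if => //; exact: measurable_fun_ltr.
Qed.

Lemma measurable_stair n f : measurable_fun D f -> measurable_fun D (stair n f).
Proof.
move=> mf; apply: measurable_funM => //.
apply: (@measurable_sum _ _ _ _ _ _ (fun j x => if j%:R / n%:R < f x then 1 else 0)).
by move=> j; exact: measurable_step.
Qed.

Lemma Rintegral_sum I (s : seq I) (F : I -> T -> R) :
  (forall i, mu.-integrable D (EFin \o F i)) ->
  \int[mu]_(x in D) (\sum_(i <- s) F i x) = \sum_(i <- s) \int[mu]_(x in D) F i x.
Proof.
move=> iF; elim: s => [|i s IH].
  rewrite big_nil (@eq_Rintegral _ _ _ mu D (fun=> 0)); last by move=> x _; rewrite big_nil.
  by rewrite Rintegral_cst// mul0r.
rewrite big_cons -IH -RintegralD//.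
  by apply: eq_Rintegral => x _; rewrite big_cons.
have := integrable_sum mD s (P := xpredT) (fun i _ => iF i).
by apply: eq_integrable => // x _ /=; rewrite -sumEFin.
Qed.

Lemma integrable_step_mul f g (a : R) : measurable_fun D f ->
  mu.-integrable D (EFin \o g) ->
  mu.-integrable D (EFin \o (fun x => g x * (if a < f x then 1 else 0))).
Proof.
move=> mf ig; have mg : measurable_fun D g by apply/measurable_EFinP; exact: measurable_int ig.
apply: (le_integrable mD _ _ ig) => /=.
  by apply/measurable_EFinP; apply: measurable_funM => //; exact: measurable_step.
by move=> x Dx /=; rewrite lee_fin normrM ler_piMr//; case: ifP; rewrite ?normr1 ?normr0.
Qed.

Lemma Rintegral_step_mul f g (a : R) :
  \int[mu]_(x in D) (g x * (if a < f x then 1 else 0))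
  = \int[mu]_(x in D `&` [set x | a < f x]) g x.
Proof.
rewrite Rintegral_mkcondr; apply: eq_Rintegral => x _.
rewrite patchE (_ : (x \in _) = (a < f x)); last by apply/idP/idP; rewrite inE.
by case: ifP; rewrite ?mulr1 ?mulr0.
Qed.

Lemma Rintegral_mul_stair n f g : measurable_fun D f ->
  mu.-integrable D (EFin \o g) ->
  \int[mu]_(x in D) (g x * stair n f x)
  = n%:R^-1 * \sum_(1 <= j < n) \int[mu]_(x in D `&` [set x | j%:R / n%:R < f x]) g x.
Proof.
move=> mf ig.
rewrite (@eq_Rintegral _ _ _ mu D (fun x => n%:R^-1 * \sum_(1 <= j < n)
    (g x * (if j%:R / n%:R < f x then 1 else 0)))); last first.
  by move=> x _; rewrite /stair mulrCA mulr_sumr.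
rewrite RintegralZl//; last first.
  have := integrable_sum mD (index_iota 1 n) (P := xpredT)
    (fun j _ => integrable_step_mul (j%:R / n%:R) mf ig).
  by apply: eq_integrable => // x _ /=; rewrite -sumEFin.
rewrite Rintegral_sum; last by move=> j; exact: integrable_step_mul.
by congr (_ * _); apply: eq_bigr => j _; rewrite Rintegral_step_mul.
Qed.

(** With [Rintegral_le_stair], it encloses an integral between Riemann sums of the measures of
    superlevel sets. An inequality known level by level thus passes to integrals, at the price of an
    error [mu D / n]. *)
Lemma Rintegral_ge_stair n f : (0 < n)%N -> mu.-integrable D (EFin \o f) ->
  (forall x, D x -> 0 <= f x) ->
  n%:R^-1 * \sum_(1 <= j < n) fine (mu (D `&` [set x | j%:R / n%:R < f x]))
  <= \int[mu]_(x in D) f x.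
Proof.
move=> n0 If f0; have mf : measurable_fun D f by apply/measurable_EFinP; exact: measurable_int If.
have i1 : mu.-integrable D (EFin \o cst (1 : R)).
  by apply: (@bounded_integrable _ 1) => // x _; rewrite normr1.
rewrite (eq_bigr (fun j => \int[mu]_(x in D `&` [set x | j%:R / n%:R < f x]) cst 1 x));
  last by move=> j _; rewrite Rintegral_cst ?mul1r//; exact: measurable_gt.
rewrite -(@Rintegral_mul_stair n f (cst 1))//.
apply: le_Rintegral => //.
  apply: (le_integrable mD _ _ If).
    by apply/measurable_EFinP; apply: measurable_funM => //; exact: measurable_stair.
  move=> x Dx; rewrite lee_fin/= mul1r !ger0_norm ?stair_ge0 ?stair_le1//; exact: f0.
by move=> x Dx; rewrite mul1r stair_le1// f0.
Qed.

Lemma Rintegral_le_stair n f : (0 < n)%N -> measurable_fun D f ->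
  (forall x, D x -> 0 <= f x <= 1) ->
  \int[mu]_(x in D) f x <= n%:R^-1 * fine (mu D)
   + n%:R^-1 * \sum_(1 <= j < n) fine (mu (D `&` [set x | j%:R / n%:R < f x])).
Proof.
move=> n0 mf f01.
have i1 : mu.-integrable D (EFin \o cst (1 : R)).
  by apply: (@bounded_integrable _ 1) => // x _; rewrite normr1.
rewrite (eq_bigr (fun j => \int[mu]_(x in D `&` [set x | j%:R / n%:R < f x]) cst 1 x));
  last by move=> j _; rewrite Rintegral_cst ?mul1r//; exact: measurable_gt.
rewrite -(@Rintegral_mul_stair n f (cst 1))// -Rintegral_cst//.
have ist : mu.-integrable D (EFin \o (fun x => cst 1 x * stair n f x)).
  apply: (@bounded_integrable _ 1).
    by apply: measurable_funM => //; exact: measurable_stair.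
  move=> x Dx; have /andP[f0 f1] := f01 _ Dx; rewrite mul1r ger0_norm.
    exact: le_trans (stair_le1 n0 f0) f1.
  exact: stair_ge0.
have icst : mu.-integrable D (EFin \o cst (n%:R^-1 : R)).
  by apply: (@bounded_integrable _ (n%:R^-1)) => // x _; rewrite ger0_norm// invr_ge0.
rewrite -RintegralD//.
apply: le_Rintegral => //.
- apply: (@bounded_integrable _ 1) => // x Dx; have /andP[f0 f1] := f01 _ Dx.
  by rewrite ger0_norm.
- have := integrableD mD icst ist.
  by apply: eq_integrable.
- by move=> x Dx; rewrite mul1r stair_ge1//; have /andP[] := f01 _ Dx.
Qed.

(* Abel summation: [w] is an average of the indicators of its superlevel sets. *)
Lemma Rintegral_mul_le f g (M : R) : measurable_fun D f ->
  mu.-integrable D (EFin \o g) -> (forall x, D x -> 0 <= f x <= 1) -> 0 <= M ->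
  (forall t, 0 <= t < 1 -> \int[mu]_(x in D `&` [set x | t < f x]) g x <= M) ->
  \int[mu]_(x in D) (g x * f x) <= M.
Proof.
move=> mf ig f01 M0 gM.
have mg : measurable_fun D g by apply/measurable_EFinP; exact: measurable_int ig.
pose C := \int[mu]_(x in D) `|g x|.
have ign : mu.-integrable D (EFin \o (fun x => `|g x|)) by exact: integrable_norm ig.
have st01 n x : (0 < n)%N -> D x -> `|stair n f x| <= 1.
  move=> n0 Dx; have /andP[f0 f1] := f01 _ Dx; rewrite ger0_norm.
    exact: le_trans (stair_le1 n0 f0) f1.
  exact: stair_ge0.
(* The staircase is within [1 / n] of [f], whence the error [C / n]; its levels [j / n] lie in
   [[0, 1)], where [gM] applies. *)
have H n : (0 < n)%N -> \int[mu]_(x in D) (g x * f x) <= M + n%:R^-1 * C.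
  move=> n0; have n0' : 0 < n%:R :> R by rewrite ltr0n.
  have ist : mu.-integrable D (EFin \o (fun x => g x * stair n f x)).
    apply: (le_integrable mD _ _ ig) => /=.
      by apply/measurable_EFinP; apply: measurable_funM => //; exact: measurable_stair.
    by move=> x Dx; rewrite lee_fin normrM ler_piMr// st01.
  have icn : mu.-integrable D (EFin \o (fun x => n%:R^-1 * `|g x|)).
    by have := integrableZl mD (n%:R^-1) ign; apply: eq_integrable.
  apply: (@le_trans _ _ (\int[mu]_(x in D) (g x * stair n f x + n%:R^-1 * `|g x|))).
    apply: le_Rintegral => //.
    - apply: (le_integrable mD _ _ ig) => /=.
        by apply/measurable_EFinP; apply: measurable_funM.
      move=> x Dx; rewrite lee_fin normrM ler_piMr//.
      by have /andP[f0 f1] := f01 _ Dx; rewrite ger0_norm.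
    - by have := integrableD mD ist icn; apply: eq_integrable.
    - move=> x Dx; have /andP[f0 f1] := f01 _ Dx.
      rewrite -lerBlDl -mulrBr (le_trans (ler_norm _))// normrM mulrC ler_wpM2r//.
      by rewrite ger0_norm ?subr_ge0 ?stair_le1// lerBlDr stair_ge1.
  rewrite RintegralD// Rintegral_mul_stair// RintegralZl// lerD2r.
  apply: (@le_trans _ _ (n%:R^-1 * \sum_(1 <= j < n) M)).
    rewrite ler_pM2l ?invr_gt0// ler_sum_nat// => j /andP[j1 jn]; apply: gM.
    by rewrite divr_ge0//= ltr_pdivrMr// mul1r ltr_nat.
  by rewrite ler_pdivrMl// big_const_nat iter_addr_0 -[M *+ _]mulr_natl ler_wpM2r// ler_nat leq_subr.
have C0 : 0 <= C by exact: Rintegral_ge0.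
apply/ler_addgt0Pr => e e0.
pose n := (Num.truncn (C / e)).+1.
apply: (le_trans (H n isT)); rewrite lerD2l ler_pdivrMl ?ltr0n//.
rewrite -ler_pdivrMr//; apply: ltW.
by rewrite truncnS_gt.
Qed.

End bounded_integrals.

(** * Lebesgue measure on R^d *)

Section volume.
Context {R : realType}.
Local Notation leb := (@lebesgue_measure R).

Lemma continuous_measurable_rV d (f : 'rV[R]_d -> R) : continuous f ->
  measurable_fun [set: 'rV[R]_d] f.
Proof.
move=> /continuousP cf; apply: (measurability _ (RGenOpens.measurableE R)) => //.
move=> _ [_ [a [b ->] <-]]; rewrite setTI; apply: open_measurable_rV; exact: cf.
Qed.

Section affine_line.
Variables (a b : R).
Hypothesis a0 : 0 < a.

Let S (s : measurableTypeR R) : measurableTypeR R := a * s + b.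

Let mS : measurable_fun setT S.
Proof. by apply: measurable_funD => //; exact: measurable_funM. Qed.

Let pS : {measure set (measurableTypeR R) -> \bar R}.
Proof. by refine (pushforward leb S : {measure set _ -> \bar R}). Defined.

Lemma ge0_integral_affine_line (f : R -> \bar R) : measurable_fun setT f ->
  (forall x, 0 <= f x)%E ->
  (\int[leb]_s f (a * s + b)%R = a^-1%:E * \int[leb]_s f s)%E.
Proof.
move=> mf f0.
have a'0 : 0 <= a^-1 by rewrite invr_ge0 ltW.
(* By uniqueness of Lebesgue measure: [a] times the image measure under [S] gives each half-open
   interval its length. *)
have pushE A : measurable A -> leb A = mscale (NngNum (ltW a0)) pS A.
  apply: (@lebesgue_measure_unique R (mscale (NngNum (ltW a0)) pS)).
  move=> _ [[x y] _ <-] /=; rewrite /mscale/= /pushforward.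
  rewrite (_ : S @^-1` _ = `](x - b) / a, (y - b) / a]%classic); last first.
    apply/seteqP; split => s /=; rewrite /S !in_itv/= ltr_pdivrMr// ler_pdivlMr//;
      by rewrite ltrBlDr lerBrDr (mulrC s).
  rewrite !lebesgue_measure_itv/= !lte_fin ltr_pM2r ?invr_gt0// ltrD2r.
  case: ifPn => xy; last by rewrite mule0.
  by rewrite -!EFinB -EFinM -mulrBl mulrCA divff ?gt_eqF// mulr1 opprB addrA subrK.
rewrite [in RHS](eq_measure_integral (mscale (NngNum (ltW a0)) pS)); last first.
  by move=> A mA _; rewrite /= pushE.
rewrite ge0_integral_mscale//= muleA -EFinM mulVf ?gt_eqF// mul1e.
rewrite ge0_integral_pushforward//.
Qed.

End affine_line.

Lemma vol_succ_integral d (f : 'rV[R]_d.+1 -> \bar R) : measurable_fun setT f ->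
  (forall x, 0 <= f x)%E ->
  (\int[vol]_x f x = \int[leb]_a \int[vol]_y f (rVcons (a, y)))%E.
Proof.
move=> mf f0.
have := @fubini_tonelli1 _ _ _ _ _ leb (@vol R d) (f \o @rVcons R d).
rewrite /fubini_F/= => <-//; last first.
  by apply: measurableT_comp => //; exact: measurable_rVcons.
pose p : {measure set _ -> \bar R} := (leb \x @vol R d)%E.
exact: (@ge0_integral_pushforward _ _ _ _ _ _ (@measurable_rVcons R d) p setT f measurableT mf).
Qed.

Lemma measurable_affine d (a : R) (b : 'rV[R]_d) :
  measurable_fun setT (fun x : 'rV[R]_d => a *: x + b : 'rV[R]_d).
Proof.
apply: measurable_fun_coordP => i.
rewrite (_ : (fun _ => _) = fun x : 'rV[R]_d => a * x ord0 i + b ord0 i); last first.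
  by apply/funext => x; rewrite !mxE.
apply: measurable_funD => //; apply: measurable_funM => //; exact: measurable_coord.
Qed.

Lemma ge0_integral_affine d (a : R) (b : 'rV[R]_d) (f : 'rV[R]_d -> \bar R) :
  0 < a -> measurable_fun setT f -> (forall x, 0 <= f x)%E ->
  (\int[vol]_x f (a *: x + b)%R = (a^-1 ^+ d)%:E * \int[vol]_x f x)%E.
Proof.
move=> a0; elim: d b f => [|d IH] b f mf f0.
  rewrite expr0 mul1e; apply: eq_integral => x _; congr f.
  by apply/rowP => -[].
rewrite vol_succ_integral//; last first.
  by apply: (measurableT_comp mf); exact: measurable_affine.
have mfc s : measurable_fun setT (fun y : 'rV[R]_d => f (rVcons (s, y))).
  apply: (measurableT_comp mf); apply: (measurableT_comp (@measurable_rVcons R d)).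
  exact: measurable_pair1.
have E s y : a *: rVcons (s, y) + b
    = rVcons (a * s + b ord0 ord0, a *: y + \row_i b ord0 (lift ord0 i)).
  apply/rowP => i; rewrite [LHS]mxE [X in X + _]mxE.
  case: (unliftP ord0 i) => [j|] ->; last by rewrite !rVconsE0.
  by rewrite !rVconsES/= !mxE.
under eq_integral do (under eq_integral do rewrite E).
under eq_integral => s _ do rewrite (IH _ (fun y => f (rVcons (a * s + b ord0 ord0, y))))//.
have mF : measurable_fun setT (fun s : measurableTypeR R => \int[vol]_y f (rVcons (s, y)))%E.
  have := @measurable_fun_fubini_tonelli_F _ _ _ _ _ (@vol R d) (f \o @rVcons R d).
  apply => //; first by apply: (measurableT_comp mf); exact: measurable_rVcons.
  by move=> x /=.
rewrite ge0_integralZl//; last 3 first.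
- apply: (measurableT_comp mF).
  by apply: measurable_funD => //; exact: measurable_funM.
- by move=> s _; exact: integral_ge0.
- by rewrite lee_fin exprn_ge0// invr_ge0 ltW.
rewrite (ge0_integral_affine_line (b ord0 ord0) a0 mF); last first.
  by move=> s; exact: integral_ge0.
by rewrite muleA -EFinM -exprSr vol_succ_integral.
Qed.

Lemma vol_affine d (a : R) (b : 'rV[R]_d) (A : set 'rV[R]_d) : 0 < a -> measurable A ->
  vol ((fun x : 'rV[R]_d => a *: x + b : 'rV[R]_d) @^-1` A) = ((a^-1 ^+ d)%:E * vol A)%E.
Proof.
move=> a0 mA; have mp : measurable ((fun x : 'rV[R]_d => a *: x + b : 'rV[R]_d) @^-1` A).
  by rewrite -[X in measurable X]setTI; exact: measurable_affine.
rewrite -[in RHS](setIT A) -integral_indic// -(ge0_integral_affine b)//; last exact/measurable_EFinP.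
by rewrite -[in LHS](setIT (_ @^-1` _)) -integral_indic.
Qed.

(** A ball of the sup norm, used as a container for supports because it is compact and of finite
    volume. *)
Definition cube d (M : R) : set 'rV[R]_d := [set x | forall i, `|x ord0 i| <= M].
Arguments cube : clear implicits.

Lemma cubeE d (M : R) :
  cube d M = [set x : 'rV[R]_d | forall i, `[- M, M]%classic (x ord0 i)].
Proof. by apply/seteqP; split => x /= xM i; have := xM i; rewrite in_itv/= ler_norml. Qed.

Lemma measurable_cube d (M : R) : measurable (cube d M).
Proof.
by rewrite cubeE; apply: (@measurable_box R d (fun=> `[- M, M]%classic)) => i; exact: measurable_itv.
Qed.

Lemma vol_cube_fin d (M : R) : (vol (cube d M) < +oo)%E.
Proof.
rewrite cubeE (@vol_box R d (fun=> `[- M, M]%classic)).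
  rewrite ltey_eq (_ : _ \is a fin_num)//.
  elim/big_ind: _ => // [x y|i _]; first exact: fin_numM.
  by rewrite /= lebesgue_measure_itv/=; case: ifP => _; rewrite -?EFinB.
by move=> i; exact: measurable_itv.
Qed.

End volume.
Arguments cube {R} d M.
Arguments measurable_cube {R} d M.
Arguments vol_cube_fin {R} d M.

Section rV_topology.
Context {R : realType} {d : nat}.
Implicit Types (x y c : 'rV[R]_d) (A K : set 'rV[R]_d).

Definition enorm x : R := Num.sqrt (\sum_i x ord0 i ^+ 2).

Lemma enorm_ge0 x : 0 <= enorm x. Proof. exact: sqrtr_ge0. Qed.

Lemma sqr_enorm x : enorm x ^+ 2 = \sum_i x ord0 i ^+ 2.
Proof. by rewrite sqr_sqrtr// sumr_ge0// => i _; exact: sqr_ge0. Qed.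

Lemma eballE c r : eball c r = [set x | enorm (x - c) < r].
Proof.
apply/seteqP; split => x /=; rewrite /eball/enorm/=;
  by under eq_bigr do rewrite ?mxE; under [in X in _ -> X]eq_bigr do rewrite ?mxE.
Qed.

Lemma ler_coord_enorm x i : `|x ord0 i| <= enorm x.
Proof.
rewrite -sqrtr_sqr ler_sqrt ?sumr_ge0//; last by move=> j _; exact: sqr_ge0.
by rewrite (bigD1 i)//= lerDl sumr_ge0// => j _; exact: sqr_ge0.
Qed.

Lemma enormZ (a : R) x : enorm (a *: x) = `|a| * enorm x.
Proof.
rewrite /enorm -sqrtr_sqr -sqrtrM ?sqr_ge0// mulr_sumr.
by congr Num.sqrt; apply: eq_bigr => i _; rewrite mxE exprMn.
Qed.

Lemma enormN x : enorm (- x) = enorm x.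
Proof. by rewrite -scaleN1r enormZ normrN1 mul1r. Qed.

Lemma CS_sum (a b : 'I_d -> R) :
  \sum_i a i * b i <= Num.sqrt (\sum_i a i ^+ 2) * Num.sqrt (\sum_i b i ^+ 2).
Proof.
set A := \sum_i a i ^+ 2; set B := \sum_i b i ^+ 2; set C := \sum_i _.
have A0 : 0 <= A by apply: sumr_ge0 => i _; exact: sqr_ge0.
have B0 : 0 <= B by apply: sumr_ge0 => i _; exact: sqr_ge0.
have quad (t : R) : 0 <= A * t ^+ 2 - 2 * C * t + B.
  rewrite (_ : _ + B = \sum_i (a i * t - b i) ^+ 2).
    by apply: sumr_ge0 => i _; exact: sqr_ge0.
  rewrite /A /B /C mulr_suml mulr_sumr mulr_suml -sumrB -big_split/=.
  by apply: eq_bigr => i _; ring.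
apply: (le_trans (ler_norm _)).
rewrite -sqrtrM// -sqrtr_sqr ler_sqrt ?mulr_ge0//.
have [A1|A1] := ltrP 0 A; last first.
  have A00 : A = 0 by apply/eqP; rewrite eq_le A0 A1.
  have a00 i : a i = 0.
    move/eqP: A00; rewrite psumr_eq0; last by move=> j _; exact: sqr_ge0.
    by move/allP/(_ i (mem_index_enum _)); rewrite sqrf_eq0 => /eqP.
  rewrite /C (eq_bigr (fun=> 0)); last by move=> i _; rewrite a00 mul0r.
  by rewrite big1// A00 mul0r expr0n.
have := quad (C / A).
rewrite (_ : A * (C / A) ^+ 2 - 2 * C * (C / A) + B = (A * B - C ^+ 2) / A); last first.
  by field; rewrite gt_eqF.
by rewrite pmulr_lge0 ?invr_gt0// subr_ge0.
Qed.

Lemma enormD x y : enorm (x + y) <= enorm x + enorm y.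
Proof.
rewrite -ler_sqr ?nnegrE ?addr_ge0 ?enorm_ge0// sqrrD !sqr_enorm.
rewrite (eq_bigr (fun i => x ord0 i ^+ 2 + (x ord0 i * y ord0 i) *+ 2 + y ord0 i ^+ 2)); last first.
  by move=> i _; rewrite mxE sqrrD.
rewrite 2!big_split/= lerD2r lerD2l sumrMnl lerMn2r/=.
exact: (CS_sum (x ord0) (y ord0)).
Qed.

Lemma norm_le_enorm x : `|x| <= enorm x.
Proof.
rewrite [leLHS]/Num.Def.normr/= mx_normrE (bigmax_le _ (enorm_ge0 x))//= => -[i j] _.
by rewrite ord1; exact: ler_coord_enorm.
Qed.

Lemma enorm_continuous : continuous enorm.
Proof.
have c2 : continuous (fun x : 'rV[R]_d => \sum_i x ord0 i ^+ 2).
  apply: continuous_big => [|i _ y]; first exact: add_continuous.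
  apply: (@continuous_comp _ _ _ (fun x : 'rV[R]_d => x ord0 i) (fun t => t ^+ 2)).
    exact: coord_continuous.
  exact: exprn_continuous.
by move=> x; apply: (continuous_comp (c2 x)); exact: sqrt_continuous.
Qed.

Lemma enorm_sub_continuous c : continuous (fun x => enorm (x - c)).
Proof.
move=> x; apply: (@continuous_comp _ _ _ (fun x : 'rV[R]_d => x - c)).
  by apply: continuousB; [exact: cvg_id|exact: cst_continuous].
exact: enorm_continuous.
Qed.

Lemma open_eball c r : open (eball c r).
Proof.
rewrite eballE (_ : mkset _ = (fun x => enorm (x - c)) @^-1` `]-oo, r[%classic).
  apply: open_comp; last exact: interval_open.
  by move=> x _; exact: enorm_sub_continuous.
by apply/seteqP; split => x /=; rewrite in_itv/=.
Qed.

Lemma measurable_eball c r : measurable (eball c r).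
Proof. by apply: open_measurable_rV; exact: open_eball. Qed.

Lemma vol_eball_fin c r : (vol (eball c r) < +oo)%E.
Proof.
pose M := enorm c + `|r|.
apply: le_lt_trans (vol_cube_fin d M).
apply: le_measure; rewrite ?inE.
- exact: measurable_eball.
- exact: measurable_cube.
- rewrite eballE => x /= xr i; rewrite (le_trans (ler_coord_enorm _ _))//.
  rewrite -(subrK c x) (le_trans (enormD _ _))// addrC lerD2l.
  by rewrite (le_trans (ltW xr))// ler_norm.
Qed.

Lemma vol_eballE c r : 0 < r -> vol (eball c r) = ((r ^+ d)%:E * vol (eball (0 : 'rV[R]_d) 1))%E.
Proof.
move=> r0.
have := @vol_affine R d r^-1 (- (r^-1 *: c)) (eball 0 1).
rewrite invr_gt0 => /(_ r0 (measurable_eball _ _)).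
rewrite invrK => <-; congr (vol _).
rewrite !eballE; apply/seteqP; split => x; rewrite /= subr0 -scalerBr enormZ gtr0_norm ?invr_gt0//;
  by rewrite mulrC ltr_pdivrMr// mul1r.
Qed.

Lemma vol_open_gt0 A : open A -> A !=set0 -> (0 < vol A)%E.
Proof.
move=> oA [x Ax]; have /nbhs_ballP[e /= e0 xeA] := open_nbhs_nbhs (conj oA Ax).
pose B := [set y : 'rV[R]_d | forall i, `]x ord0 i - e, x ord0 i + e[%classic (y ord0 i)].
have mB : measurable B.
  apply: (@measurable_box R d (fun i => `]x ord0 i - e, x ord0 i + e[%classic)) => i.
  exact: measurable_itv.
apply: (@lt_le_trans _ _ (vol B)).
  rewrite (@vol_box R d (fun i => `]x ord0 i - e, x ord0 i + e[%classic)); last first.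
    by move=> i; exact: measurable_itv.
  elim/big_ind: _ => // [y z y0 z0|i _]; first exact: mule_gt0.
  by rewrite lebesgue_measure_itv/= lte_fin ltrD2l gtrN// -EFinB lte_fin; lra.
apply: le_measure; rewrite ?inE//; first exact: open_measurable_rV.
move=> y By; apply: xeA; split => // i j; rewrite ord1.
by have := By j; rewrite /= in_itv/= /ball/= ltr_distlC.
Qed.

Definition omega : R := fine (vol (eball (0 : 'rV[R]_d) 1)).

Lemma omega_gt0 : 0 < omega.
Proof.
rewrite fine_gt0// vol_eball_fin andbT vol_open_gt0//; first exact: open_eball.
by exists 0; rewrite eballE/= subrr /enorm big1 ?sqrtr0// => i _; rewrite mxE expr0n.
Qed.

(** The condition [0 < d] matters at [r = 0], where the open ball is empty and [r ^+ d] has to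
    vanish. *)
Lemma vol_eball c r : (0 < d)%N -> 0 <= r -> vol (eball c r) = (omega * r ^+ d)%:E.
Proof.
move=> d0; rewrite le_eqVlt => /predU1P[<-|r0]; last first.
  by rewrite vol_eballE// mulrC EFinM fineK// ge0_fin_numE// vol_eball_fin.
rewrite expr0n gtn_eqF// mulr0 eballE (_ : mkset _ = set0) ?measure0//.
by apply/seteqP; split => x //=; rewrite ltNge enorm_ge0.
Qed.

End rV_topology.
Arguments omega : clear implicits.

(** * Brunn-Minkowski and isoperimetric inequalities *)

Section prekopa_leindler.
Context {R : realType}.
Local Notation leb := (@lebesgue_measure R).
Implicit Types l : R.

Lemma weighted_amgm l (x y : R) : 0 < l < 1 -> 0 <= x -> 0 <= y ->
  x `^ (1 - l) * y `^ l <= (1 - l) * x + l * y.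
Proof.
move=> /andP[l0 l1] x0 y0; have l'0 : 0 < 1 - l by rewrite subr_gt0.
have := @conjugate_powR _ (x `^ (1 - l)) (y `^ l) (1 - l)^-1 l^-1.
rewrite !powR_ge0 !invr_gt0 l0 l'0 => /(_ isT isT isT isT).
rewrite !invrK subrK => /(_ erefl) /le_trans; apply.
by rewrite -!powRrM !divff ?gt_eqF// !powRr1// mulrC (mulrC l).
Qed.

Definition affine_line (a b : R) (s : measurableTypeR R) : measurableTypeR R := a * s + b.

Lemma measurable_affine_line a b : measurable_fun setT (affine_line a b).
Proof. by apply: measurable_funD => //; exact: measurable_funM. Qed.

Lemma lebesgue_affine (a b : R) (A : set (measurableTypeR R)) : 0 < a -> measurable A ->
  (leb (affine_line a b @^-1` A) = a^-1%:E * leb A)%E.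
Proof.
move=> a0 mA.
have mp : measurable (affine_line a b @^-1` A).
  by rewrite -[X in measurable X]setTI; exact: measurable_affine_line.
rewrite -[in RHS](setIT A) -integral_indic// -(ge0_integral_affine_line b)//; last exact/measurable_EFinP.
by rewrite -[in LHS](setIT (_ @^-1` _)) -integral_indic.
Qed.

(** The class in which Prekopa-Leindler is proved. With [D] a cube it is stable under slicing and
    under integrating out coordinates, so the induction on the dimension stays inside it. *)
Definition tame d (T : measurableType d) (D : set T) (f : T -> R) :=
  [/\ measurable_fun setT f, exists M, forall x, 0 <= f x <= M & forall x, ~ D x -> f x = 0].

Section line.
Variable M : R.
Let D : set (measurableTypeR R) := `[- M, M]%classic.

Let mD : measurable D. Proof. exact: measurable_itv. Qed.

Let finD : (leb D < +oo)%E.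
Proof. by rewrite /D lebesgue_measure_itv/=; case: ifP => _; rewrite -?EFinB ltry. Qed.

(** Pick [a'] near the supremum of [A] and [b'] near the infimum of [B]. The copies
    [(1 - l) A + l b'] and [(1 - l) a' + l B] both lie in [C], and they overlap only in an interval
    of length at most [e]. *)
Lemma brunn_minkowski_line l (A B C : set (measurableTypeR R)) : 0 < l < 1 ->
  measurable A -> measurable B -> measurable C ->
  A `<=` D -> B `<=` D -> C `<=` D -> A !=set0 -> B !=set0 ->
  (forall x y, A x -> B y -> C ((1 - l) * x + l * y)) ->
  (1 - l) * fine (leb A) + l * fine (leb B) <= fine (leb C).
Proof.
move=> /andP[l0 l1] mA mB mC AD BD CD A0 B0 ABC.
have l'0 : 0 < 1 - l by rewrite subr_gt0.
have fA : leb A \is a fin_num := fin_meas_sub mD finD mA AD.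
have fB : leb B \is a fin_num := fin_meas_sub mD finD mB BD.
have fC : leb C \is a fin_num := fin_meas_sub mD finD mC CD.
have supA : has_sup A.
  by split => //; exists M => x /AD; rewrite /D/= in_itv/= => /andP[].
have infB : has_inf B.
  by split => //; exists (- M) => x /BD; rewrite /D/= in_itv/= => /andP[].
apply/ler_addgt0Pr => e e0.
have [a' Aa' a'e] := sup_adherent e0 supA.
have [b' Bb' b'e] := inf_adherent e0 infB.
pose A' := affine_line (1 - l)^-1 (- (l * b') / (1 - l)) @^-1` A.
pose B' := affine_line l^-1 (- ((1 - l) * a') / l) @^-1` B.
have mA' : measurable A'.
  by rewrite -[X in measurable X]setTI; exact: measurable_affine_line.
have mB' : measurable B'.
  by rewrite -[X in measurable X]setTI; exact: measurable_affine_line.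
have A'C : A' `<=` C.
  move=> z /= Az; have := ABC _ _ Az Bb'; rewrite /affine_line; congr (C _); field; lra.
have B'C : B' `<=` C.
  move=> z /= Bz; have := ABC _ _ Aa' Bz; rewrite /affine_line; congr (C _); field; lra.
have lA' : leb A' = ((1 - l)%:E * leb A)%E by rewrite lebesgue_affine ?invr_gt0// invrK.
have lB' : leb B' = (l%:E * leb B)%E by rewrite lebesgue_affine ?invr_gt0// invrK.
have lI : (leb (A' `&` B') <= e%:E)%E.
  pose p := (1 - l) * a' + l * inf B; pose q := (1 - l) * sup A + l * b'.
  apply: (@le_trans _ _ (leb `[p, q]%classic)).
    apply: le_measure; rewrite ?inE//; first exact: measurableI.
    move=> z [/= Az Bz]; rewrite in_itv/= /p /q /affine_line; apply/andP; split.
      have := ge_inf (proj2 infB) Bz.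
      rewrite -(ler_pM2l l0) (_ : l * (_ + _) = z - (1 - l) * a'); first lra.
      by field; lra.
    have := ub_le_sup (proj2 supA) Az.
    rewrite -(ler_pM2l l'0) (_ : (1 - l) * (_ + _) = z - l * b'); first lra.
    by field; lra.
  rewrite lebesgue_measure_itv/=; case: ifPn => _; last by rewrite lee_fin ltW.
  rewrite -EFinB lee_fin /p /q.
  have H1 : (1 - l) * sup A <= (1 - l) * a' + (1 - l) * e.
    by rewrite -mulrDr ler_pM2l// -lerBlDr ltW.
  have H2 : l * b' <= l * inf B + l * e.
    by rewrite -mulrDr ler_pM2l// ltW.
  lra.
have UC : (leb (A' `|` B') <= leb C)%E.
  by apply: le_measure; rewrite ?inE//; [exact: measurableU|by move=> z [/A'C|/B'C]].
have fA' : (leb A' < +oo)%E by rewrite lA' -(fineK fA) -EFinM ltry.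
have HU : (leb (A' `|` B') = leb A' + leb B' - leb (A' `&` B'))%E := measureUfinl mA' mB' fA'.
have fI : leb (A' `&` B') \is a fin_num.
  by rewrite ge0_fin_numE// (le_lt_trans lI)// ltry.
move: UC; rewrite HU lA' lB'.
move: lI; rewrite -(fineK fA) -(fineK fB) -(fineK fC) -(fineK fI) -!EFinM !lee_fin/=.
lra.
Qed.

Lemma tame_integrable (f : measurableTypeR R -> R) : tame D f ->
  leb.-integrable D (EFin \o f).
Proof.
move=> [mf [N fN] _]; apply: (bounded_integrable mD finD (M := N)).
  exact: measurable_funTS.
by move=> x _; have /andP[f0 fN'] := fN x; rewrite ger0_norm.
Qed.

Lemma tame_Rintegral (f : measurableTypeR R -> R) : tame D f ->
  \int[leb]_x f x = \int[leb]_(x in D) f x.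
Proof.
move=> [_ _ f0]; rewrite [RHS]Rintegral_mkcond; apply: eq_Rintegral => x _.
by rewrite patchE; case: ifPn => //; rewrite notin_setE => /f0.
Qed.

Lemma tame_sup (f : measurableTypeR R -> R) : tame D f -> 0 < \int[leb]_x f x ->
  exists2 a, 0 < a & (forall x, f x <= a) /\ (forall t, t < a -> exists x, t < f x).
Proof.
move=> tf; have [mf [N fN] f0] := tf => if0.
have [x fx] : exists x, 0 < f x.
  apply: contrapT => /forallNP nf; move: if0.
  rewrite (_ : f = cst 0) ?Rintegral_cst ?mul0r ?ltxx//.
  apply/funext => x; apply/eqP; rewrite eq_le; have /andP[-> _] := fN x.
  by rewrite andbT leNgt; exact/negP.
have ubf : has_sup (range f).
  split; first by exists (f x), x.
  by exists N => _ [y _ <-]; have /andP[] := fN y.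
exists (sup (range f)).
  by apply: (lt_le_trans fx); apply: (ub_le_sup (proj2 ubf)); exists x.
split; first by move=> y; apply: (ub_le_sup (proj2 ubf)); exists y.
by move=> t ta; have [_ [y _ <-] ty] := sup_gt (proj1 ubf) ta; exists y.
Qed.

(** Once [f] and [g] are divided by their suprema, their superlevel sets are nonempty for every
    level below 1, so Brunn-Minkowski on the line applies at each of these levels and integrates to
    an arithmetic-mean inequality. The geometric mean follows by the weighted inequality of means,
    and the normalising constants cancel. *)
Lemma prekopa_leindler_line l (f g h : measurableTypeR R -> R) : 0 < l < 1 ->
  tame D f -> tame D g -> tame D h ->
  (forall x y, f x `^ (1 - l) * g y `^ l <= h ((1 - l) * x + l * y)) ->
  (\int[leb]_x f x) `^ (1 - l) * (\int[leb]_x g x) `^ l <= \int[leb]_x h x.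
Proof.
move=> l01 tf tg th fgh; have /andP[l0 l1] := l01.
have l'0 : 0 < 1 - l by rewrite subr_gt0.
have ge0 k : tame D k -> 0 <= \int[leb]_x k x.
  by move=> [_ [N kN] _]; apply: Rintegral_ge0 => x _; have /andP[] := kN x.
have [if0|if0] := leP (\int[leb]_x f x) 0.
  rewrite (_ : \int[leb]_x f x = 0); last by apply/eqP; rewrite eq_le if0 ge0.
  by rewrite powR0 ?mul0r ?gt_eqF// ge0.
have [ig0|ig0] := leP (\int[leb]_x g x) 0.
  rewrite (_ : \int[leb]_x g x = 0); last by apply/eqP; rewrite eq_le ig0 ge0.
  by rewrite powR0 ?mulr0 ?gt_eqF// ge0.
have [a a0 [fa fat]] := tame_sup tf if0.
have [b b0 [gb gbt]] := tame_sup tg ig0.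
pose m := a `^ (1 - l) * b `^ l.
have m0 : 0 < m by rewrite mulr_gt0// powR_gt0.
have [mf [Nf fN] fD] := tf; have [mg [Ng gN] gD] := tg; have [mh [Nh hN] hD] := th.
have f0 x : 0 <= f x by have /andP[] := fN x.
have g0 x : 0 <= g x by have /andP[] := gN x.
have h0 x : 0 <= h x by have /andP[] := hN x.
have nrm k c : tame D k -> 0 < c -> tame D (fun x => k x / c).
  move=> [mk [N kN] kD] c0; split.
  - by apply: measurable_funM.
  - exists (N / c) => x; have /andP[k0 kN'] := kN x.
    by rewrite divr_ge0 ?(ltW c0)// ler_pM2r ?invr_gt0.
  - by move=> x /kD ->; rewrite mul0r.
have nrmI k c : tame D k -> 0 < c ->
    \int[leb]_(x in D) (k x / c) = (\int[leb]_x k x) / c.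
  by move=> tk c0; rewrite RintegralZr//; [rewrite tame_Rintegral|exact: tame_integrable].
have lev t : 0 < t < 1 ->
    (1 - l) * fine (leb (D `&` [set x | t < f x / a]))
    + l * fine (leb (D `&` [set x | t < g x / b]))
    <= fine (leb (D `&` [set x | t < h x / m])).
  move=> /andP[t0 t1]; apply: brunn_minkowski_line => //.
  - by apply: measurable_gt => //; apply: measurable_funM => //; exact: measurable_funTS.
  - by apply: measurable_gt => //; apply: measurable_funM => //; exact: measurable_funTS.
  - by apply: measurable_gt => //; apply: measurable_funM => //; exact: measurable_funTS.
  - have [x tx] := fat (t * a) ltac:(by rewrite gtr_pMl).
    exists x; split; last by rewrite /= ltr_pdivlMr.
    by apply: contrapT => /fD fx0; move: tx; rewrite fx0 ltNge mulr_ge0// ltW.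
  - have [x tx] := gbt (t * b) ltac:(by rewrite gtr_pMl).
    exists x; split; last by rewrite /= ltr_pdivlMr.
    by apply: contrapT => /gD fx0; move: tx; rewrite fx0 ltNge mulr_ge0// ltW.
  - move=> x y [Dx /=]; rewrite ltr_pdivlMr// => tfx [Dy /=]; rewrite ltr_pdivlMr// => tgy.
    have hm : t * m < h ((1 - l) * x + l * y).
      apply: (@lt_le_trans _ _ (f x `^ (1 - l) * g y `^ l)); last exact: fgh.
      rewrite (_ : t * m = (t * a) `^ (1 - l) * (t * b) `^ l).
        apply: ltr_pM; rewrite ?powR_ge0//.
        - by apply: gt0_ltr_powR; rewrite ?nnegrE ?mulr_ge0// ltW.
        - by apply: gt0_ltr_powR; rewrite ?nnegrE ?mulr_ge0// ltW.
      rewrite !powRM ?(ltW t0) ?(ltW a0) ?(ltW b0)// mulrACA -powRD ?subrK ?powRr1 ?(ltW t0)//.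
      by rewrite gt_eqF// implybT.
    split; last by rewrite /= ltr_pdivlMr.
    by apply: contrapT => /hD hx0; move: hm; rewrite hx0 ltNge mulr_ge0// ltW.
have key n : (0 < n)%N ->
    (1 - l) * ((\int[leb]_x f x) / a) + l * ((\int[leb]_x g x) / b)
    <= (\int[leb]_x h x) / m + n%:R^-1 * fine (leb D).
  move=> n0; rewrite -!nrmI//.
  have mdiv (k : measurableTypeR R -> R) c : measurable_fun setT k -> measurable_fun D (fun x => k x / c).
    by move=> mk; apply: measurable_funM => //; exact: measurable_funTS.
  have Hf := Rintegral_le_stair mD finD n0 (mdiv _ a mf) ltac:(by move=> x _;
    rewrite divr_ge0 ?(ltW a0)//= ler_pdivrMr// mul1r).
  have Hg := Rintegral_le_stair mD finD n0 (mdiv _ b mg) ltac:(by move=> x _;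
    rewrite divr_ge0 ?(ltW b0)//= ler_pdivrMr// mul1r).
  have Hh := Rintegral_ge_stair mD finD n0 (tame_integrable (nrm _ _ th m0))
    ltac:(by move=> x _; rewrite divr_ge0// ltW).
  set sf := \sum_(1 <= j < n) _ in Hf.
  set sg := \sum_(1 <= j < n) _ in Hg.
  set sh := \sum_(1 <= j < n) _ in Hh.
  have Hs : (1 - l) * sf + l * sg <= sh.
    rewrite /sf /sg !mulr_sumr -big_split/=; apply: ler_sum_nat => j /andP[j1 jn].
    by apply: lev; rewrite divr_gt0 ?ltr0n//= ltr_pdivrMr ?ltr0n// mul1r ltr_nat.
  have n'0 : 0 < n%:R^-1 :> R by rewrite invr_gt0 ltr0n.
  rewrite -(ler_pM2l n'0) in Hs.
  move: Hf Hg; rewrite -(ler_pM2l l'0) => Hf; rewrite -(ler_pM2l l0) => Hg.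
  apply: (le_trans (lerD Hf Hg)); rewrite addrC.
  apply: le_trans (_ : _ <= n%:R^-1 * fine (leb D) + n%:R^-1 * sh) _; last by rewrite addrC lerD2r.
  by rewrite -subr_ge0; move: Hs; rewrite -subr_ge0; congr (0 <= _); ring.
have key' : (1 - l) * ((\int[leb]_x f x) / a) + l * ((\int[leb]_x g x) / b)
    <= (\int[leb]_x h x) / m.
  apply/ler_addgt0Pr => e e0.
  pose n := (Num.truncn (fine (leb D) / e)).+1.
  apply: (le_trans (key n isT)); rewrite lerD2l ler_pdivrMl ?ltr0n//.
  by rewrite -ler_pdivrMr//; apply: ltW; rewrite truncnS_gt.
have := le_trans (weighted_amgm l01 _ _) key'.
rewrite !divr_ge0 ?ge0 ?(ltW a0) ?(ltW b0)// => /(_ isT isT).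
rewrite ler_pdivlMr// /m mulrACA -!powRM ?divr_ge0 ?ge0 ?(ltW a0) ?(ltW b0)//.
by rewrite !divfK ?gt_eqF.
Qed.

End line.

Section space.
Variable M : R.

Lemma tame_integrable_rV d (f : 'rV[R]_d -> R) : tame (cube d M) f ->
  vol.-integrable [set: 'rV[R]_d] (EFin \o f).
Proof.
move=> [mf [N fN] f0].
have mC := measurable_cube d M.
have : vol.-integrable (cube d M) (EFin \o f).
  apply: (bounded_integrable mC (vol_cube_fin d M) (M := N)).
    exact: measurable_funTS.
  by move=> x _; have /andP[f0' fN'] := fN x; rewrite ger0_norm.
rewrite (integrable_mkcond _ mC); apply: eq_integrable => // x _.
by rewrite patchE /=; case: ifPn => //; rewrite notin_setE => /f0 ->.
Qed.

Lemma tame_slice d (f : 'rV[R]_d.+1 -> R) (a : measurableTypeR R) :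
  tame (cube d.+1 M) f -> tame (cube d M) (fun y => f (rVcons (a, y))).
Proof.
move=> [mf [N fN] f0]; split.
- apply: (measurableT_comp mf); apply: (measurableT_comp (@measurable_rVcons R d)).
  exact: measurable_pair1.
- by exists N.
- by move=> y ny; apply: f0 => H; apply: ny => i; have := H (lift ord0 i); rewrite rVconsES.
Qed.

Lemma tame_slice_integral d (f : 'rV[R]_d.+1 -> R) : tame (cube d.+1 M) f ->
  tame `[- M, M]%classic
    (fun a : measurableTypeR R => \int[vol]_y f (rVcons (a, y)) : R) /\
  \int[vol]_x f x = \int[leb]_a \int[vol]_y f (rVcons (a, y)).
Proof.
move=> tf; have [mf [N fN] f0] := tf.
have fE (a : measurableTypeR R) : (\int[vol]_y (f (rVcons (a, y)))%:E
    = (\int[vol]_y f (rVcons (a, y)))%:E)%E.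
  rewrite /Rintegral fineK//; apply: integrable_fin_num => //.
  exact: tame_integrable_rV (tame_slice a tf).
have mF : measurable_fun setT (fun a : measurableTypeR R => \int[vol]_y (f (rVcons (a, y)))%:E)%E.
  have := @measurable_fun_fubini_tonelli_F _ _ _ _ _ (@vol R d) (EFin \o f \o @rVcons R d).
  apply => //; last by move=> x /=; rewrite lee_fin; have /andP[] := fN (rVcons x).
  by apply: measurableT_comp; [exact/measurable_EFinP|exact: measurable_rVcons].
split; last first.
  rewrite {1}/Rintegral vol_succ_integral//; last 2 first.
  - exact/measurable_EFinP.
  - by move=> x; rewrite lee_fin; have /andP[] := fN x.
  by congr fine; apply: eq_integral => a _; exact: fE.
split.
- apply/measurable_EFinP; move: mF; congr measurable_fun.
  by apply/funext => a; rewrite fE.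
- exists (N * fine (vol (cube d M))) => a; apply/andP; split.
    by apply: Rintegral_ge0 => y _; have /andP[] := fN (rVcons (a, y)).
  rewrite -Rintegral_cst; last exact: measurable_cube.
  rewrite [leRHS]Rintegral_mkcond; apply: le_Rintegral => //.
  + exact: tame_integrable_rV (tame_slice a tf).
  + have := @bounded_integrable _ _ _ vol _ (measurable_cube d M) (vol_cube_fin d M) (cst N) `|N|.
    move=> /(_ (measurable_cst _) (fun _ _ => lexx _)).
    rewrite (integrable_mkcond _ (measurable_cube d M)).
    by apply: eq_integrable => // y _ /=; rewrite !patchE; case: ifP.
  + move=> y _; rewrite patchE; case: ifPn => [_|]; first by have /andP[] := fN (rVcons (a, y)).
    by rewrite notin_setE; have [_ _ sl0] := tame_slice a tf; move=> /sl0 ->.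
- move=> a na; apply/eqP; rewrite eq_le; apply/andP; split; last first.
    by apply: Rintegral_ge0 => y _; have /andP[] := fN (rVcons (a, y)).
  rewrite (_ : (fun y => _) = cst 0) ?Rintegral_cst ?mul0r//.
  apply/funext => y; apply: f0 => /(_ ord0); rewrite rVconsE0/= => aM.
  by apply: na; rewrite /= in_itv/= -ler_norml.
Qed.

(** Induction on the dimension: slices at fixed first coordinates satisfy the hypothesis with the
    same [l], so their integrals, as functions of the first coordinate, satisfy the hypothesis on
    the line. *)
Lemma prekopa_leindler d l (f g h : 'rV[R]_d -> R) : 0 < l < 1 ->
  tame (cube d M) f -> tame (cube d M) g -> tame (cube d M) h ->
  (forall x y, f x `^ (1 - l) * g y `^ l <= h ((1 - l) *: x + l *: y)) ->
  (\int[vol]_x f x) `^ (1 - l) * (\int[vol]_x g x) `^ l <= \int[vol]_x h x.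
Proof.
move=> l01; elim: d f g h => [|d IH] f g h tf tg th fgh.
  have E (k : 'rV[R]_0 -> R) : tame (cube 0 M) k -> \int[vol]_x k x = k 0.
    move=> [mk _ _]; rewrite /Rintegral integral_dirac//=; last exact/measurable_EFinP.
    by rewrite indicT mul1r.
  rewrite !E//; apply: (le_trans (fgh 0 0)).
  by rewrite !scaler0 addr0.
have [tF ->] := tame_slice_integral tf.
have [tG ->] := tame_slice_integral tg.
have [tH ->] := tame_slice_integral th.
apply: (prekopa_leindler_line l01 tF tG tH) => x y.
apply: IH; [exact: tame_slice|exact: tame_slice|exact: tame_slice|].
move=> u v; apply: (le_trans (fgh _ _)).
rewrite le_eqVlt; apply/orP; left; apply/eqP; congr h.
apply/rowP => i; rewrite [LHS]mxE.
case: (unliftP ord0 i) => [j|] ->.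
  by rewrite rVconsES/= [X in X + _]mxE [X in _ + X]mxE !rVconsES/= !mxE.
by rewrite rVconsE0/= [X in X + _]mxE [X in _ + X]mxE !rVconsE0/=.
Qed.

Lemma tame_indic d (A : set 'rV[R]_d) : measurable A -> A `<=` cube d M ->
  tame (cube d M) (\1_A : 'rV[R]_d -> R).
Proof.
move=> mA AM; split; first exact: measurable_indic.
- by exists 1 => x; rewrite indicE; case: (_ \in _); rewrite ?lexx ?ler01.
- by move=> x nx; rewrite indicE memNset// => /AM.
Qed.

End space.

(** With [l = e / (rho + e)], both [A / (1 - l)] and the ball of radius [rho + e] have volume
    [omega * (rho + e) ^+ d], and [l] times that ball is the ball of radius [e]. Prekopa-Leindler
    for the two indicators has equal factors on the left, so no optimisation over [l] is left to
    do. *)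
Lemma brunn_minkowski_ball d (M rho e : R) (A C : set 'rV[R]_d) : (0 < d)%N ->
  0 < rho -> 0 < e -> measurable A -> measurable C -> A `<=` cube d M -> C `<=` cube d M ->
  (vol A = (omega R d * rho ^+ d)%:E)%E ->
  (forall x y, A x -> enorm y < e -> C (x + y)) ->
  ((omega R d * (rho + e) ^+ d)%:E <= vol C)%E.
Proof.
move=> d0 rho0 e0 mA mC AM CM vA AC.
have re0 : 0 < rho + e by rewrite addr_gt0.
pose l := e / (rho + e); have l'E : 1 - l = rho / (rho + e) by rewrite /l; field; rewrite gt_eqF.
have l01 : 0 < l < 1 by rewrite divr_gt0//= ltr_pdivrMr// mul1r ltrDr.
have /andP[l0 l1] := l01.
have l'0 : 0 < 1 - l by rewrite subr_gt0.
pose A' := (fun x : 'rV[R]_d => (1 - l) *: x + 0 : 'rV[R]_d) @^-1` A.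
pose B' : set 'rV[R]_d := eball 0 (rho + e).
have mA' : measurable A' by rewrite -[X in measurable X]setTI; exact: measurable_affine.
pose N := `|M| / (1 - l) + `|M| + (rho + e).
have N1 : 0 <= `|M| / (1 - l) by rewrite divr_ge0// ltW.
have MN : M <= N by rewrite /N (le_trans (ler_norm M))//; have := ltW re0; lra.
have AN : A' `<=` cube d N.
  move=> x /AM xM i; have := xM i; rewrite addr0 mxE normrM gtr0_norm// mulrC -ler_pdivlMr//.
  move=> /le_trans; apply; apply: (@le_trans _ _ (`|M| / (1 - l))).
    by rewrite ler_pM2r ?invr_gt0// ler_norm.
  by rewrite /N -addrA lerDl addr_ge0// ltW.
have BN : B' `<=` cube d N.
  rewrite /B' eballE => x /=; rewrite subr0 => xr i.
  apply: (le_trans (ler_coord_enorm x i)); apply: (le_trans (ltW xr)).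
  by rewrite /N lerDr addr_ge0.
have CN : C `<=` cube d N by move=> x /CM H i; exact: le_trans (H i) MN.
have tA := tame_indic mA' AN.
have tB := tame_indic (measurable_eball _ _) BN.
have tC := tame_indic mC CN.
have := prekopa_leindler l01 tA tB tC.
have H x y : (\1_A' x : R) `^ (1 - l) * (\1_B' y : R) `^ l <= \1_C ((1 - l) *: x + l *: y).
  rewrite !indicE; have [xA|xA] := boolP (x \in A'); last by rewrite powR0 ?gt_eqF// mul0r.
  have [yB|yB] := boolP (y \in B'); last by rewrite powR0 ?gt_eqF// mulr0.
  rewrite !powR1 mulr1 [_ \in C]mem_set//; apply: AC.
    by move/set_mem : xA; rewrite /A' /= addr0.
  move/set_mem: yB; rewrite /B' eballE/= subr0 enormZ gtr0_norm// /l => yre.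
  by rewrite mulrAC ltr_pdivrMr// ltr_pM2l.
move=> /(_ H).
have Rind (D : set 'rV[R]_d) : measurable D -> \int[vol]_x \1_D x = fine (vol D).
  by move=> mD; rewrite /Rintegral integral_indic// setIT.
rewrite !Rind//; last exact: measurable_eball.
rewrite vol_eball ?(ltW re0)// /A' vol_affine// vA -EFinM/=.
rewrite (_ : (1 - l)^-1 ^+ d * _ = omega R d * (rho + e) ^+ d); last first.
  by rewrite l'E invf_div exprMn exprVn; field; rewrite expf_eq0 d0 gt_eqF.
set X := omega R d * _; have X0 : 0 < X by rewrite mulr_gt0 ?omega_gt0// exprn_gt0.
rewrite -powRD ?subrK ?powRr1 ?(ltW X0)//; last by rewrite gt_eqF// implybT.
rewrite -lee_fin fineK//; apply: (fin_meas_sub (measurable_cube d N) (vol_cube_fin d N)) => //.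
Qed.

End prekopa_leindler.

Section bounded_convergence.
Context d {T : measurableType d} {R : realType} (mu : {measure set T -> \bar R}).
Variable D : set T.
Hypotheses (mD : measurable D) (finD : (mu D < +oo)%E).

Lemma bounded_convergence (f_ : (T -> R)^nat) (f : T -> R) (M : R) :
  (forall n, measurable_fun D (f_ n)) -> measurable_fun D f ->
  {ae mu, forall x, D x -> f_ ^~ x @ \oo --> f x} ->
  (forall n x, D x -> `|f_ n x| <= M) ->
  (\int[mu]_(x in D) f_ n x) @[n --> \oo] --> \int[mu]_(x in D) f x.
Proof.
move=> mf_ mf cvgf fM.
have [|||||iF _ H] := @dominated_convergence _ _ _ mu _ mD (fun n => EFin \o f_ n) (EFin \o f) (EFin \o cst M).
- by move=> n; exact/measurable_EFinP.
- exact/measurable_EFinP.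
- by apply: filterS cvgf => x H Dx; apply/cvg_EFin; [exact: nearW|exact: H].
- by apply: (bounded_integrable mD finD (M := `|M|)) => // x _.
- by apply: aeW => x n Dx; rewrite lee_fin; exact: fM.
have fin : (\int[mu]_(x in D) (EFin \o f) x)%E \is a fin_num by exact: integrable_fin_num.
by move: H; rewrite -(fineK fin) => /fine_cvg.
Qed.

End bounded_convergence.

(** * Gradients and integration of partial derivatives *)

Section gradient.
Context {R : realType} {d : nat}.
Implicit Types (x y : 'rV[R]_d) (w : 'rV[R]_d -> R).

Lemma compact_cube (M : R) : compact (cube d M).
Proof.
by rewrite cubeE; apply: (@rV_compact _ _ (fun=> `[- M, M]%classic)) => _; exact: segment_compact.
Qed.

Lemma closed_cube (M : R) : closed (cube d M).
Proof. by apply: compact_closed; [exact: norm_hausdorff|exact: compact_cube]. Qed.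

(** Only [x] is confined to the cube: [y] may leave it, so one radius also serves for neighbourhoods
    that stick out. *)
Lemma uniform_continuous_cube (M e : R) w : continuous w -> 0 < e ->
  exists2 r, 0 < r & forall x y, cube d M x -> enorm (y - x) < r -> `|w x - w y| < e.
Proof.
move=> cw e0.
have /compact_near_coveringP := @compact_cube M.
move=> /(_ R (0^'+) (fun r x => forall y, enorm (y - x) < r -> `|w x - w y| < e)).
move=> /(_ _ _) [].
  move=> x _; have /cvgrPdist_lt /(_ (e / 2)) := cw x.
  rewrite divr_gt0// => /(_ isT) /nbhs_ballP [r /= r0 rw].
  have wy y : `|x - y| < r -> `|w x - w y| < e / 2.
    by move=> xy; apply: rw; rewrite -ball_normE.
  exists (ball x (r / 2), [set t | t < r / 2]) => /=.
    split; first by apply: nbhsx_ballx; rewrite divr_gt0.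
    by apply: nbhs_right_lt; rewrite divr_gt0.
  move=> [z t]/= [xz tr] y yz; rewrite -ball_normE /= in xz.
  rewrite (le_lt_trans (ler_distD (w x) _ _))// [ltRHS]splitr ltrD//.
    by rewrite distrC wy// (lt_trans xz)// ltr_pdivrMr// ltr_pMr// ltr1n.
  apply: wy; rewrite (le_lt_trans (ler_distD z _ _))// [ltRHS]splitr ltrD//.
  by rewrite (le_lt_trans (norm_le_enorm _))// -enormN opprB (lt_trans yz).
move=> r /= r0 H; exists (r / 2); first by rewrite divr_gt0.
move=> x y Mx; apply: (H (r / 2)) => //=; last by rewrite divr_gt0.
by rewrite sub0r normrN gtr0_norm ?divr_gt0// ltr_pdivrMr// ltr_pMr// ltr1n.
Qed.

Definition gradient w x : 'rV[R]_d := \row_i partial i w x.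

Lemma derive_partial w x v : differentiable w x ->
  'D_v w x = \sum_i v ord0 i * partial i w x.
Proof.
move=> dw; rewrite deriveE// {1}(row_sum_delta v) linear_sum; apply: eq_bigr => i _.
by rewrite linearZ /= /partial deriveE.
Qed.

Definition C1 w := (forall x, differentiable w x) /\ forall i, continuous (partial i w).

Lemma C1_continuous w : C1 w -> continuous w.
Proof. by move=> [dw _] x; exact: differentiable_continuous. Qed.

Lemma partial_out i (M : R) w : (forall x, ~ cube d M x -> w x = 0) ->
  forall x, ~ cube d M x -> partial i w x = 0.
Proof.
move=> w0 x nx; rewrite /partial.
have nw : \forall y \near x, w y = cst 0 y.
  have : nbhs x (~` cube d M) by apply: open_nbhs_nbhs; split => //; exact/closed_openC/closed_cube.
  by apply: filterS => y /w0.
by rewrite (near_eq_derive _ nw) derive_cst.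
Qed.

Lemma derive_line w x v (s : R) : differentiable w (x + s *: v) ->
  is_derive s 1 (fun t : R => w (x + t *: v)) ('D_v w (x + s *: v)).
Proof.
move=> dw.
have dv : derivable w (x + s *: v) v by exact: diff_derivable.
have E : (fun h : R => h^-1 *: ((w \o shift (x + s *: v)) (h *: v) - w (x + s *: v)))
    = (fun h : R => h^-1 *: (((fun t : R => w (x + t *: v)) \o shift s) (h *: (1 : R^o))
        - w (x + s *: v))).
  apply/funext => h; congr (_ *: (w _ - _)).
  by rewrite /= [h%:A]mulr1 scalerDl addrCA.
rewrite (_ : 'D_v w (x + s *: v) = 'D_1 (fun t : R => w (x + t *: v)) s).
  by apply: derivableP; move: dv; rewrite /derivable E.
by rewrite /derive E.
Qed.

Lemma gradient_MVT w x y : (forall z, differentiable w z) ->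
  exists2 s, 0 < s < 1 & w y - w x = \sum_i (y - x) ord0 i * partial i w (x + s *: (y - x)).
Proof.
move=> dw.
have D (s : R) := derive_line (dw (x + s *: (y - x))).
have [|c c01 E] := @MVT R (fun t : R => w (x + t *: (y - x))) _ 0 1 ltr01 (fun s _ => D s).
  apply: continuous_subspaceT => s.
  by apply: differentiable_continuous; apply/derivable1_diffP; have [] := D s.
exists c; first by rewrite in_itv/= in c01.
by move: E; rewrite scale1r scale0r addr0 subr0 mulr1 [x + (y - x)]addrC subrK => ->; rewrite derive_partial.
Qed.

Lemma gradient_continuous w : (forall i, continuous (partial i w)) ->
  continuous (fun x => enorm (gradient w x)).
Proof.
move=> cw.
have c2 : continuous (fun x => \sum_i partial i w x ^+ 2).
  apply: continuous_big => [|i _ y]; first exact: add_continuous.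
  apply: (@continuous_comp _ _ _ (partial i w) (fun t => t ^+ 2)); first exact: cw.
  exact: exprn_continuous.
move=> x; rewrite /enorm (_ : (fun _ => _) = Num.sqrt \o (fun x => \sum_i partial i w x ^+ 2)).
  by apply: (continuous_comp (c2 x)); exact: sqrt_continuous.
by apply/funext => y /=; congr Num.sqrt; apply: eq_bigr => i _; rewrite mxE.
Qed.

Lemma cont_compact_bounded (M : R) w : continuous w -> (forall x, ~ cube d M x -> w x = 0) ->
  exists2 N, 0 <= N & forall x, `|w x| <= N.
Proof.
move=> cw w0.
have [|x0 [_ H]] := @compact_bounded R _ (w @` cube d M).
  apply: continuous_compact; last exact: compact_cube.
  exact: continuous_subspaceT.
exists (`|x0| + 1); first by rewrite addr_ge0.
move=> x; have [Mx|/w0 ->] := pselect (cube d M x); last by rewrite normr0 addr_ge0.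
by apply: H; [rewrite (le_lt_trans (ler_norm _))// ltrDl|exists x].
Qed.

Lemma integrable_cont_compact (M : R) w : continuous w -> (forall x, ~ cube d M x -> w x = 0) ->
  vol.-integrable [set: 'rV[R]_d] (EFin \o w).
Proof.
move=> cw w0; have [N _ wN] := cont_compact_bounded cw w0.
have mC := measurable_cube d M.
have : vol.-integrable (cube d M) (EFin \o w).
  apply: (bounded_integrable mC (vol_cube_fin d M) (M := N)) => //.
  by apply: measurable_funTS; exact: continuous_measurable_rV.
rewrite (integrable_mkcond _ mC); apply: eq_integrable => // x _.
by rewrite patchE /=; case: ifPn => //; rewrite notin_setE => /w0 ->.
Qed.

Lemma Rintegral_support (D E : set 'rV[R]_d) w : D `<=` E -> (forall x, ~ D x -> w x = 0) ->
  \int[vol]_(x in E) w x = \int[vol]_(x in D) w x.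
Proof.
move=> DE w0; rewrite Rintegral_mkcond [RHS]Rintegral_mkcond; apply: eq_Rintegral => x _.
rewrite !patchE; case: ifPn => [_|xE].
  by case: ifPn => //; rewrite notin_setE => /w0.
by rewrite ifF//; apply/negP => /set_mem/DE/mem_set; exact/negP.
Qed.

Lemma Rintegral_translate (b : 'rV[R]_d) w :
  vol.-integrable [set: 'rV[R]_d] (EFin \o w) -> continuous w ->
  \int[vol]_x w (x + b) = \int[vol]_x w x.
Proof.
move=> iw cw; pose S (x : 'rV[R]_d) : 'rV[R]_d := x + b.
have SE : S = (fun x => 1 *: x + b) by apply/funext => x; rewrite scale1r.
have mS : measurable_fun setT S by rewrite SE; exact: measurable_affine.
have mw : measurable_fun setT (EFin \o w) by apply/measurable_EFinP; exact: continuous_measurable_rV.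
have iwS : vol.-integrable (S @^-1` setT) ((EFin \o w) \o S).
  apply/integrableP; split; first exact: measurableT_comp.
  move/integrableP : iw => [_]; apply: le_lt_trans.
  rewrite preimage_setT -[leRHS]mul1e.
  have := @ge0_integral_affine R d 1 b (fun x => `|(w x)%:E|)%E ltr01.
  rewrite invr1 expr1n => <- //; last exact: measurableT_comp.
  by under [leRHS]eq_integral do rewrite scale1r.
have [p pE] : exists p : {measure set 'rV[R]_d -> \bar R}, p = pushforward vol S :> (set _ -> _).
  by unshelve eexists (pushforward vol S : {measure set _ -> \bar R}).
rewrite /Rintegral; congr fine.
have -> : (\int[vol]_x (w x)%:E = \int[p]_x (w x)%:E)%E.
  apply: eq_measure_integral => A mA _; rewrite pE /= /pushforward SE vol_affine//.
  by rewrite invr1 expr1n mul1e.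
by rewrite pE (integral_pushforward mS mw iwS measurableT) preimage_setT.
Qed.

(** The derivative is the bounded limit of difference quotients, whose integrals vanish because
    Lebesgue measure is invariant under translations. *)
Lemma Rintegral_partial i (M : R) w : C1 w -> (forall x, ~ cube d M x -> w x = 0) ->
  \int[vol]_x partial i w x = 0.
Proof.
move=> [dw cpw] w0; have cw := C1_continuous (conj dw cpw).
pose e_ : 'rV[R]_d := delta_mx ord0 i.
(* Steps of length at most 1 keep the translated supports inside [cube d (M + 1)]. *)
pose h_ n : R := n.+1%:R^-1.
have h0 n : 0 < h_ n by rewrite invr_gt0.
have h1 n : h_ n <= 1 by rewrite invf_le1// ler1n.
pose f_ n x := (w (x + h_ n *: e_) - w x) / h_ n.
have pw0 := partial_out i w0.
have [N N0 pN] := cont_compact_bounded (cpw i) pw0.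
have M1 : cube d M `<=` cube d (M + 1) by move=> x Mx j; rewrite (le_trans (Mx j))// lerDl.
have csh (b : 'rV[R]_d) : continuous (fun x => w (x + b)).
  move=> x; apply: (@continuous_comp _ _ _ (fun x : 'rV[R]_d => x + b)); last exact: cw.
  by apply: continuousD; [exact: cvg_id|exact: cst_continuous].
have wsh n x : ~ cube d (M + 1) x -> w (x + h_ n *: e_) = 0.
  move=> nx; apply: w0 => H; apply: nx => j.
  have eb : `|(h_ n *: e_) ord0 j| <= 1.
    rewrite !mxE normrM gtr0_norm// mulr_ile1 ?(ltW (h0 n))//.
    by case: (_ && _); rewrite ?normr1 ?normr0 ?ler01.
  rewrite -(addrK ((h_ n *: e_) ord0 j) (x ord0 j)) (le_trans (ler_normB _ _))// lerD//.
  by have := H j; rewrite mxE.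
have f0 n x : ~ cube d (M + 1) x -> f_ n x = 0.
  by move=> nx; rewrite /f_ wsh// w0 ?subrr ?mul0r// => /M1.
have if0 n : \int[vol]_(x in cube d (M + 1)) f_ n x = 0.
  rewrite -(@Rintegral_support _ setT)//; last exact: f0.
  have i1 : vol.-integrable setT (EFin \o (fun x => w (x + h_ n *: e_))).
    by apply: (@integrable_cont_compact (M + 1)) => //; exact: wsh.
  have i2 := integrable_cont_compact cw w0.
  rewrite RintegralZr//; last first.
    by have := integrableB measurableT i1 i2; apply: eq_integrable.
  by rewrite RintegralB// Rintegral_translate// subrr mul0r.
have fN n x : `|f_ n x| <= N.
  have [s _ E] := gradient_MVT x (x + h_ n *: e_) dw.
  rewrite /f_ E addrC addKr (bigD1 i)//= big1 ?addr0; last first.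
    by move=> j ji; rewrite !mxE (negbTE ji) andbF mulr0 mul0r.
  by rewrite !mxE !eqxx mulr1 mulrAC divff ?gt_eqF// mul1r.
have mcont (v : 'rV[R]_d -> R) : continuous v -> measurable_fun (cube d (M + 1)) v.
  by move=> cv; apply: measurable_funTS; exact: continuous_measurable_rV.
have := @bounded_convergence _ _ _ (@vol R d) _ (measurable_cube d (M + 1)) (vol_cube_fin d (M + 1))
  f_ (partial i w) N.
have mf n : measurable_fun (cube d (M + 1)) (f_ n).
  by apply: measurable_funM => //; apply: measurable_funB; apply: mcont => //; exact: csh.
move=> /(_ mf (mcont _ (cpw i))).
have cvf : {ae (@vol R d), forall x, cube d (M + 1) x -> f_ ^~ x @ \oo --> partial i w x}.
  apply: aeW => x _; rewrite /partial.
  have : derivable w x e_ by exact: diff_derivable.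
  move=> dwx; have H := (cvgr_dnbhsP _ _ _).1 dwx h_.
  have {}H := H (conj (fun n => lt0r_neq0 (h0 n)) cvg_harmonic).
  rewrite (_ : f_ ^~ x = fun n => (h_ n)^-1 *: ((w \o shift x) (h_ n *: e_) - w x)); first exact: H.
  by apply/funext => n /=; rewrite /f_ /shift/= [RHS]mulrC [x + _]addrC.
move=> /(_ cvf (fun n x _ => fN n x)).
rewrite (_ : (fun n => _) = cst 0); last by apply/funext => n; rewrite if0.
move=> /cvg_lim H; rewrite (@Rintegral_support (cube d (M + 1)))//; last first.
  by move=> x nx; apply: pw0 => /M1.
by rewrite -H// lim_cst.
Qed.

End gradient.

Section powers.
Context {R : realType}.
Implicit Types (d : nat) (x a e rho : R).

Lemma root_exists d x : (0 < d)%N -> 0 <= x -> exists2 r, 0 <= r & r ^+ d = x.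
Proof.
move=> d0 x0; exists (x `^ d%:R^-1); first exact: powR_ge0.
by rewrite -powR_mulrn ?powR_ge0// -powRrM mulVf ?powRr1// pnatr_eq0 -lt0n.
Qed.

(** The derivative at [a] is replaced by that at the lower bound [rho], so the growth of volume is
    bounded below uniformly over all level sets at least as large as the ball of radius [rho]. *)
Lemma ler_pow_increment d rho a e : 0 <= rho -> rho <= a -> 0 <= e ->
  a ^+ d + d%:R * rho ^+ d.-1 * e <= (a + e) ^+ d.
Proof.
move=> rho0 rhoa e0; have a0 := le_trans rho0 rhoa.
elim: d => [|d IH]; first by rewrite !expr0 !mul0r addr0.
case: d IH => [|d] IH; first by rewrite !expr1 expr0 !mul1r.
rewrite [in leRHS]exprS; apply: (@le_trans _ _ ((a + e) * (a ^+ d.+1 + d.+1%:R * rho ^+ d * e))).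
  rewrite /= -[d.+2%:R]natr1.
  have -> : (a + e) * (a ^+ d.+1 + d.+1%:R * rho ^+ d * e) =
    a ^+ d.+2 + d.+1%:R * (a * rho ^+ d) * e + a ^+ d.+1 * e + d.+1%:R * rho ^+ d * e * e.
    by rewrite [a ^+ d.+2]exprS; move: (a ^+ d.+1) (d.+1%:R : R) => b c; ring.
  have H1 : rho ^+ d.+1 <= a * rho ^+ d by rewrite exprS ler_wpM2r// exprn_ge0.
  have H2 : rho ^+ d.+1 <= a ^+ d.+1 by rewrite lerXn2r.
  have H3 : 0 <= d.+1%:R * rho ^+ d * e * e by rewrite !mulr_ge0// exprn_ge0.
  have H4 : d.+1%:R * rho ^+ d.+1 * e <= d.+1%:R * (a * rho ^+ d) * e.
    by rewrite ler_wpM2r// ler_wpM2l.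
  have H5 : rho ^+ d.+1 * e <= a ^+ d.+1 * e by rewrite ler_wpM2r.
  rewrite [X in X <= _](_ : _ = a ^+ d.+2 + d.+1%:R * rho ^+ d.+1 * e + rho ^+ d.+1 * e); last by ring.
  lra.
by rewrite ler_wpM2l ?addr_ge0.
Qed.

End powers.

(** * Sup-convolution and the isoperimetric inequality for gradients *)

Section sup_convolution.
Context {R : realType} {d : nat}.
Implicit Types (x y : 'rV[R]_d) (w : 'rV[R]_d -> R) (e : R).

(** As the ball is open, [{t < sup_conv e w}] is a union of open balls: the sup-convolution of a
    bounded function is measurable whatever its regularity. *)
Definition sup_conv e w x : R := sup [set w y | y in [set y | enorm (y - x) < e]].

Variables (w : 'rV[R]_d -> R) (N e : R).
Hypotheses (e0 : 0 < e) (wN : forall x, 0 <= w x <= N).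

Let has_sup_conv x : has_sup [set w y | y in [set y | enorm (y - x) < e]].
Proof.
split; last by exists N => _ [y _ <-]; have /andP[] := wN y.
by exists (w x), x => //=; rewrite subrr -(scale0r 0) enormZ normr0 mul0r.
Qed.

Lemma sup_conv_gt t x : (t < sup_conv e w x) <-> exists2 y, enorm (y - x) < e & t < w y.
Proof.
split; last first.
  move=> [y yx ty]; apply: (lt_le_trans ty).
  by apply: (ub_le_sup (proj2 (has_sup_conv x))); exists y.
by move=> /(sup_gt (proj1 (has_sup_conv x)))[_ [y yx <-] ty]; exists y.
Qed.

Lemma open_sup_conv_gt t : open [set x | t < sup_conv e w x].
Proof.
rewrite (_ : mkset _ = \bigcup_(y in [set y | t < w y]) eball y e).
  by apply: bigcup_open => y _; exact: open_eball.
apply/seteqP; split => x.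
  by move=> /sup_conv_gt [y yx ty]; exists y => //; rewrite eballE/= -enormN opprB.
by move=> [y ty]; rewrite eballE/= => yx; apply/sup_conv_gt; exists y => //; rewrite -enormN opprB.
Qed.

Lemma measurable_sup_conv : measurable_fun setT (sup_conv e w).
Proof.
apply: (measurability _ (RGenOInfty.measurableE R)) => //.
move=> _ [_ [a ->] <-]; rewrite setTI preimage_itvoy.
by apply: open_measurable_rV; exact: open_sup_conv_gt.
Qed.

Lemma sup_conv_ge0 x : 0 <= sup_conv e w x.
Proof.
have /andP[w0 _] := wN x; apply: (le_trans w0); apply: (ub_le_sup (proj2 (has_sup_conv x))).
by exists x => //=; rewrite subrr -(scale0r 0) enormZ normr0 mul0r.
Qed.

Lemma sup_conv_le (c : R) x : (forall y, enorm (y - x) < e -> w y <= c) -> sup_conv e w x <= c.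
Proof.
move=> H; apply: ge_sup; first exact: (proj1 (has_sup_conv x)).
by move=> _ [y yx <-]; exact: H.
Qed.

End sup_convolution.

Section isoperimetry.
Context {R : realType} {d : nat}.
Hypothesis d0 : (0 < d)%N.
Implicit Types (x y : 'rV[R]_d) (w : 'rV[R]_d -> R).

Lemma sup_conv_level w (M N e rho t : R) : continuous w -> (forall x, ~ cube d M x -> w x = 0) ->
  (forall x, 0 <= w x <= N) -> 0 < e -> 0 < rho -> 0 <= t ->
  ((omega R d * rho ^+ d)%:E <= vol [set x | (t < w x)%R])%E ->
  fine (vol [set x | t < w x]) + omega R d * (d%:R * rho ^+ d.-1 * e)
  <= fine (vol [set x | t < sup_conv e w x]).
Proof.
move=> cw w0 wN e0 rho0 t0 volw.
pose A := [set x | t < w x].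
pose C := [set x | t < sup_conv e w x].
have oA : open A.
  rewrite /A (_ : mkset _ = w @^-1` `]t, +oo[%classic).
    by apply: open_comp; [move=> x _; exact: cw|exact: interval_open].
  by apply/seteqP; split => x /=; rewrite in_itv/= andbT.
have oC : open C by exact: (open_sup_conv_gt e0 wN).
have mA : measurable A by exact: open_measurable_rV.
have mC : measurable C by exact: open_measurable_rV.
have AM : A `<=` cube d (M + e).
  move=> x Ax; have : cube d M x by apply: contrapT => /w0 wx0; move: Ax; rewrite /A/= wx0 ltNge t0.
  by move=> Mx i; rewrite (le_trans (Mx i))// lerDl ltW.
have CM : C `<=` cube d (M + e).
  move=> x /(sup_conv_gt e0 wN) [y yx ty].
  have My : cube d M y by apply: contrapT => /w0 wx0; move: ty; rewrite wx0 ltNge t0.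
  move=> i; rewrite -(subrKC (y ord0 i) (x ord0 i)) (le_trans (ler_normD _ _))// lerD//.
  have := ler_coord_enorm (x - y) i; rewrite !mxE => /le_trans; apply.
  by rewrite -enormN opprB ltW.
have finA := fin_meas_sub (measurable_cube d (M + e)) (vol_cube_fin d _) mA AM.
have finC := fin_meas_sub (measurable_cube d (M + e)) (vol_cube_fin d _) mC CM.
have om0 : 0 < omega R d by exact: omega_gt0.
have vA0 : 0 <= fine (vol A) by exact: fine_ge0.
(* [r] is the radius of the ball with the volume of [{t < w}]. It is at least [rho], so the
   enlargement gains at least the area of the sphere of radius [rho] times [e]. *)
have [r r0 rE] := root_exists d0 (divr_ge0 vA0 (ltW om0)).
have vAE : vol A = (omega R d * r ^+ d)%:E.
  by rewrite rE mulrC divfK ?gt_eqF// fineK.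
have rhor : rho <= r.
  move: volw; rewrite -/A vAE lee_fin ler_pM2l// => H; rewrite leNgt; apply/negP => rrho.
  by move: H; rewrite leNgt ltr_pXn2r ?nnegrE ?(ltW rho0)// rrho.
have := @brunn_minkowski_ball R d (M + e) r e A C d0 (lt_le_trans rho0 rhor) e0 mA mC AM CM vAE.
have AC x y : A x -> enorm y < e -> C (x + y).
  move=> Ax ye; apply/(sup_conv_gt e0 wN); exists x => //.
  by rewrite opprD addNKr enormN.
move=> /(_ AC); rewrite -(fineK finC) lee_fin -/A vAE/= => /(le_trans _); apply.
rewrite -mulrDr ler_pM2l//; apply: ler_pow_increment => //; exact: ltW.
Qed.

(* The level sets of the sup-convolution of [w] at scale [e] are [e]-neighbourhoods of those of
   [w], so Brunn-Minkowski makes its integral grow at least linearly in [e]; it exceeds [w] by at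
   most [e |grad w| + o(e)]. *)
Lemma isoperimetric_gradient w (M H rho : R) : C1 w -> (forall x, ~ cube d M x -> w x = 0) ->
  (forall x, 0 <= w x <= H) -> 0 < H -> 0 < rho ->
  ((omega R d * rho ^+ d)%:E <= vol [set x | (H <= w x)%R])%E ->
  H * (omega R d * (d%:R * rho ^+ d.-1))
  <= \int[vol]_(x in cube d (M + 1)) enorm (gradient w x).
Proof.
move=> [dw cpw] w0 wH H0 rho0 volH; have cw := C1_continuous (conj dw cpw).
set D := cube d (M + 1); set G := fun x => enorm (gradient w x).
have mD : measurable D by exact: measurable_cube.
have finD : (vol D < +oo)%E by exact: vol_cube_fin.
have cG : continuous G by exact: gradient_continuous.
have G0 x : ~ cube d M x -> G x = 0.
  move=> nx; rewrite /G /enorm big1 ?sqrtr0// => i _.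
  by rewrite mxE (partial_out _ w0)// expr0n.
have iG : vol.-integrable D (EFin \o G).
  by apply: (@integrableS _ _ _ vol setT) => //; exact: integrable_cont_compact G0.
set P := omega R d * (d%:R * rho ^+ d.-1).
have mcont (v : 'rV[R]_d -> R) : continuous v -> measurable_fun D v.
  by move=> cv; apply: measurable_funTS; exact: continuous_measurable_rV.
have key (eta : R) : 0 < eta -> H * P <= \int[vol]_(x in D) G x + eta * fine (vol D).
  move=> eta0; have [r r0 Gr] := @uniform_continuous_cube R d (M + 1) eta G cG eta0.
  (* [e <= r] is for the uniform continuity of [G], and [e <= 1] keeps the support of [W] inside
     [D]. *)
  pose e := Num.min r 1; have e0 : 0 < e by rewrite lt_min r0 ltr01.
  have e1 : e <= 1 by rewrite ge_min lexx orbT.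
  have er : e <= r by rewrite ge_min lexx.
  pose W := sup_conv e w.
  have mW : measurable_fun D W by apply: measurable_funTS; exact: (measurable_sup_conv e0 wH).
  have WH x : 0 <= W x <= H.
    rewrite (sup_conv_ge0 e0 wH)/=; apply: (sup_conv_le e0 wH) => y _.
    by have /andP[] := wH y.
  (* Mean value theorem and Cauchy-Schwarz on the segment from [x] to [y], along which the norm of
     the gradient stays within [eta] of its value at [x]. *)
  have Wle x : D x -> W x <= w x + e * (G x + eta).
    move=> Dx; apply: (sup_conv_le e0 wH) => y yx.
    have [s /andP[s0 s1] E] := gradient_MVT x y dw.
    rewrite -lerBlDl E; set z := x + s *: (y - x).
    have := CS_sum ((y - x) ord0) (gradient w z ord0).
    under eq_bigr do rewrite [gradient w z _ _]mxE.
    move=> /le_trans; apply; apply: ler_pM; rewrite ?sqrtr_ge0 ?(ltW yx)//.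
    have : `|G x - G z| < eta.
      apply: Gr => //; rewrite /z addrC addKr enormZ gtr0_norm//.
      rewrite (lt_le_trans _ er)// (le_lt_trans _ yx)// ler_piMl ?enorm_ge0//.
      exact: ltW.
    rewrite -/(enorm (gradient w z)) -/(G z) ltr_norml; lra.
  have supp t : 0 <= t -> D `&` [set x | t < w x / H] = [set x | t * H < w x].
    move=> t0; apply/seteqP; split => x /=; rewrite ltr_pdivlMr//; first by case.
    move=> tx; split => //; have Mx : cube d M x.
      by apply: contrapT => /w0 wx; move: tx; rewrite wx ltNge mulr_ge0// ltW.
    by move=> i; rewrite (le_trans (Mx i))// lerDl.
  have suppW t : 0 <= t -> D `&` [set x | t < W x / H] = [set x | t * H < W x].
    move=> t0; apply/seteqP; split => x /=; rewrite ltr_pdivlMr//; first by case.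
    move=> tx; split => //.
    have tH0 : 0 <= t * H by rewrite mulr_ge0// ltW.
    have /(sup_conv_gt e0 wH) [y yx ty] := tx.
    have My : cube d M y by apply: contrapT => /w0 wx0; move: ty; rewrite wx0 ltNge tH0.
    move=> i; rewrite -(subrKC (y ord0 i) (x ord0 i)) (le_trans (ler_normD _ _))// lerD//.
    have := ler_coord_enorm (x - y) i; rewrite !mxE => /le_trans; apply.
    by rewrite -enormN opprB (le_trans (ltW yx)).
  have iW : vol.-integrable D (EFin \o W).
    by apply: (bounded_integrable mD finD (M := H)) => // x _; have /andP[? ?] := WH x; rewrite ger0_norm.
  have iw : vol.-integrable D (EFin \o w).
    apply: (bounded_integrable mD finD (M := H)); first exact: mcont.
    by move=> x _; have /andP[? ?] := wH x; rewrite ger0_norm.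
  (* Each of the [n - 1] levels [j / n] gains a volume [P * e]; the subtracted term is the error of
     the layer-cake sums. *)
  have lev n : (0 < n)%N ->
      (n%:R - 1) / n%:R * (P * e) - n%:R^-1 * fine (vol D)
      <= (\int[vol]_(x in D) W x) / H - (\int[vol]_(x in D) w x) / H.
    move=> n0; rewrite -!RintegralZr//.
    have iWH : vol.-integrable D (EFin \o (fun x => W x / H)).
      by have := integrableZr mD H^-1 iW; apply: eq_integrable.
    have := @Rintegral_ge_stair _ _ _ vol D mD finD n _ n0 iWH.
    have W0 x : D x -> 0 <= W x / H by move=> _; have /andP[? _] := WH x; rewrite divr_ge0// ltW.
    move=> /(_ W0) HW.
    have := @Rintegral_le_stair _ _ _ vol D mD finD n (fun x => w x / H) n0.
    have mwH : measurable_fun D (fun x => w x / H) by apply: measurable_funM => //; exact: mcont.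
    have w01 x : D x -> 0 <= w x / H <= 1.
      by move=> _; have /andP[? ?] := wH x; rewrite divr_ge0 ?(ltW H0)//= ler_pdivrMr// mul1r.
    move=> /(_ mwH w01) Hw.
    have n'0 : 0 < n%:R :> R by rewrite ltr0n.
    set sW := \sum_(1 <= j < n) _ in HW; set sw := \sum_(1 <= j < n) _ in Hw.
    have Hs : sw + (n%:R - 1) * (P * e) <= sW.
      have -> : (n%:R - 1) * (P * e) = \sum_(1 <= j < n) (P * e).
        by rewrite big_const_nat iter_addr_0 -[RHS]mulr_natl natrB.
      rewrite /sw /sW -big_split/=; apply: ler_sum_nat => j /andP[j1 jn].
      have j0 : 0 <= j%:R / n%:R :> R by rewrite divr_ge0.
      have jH : j%:R / n%:R * H < H by rewrite gtr_pMl// ltr_pdivrMr// mul1r ltr_nat.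
      rewrite supp// suppW// /P -[omega R d * _ * e]mulrA.
      apply: (@sup_conv_level w M H) => //; first by rewrite mulr_ge0// ltW.
      apply: (le_trans volH); apply: le_measure; rewrite ?inE.
      - rewrite (_ : mkset _ = w @^-1` `[H, +oo[%classic).
          rewrite -[X in measurable X]setTI.
          by apply: continuous_measurable_rV => //; exact: measurable_itv.
        by apply/seteqP; split => x /=; rewrite in_itv/= andbT.
      - rewrite -supp//; apply: measurable_gt => //.
      - by move=> x /=; exact: lt_le_trans.
    have nV : 0 < n%:R^-1 :> R by rewrite invr_gt0.
    move: Hs; rewrite -(ler_pM2l nV) mulrDr => Hs.
    rewrite -[(n%:R - 1) / n%:R]mulrC -mulrA.
    lra.
  have lev' : P * e <= (\int[vol]_(x in D) W x) / H - (\int[vol]_(x in D) w x) / H.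
    apply/ler_addgt0Pr => z z0.
    pose n := (Num.truncn ((P * e + fine (vol D)) / z)).+1.
    have n'0 : 0 < n%:R :> R by rewrite ltr0n.
    have L := lev n isT.
    have K : (P * e + fine (vol D)) / n%:R <= z.
      by rewrite ler_pdivrMr// [z * _]mulrC -ler_pdivrMr// ltW// truncnS_gt.
    have E : (n%:R - 1) / n%:R * (P * e) - n%:R^-1 * fine (vol D)
        = P * e - (P * e + fine (vol D)) / n%:R.
      by move: (n%:R : R) n'0 => m m0; field; rewrite gt_eqF.
    rewrite E in L; rewrite -lerBlDr; apply: le_trans L; rewrite lerD2l lerN2.
    exact: K.
  have intW : \int[vol]_(x in D) W x <= \int[vol]_(x in D) w x + e * (\int[vol]_(x in D) G x + eta * fine (vol D)).
    have i1 : vol.-integrable D (EFin \o (fun x => G x + eta)).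
      have ic : vol.-integrable D (EFin \o cst eta).
        by apply: (bounded_integrable mD finD (M := `|eta|)).
      by have := integrableD mD iG ic; apply: eq_integrable.
    have i2 : vol.-integrable D (EFin \o (fun x => e * (G x + eta))).
      by have := integrableZl mD e i1; apply: eq_integrable.
    rewrite -Rintegral_cst// -RintegralD//; last first.
      by apply: (bounded_integrable mD finD (M := `|eta|)).
    rewrite -RintegralZl// -RintegralD//; apply: le_Rintegral => //.
    by have := integrableD mD iw i2; apply: eq_integrable.
  move: lev'; rewrite -mulrBl ler_pdivlMr// => lev'.
  have : P * e * H <= e * (\int[vol]_(x in D) G x + eta * fine (vol D)).
    by apply: (le_trans lev'); rewrite lerBlDl.
  by rewrite (_ : P * e * H = e * (H * P)) ?ler_pM2l//; ring.
apply/ler_addgt0Pr => z z0.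
pose V := fine (vol D); have V0 : 0 <= V by exact: fine_ge0.
have zV : 0 < z / (V + 1) by rewrite divr_gt0// ltr_wpDl.
apply: (le_trans (key _ zV)); rewrite lerD2l -mulrA ler_piMr ?(ltW z0)//.
by rewrite mulrC ler_pdivrMr ?ltr_wpDl// mul1r lerDl.
Qed.

End isoperimetry.

(** * Symmetric decreasing rearrangement *)

Section equidistribution.
Context d1 d2 {T1 : measurableType d1} {T2 : measurableType d2} {R : realType}.
Variables (mu1 : {measure set T1 -> \bar R}) (mu2 : {measure set T2 -> \bar R}).
Variables (D1 : set T1) (D2 : set T2) (f1 : T1 -> R) (f2 : T2 -> R).
Hypotheses (mD1 : measurable D1) (mD2 : measurable D2).
Hypotheses (mf1 : measurable_fun setT f1) (mf2 : measurable_fun setT f2).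
Hypothesis fin1 : (mu1 D1 < +oo)%E.
Hypothesis lev : forall k : R,
  mu1 (D1 `&` [set x | k < f1 x]) = mu2 (D2 `&` [set x | k < f2 x]).

Let gtE d (T : measurableType d) (f : T -> R) k : [set x | k < f x] = f @^-1` `]k, +oo[%classic.
Proof. by apply/seteqP; split => x; rewrite /= in_itv/= andbT. Qed.

(** Rays form a pi-system generating the Borel sets, and the image measures are finite, so agreement
    on rays is enough. *)
Lemma equidistribution (A : set (measurableTypeR R)) : measurable A ->
  mu1 (D1 `&` f1 @^-1` A) = mu2 (D2 `&` f2 @^-1` A).
Proof.
move=> mA; rewrite setIC [in RHS]setIC.
have [p1 p1E] : exists p : {measure set (measurableTypeR R) -> \bar R}, p = pushforward (mrestr mu1 mD1) (f1 : T1 -> measurableTypeR R) :> (set (measurableTypeR R) -> _).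
  by unshelve eexists (pushforward (mrestr mu1 mD1) (f1 : T1 -> measurableTypeR R) : {measure set (measurableTypeR R) -> \bar R}).
have [p2 p2E] : exists p : {measure set (measurableTypeR R) -> \bar R}, p = pushforward (mrestr mu2 mD2) (f2 : T2 -> measurableTypeR R) :> (set (measurableTypeR R) -> _).
  by unshelve eexists (pushforward (mrestr mu2 mD2) (f2 : T2 -> measurableTypeR R) : {measure set (measurableTypeR R) -> \bar R}).
suff : p1 A = p2 A by rewrite p1E p2E.
apply: (@measure_unique _ R (measurableTypeR R) (@RGenOInfty.G R) (fun n => `](- n%:R)%R, +oo[%classic)
  _ _ _ _ p1 p2 _ _ A mA) => //.
- exact: RGenOInfty.measurableE.
- move=> _ _ [x ->] [y ->]; exists (Num.max x y).
  by apply/seteqP; split => z /=; rewrite !in_itv/= !andbT gt_max => /andP.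
- by move=> n; exists (- n%:R).
- apply/seteqP; split => // x _; exists (Num.truncn `|x|).+1 => //=.
  rewrite in_itv/= andbT ltrNl (le_lt_trans _ (truncnS_gt _))//.
  by rewrite -normrN ler_norm.
- by move=> _ [x ->]; rewrite p1E p2E /pushforward /mrestr -!gtE setIC lev setIC.
- move=> n; rewrite p1E /pushforward /mrestr (le_lt_trans _ fin1)// le_measure ?inE//.
  apply: measurableI => //; rewrite -[X in measurable X]setTI; exact: mf1.
Qed.

Let ge0_eq (h : R -> \bar R) : measurable_fun setT h -> (forall y, 0 <= h y)%E ->
  (\int[mu1]_(x in D1) h (f1 x) = \int[mu2]_(x in D2) h (f2 x))%E.
Proof.
move=> mh h0.
have H d (T : measurableType d) (mu : {measure set T -> \bar R}) D (mD : measurable D) (f : T -> R) :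
    measurable_fun setT f ->
    (\int[mu]_(x in D) h (f x) = \int[pushforward (mrestr mu mD) f]_y h y)%E.
  move=> mf; rewrite (@ge0_integral_pushforward _ _ _ _ _ _ mf (mrestr mu mD) setT h)//.
  rewrite preimage_setT.
  have mhf : measurable_fun setT (h \o f) by exact: measurableT_comp.
  rewrite (@ge0_negligible_integral _ _ _ (mrestr mu mD) setT (~` D) (h \o f))//; last 3 first.
  - exact: measurableC.
  - by move=> x _; exact: h0.
  - by rewrite /= /mrestr setICl measure0.
  rewrite setTD setCK; apply: eq_measure_integral => A mA AD.
  by rewrite /= /mrestr setIidl.
rewrite (H _ _ _ _ mD1)// (H _ _ _ _ mD2)//; apply: eq_measure_integral => A mA _.
by rewrite /= /pushforward /mrestr setIC equidistribution// setIC.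
Qed.

(** [h] may change sign, so its positive and negative parts are transported separately. *)
Lemma equidistribution_Rintegral (h : R -> R) : measurable_fun setT h ->
  \int[mu1]_(x in D1) h (f1 x) = \int[mu2]_(x in D2) h (f2 x).
Proof.
move=> mh; rewrite /Rintegral; congr fine.
have mEh : measurable_fun setT (EFin \o h) by exact/measurable_EFinP.
have P d (T : measurableType d) (mu : {measure set T -> \bar R}) D (f : T -> R) :
    (\int[mu]_(x in D) (h (f x))%:E = \int[mu]_(x in D) (EFin \o h)^\+ (f x)
      - \int[mu]_(x in D) (EFin \o h)^\- (f x))%E.
  rewrite integralE; congr (_ - _)%E; apply: eq_integral => x _.
    by rewrite !funeposE.
  by rewrite !funenegE.
rewrite !P (ge0_eq (measurable_funepos mEh) (fun y => funepos_ge0 _ y)).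
by rewrite (ge0_eq (measurable_funeneg mEh) (fun y => funeneg_ge0 _ y)).
Qed.

End equidistribution.

Section rearrangement.
Context {R : realType} {d : nat}.
Hypothesis d0 : (0 < d)%N.
Variables (Omega : set 'rV[R]_d) (c : 'rV[R]_d) (r : R).
Hypotheses (r0 : 0 < r) (oO : open Omega) (vO : vol Omega = (omega R d * r ^+ d)%:E).
Variables (f : 'rV[R]_d -> R) (a : R).
Hypotheses (cf : continuous f) (fa : forall x, Omega x -> a <= f x).
Variable N : R.
Hypothesis fN : forall x, f x <= N.
Hypothesis f0 : forall x, ~ Omega x -> f x = 0.

Let om0 : 0 < omega R d. Proof. exact: omega_gt0. Qed.
Let mO : measurable Omega. Proof. exact: open_measurable_rV. Qed.
Let finO : (vol Omega < +oo)%E. Proof. by rewrite vO ltry. Qed.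
Let mf : measurable_fun setT f. Proof. exact: continuous_measurable_rV. Qed.

Definition distrib (k : R) : R := fine (vol (Omega `&` [set x | k < f x])).

Let mlev k : measurable (Omega `&` [set x | k < f x]).
Proof. by apply: measurable_gt => //; exact: measurable_funTS. Qed.

Lemma distribE k : vol (Omega `&` [set x | k < f x]) = (distrib k)%:E.
Proof. by rewrite fineK// (fin_meas_sub mO finO). Qed.

Lemma distrib_ge0 k : 0 <= distrib k. Proof. exact: fine_ge0. Qed.

Lemma le_distrib k l : k <= l -> distrib l <= distrib k.
Proof.
move=> kl; rewrite -lee_fin -!distribE; apply: le_measure; rewrite ?inE//.
by move=> x [Ox /= lx]; split => //=; exact: le_lt_trans lx.
Qed.

Lemma distrib_le k : distrib k <= omega R d * r ^+ d.
Proof. by rewrite -lee_fin -distribE -vO; apply: le_measure; rewrite ?inE. Qed.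

Lemma distrib_out k : N <= k -> distrib k = 0.
Proof.
move=> Nk; rewrite /distrib (_ : _ `&` _ = set0) ?measure0//.
by apply/seteqP; split => x //= [_]; rewrite ltNge (le_trans (fN x)).
Qed.

Lemma distrib_below k : k < a -> distrib k = omega R d * r ^+ d.
Proof.
move=> ka; apply/EFin_inj; rewrite -distribE -vO; congr (vol _).
by apply/seteqP; split => x /=; [case|move=> Ox; split => //; exact: lt_le_trans (fa Ox)].
Qed.

(** Right continuity of the distribution function: [{k < f}] is the increasing union of the sets
    [{k + 1 / (n + 1) < f}]. *)
Lemma distrib_right k s : s < distrib k -> exists2 l, k < l & s < distrib l.
Proof.
move=> sk; pose F n := Omega `&` [set x | k + n.+1%:R^-1 < f x].
have UF : \bigcup_n F n = Omega `&` [set x | k < f x].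
  apply/seteqP; split => x.
    by move=> [n _ [Ox /= H]]; split => //=; apply: lt_trans H; rewrite ltrDl invr_gt0.
  move=> [Ox /= kx]; have xk : 0 < f x - k by rewrite subr_gt0.
  have [n _ /(_ _ (leqnn _)) nx] := near_infty_natSinv_lt (PosNum xk).
  by exists n => //; split => //=; rewrite -ltrBrDl.
have ndF : nondecreasing_seq F.
  move=> n m nm; apply/subsetPset => x [Ox /= H]; split => //=; apply: le_lt_trans H.
  by rewrite lerD2l lef_pV2 ?posrE// ler_nat.
have H : (vol \o F) n @[n --> \oo] --> vol (\bigcup_n F n).
  by apply: nondecreasing_cvg_mu => //; [move=> n; exact: mlev|rewrite UF; exact: mlev].
move: H; rewrite UF distribE => /fine_cvg /cvgrPdist_lt /(_ (distrib k - s)).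
rewrite subr_gt0 => /(_ sk) [n _ /(_ _ (leqnn _)) /= H].
exists (k + n.+1%:R^-1); first by rewrite ltrDl invr_gt0.
move: H; rewrite -/(distrib (k + n.+1%:R^-1)) ltr_norml; lra.
Qed.

(** The clause [k <= a] keeps the set nonempty when [rho >= r], and the rearrangement then equals
    [a]. A lower bound other than 0 is needed because [f] may be negative. *)
Definition rearr (rho : R) : R :=
  sup [set k | k <= a \/ omega R d * rho ^+ d < distrib k].

Let hs rho : 0 <= rho -> has_sup [set k | k <= a \/ omega R d * rho ^+ d < distrib k].
Proof.
move=> rho0; split; first by exists a; left.
exists (Num.max a N) => k [ka|]; first by rewrite le_max ka.
apply: contraPP => /negP; rewrite -ltNge gt_max => /andP[_ Nk].
by rewrite distrib_out ?(ltW Nk)//; apply/negP; rewrite -leNgt mulr_ge0 ?exprn_ge0// ltW.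
Qed.

Lemma rearr_ge rho : 0 <= rho -> a <= rearr rho.
Proof. by move=> rho0; apply: (ub_le_sup (proj2 (hs rho0))); left. Qed.

(** By [distrib_right], a level satisfying the volume condition is never the largest one, which is
    why the equivalence holds with strict inequalities on both sides. *)
Lemma rearr_gt rho k : 0 <= rho -> a <= k ->
  (k < rearr rho) <-> (omega R d * rho ^+ d < distrib k).
Proof.
move=> rho0 ak; split.
  move=> /(sup_gt (proj1 (hs rho0)))[l [la|rl] kl]; last by rewrite (lt_le_trans rl)// le_distrib// ltW.
  by move: kl; rewrite ltNge (le_trans la).
move=> /distrib_right[l kl sl]; apply: (lt_le_trans kl).
by apply: (ub_le_sup (proj2 (hs rho0))); right.
Qed.

Lemma rearr_gt_in rho k : 0 <= rho -> rho < r ->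
  (k < rearr rho) <-> (omega R d * rho ^+ d < distrib k).
Proof.
move=> rho0 rhor; have [ak|ka] := leP a k; first exact: rearr_gt.
rewrite distrib_below// ltr_pM2l// ltr_pXn2r ?nnegrE ?(ltW r0)//.
by split => // _; rewrite (lt_le_trans ka)// rearr_ge.
Qed.

Lemma rearr_le rho : 0 <= rho -> rearr rho <= Num.max a N.
Proof.
move=> rho0; rewrite leNgt; apply/negP => /(rearr_gt rho0 _).1.
rewrite le_max lexx => /(_ isT); rewrite distrib_out ?le_max ?lexx ?orbT//.
by apply/negP; rewrite -leNgt mulr_ge0 ?exprn_ge0// ltW.
Qed.

Lemma rearr_end : rearr r = a.
Proof.
apply/eqP; rewrite eq_le rearr_ge ?(ltW r0)// andbT leNgt; apply/negP.
by move=> /(rearr_gt (ltW r0) (lexx _)); rewrite ltNge distrib_le.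
Qed.

Lemma rearr_anti rho1 rho2 : 0 <= rho1 -> rho1 <= rho2 -> rearr rho2 <= rearr rho1.
Proof.
move=> r10 r12; have r20 := le_trans r10 r12; rewrite leNgt; apply/negP => H.
have := (rearr_gt r20 (rearr_ge r10)).1 H; apply/negP; rewrite -leNgt.
apply: (@le_trans _ _ (omega R d * rho1 ^+ d)); last by rewrite ler_pM2l// lerXn2r.
rewrite leNgt; apply/negP => /(rearr_gt r10 (rearr_ge r10)).2.
by rewrite ltxx.
Qed.

Definition radius k : R := xget 0 [set rho | 0 <= rho /\ omega R d * rho ^+ d = distrib k].

Lemma radiusP k : 0 <= radius k /\ omega R d * radius k ^+ d = distrib k.
Proof.
apply: (@xgetPex _ 0 [set rho | 0 <= rho /\ omega R d * rho ^+ d = distrib k]).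
have [x x0 xE] := root_exists d0 (divr_ge0 (distrib_ge0 k) (ltW om0)).
by exists x; split => //; rewrite xE mulrC divfK ?gt_eqF.
Qed.

Lemma radius_le k : radius k <= r.
Proof.
have [rk0 E] := radiusP k; have := distrib_le k; rewrite -E ler_pM2l//.
by move=> H; rewrite leNgt; apply/negP => rrk; move: H; rewrite leNgt ltr_pXn2r ?nnegrE ?(ltW r0)// rrk.
Qed.

Lemma lt_radius rho k : 0 <= rho -> (rho < radius k) <-> (omega R d * rho ^+ d < distrib k).
Proof.
by have [rk0 <-] := radiusP k => rho0; rewrite ltr_pM2l// ltr_pXn2r ?nnegrE.
Qed.

Lemma radius_rearr k rho : 0 <= rho -> rho < r -> (k < rearr rho) <-> (rho < radius k).
Proof. by move=> rho0 rhor; rewrite rearr_gt_in// lt_radius. Qed.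

Definition schwarz (x : 'rV[R]_d) : R := rearr (enorm (x - c)).

Let B := eball c r.

Lemma schwarz_level k : B `&` [set x | k < schwarz x] = eball c (radius k).
Proof.
rewrite /B !eballE; apply/seteqP; split => x /=.
  by move=> [xr /(radius_rearr _ (enorm_ge0 _) xr).1].
move=> xk; have xr := lt_le_trans xk (radius_le k).
by split => //; apply/(radius_rearr _ (enorm_ge0 _) xr).
Qed.

Lemma measurable_schwarz : measurable_fun setT schwarz.
Proof.
apply: (measurability _ (RGenOInfty.measurableE R)) => //.
move=> _ [_ [k ->] <-]; rewrite setTI preimage_itvoy.
have [ka|ak] := ltP k a.
  rewrite (_ : mkset _ = setT)//; apply/seteqP; split => x //= _.
  by rewrite (lt_le_trans ka)// rearr_ge ?enorm_ge0.
rewrite (_ : mkset _ = eball c (radius k)); first exact: measurable_eball.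
rewrite eballE; apply/seteqP; split => x /=.
  by move=> /(rearr_gt (enorm_ge0 _) ak).1 /(lt_radius _ (enorm_ge0 _)).2.
by move=> /(lt_radius _ (enorm_ge0 _)).1 /(rearr_gt (enorm_ge0 _) ak).2.
Qed.

Lemma schwarz_integral (h : R -> R) : measurable_fun setT h ->
  \int[vol]_(x in Omega) h (f x) = \int[vol]_(x in B) h (schwarz x).
Proof.
apply: equidistribution_Rintegral => //; [exact: measurable_eball|exact: measurable_schwarz|].
move=> k; transitivity (distrib k)%:E; first exact: distribE.
transitivity (vol (eball c (radius k))); last by congr (vol _); rewrite -schwarz_level.
by have [rk0 <-] := radiusP k; rewrite vol_eball.
Qed.

Lemma schwarz_bounded x : `|schwarz x| <= `|a| + `|N|.
Proof.
rewrite ler_norml; apply/andP; split.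
  apply: le_trans (rearr_ge (enorm_ge0 _)); rewrite lerNl -normrN.
  by rewrite (le_trans (ler_norm _))// lerDl.
apply: le_trans (rearr_le (enorm_ge0 _)) _; rewrite ge_max.
by apply/andP; split; apply: (le_trans (ler_norm _)); rewrite ?lerDl ?lerDr.
Qed.

Lemma schwarz_integrable D : measurable D -> (vol D < +oo)%E ->
  vol.-integrable D (EFin \o schwarz).
Proof.
move=> mD fD; apply: (bounded_integrable mD fD (M := `|a| + `|N|)).
  by apply: measurable_funTS; exact: measurable_schwarz.
by move=> x _; exact: schwarz_bounded.
Qed.

Let iO : vol.-integrable Omega (EFin \o f).
Proof.
apply: (bounded_integrable mO finO (M := `|a| + `|N|)); first exact: measurable_funTS.
move=> x Ox; rewrite ler_norml; apply/andP; split.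
  apply: le_trans (fa Ox); rewrite lerNl -normrN.
  by rewrite (le_trans (ler_norm _))// lerDl.
by rewrite (le_trans (fN x))// (le_trans (ler_norm _))// lerDr.
Qed.

Lemma schwarz_integral_level k :
  \int[vol]_(x in Omega `&` [set x | k < f x]) f x
  = \int[vol]_(x in eball c (radius k)) schwarz x.
Proof.
pose h y := if k < y then y else 0.
have mh : measurable_fun setT h by apply: measurable_fun_if => //; exact: measurable_fun_ltr.
have := schwarz_integral mh; rewrite -schwarz_level.
rewrite !Rintegral_mkcondr => E.
transitivity (\int[vol]_(x in Omega) h (f x)); last first.
  rewrite E; apply: eq_Rintegral => x _; rewrite patchE /h.
  rewrite (_ : (x \in _) = (k < schwarz x))//.
  by apply/idP/idP; rewrite inE.
apply: eq_Rintegral => x _; rewrite patchE /h (_ : (x \in _) = (k < f x))//.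
by apply/idP/idP; rewrite inE.
Qed.

(** Let [k] be the rearrangement at [rho], and bound [f] by [(f - k)^+ + k]. The integral of
    [(f - k)^+] over [E] is at most that over [Omega]; equimeasurability moves it to [B], where the
    rearranged function exceeds [k] only within radius [rho]. The constants [k] match because [E]
    has the volume of that ball. *)
Lemma hardy_littlewood (E : set 'rV[R]_d) rho : measurable E -> E `<=` Omega ->
  0 <= rho -> rho <= r -> vol E = (omega R d * rho ^+ d)%:E ->
  \int[vol]_(x in E) f x <= \int[vol]_(x in eball c rho) schwarz x.
Proof.
move=> mE EO rho0 rhor vE; pose k := rearr rho.
pose h y := Num.max (y - k) 0.
have mh : measurable_fun setT h.
  by apply: measurable_funTS; apply: measurable_maxr => //; exact: measurable_funB.
have h0 y : 0 <= h y by rewrite le_max lexx orbT.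
have finE : (vol E < +oo)%E by rewrite vE ltry.
have mBr := measurable_eball c rho; have fBr := vol_eball_fin c rho.
have BrB : eball c rho `<=` B by rewrite /B !eballE => x /= /lt_le_trans; exact.
have ih (D : set 'rV[R]_d) (g : 'rV[R]_d -> R) : measurable D -> (vol D < +oo)%E ->
    vol.-integrable D (EFin \o g) -> vol.-integrable D (EFin \o (h \o g)).
  move=> mD fD ig.
  have ic : vol.-integrable D (EFin \o cst (`|k| : R)).
    by apply: (bounded_integrable mD fD (M := `|k|)) => // x _; rewrite normr_id.
  have ign : vol.-integrable D (EFin \o (fun x => `|g x|)) by exact: integrable_norm.
  apply: (le_integrable mD _ _ (integrableD mD ign ic)).
    apply/measurable_EFinP; apply: (measurableT_comp mh).
    by apply/measurable_EFinP; exact: measurable_int ig.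
  move=> x Dx /=; rewrite lee_fin/= ger0_norm// ger0_norm ?addr_ge0// ge_max addr_ge0// andbT.
  by rewrite (le_trans (ler_norm _))// ler_normB.
have H1 : \int[vol]_(x in E) f x <= \int[vol]_(x in E) (h (f x) + k).
  apply: le_Rintegral => //.
  - exact: integrableS iO.
  - have ic : vol.-integrable E (EFin \o cst k).
      by apply: (bounded_integrable mE finE (M := `|k|)).
    have := integrableD mE (ih _ _ mE finE (integrableS mO mE EO iO)) ic.
    by apply: eq_integrable.
  - by move=> x _; rewrite -lerBlDr le_max lexx.
have ikE : vol.-integrable E (EFin \o cst k) by apply: (bounded_integrable mE finE (M := `|k|)).
have ikB : vol.-integrable (eball c rho) (EFin \o cst k).
  by apply: (bounded_integrable mBr fBr (M := `|k|)).
apply: (le_trans H1); rewrite RintegralD//; last first.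
  exact: (ih _ _ mE finE (integrableS mO mE EO iO)).
have H2 : \int[vol]_(x in E) h (f x) <= \int[vol]_(x in Omega) h (f x).
  rewrite Rintegral_mkcond [leRHS]Rintegral_mkcond; apply: le_Rintegral => //.
  - have := ih _ _ mE finE (integrableS mO mE EO iO).
    by rewrite (integrable_mkcond _ mE); apply: eq_integrable => // x _ /=; rewrite !patchE; case: ifP.
  - have := ih _ _ mO finO iO.
    by rewrite (integrable_mkcond _ mO); apply: eq_integrable => // x _ /=; rewrite !patchE; case: ifP.
  - move=> x _; rewrite !patchE; case: ifPn => xE.
      by rewrite ifT//; move/set_mem : xE => /EO; rewrite inE.
    by case: ifP.
have H3 : \int[vol]_(x in B) h (schwarz x) = \int[vol]_(x in eball c rho) h (schwarz x).
  rewrite -(setIidr BrB) Rintegral_mkcondr; apply: eq_Rintegral => x _.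
  rewrite patchE; case: ifPn => //; rewrite notin_setE eballE/= => /negP; rewrite -leNgt => xr.
  by apply/eqP; rewrite eq_le h0 andbT ge_max lexx andbT subr_le0 rearr_anti.
have H4 : \int[vol]_(x in eball c rho) h (schwarz x) + \int[vol]_(x in eball c rho) k
    = \int[vol]_(x in eball c rho) schwarz x.
  rewrite -RintegralD//; last exact: (ih _ _ mBr fBr (schwarz_integrable mBr fBr)).
  apply: eq_Rintegral => x; rewrite inE eballE/= => xr.
  by rewrite /h max_l ?subrK// subr_ge0 rearr_anti ?enorm_ge0// ltW.
rewrite -H4 -H3 -schwarz_integral// lerD//.
rewrite !Rintegral_cst// -[fine (_ E)]/(fine (vol E)) -[fine (_ (eball c rho))]/(fine (vol (eball c rho))).
by rewrite vE vol_eball.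
Qed.

End rearrangement.

Section continuous_algebra.
Context {R : realType} {T : topologicalType}.
Implicit Types f g : T -> R.

Lemma continuous_mul f g : continuous f -> continuous g -> continuous (fun x => f x * g x).
Proof. by move=> cf cg x; exact: cvgM (cf x) (cg x). Qed.

Lemma continuous_add f g : continuous f -> continuous g -> continuous (fun x => f x + g x).
Proof. by move=> cf cg x; exact: cvgD (cf x) (cg x). Qed.

Lemma continuous_sub f g : continuous f -> continuous g -> continuous (fun x => f x - g x).
Proof. by move=> cf cg x; exact: cvgB (cf x) (cg x). Qed.

Lemma continuous_scale (k : R) f : continuous f -> continuous (fun x => k * f x).
Proof. by move=> cf; apply: continuous_mul => //; exact: cst_continuous. Qed.

Lemma continuous_pow n f : continuous f -> continuous (fun x => f x ^+ n).
Proof.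
by move=> cf x; apply: (@continuous_comp _ _ _ f (fun t => t ^+ n)); [exact: cf|exact: exprn_continuous].
Qed.

End continuous_algebra.

Section rearrangement_continuity.
Context {R : realType} {d : nat}.
Hypothesis d0 : (0 < d)%N.
Variables (Omega : set 'rV[R]_d) (c : 'rV[R]_d) (r : R).
Hypotheses (r0 : 0 < r) (oO : open Omega) (vO : vol Omega = (omega R d * r ^+ d)%:E).
Variables (f : 'rV[R]_d -> R) (a : R).
Hypotheses (cf : continuous f) (fa : forall x, Omega x -> a <= f x).
Variable N : R.
Hypothesis fN : forall x, f x <= N.
Hypothesis f0 : forall x, ~ Omega x -> f x = 0.
Hypothesis fa_inf : forall k, a < k -> k <= 0 -> exists2 y, Omega y & f y < k.

Let om0 : 0 < omega R d. Proof. exact: omega_gt0. Qed.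

Let open_between p q : open [set x | p < f x < q].
Proof.
rewrite (_ : mkset _ = f @^-1` `]p, q[%classic).
  by apply: open_comp; [move=> x _; exact: cf|exact: interval_open].
by apply/seteqP; split => x; rewrite /= in_itv.
Qed.

Let outside : exists z, ~ Omega z.
Proof.
apply/not_existsP => H.
have OT : eball c (r + 1) `<=` Omega by move=> x _; apply: contrapT; exact: H.
have : (vol (eball c (r + 1)) <= vol Omega)%E.
  by apply: le_measure; rewrite ?inE//; [exact: measurable_eball|exact: open_measurable_rV].
have r1 : 0 < r + 1 by rewrite addr_gt0.
rewrite vO vol_eball ?(ltW r1)// lee_fin ler_pM2l// leNgt ltr_pXn2r ?nnegrE ?(ltW r0) ?(ltW r1)//.
by rewrite ltrDl ltr01.
Qed.

(** A continuous function with values on both sides of an interval of levels takes values inside it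
    on a nonempty open set, which has positive volume. As [Omega] may be disconnected, the low point
    [x2] is sought outside [Omega], where [f = 0], if [l > 0], and through [fa_inf] otherwise.
    Either way the levels between [p] and [q] avoid 0, so the open set lies in [Omega]. *)
Lemma lt_distrib k l : a <= k -> k < l -> 0 < distrib Omega f l ->
  distrib Omega f l < distrib Omega f k.
Proof.
move=> ak kl ml; have mO : measurable Omega by exact: open_measurable_rV.
have finO : (vol Omega < +oo)%E by rewrite vO ltry.
have [x1 Ox1 lx1] : exists2 x, Omega x & l < f x.
  apply: contrapT => H; move: ml; rewrite /distrib (_ : _ `&` _ = set0) ?measure0 ?ltxx//.
  by apply/seteqP; split => x //= [Ox lx]; apply: H; exists x.
have [p [q [[kp pq ql] [[x2 x2p] pqO]]]] : exists p q, [/\ k <= p, p < q & q <= l] /\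
    (exists x2, f x2 <= p) /\ (forall x, p < f x < q -> Omega x).
  have [l0|l0] := ltP 0 l.
    exists (Num.max k 0), l; split; [|split].
    - by rewrite le_max lexx gt_max kl l0.
    - by have [z nz] := outside; exists z; rewrite f0// le_max lexx orbT.
    - move=> x; rewrite gt_max => /andP[/andP[_ fx0] _]; apply: contrapT => /f0 fx.
      by rewrite fx ltxx in fx0.
  have [y Oy yl] := fa_inf (le_lt_trans ak kl) l0.
  exists (Num.max k (f y)), l; split; [|split].
  - by rewrite le_max lexx gt_max kl yl.
  - by exists y; rewrite le_max lexx orbT.
  - move=> x /andP[_ xl]; apply: contrapT => /f0 fx.
    by rewrite fx ltNge l0 in xl.
have [t _ ft] : exists2 t, t \in `[0, 1] & f (x2 + t *: (x1 - x2)) = (p + q) / 2.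
  apply: IVT => //.
    apply: continuous_subspaceT => t.
    apply: (@continuous_comp _ _ _ (fun t : R => x2 + t *: (x1 - x2))); last exact: cf.
    by apply: continuousD; [exact: cst_continuous|exact: scalel_continuous].
  rewrite scale0r addr0 scale1r addrC subrK ge_min le_max.
  have H1 : f x2 <= (p + q) / 2 by lra.
  have H2 : (p + q) / 2 <= f x1 by lra.
  by rewrite H1 H2 orbT.
have vpq : (0 < vol [set x | (p < f x < q)%R])%E.
  apply: vol_open_gt0; first exact: open_between.
  by exists (x2 + t *: (x1 - x2)); rewrite /= ft; lra.
have mpq : measurable [set x | p < f x < q] by exact: open_measurable_rV.
have mf : measurable_fun Omega f by apply: measurable_funTS; exact: continuous_measurable_rV.
rewrite -lte_fin -!(distribE oO vO)//.
apply: (@lt_le_trans _ _ (vol (Omega `&` [set x | (l < f x)%R]) + vol [set x | (p < f x < q)%R])%E).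
  by rewrite lteDl// (fin_meas_sub mO finO)//; exact: measurable_gt.
rewrite -measureU//; last 2 first.
- exact: measurable_gt.
- by apply/seteqP; split => x //= [[_ lx] /andP[_ xq]]; lra.
apply: le_measure; rewrite ?inE.
- by apply: measurableU => //; exact: measurable_gt.
- exact: measurable_gt.
- move=> x [[Ox /= lx]|/= px]; first by split => //=; exact: lt_trans lx.
  by split; [exact: pqO|have /andP[px' _] := px; exact: le_lt_trans px'].
Qed.

(** Extends functions of the radius from [[0, r]] to the whole line by constants, so that continuity
    can be stated globally. *)
Definition clamp (rho : R) : R := Num.max 0 (Num.min rho r).

Lemma clamp_ge0 rho : 0 <= clamp rho. Proof. by rewrite le_max lexx. Qed.

Lemma clamp_in rho : 0 <= rho -> rho <= r -> clamp rho = rho.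
Proof. by move=> H1 H2; rewrite /clamp min_l// max_r. Qed.

Lemma clamp_continuous : continuous clamp.
Proof.
move=> x; have H1 : {for x, continuous ((id : R -> R^o) \min cst r)}.
  by apply: (@continuous_min R R); [exact: cvg_id|exact: cst_continuous].
exact: (@continuous_max R R (cst 0) _ x (@cst_continuous _ _ _ _) H1).
Qed.

Local Notation g := (rearr Omega f a).

(** The lower bound near [rho] is immediate from [rearr_gt]. For the upper bound, a jump would leave
    an interval of levels carrying no volume, which [lt_distrib] excludes. *)
Lemma rearr_continuous : continuous (fun rho => g (clamp rho)).
Proof.
have P rho k : a <= k -> (k < g (clamp rho)) <-> (omega R d * clamp rho ^+ d < distrib Omega f k).
  by move=> ak; apply: (rearr_gt oO vO cf fN) => //; exact: clamp_ge0.
have ga rho : a <= g (clamp rho) by apply: (rearr_ge _ _ fN) => //; exact: clamp_ge0.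
have cpow : continuous (fun rho => omega R d * clamp rho ^+ d).
  move=> rho; apply: (@continuous_comp _ _ _ clamp (fun t => omega R d * t ^+ d)).
    exact: clamp_continuous.
  apply: continuous_scale; exact: exprn_continuous.
move=> rho; apply/cvgrPdist_le => e e0.
have lo : \forall t \near rho, g (clamp rho) - e <= g (clamp t).
  have [ka|ak] := ltP (g (clamp rho) - e) a.
    by near=> t; rewrite (le_trans (ltW ka)).
  have : omega R d * clamp rho ^+ d < distrib Omega f (g (clamp rho) - e).
    by apply/P => //; rewrite gtrBl.
  move=> H; have : \forall t \near rho, omega R d * clamp t ^+ d < distrib Omega f (g (clamp rho) - e).
    by apply: (cvgr_lt _ (cpow rho)).
  by apply: filterS => t /P H'; apply/ltW/H'.
have hi : \forall t \near rho, g (clamp t) <= g (clamp rho) + e.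
  pose k := g (clamp rho) + e; have ak : a < k by rewrite (le_lt_trans (ga rho))// ltrDl.
  have [mk0|mk0] := leP (distrib Omega f k) 0.
    near=> t; rewrite leNgt; apply/negP => /(P _ _ (ltW ak)).
    by apply/negP; rewrite -leNgt (le_trans mk0)// mulr_ge0 ?exprn_ge0 ?clamp_ge0// ltW.
  have H : distrib Omega f k < omega R d * clamp rho ^+ d.
    apply: (lt_le_trans (lt_distrib (ga rho) _ mk0)); first by rewrite ltrDl.
    by rewrite leNgt; apply/negP => /(P _ _ (ga rho)); rewrite ltxx.
  have : \forall t \near rho, distrib Omega f k < omega R d * clamp t ^+ d.
    by apply: (cvgr_gt _ (cpow rho)).
  apply: filterS => t H'; rewrite leNgt; apply/negP => /(P _ _ (ltW ak)).
  by rewrite ltNge (ltW H').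
near=> t; rewrite ler_distlC; apply/andP; split.
- by near: t.
- by near: t.
Unshelve. all: by end_near. Qed.

End rearrangement_continuity.

Section derivative_criterion.
Context {R : realType}.

Lemma is_derive_eps (A : R -> R) (x l : R) :
  (forall e, 0 < e -> exists2 r, 0 < r &
    forall h, `|h| < r -> `|A (x + h) - A x - l * h| <= e * `|h|) ->
  is_derive x 1 A l.
Proof.
move=> H.
have cv : h^-1 *: ((A \o shift x) (h *: (1 : R^o)) - A x) @[h --> 0^'] --> l.
  apply/cvgrPdist_le => e e0; have [r r0 Hr] := H e e0.
  near=> h.
  have h0 : h != 0 by near: h; exact: nbhs_dnbhs_neq.
  have hr : `|h| < r by near: h; exact: dnbhs0_lt.
  have := Hr _ hr; rewrite /= [h%:A]mulr1 [h + x]addrC => Hh.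
  rewrite -(ler_pM2r (x := `|h|)) ?normr_gt0// -normrM mulrBl.
  rewrite -[_ *: _ * h]/(h^-1 * (A (x + h) - A x) * h) mulrAC mulVf// mul1r.
  by rewrite distrC.
by apply: DeriveDef; [apply/cvg_ex; exists l|apply: cvg_lim].
Unshelve. all: by end_near. Qed.

End derivative_criterion.

(** * Integrals of radial functions over balls *)

Section radial_integral.
Context {R : realType} {d : nat}.
Hypothesis d0 : (0 < d)%N.
Variable c : 'rV[R]_d.
Local Notation om := (omega R d).

(** The area of the sphere of radius [rho], obtained as the derivative of the volume of the ball. *)
Definition sphere_weight (rho : R) : R := om * (d%:R * rho ^+ d.-1).

Let om0 : 0 < om. Proof. exact: omega_gt0. Qed.

Lemma sphere_weight_gt0 rho : 0 < rho -> 0 < sphere_weight rho.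
Proof. by move=> rho0; rewrite !mulr_gt0 ?exprn_gt0// ltr0n. Qed.

Lemma is_derive_ball_volume (rho : R) :
  is_derive rho 1 (fun s : R => om * s ^+ d) (sphere_weight rho).
Proof.
rewrite /sphere_weight; have := @is_deriveX R R id d rho 1 1 (is_derive_id rho 1).
move=> H; have := is_deriveZ om H; rewrite exprfctE => H'.
by apply: is_derive_eq H' _; rewrite /GRing.scale/= mulr1.
Qed.

Lemma sphere_weight_continuous : continuous sphere_weight.
Proof.
by apply: continuous_scale; apply: continuous_scale; exact: exprn_continuous.
Qed.

Definition radial_int (g : R -> R) (rho : R) : R := \int[vol]_(x in eball c rho) g (enorm (x - c)).

Variable g : R -> R.
Hypothesis cg : continuous g.

Lemma radial_continuous : continuous (fun x : 'rV[R]_d => g (enorm (x - c))).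
Proof.
move=> x; apply: (@continuous_comp _ _ _ (fun x : 'rV[R]_d => enorm (x - c))).
  exact: enorm_sub_continuous.
exact: cg.
Qed.

Lemma radial_bounded rho : exists2 M, 0 <= M & forall t, 0 <= t <= rho -> `|g t| <= M.
Proof.
have [rho0|rho0] := leP 0 rho; last first.
  by exists 0 => // t /andP[t0 tr]; have := le_lt_trans (le_trans t0 tr) rho0; rewrite ltxx.
have [|x0 [_ H]] := @compact_bounded R _ (g @` `[0, rho]%classic).
  apply: continuous_compact; last exact: segment_compact.
  exact: continuous_subspaceT.
exists (`|x0| + 1); first by rewrite addr_ge0.
move=> t t0; apply: H; first by rewrite (le_lt_trans (ler_norm _))// ltrDl.
by exists t => //=; rewrite in_itv/=.
Qed.

Lemma radial_integrable rho : vol.-integrable (eball c rho) (EFin \o (fun x => g (enorm (x - c)))).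
Proof.
have [M M0 gM] := radial_bounded rho.
apply: (bounded_integrable (measurable_eball _ _) (vol_eball_fin _ _) (M := M)).
  by apply: measurable_funTS; apply: continuous_measurable_rV; exact: radial_continuous.
by rewrite eballE => x /= xr; apply: gM; rewrite enorm_ge0 ltW.
Qed.

Lemma radial_int_le0 rho : rho <= 0 -> radial_int g rho = 0.
Proof.
move=> rho0; rewrite /radial_int (_ : eball c rho = set0) ?Rintegral_set0//.
by rewrite eballE; apply/seteqP; split => x //= /lt_le_trans/(_ rho0); rewrite ltNge enorm_ge0.
Qed.

Lemma eball_sub s t : s <= t -> eball c s `<=` eball c t.
Proof. by move=> st; rewrite !eballE => x /= /lt_le_trans; exact. Qed.

(** An estimate on the shell between radii [s] and [t]. It stands in for integration in polar
    coordinates: the differentiability and the continuity of [radial_int] rest on it. *)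
Lemma radial_int_diff s t (l e : R) : 0 <= s -> s <= t -> (forall u, s <= u <= t -> `|g u - l| <= e) ->
  `|radial_int g t - radial_int g s - l * (om * t ^+ d - om * s ^+ d)|
  <= e * (om * t ^+ d - om * s ^+ d).
Proof.
move=> s0 st H; have t0 := le_trans s0 st.
pose A := eball c t `\` eball c s.
have mt := measurable_eball c t; have ms := measurable_eball c s.
have mA : measurable A by exact: measurableD.
have finA : (vol A < +oo)%E.
  by apply: le_lt_trans (vol_eball_fin c t); apply: le_measure; rewrite ?inE// => x [].
have tE : eball c t = eball c s `|` A by rewrite setDUK//; exact: eball_sub.
have vA : fine (vol A) = om * t ^+ d - om * s ^+ d.
  have : vol (eball c t) = (vol (eball c s) + vol A)%E.
    by rewrite tE measureU// setDIK.
  rewrite !vol_eball// -(fineK (_ : vol A \is a fin_num)) ?ge0_fin_numE//.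
  by rewrite -EFinD => -[->]; rewrite addrC addKr.
have it : vol.-integrable (eball c s `|` A) (EFin \o (fun x => g (enorm (x - c)))).
  by rewrite -tE; exact: radial_integrable.
have iA : vol.-integrable A (EFin \o (fun x => g (enorm (x - c)))).
  by apply: integrableS it => //; exact: measurableU.
have -> : radial_int g t - radial_int g s = \int[vol]_(x in A) g (enorm (x - c)).
  rewrite /radial_int tE Rintegral_setU//; first by rewrite addrC addKr.
  by apply/disj_setPS => x [? []].
have ic k : vol.-integrable A (EFin \o cst k).
  by apply: (bounded_integrable mA finA (M := `|k|)).
have cst_int k : \int[vol]_(x in A) k = k * (om * t ^+ d - om * s ^+ d).
  by rewrite Rintegral_cst//; congr (_ * _); exact: vA.
rewrite -cst_int -RintegralB//; last exact: ic.
have iB : vol.-integrable A (EFin \o (fun x => g (enorm (x - c)) - l)).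
  by have := integrableB mA iA (ic l); apply: eq_integrable.
apply: (le_trans (le_normr_Rintegral _ _)) => //.
rewrite -cst_int; apply: le_Rintegral => //; [exact: integrable_norm|exact: ic|].
move=> x; rewrite /A !eballE => -[/= xt /negP]; rewrite -leNgt => xs.
by apply: H; rewrite xs ltW.
Qed.

Lemma is_derive_radial_int (rho : R) : 0 < rho ->
  is_derive rho 1 (radial_int g) (sphere_weight rho * g rho).
Proof.
(* [g rho] times the volume of the ball is split off, its derivative being known; by continuity of
   [g] the remainder [B] has derivative 0 at [rho]. *)
move=> rho0; pose B s := radial_int g s - g rho * (om * s ^+ d).
have dB : is_derive rho 1 B 0.
  apply: is_derive_eps => e e0.
  have [M M0 bM] : exists2 M, 0 < M & forall h, `|h| < rho ->
      `|om * (rho + h) ^+ d - om * rho ^+ d| <= M * `|h|.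
    have [N N0 NP] : exists2 N, 0 <= N & forall t, 0 <= t <= rho + rho -> sphere_weight t <= N.
      exists (sphere_weight (rho + rho)); first by rewrite ltW// sphere_weight_gt0// addr_gt0.
      move=> t /andP[t0 t2]; rewrite ler_wpM2l ?(ltW om0)// ler_wpM2l// lerXn2r//.
      by rewrite nnegrE addr_ge0// ltW.
    have mono s t : 0 <= s -> s <= t -> t <= rho + rho -> `|om * t ^+ d - om * s ^+ d| <= (N + 1) * `|t - s|.
      move=> s0 st tr.
      have [|xi xir ->] := MVT_segment st (fun x _ => is_derive_ball_volume x).
        apply: continuous_subspaceT; apply: continuous_scale; exact: exprn_continuous.
      rewrite normrM ler_wpM2r// ger0_norm ?(le_trans (NP _ _)) ?lerDl//.
        by move: xir; rewrite in_itv/= => /andP[x1 x2]; rewrite (le_trans s0 x1) (le_trans x2 tr).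
      move: xir; rewrite in_itv/= => /andP[x1 x2].
      by rewrite mulr_ge0 ?(ltW om0)// mulr_ge0// exprn_ge0// (le_trans s0).
    exists (N + 1); first by rewrite ltr_wpDl.
    move=> h; rewrite ltr_norml => /andP[h1 h2]; have [h0|h0] := leP 0 h.
      by rewrite -[in leRHS](addrK rho h) [h + rho]addrC mono//; lra.
    have -> : `|h| = `|rho - (rho + h)| by rewrite opprD addrA subrr sub0r normrN.
    by rewrite distrC mono//; lra.
  have /cvgrPdist_le/(_ (e / M)) := @cg rho.
  rewrite divr_gt0// => /(_ isT) /nbhs_ballP[q /= q0 gq].
  exists (Num.min q rho); first by rewrite lt_min q0.
  move=> h; rewrite lt_min => /andP[hq hr].
  have gq' u : `|u - rho| < q -> `|g u - g rho| <= e / M.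
    by move=> ur; rewrite distrC; apply: gq; rewrite -ball_normE/= distrC.
  rewrite mul0r subr0.
  have -> : B (rho + h) - B rho = radial_int g (rho + h) - radial_int g rho
      - g rho * (om * (rho + h) ^+ d - om * rho ^+ d) by rewrite /B; ring.
  have hr' := hr; have hq' := hq.
  move: hr hq; rewrite !ltr_norml => /andP[h1 h2] /andP[h3 h4].
  have fin : e / M * `|om * (rho + h) ^+ d - om * rho ^+ d| <= e * `|h|.
    rewrite (le_trans (ler_wpM2l _ (bM _ hr')))//; first by rewrite ltW// divr_gt0.
    by rewrite mulrA divfK ?gt_eqF.
  have [h0|h0] := leP 0 h.
    apply: le_trans (radial_int_diff _ _ _) (le_trans _ fin); first exact: ltW.
    - by rewrite lerDl.
    - move=> u /andP[u1 u2]; apply: gq'; rewrite ger0_norm; last by rewrite subr_ge0.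
      by rewrite (le_lt_trans _ h4)// lerBlDl.
    - by rewrite ler_wpM2l ?ler_norm// ltW// divr_gt0.
  have -> : `|radial_int g (rho + h) - radial_int g rho - g rho * (om * (rho + h) ^+ d - om * rho ^+ d)|
     = `|radial_int g rho - radial_int g (rho + h) - g rho * (om * rho ^+ d - om * (rho + h) ^+ d)|.
    by rewrite -normrN; congr (`| _ |); ring.
  apply: le_trans (radial_int_diff (e := e / M) _ _ _) (le_trans _ fin); [lra|lra| |].
  - move=> u /andP[u1 u2]; apply: gq'; rewrite ltr_norml; lra.
  - by rewrite distrC ler_wpM2l ?ler_norm// ltW// divr_gt0.
have dV := is_derive_ball_volume rho.
have := is_deriveD dB (is_deriveZ (g rho) dV).
rewrite add0r (_ : B + _ = radial_int g); last first.
  by apply/funext => s; rewrite -[RHS](subrK (g rho * (om * s ^+ d))).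
by move=> H; apply: is_derive_eq H _; rewrite /GRing.scale/= mulrC.
Qed.

Lemma radial_int_continuous : continuous (radial_int g).
Proof.
move=> rho; have [rho0|] := ltP 0 rho.
  by apply: differentiable_continuous; apply/derivable1_diffP; have [] := is_derive_radial_int rho0.
move=> rho0; have [M M0 gM] := radial_bounded 1.
have B s : 0 <= s <= 1 -> `|radial_int g s| <= M * om * s.
  move=> /andP[s0 s1]; have := @radial_int_diff 0 s 0 M (lexx 0) s0.
  rewrite (radial_int_le0 (lexx 0)) mul0r !subr0 expr0n gtn_eqF// mulr0 subr0 => H.
  apply: le_trans (H _) _; first by move=> u /andP[u0 us]; rewrite subr0 gM// u0 (le_trans us).
  rewrite -mulrA ler_wpM2l// ler_wpM2l ?(ltW om0)//.
  by case: (d) d0 => // n _; rewrite exprS ler_piMr// exprn_ile1.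
apply/cvgrPdist_le => e e0; rewrite (radial_int_le0 rho0).
have MO : 0 < M * om + 1 by rewrite ltr_wpDl// mulr_ge0// ltW.
near=> s; rewrite sub0r normrN; have [s0|s0] := leP s 0.
  by rewrite radial_int_le0// normr0 ltW.
have sE : s <= Num.min 1 (e / (M * om + 1)).
  rewrite -(lerD2l (- rho)); apply: (@le_trans _ _ (Num.min 1 (e / (M * om + 1)))); last by lra.
  rewrite addrC (le_trans (ler_norm _))// distrC.
  by near: s; apply: cvgr_dist_le => //; rewrite lt_min ltr01 divr_gt0.
move: sE; rewrite le_min => /andP[s1 se].
apply: le_trans (B s _) _; first by rewrite (ltW s0).
move: se; rewrite ler_pdivlMr// mulrDr mulr1 [s * _]mulrC => se.
by rewrite (le_trans _ se)// lerDl ltW.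
Unshelve. all: by end_near. Qed.

End radial_integral.

(** * Talenti's comparison of level sets *)

Section partial_rules.
Context {R : realType} {d : nat}.
Implicit Types (x : 'rV[R]_d) (f g : 'rV[R]_d -> R).

Lemma differentiable_mul f g x : differentiable f x -> differentiable g x ->
  differentiable (fun x => f x * g x) x.
Proof. exact: differentiableM. Qed.

Lemma differentiable_add f g x : differentiable f x -> differentiable g x ->
  differentiable (fun x => f x + g x) x.
Proof. exact: differentiableD. Qed.

Lemma partial_mul i f g x : differentiable f x -> differentiable g x ->
  partial i (fun x => f x * g x) x = f x * partial i g x + g x * partial i f x.
Proof.
by move=> df dg; rewrite /partial (@deriveM _ _ f g x)//; exact: diff_derivable.
Qed.

Lemma partial_add i f g x : differentiable f x -> differentiable g x ->
  partial i (fun x => f x + g x) x = partial i f x + partial i g x.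
Proof.
by move=> df dg; rewrite /partial (@deriveD _ _ _ f g x)//; exact: diff_derivable.
Qed.

Lemma partial_cst i (k : R) x : partial i (fun=> k) x = 0.
Proof. by rewrite /partial derive_cst. Qed.

Lemma differentiable_compr (b : R -> R) (db : R) f x : is_derive (f x) 1 b db ->
  differentiable f x -> differentiable (fun x => b (f x)) x.
Proof.
move=> [b1 _] df; apply: (@differentiable_comp _ _ _ _ f b) => //.
exact/derivable1_diffP.
Qed.

Lemma partial_comp i (b : R -> R) (db : R) f x : is_derive (f x) 1 b db ->
  differentiable f x -> partial i (fun x => b (f x)) x = db * partial i f x.
Proof.
move=> hb df; pose e : 'rV[R]_d := delta_mx ord0 i.
have df' : differentiable f (x + 0 *: e) by rewrite scale0r addr0.
have dbf' : differentiable (fun x => b (f x)) (x + 0 *: e).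
  by rewrite scale0r addr0; exact: differentiable_compr hb df.
have H1 := derive_line df'; have H2 := derive_line dbf'.
have hb' : is_derive (f (x + 0 *: e)) 1 b db by rewrite scale0r addr0.
have H3 := is_derive1_comp hb' H1.
have E : 'D_e (fun x => b (f x)) (x + 0 *: e) = db * 'D_e f (x + 0 *: e).
  by have [_ <-] := H2; have [_ <-] := H3.
by move: E; rewrite scale0r addr0.
Qed.

Definition lap f x : R := \sum_i partial i (partial i f) x.

Definition C2 f := C1 f /\ forall i, C1 (partial i f).

Lemma lap_continuous f : C2 f -> continuous (lap f).
Proof.
move=> [_ H]; apply: continuous_big => [|i _]; first exact: add_continuous.
by have [_] := H i; apply.
Qed.

Lemma lap_out f (M : R) : (forall x, ~ cube d M x -> f x = 0) ->
  forall x, ~ cube d M x -> lap f x = 0.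
Proof.
move=> f0 x nx; rewrite /lap big1// => i _.
by apply: (partial_out _ _ nx); exact: partial_out.
Qed.

Lemma integrable_cube f (M : R) : continuous f -> vol.-integrable (cube d M) (EFin \o f).
Proof.
move=> cf; have mC := measurable_cube d M.
have [|x0 [_ H]] := @compact_bounded R _ (f @` cube d M).
  by apply: continuous_compact; [exact: continuous_subspaceT|exact: compact_cube].
apply: (bounded_integrable mC (vol_cube_fin d M) (M := `|x0| + 1)).
  by apply: measurable_funTS; exact: continuous_measurable_rV.
by move=> x Mx; apply: H; [rewrite (le_lt_trans (ler_norm _))// ltrDl|exists x].
Qed.

(** The vector field [b (f) grad f] has compact support, so its divergence integrates to 0. It
    serves both for [b] a truncation and for [b] the identity. *)
Lemma green_identity f (b : R -> R) (db : R -> R) (M : R) : C2 f ->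
  (forall x, ~ cube d M x -> f x = 0) -> b 0 = 0 -> (forall y : R, is_derive y 1 b (db y)) ->
  continuous db ->
  \int[vol]_(x in cube d M) (db (f x) * enorm (gradient f x) ^+ 2)
  = \int[vol]_(x in cube d M) (- lap f x * b (f x)).
Proof.
move=> [[df cpf] C1p] f0 b0 hb cdb.
have cf : continuous f by exact: C1_continuous (conj df cpf).
have cb : continuous b.
  by move=> y; apply: differentiable_continuous; apply/derivable1_diffP; have [] := hb y.
have cbf : continuous (fun x => b (f x)) by move=> x; apply: (continuous_comp (cf x)); exact: cb.
have cdbf : continuous (fun x => db (f x)) by move=> x; apply: (continuous_comp (cf x)); exact: cdb.
pose w i x := partial i f x * b (f x).
have pw i : partial i (w i) = fun x => partial i f x * (db (f x) * partial i f x) + b (f x) * partial i (partial i f) x.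
  apply/funext => x; rewrite partial_mul; last 2 first.
  - by have [H _] := C1p i; exact: H.
  - exact: (differentiable_compr (hb _) (df _)).
  by rewrite (partial_comp _ (hb (f x)))//; exact: df.
have cpw i : continuous (partial i (w i)).
  rewrite pw; have [_ cpp] := C1p i; apply: continuous_add; last exact: continuous_mul.
  by apply: continuous_mul => //; exact: continuous_mul.
have w0 i x : ~ cube d M x -> w i x = 0 by move=> nx; rewrite /w f0// b0 mulr0.
have int0 i : \int[vol]_(x in cube d M) partial i (w i) x = 0.
  rewrite -(@Rintegral_support _ _ (cube d M) setT)//; last first.
    exact: partial_out (w0 i).
  suff C1w : C1 (w i) by exact: (Rintegral_partial i C1w (w0 i)).
  split.
    move=> x; apply: differentiable_mul; first by have [H _] := C1p i; exact: H.
    exact: (differentiable_compr (hb _) (df _)).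
  move=> j; rewrite (_ : partial j (w i) = fun x => partial i f x * (db (f x) * partial j f x)
      + b (f x) * partial j (partial i f) x).
    have [_ cpp] := C1p i; apply: continuous_add; last exact: continuous_mul.
    by apply: continuous_mul => //; exact: continuous_mul.
  apply/funext => x; rewrite partial_mul; last 2 first.
  - by have [H _] := C1p i; exact: H.
  - exact: (differentiable_compr (hb _) (df _)).
  by rewrite (partial_comp _ (hb (f x)))//; exact: df.
have cg : continuous (fun x => db (f x) * enorm (gradient f x) ^+ 2).
  by apply: continuous_mul => //; apply: continuous_pow; exact: gradient_continuous.
have cl : continuous (fun x => - lap f x * b (f x)).
  rewrite (_ : (fun x => _) = fun x => (-1 * lap f x) * b (f x)); last first.
    by apply/funext => x; rewrite mulN1r.
  apply: continuous_mul => //; apply: continuous_scale.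
  exact: (lap_continuous (conj (conj df cpf) C1p)).
apply/eqP; rewrite -subr_eq0 -RintegralB//; [|exact: measurable_cube|exact: integrable_cube|exact: integrable_cube].
rewrite (_ : (fun x => _) = fun x => \sum_i partial i (w i) x); last first.
  apply/funext => x; rewrite sqr_enorm /lap mulNr opprK mulr_sumr mulr_suml -big_split/=.
  by apply: eq_bigr => i _; rewrite pw mxE; ring.
rewrite Rintegral_sum; [|exact: measurable_cube|by move=> i; exact: integrable_cube].
by rewrite big1// => i _; rewrite int0.
Qed.

Lemma gradient_comp f (b : R -> R) (db : R -> R) x : (forall y : R, is_derive y 1 b (db y)) ->
  differentiable f x -> gradient (fun x => b (f x)) x = db (f x) *: gradient f x.
Proof.
by move=> hb df; apply/rowP => i; rewrite !mxE (partial_comp _ (hb _)).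
Qed.

End partial_rules.

Section truncation.
Context {R : realType}.
Implicit Types (x y h t s e : R).

Let pos y : R := Num.max y 0.

Let sqpos y : R := pos y ^+ 2 / 2.

Let is_derive_sqpos y : is_derive y 1 sqpos (pos y).
Proof.
apply: is_derive_eps => e e0; exists e => // h he.
have : `|sqpos (y + h) - sqpos y - pos y * h| <= h ^+ 2.
  rewrite /sqpos /pos ler_norml; have [y0|y0] := leP y 0; have [yh0|yh0] := leP (y + h) 0;
    apply/andP; split; nra.
move=> /le_trans; apply; rewrite -real_normK ?num_real// expr2 ler_wpM2r//.
exact: ltW.
Qed.

(** The trapezoid of [smooth_truncation], up to the factor [e^-1]: four translates of the positive
    part combined with signs +, -, -, +. *)
Let pos_trapezoid (a b p q : R) : q < p -> p <= b -> b < a -> a - b = p - q ->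
  [/\ 0 <= pos a - pos b - pos p + pos q <= a - b,
     a <= 0 -> pos a - pos b - pos p + pos q = 0, 0 <= q -> pos a - pos b - pos p + pos q = 0 &
     q < 0 -> 0 < a -> 0 < pos a - pos b - pos p + pos q].
Proof.
rewrite /pos => qp pb ba E; have [a0|a0] := leP a 0.
  rewrite !max_r; [|lra..]; split; lra.
have [b0|b0] := leP b 0; first by rewrite !max_r; [|lra..]; split; lra.
have [p0|p0] := leP p 0; first by rewrite max_r; [|lra..]; split; lra.
have [q0|q0] := leP q 0; split; lra.
Qed.

Let pos_continuous t : continuous (fun y => pos (y - t)).
Proof.
move=> y; have H : {for y, continuous (fun y : R => y - t : R^o)}.
  by apply: continuousB; [exact: cvg_id|exact: cst_continuous].
exact: (@continuous_max R R _ (cst 0) y H (@cst_continuous _ _ _ _)).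
Qed.

(* The primitive [b] of a trapezoid supported in [t, s] that is 1 on [t + e, s - e]. *)
Lemma smooth_truncation t s e : 0 <= t -> 0 < e -> t + e + e <= s ->
  exists b db : R -> R, [/\ (forall y : R, is_derive y 1 b (db y)), continuous db,
    (forall y, y <= t -> b y = 0), (forall y, s <= y -> b y = s - t - e) &
    [/\ forall y, 0 <= db y <= 1, forall y, y <= t \/ s <= y -> db y = 0 &
        forall y, t < y < s -> 0 < db y]].
Proof.
move=> t0 e0 ts.
pose b y := e^-1 * (sqpos (y - t) - sqpos (y - (t + e)) - sqpos (y - (s - e)) + sqpos (y - s)).
pose db y := e^-1 * (pos (y - t) - pos (y - (t + e)) - pos (y - (s - e)) + pos (y - s)).
exists b, db.
have dsq u y : is_derive y 1 (fun y => sqpos (y - u)) (pos (y - u)).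
  have H : is_derive y 1 (fun y : R => y - u) 1.
    have := is_deriveB (is_derive_id y (1 : R)) (is_derive_cst u y 1).
    by rewrite subr0.
  by have := @is_derive1_comp R sqpos (fun y : R => y - u) y _ _ (is_derive_sqpos (y - u)) H;
    rewrite mulr1.
split.
- move=> y; apply: is_deriveZ.
- apply: continuous_scale; apply: continuous_add => //.
  by apply: continuous_sub => //; apply: continuous_sub.
- move=> y yt; rewrite /b /sqpos /pos !max_r; try lra.
- move=> y sy; rewrite /b /sqpos /pos !max_l; try lra.
  by field; rewrite gt_eqF.
have pE y : db y = e^-1 * (pos (y - t) - pos (y - (t + e)) - pos (y - (s - e)) + pos (y - s)) by [].
have trap y := @pos_trapezoid (y - t) (y - (t + e)) (y - (s - e)) (y - s)
  ltac:(lra) ltac:(lra) ltac:(lra) ltac:(lra).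
split.
- move=> y; rewrite pE mulrC; have [/andP[H1 H2] _ _ _] := trap y.
  rewrite divr_ge0 ?(ltW e0)//= ler_pdivrMr// mul1r; move: H2; lra.
- move=> y; rewrite pE; have [_ H1 H2 _] := trap y.
  by case=> H; [rewrite H1 ?subr_le0// mulr0|rewrite H2 ?subr_ge0// mulr0].
- move=> y /andP[y1 y2]; rewrite pE mulr_gt0 ?invr_gt0//; have [_ _ _ H] := trap y.
  by apply: H; lra.
Qed.

End truncation.

Section weighted_cauchy_schwarz.
Context d {T : measurableType d} {R : realType} (mu : {measure set T -> \bar R}).
Variable D : set T.
Hypothesis mD : measurable D.

Lemma Rintegral_CS (p q : T -> R) : mu.-integrable D (EFin \o p) ->
  mu.-integrable D (EFin \o (fun x => p x * q x)) ->
  mu.-integrable D (EFin \o (fun x => p x * q x ^+ 2)) -> (forall x, D x -> 0 <= p x) ->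
  (\int[mu]_(x in D) (p x * q x)) ^+ 2
  <= (\int[mu]_(x in D) p x) * \int[mu]_(x in D) (p x * q x ^+ 2).
Proof.
move=> ip ipq ipqq p0.
set A := \int[mu]_(x in D) p x; set B := \int[mu]_(x in D) (p x * q x).
set C := \int[mu]_(x in D) (p x * q x ^+ 2).
have quad (t : R) : 0 <= A * t ^+ 2 - 2 * B * t + C.
  have i1 : mu.-integrable D (EFin \o (fun x => t ^+ 2 * p x)).
    by have := integrableZl mD (t ^+ 2) ip; apply: eq_integrable.
  have i2 : mu.-integrable D (EFin \o (fun x => (2 * t) * (p x * q x))).
    by have := integrableZl mD (2 * t) ipq; apply: eq_integrable.
  have i3 : mu.-integrable D (EFin \o (fun x => t ^+ 2 * p x - (2 * t) * (p x * q x))).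
    by have := integrableB mD i1 i2; apply: eq_integrable.
  rewrite (_ : _ + C = \int[mu]_(x in D) (t ^+ 2 * p x - (2 * t) * (p x * q x) + p x * q x ^+ 2)).
    apply: Rintegral_ge0 => x Dx.
    rewrite (_ : _ + _ = p x * (t - q x) ^+ 2); last by ring.
    by rewrite mulr_ge0 ?p0// sqr_ge0.
  rewrite RintegralD// RintegralB// !RintegralZl// -/A -/B -/C; ring.
have A0 : 0 <= A by apply: Rintegral_ge0.
have C0 : 0 <= C by apply: Rintegral_ge0 => x Dx; rewrite mulr_ge0 ?p0// sqr_ge0.
move: A0; rewrite le_eqVlt => /predU1P[A0|A0].
  rewrite -A0 mul0r; have H t : 0 <= - (2 * B * t) + C by have := quad t; rewrite -A0 mul0r sub0r.
  have [->|B0] := eqVneq B 0; first by rewrite expr0n.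
  have := H ((C + 1) / (2 * B)); rewrite mulrC divfK ?mulf_neq0//; lra.
have := quad (B / A).
rewrite (_ : A * (B / A) ^+ 2 - 2 * B * (B / A) + C = (A * C - B ^+ 2) / A); last first.
  by field; rewrite gt_eqF.
by rewrite pmulr_lge0 ?invr_gt0// subr_ge0.
Qed.

End weighted_cauchy_schwarz.

Lemma le_vol {R : realType} {d : nat} (A B : set 'rV[R]_d) : measurable A -> measurable B ->
  A `<=` B -> (vol A <= vol B)%E.
Proof. by move=> mA mB AB; apply: le_measure; rewrite ?inE. Qed.

Lemma continuous_compr {R : realType} {T : topologicalType} (b : R -> R) (f : T -> R) :
  continuous b -> continuous f -> continuous (fun x => b (f x)).
Proof. by move=> cb cf x; apply: (@continuous_comp _ _ _ f b); [exact: cf|exact: cb]. Qed.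

Section talenti.
Context {R : realType} {d : nat}.
Hypothesis d0 : (0 < d)%N.
Variables (Omega : set 'rV[R]_d) (r : R).
Hypotheses (r0 : 0 < r) (oO : open Omega) (vO : vol Omega = (omega R d * r ^+ d)%:E).
Variables (phi : 'rV[R]_d -> R) (M : R).
Hypotheses (C2phi : C2 phi) (phiM : forall x, ~ cube d M x -> phi x = 0).
Hypothesis phi0 : forall x, ~ Omega x -> phi x = 0.

Let mO : measurable Omega. Proof. exact: open_measurable_rV. Qed.
Let finO : (vol Omega < +oo)%E. Proof. by rewrite vO ltry. Qed.
Let cphi : continuous phi. Proof. by apply: C1_continuous; have [] := C2phi. Qed.

Let phi_in x : 0 < phi x -> Omega x /\ cube d (M + 1) x.
Proof.
move=> p0; split; apply: contrapT => H; first by rewrite phi0// ltxx in p0.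
suff : ~ cube d M x by move=> /phiM H'; rewrite H' ltxx in p0.
move=> H'; apply: H => i; have := H' i; lra.
Qed.

(* Cauchy-Schwarz on the layer [t < phi < t']: the integral of [|grad phi|] is bounded below by the
   isoperimetric inequality and that of [|grad phi|^2] is computed by Green's identity. *)
Lemma talenti_levels (t t' rho K : R) : 0 <= t -> t < t' -> 0 < rho ->
  omega R d * rho ^+ d <= distrib Omega phi t' -> 0 <= K ->
  (forall s, t <= s -> s < t' -> \int[vol]_(x in Omega `&` [set x | s < phi x]) (- lap phi x) <= K) ->
  (t' - t) * @sphere_weight R d rho ^+ 2 <= (distrib Omega phi t - distrib Omega phi t') * K.
Proof.
move=> t0 tt' rho0 hd K0 HK; set w := @sphere_weight R d rho; pose dl := distrib Omega phi t - distrib Omega phi t'; rewrite -/dl.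
have w0 : 0 < w by exact: sphere_weight_gt0.
(* The ramps of the truncation lower its height from [t' - t] to [t' - t - e]; the loss disappears
   as [e] tends to 0. *)
suff main (e : R) : 0 < e -> t + e + e <= t' -> (t' - t - e) * w ^+ 2 <= dl * K.
  apply/ler_addgt0Pr => e e0; pose e' := Num.min ((t' - t) / 2) (e / w ^+ 2).
  have e'0 : 0 < e' by rewrite lt_min !divr_gt0 ?subr_gt0 ?exprn_gt0.
  have e'1 : e' <= (t' - t) / 2 by rewrite ge_min lexx.
  have e'2 : e' * w ^+ 2 <= e by rewrite -ler_pdivlMr ?exprn_gt0// ge_min lexx orbT.
  have := main e' e'0 ltac:(lra); lra.
move=> e0 te; set H := t' - t - e.
have H0 : 0 < H by rewrite /H; lra.
have [b [db [hb cdb b_t b_t' [db01 db_out db_in]]]] := smooth_truncation t0 e0 te.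
have b0 : b 0 = 0 by apply: b_t.
have cb : continuous b.
  by move=> y; apply: differentiable_continuous; apply/derivable1_diffP; have [] := hb y.
have mvt y z : y < z -> exists2 s, y < s < z & b z - b y = db s * (z - y).
  move=> yz; have [s] := @MVT R b db y z yz (fun s _ => hb s) (continuous_subspaceT cb).
  by rewrite in_itv/= => s1 s2; exists s.
have b_mono y z : y <= z -> b y <= b z.
  rewrite le_eqVlt => /predU1P[->//|yz]; have [s _ E] := mvt _ _ yz.
  have : 0 <= db s * (z - y).
    by apply: mulr_ge0; [have /andP[] := db01 s|rewrite subr_ge0 ltW].
  by rewrite -E subr_ge0.
have b_smono y z : t <= y -> y < z -> z <= t' -> b y < b z.
  move=> ty yz zt'; have [s /andP[s1 s2] E] := mvt _ _ yz.
  rewrite -subr_gt0 E; apply: mulr_gt0; last by rewrite subr_gt0.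
  apply: db_in; rewrite (le_lt_trans ty s1)/=.
  exact: lt_le_trans s2 zt'.
have bH y : 0 <= b y <= H.
  apply/andP; split.
    by rewrite -(b_t (Num.min y t)) ?b_mono// ge_min lexx ?orbT.
  by rewrite /H -(b_t' (Num.max y t')) ?b_mono// le_max lexx ?orbT.
have [[dphi cpphi] C1p] := C2phi.
have C1w : C1 (fun x => b (phi x)).
  split; first by move=> x; exact: (differentiable_compr (hb _) (dphi x)).
  move=> i; rewrite (_ : partial i _ = fun x => db (phi x) * partial i phi x); last first.
    by apply/funext => x; rewrite (partial_comp _ (hb (phi x))).
  apply: continuous_mul; last exact: cpphi.
  exact: continuous_compr.
have lev : (((omega R d) * rho ^+ d)%:E <= vol [set x | (H <= b (phi x))%R])%E.
  apply: le_trans (_ : ((distrib Omega phi t')%:E <= _)%E); first by rewrite lee_fin.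
  rewrite -(distribE oO vO cphi); apply: le_measure; rewrite ?inE.
  - by apply: measurable_gt => //; apply: measurable_funTS; exact: continuous_measurable_rV.
  - rewrite -[X in measurable X]setTI.
    have cbp : continuous (fun x => b (phi x)).
      exact: continuous_compr.
    have := continuous_measurable_rV cbp.
    move=> /(_ measurableT _ (measurable_itv `[H, +oo[)); congr (measurable _).
    by apply/seteqP; split => x /= []; rewrite ?in_itv/= andbT.
  - by move=> x [_ /= p]; rewrite b_t'// ltW.
have b_out x : ~ cube d M x -> b (phi x) = 0 by move=> nx; rewrite phiM.
have iso := isoperimetric_gradient d0 C1w b_out (fun x => bH (phi x)) H0 rho0 lev.
set D := cube d (M + 1) in iso.
have mD : measurable D by exact: measurable_cube.
have finD : (vol D < +oo)%E by exact: vol_cube_fin.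
have cdbp : continuous (fun x => db (phi x)).
  exact: continuous_compr.
have cgr : continuous (fun x => enorm (gradient phi x)).
  exact: gradient_continuous.
have cint (v : 'rV[R]_d -> R) : continuous v -> vol.-integrable D (EFin \o v).
  exact: integrable_cube.
have E1 : \int[vol]_(x in D) enorm (gradient (fun x => b (phi x)) x)
   = \int[vol]_(x in D) (db (phi x) * enorm (gradient phi x)).
  apply: eq_Rintegral => x _; rewrite (gradient_comp hb (dphi x)) enormZ ger0_norm//.
  by have /andP[] := db01 (phi x).
rewrite E1 -/(@sphere_weight R d rho) -/w in iso.
have CS := @Rintegral_CS _ _ _ vol D mD (fun x => db (phi x)) (fun x => enorm (gradient phi x))
   (cint _ cdbp) (cint _ (continuous_mul cdbp cgr))
   (cint _ (continuous_mul cdbp (continuous_pow (n:=2) cgr))) (fun x _ => proj1 (andP (db01 (phi x)))).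
rewrite (@green_identity _ _ phi b db (M + 1))// in CS; last first.
  by move=> x nx; apply: phiM => Mx; apply: nx => i; have := Mx i; lra.
(* The integrand is at most 1 and vanishes off the layer [t < phi < t'], whose volume is at most
   [dl]. *)
have I1 : \int[vol]_(x in D) db (phi x) <= dl.
  pose A := Omega `&` [set x | t < phi x]; pose A' := Omega `&` [set x | t' < phi x].
  have mA s : measurable (Omega `&` [set x | s < phi x]).
    by apply: measurable_gt => //; apply: measurable_funTS; exact: continuous_measurable_rV.
  have A'A : A' `<=` A by move=> x [Ox /= /(lt_trans tt') xt]; split.
  have mAt : measurable A by exact: mA.
  have mAt' : measurable A' by exact: mA.
  have vA : fine (vol (A `\` A')) = dl.
    rewrite measureD//; last by apply: le_lt_trans finO; apply: le_measure; rewrite ?inE// => x [].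
    rewrite (setIidr A'A).
    exact: (congr1 fine (congr2 (fun p q => p - q)%E (distribE oO vO cphi t) (distribE oO vO cphi t'))).
  rewrite -vA; have mAA : measurable (A `\` A') by exact: measurableD.
  have finAA : (vol (A `\` A') < +oo)%E.
    by apply: le_lt_trans finO; apply: le_measure; rewrite ?inE// => x [[]].
  rewrite (_ : \int[vol]_(x in D) _ = \int[vol]_(x in D `&` (A `\` A')) db (phi x)).
    apply: le_trans (_ : \int[vol]_(x in D `&` (A `\` A')) 1 <= _).
      have mI : measurable (D `&` (A `\` A')) by exact: measurableI.
      apply: le_Rintegral => //.
      + by apply: integrableS (cint _ cdbp) => // x [].
      + apply: (bounded_integrable mI _ (M := 1)) => //; last by move=> x _; rewrite normr1.
        by apply: le_lt_trans finD; apply: le_measure; rewrite ?inE// => x [].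
      + by move=> x _; have /andP[] := db01 (phi x).
    rewrite Rintegral_cst ?mul1r//; last exact: measurableI.
    apply: fine_le.
    + by apply: (fin_meas_sub mAA finAA); [exact: measurableI|move=> x []].
    + by rewrite ge0_fin_numE.
    + have mI : measurable (D `&` (A `\` A')) by exact: measurableI.
      by apply: (le_vol mI mAA) => x [].
  rewrite /Rintegral; congr fine.
  have -> : (\int[vol]_(x in D) (db (phi x))%:E = \int[vol]_(x in D) ((fun x => (db (phi x))%:E) \_ (A `\` A')) x)%E.
    apply: eq_integral => x _; rewrite patchE; case: ifPn => // /negP; rewrite inE => nx.
    congr EFin; apply: db_out; have [|h1] := leP (phi x) t; first by left.
    have [|h2] := leP t' (phi x); first by right.
    exfalso; apply: nx; have [Ox _] := phi_in (le_lt_trans t0 h1).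
    by do 2?split => // -[_ /=]; rewrite ltNge (ltW h2).
  by rewrite integral_mkcondr.
(* [b (phi x) / H] has values in [[0, 1]], and its superlevel sets are the sets [{q < phi}] with
   [t <= q < t'], to which [HK] applies. *)
have I2 : \int[vol]_(x in D) (- lap phi x * b (phi x)) <= H * K.
  have cl : continuous (fun x => - lap phi x).
    rewrite (_ : (fun x => _) = fun x => -1 * lap phi x); last by apply/funext => x; rewrite mulN1r.
    by apply: continuous_scale; exact: lap_continuous.
  have cbp : continuous (fun x => H^-1 * b (phi x)).
    by apply: continuous_scale; exact: continuous_compr.
  have -> : \int[vol]_(x in D) (- lap phi x * b (phi x))
      = H * \int[vol]_(x in D) (- lap phi x * (H^-1 * b (phi x))).
    rewrite -RintegralZl//; last exact: cint (continuous_mul cl cbp).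
    by apply: eq_Rintegral => x _; field; rewrite gt_eqF.
  rewrite ler_pM2l//; apply: Rintegral_mul_le => //.
  - by apply: measurable_funTS; exact: continuous_measurable_rV.
  - exact: cint.
  - move=> x _; have /andP[h1 h2] := bH (phi x).
    by rewrite mulr_ge0 ?invr_ge0 ?(ltW H0)//= mulrC ler_pdivrMr ?mul1r.
  - move=> s /andP[s0 s1].
    have [q] : exists2 q, q \in `[t, t'] & b q = H * s.
      apply: (@IVT R b t t'); [exact: ltW|exact: continuous_subspaceT|].
      rewrite b_t// b_t'// -/H min_l ?max_r ?(ltW H0)//.
      by rewrite mulr_ge0 ?(ltW H0)//= ger_pMr// ltW.
    rewrite in_itv/= => /andP[q1 q2] bq.
    have q2' : q < t'.
      rewrite lt_neqAle q2 andbT; apply/eqP => E.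
      have : H * s < H by rewrite gtr_pMr.
      by rewrite -bq E b_t'// ltxx.
    rewrite (_ : D `&` _ = Omega `&` [set x | q < phi x]); first exact: HK.
    have pos y : q < y -> H * s < b y.
      move=> qy; rewrite -bq; have [yt|yt] := leP y t'; first exact: b_smono.
      by rewrite (b_t' y) ?(ltW yt)// -/H bq gtr_pMr.
    apply/seteqP; split => x [] /= _; rewrite mulrC ltr_pdivlMr// (mulrC s).
      move=> hs; have hq : q < phi x.
        by rewrite ltNge; apply/negP => /b_mono; rewrite bq leNgt hs.
      by have [] := phi_in (le_lt_trans (le_trans t0 q1) hq).
    by move=> hq; have [] := phi_in (le_lt_trans (le_trans t0 q1) hq); split => //; exact: pos.
have dl0 : 0 <= dl by rewrite subr_ge0 (le_distrib oO vO cphi)// ltW.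
(* Isoperimetry on the left; Cauchy-Schwarz, [I1] and [I2] on the right. One factor [H] then
   cancels. *)
have HH : (H * w) ^+ 2 <= dl * (H * K).
  apply: le_trans (_ : _ <= (\int[vol]_(x in D) (db (phi x) * enorm (gradient phi x))) ^+ 2) _.
    have Hw : 0 <= H * w by rewrite mulr_ge0 ?ltW.
    by rewrite lerXn2r ?nnegrE// (le_trans Hw).
  apply: (le_trans CS); apply: (le_trans (ler_wpM2l _ I2)).
    by apply: Rintegral_ge0 => x _; have /andP[] := db01 (phi x).
  by rewrite ler_wpM2r// mulr_ge0 ?(ltW H0).
rewrite -(ler_pM2l H0); move: HH; rewrite exprMn expr2; lra.
Qed.

Section comparison_inequality.
Variables (x0 : 'rV[R]_d) (k a N P : R).
Let u x := Num.max (phi x) 0.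
Let f x := - lap phi x + k * phi x.
Hypotheses (k0 : 0 <= k) (fa : forall x, Omega x -> a <= f x) (fN : forall x, f x <= N).
Hypothesis phiP : forall x, phi x <= P.

Let cu : continuous u.
Proof.
by move=> x; apply: (@continuous_max _ _ phi (cst 0) x (@cphi x) (@cst_continuous _ _ _ _)).
Qed.

Let clap : continuous (lap phi). Proof. exact: lap_continuous. Qed.

Let cf : continuous f.
Proof.
rewrite (_ : f = fun x => k * phi x - lap phi x); last by apply/funext => x; rewrite /f addrC.
by apply: continuous_sub => //; exact: continuous_scale.
Qed.

Let u_ge0 x : Omega x -> 0 <= u x. Proof. by move=> _; rewrite le_max lexx orbT. Qed.

Let uP x : u x <= Num.max P 0.
Proof. by rewrite ge_max !le_max phiP lexx orbT. Qed.

Let u_level s : 0 <= s -> [set x | s < u x] = [set x | s < phi x].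
Proof.
move=> s0; apply/seteqP; split => x /=; rewrite lt_max; last by move=> ->.
by move=> /orP[//|]; rewrite ltNge s0.
Qed.

Let distrib_u s : 0 <= s -> distrib Omega u s = distrib Omega phi s.
Proof. by move=> s0; rewrite /distrib u_level. Qed.

Local Notation F := (fun rho => rearr Omega f a (clamp r rho)).
Local Notation us := (fun rho => rearr Omega u 0 (clamp r rho)).
Local Notation h := (fun rho => radial_int x0 F rho - k * radial_int x0 us rho).

Let radial_schwarz (g : 'rV[R]_d -> R) b s : s <= r ->
  radial_int x0 (fun rho => rearr Omega g b (clamp r rho)) s
  = \int[vol]_(x in eball x0 s) schwarz Omega x0 g b x.
Proof.
move=> sr; apply: eq_Rintegral => x; rewrite inE eballE /= => xs.
by rewrite clamp_in ?enorm_ge0// (le_trans (ltW xs)).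
Qed.

(** A difference form of the inequality [- u' <= h / w], since the rearrangement is not known to be
    differentiable. The levels are its values at the two radii, and Hardy-Littlewood bounds the
    integral of [- lap phi] over [{s < phi}] by [h] at the radius of that set. *)
Lemma talenti_comparison rho1 rho2 K : 0 < rho1 -> rho1 < rho2 -> rho2 <= r -> 0 <= K ->
  (forall s, rho1 <= s -> s <= rho2 -> h s <= K) ->
  (us rho1 - us rho2) * @sphere_weight R d rho1 ^+ 2
  <= (omega R d * rho2 ^+ d - omega R d * rho1 ^+ d) * K.
Proof.
move=> r1 r12 r2 K0 hK; have r20 := lt_trans r1 r12; have r1r := ltW (lt_le_trans r12 r2).
rewrite !clamp_in ?(ltW r1) ?(ltW r20)//.
set w := sphere_weight _; set t := rearr _ _ _ rho2; set t1 := rearr _ _ _ rho1.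
have w0 : 0 < w by exact: sphere_weight_gt0.
have om0 : 0 < omega R d by exact: omega_gt0.
have r120 : 0 <= omega R d * rho2 ^+ d - omega R d * rho1 ^+ d.
  by rewrite subr_ge0 ler_pM2l// lerXn2r ?nnegrE ?ltW.
have t0 : 0 <= t by apply: (rearr_ge Omega 0 uP); exact: ltW.
have [t1t|tt1] := leP t1 t.
  by rewrite (le_trans (y := 0)) ?mulr_ge0// mulr_le0_ge0 ?subr_le0 ?sqr_ge0.
(* Strictly below [us rho1] the superlevel set has more than the volume of the ball of radius
   [rho1], which is what [talenti_levels] asks for; [t'] tends to [us rho1] at the end. *)
have main t' : t < t' -> t' < t1 -> (t' - t) * w ^+ 2 <=
    (omega R d * rho2 ^+ d - omega R d * rho1 ^+ d) * K.
  move=> tt' t't1; have t'0 := le_lt_trans t0 tt'.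
  have H1 : omega R d * rho1 ^+ d < distrib Omega phi t'.
    by rewrite -distrib_u ?(ltW t'0)//; apply/(rearr_gt oO vO cu uP (ltW r1) (ltW t'0)).
  have H2 : distrib Omega phi t <= omega R d * rho2 ^+ d.
    rewrite -distrib_u// leNgt; apply/negP => /(rearr_gt oO vO cu uP (ltW r20) t0).
    by rewrite ltxx.
  apply: le_trans (@talenti_levels t t' rho1 K t0 tt' r1 (ltW H1) K0 _) _; last first.
    by rewrite ler_wpM2r// lerB// ltW.
  move=> s ts st'; have s0 := le_trans t0 ts.
  have [rs0 rsE] := radiusP d0 Omega u s.
  have rsr := radius_le d0 r0 oO vO cu s.
  have ds : omega R d * radius Omega u s ^+ d = distrib Omega phi s by rewrite rsE distrib_u.
  have pw (p q : R) : 0 <= p -> 0 <= q -> omega R d * p ^+ d <= omega R d * q ^+ d -> p <= q.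
    by move=> p0 q0; rewrite ler_pM2l// ler_pXn2r.
  apply: le_trans (_ : h (radius Omega u s) <= _); last first.
    apply: hK; apply: pw; rewrite ?(ltW r1) ?(ltW r20)// ds.
      by rewrite (le_trans (ltW H1))// (le_distrib oO vO cphi)// ltW.
    by rewrite (le_trans _ H2)// (le_distrib oO vO cphi).
  have mE : measurable (Omega `&` [set x | s < phi x]).
    by apply: measurable_gt => //; apply: measurable_funTS; exact: continuous_measurable_rV.
  have EO : Omega `&` [set x | s < phi x] `<=` cube d (M + 1).
    by move=> x [_ /= /(le_lt_trans s0)/phi_in[]].
  have iE (v : 'rV[R]_d -> R) : continuous v ->
      vol.-integrable (Omega `&` [set x | s < phi x]) (EFin \o v).
    move=> cv; apply: (integrableS _ _ EO (integrable_cube (M + 1) cv)) => //.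
    exact: measurable_cube.
  rewrite !radial_schwarz//.
  have -> : \int[vol]_(x in Omega `&` [set x | s < phi x]) (- lap phi x)
    = \int[vol]_(x in Omega `&` [set x | s < phi x]) f x
      - k * \int[vol]_(x in Omega `&` [set x | s < phi x]) u x.
    rewrite -RintegralZl ?iE// -RintegralB ?iE//; last exact: continuous_scale.
    apply: eq_Rintegral => x; rewrite inE => -[_ /= sx].
    by rewrite /f /u max_l ?addrK// ltW// (le_lt_trans s0).
  rewrite -(u_level s0) (schwarz_integral_level d0 x0 r0 oO vO cu u_ge0 uP) lerD2r u_level//.
  apply: (hardy_littlewood d0 x0 r0 oO vO cf fa fN) => //.
  by rewrite ds (distribE oO vO cphi).
apply/ler_addgt0Pr => e e0.
pose e' := Num.min ((t1 - t) / 2) (e / w ^+ 2).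
have e'0 : 0 < e' by rewrite lt_min !divr_gt0 ?subr_gt0 ?exprn_gt0.
have e'1 : e' <= (t1 - t) / 2 by rewrite ge_min lexx.
have e'2 : e' * w ^+ 2 <= e by rewrite -ler_pdivlMr ?exprn_gt0// ge_min lexx orbT.
have := main (t1 - e') ltac:(lra) ltac:(lra); lra.
Qed.

End comparison_inequality.

End talenti.

(** * Radial comparison with a function on the ball *)

Section primitives.
Context {R : realType}.

Let half_line_primitive (g : R -> R) (a : R) : continuous g -> (forall x, x <= a -> g x = 0) ->
  exists G : R -> R, forall x : R, is_derive x 1 G (g x).
Proof.
move=> cg g0.
exists (fun x => \int[lebesgue_measure]_(t in [set` Interval -oo%O (BRight x)]) g t) => x.
have ig : lebesgue_measure.-integrable [set` Interval -oo%O (BRight (x + 1))] (EFin \o g).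
  have : lebesgue_measure.-integrable `[a, x + 1] (EFin \o g).
    apply: continuous_compact_integrable; first exact: segment_compact.
    exact: continuous_subspaceT.
  rewrite integrable_mkcond//= => H; apply/integrable_mkcond => //=.
  apply: eq_integrable H => // t _; rewrite !patchE/=.
  case: ifPn => [|/negP]; rewrite inE/= in_itv/=.
    by move=> /andP[_ tx]; rewrite mem_set//= in_itv.
  move=> nat_; case: ifPn => //; rewrite inE/= in_itv/= => tx.
  rewrite g0//; rewrite leNgt; apply/negP => /ltW at_; apply: nat_.
  by rewrite at_ tx.
have xx1 : x < x + 1 by rewrite ltrDl.
have [|D1 D2] := @continuous_FTC1 R g -oo%O x (x + 1) xx1 ig _ (cg x); first by rewrite ltNyr.
by apply: (DeriveDef D1); rewrite -derive1E.
Qed.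

(** [g - g 0] is split into its parts on the two half-lines. Each of them, after a reflection for
    the left one, vanishes to the left of 0, so integration from minus infinity gives a
    primitive. *)
Lemma primitive_exists (g : R -> R) : continuous g ->
  exists G : R -> R, forall x : R, is_derive x 1 G (g x).
Proof.
move=> cg.
have [G1 H1] : exists G, forall x : R, is_derive x 1 G (g (Num.max x 0) - g 0).
  apply: (@half_line_primitive (fun x => g (Num.max x 0) - g 0) 0).
    apply: continuous_sub; last exact: cst_continuous.
    apply: continuous_compr => // x.
    exact: (@continuous_max _ _ id (cst 0) x (@cvg_id _ _) (@cst_continuous _ _ _ _)).
  by move=> x x0; rewrite max_r ?subrr.
have [G2 H2] : exists G, forall x : R, is_derive x 1 G (g (- Num.max x 0) - g 0).
  apply: (@half_line_primitive (fun x => g (- Num.max x 0) - g 0) 0).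
    apply: continuous_sub; last exact: cst_continuous.
    apply: (@continuous_compr _ _ (fun y => g (- y))) => [|x].
      by apply: continuous_compr => //; exact: opp_continuous.
    exact: (@continuous_max _ _ id (cst 0) x (@cvg_id _ _) (@cst_continuous _ _ _ _)).
  by move=> x x0; rewrite max_r ?oppr0 ?subrr.
exists (fun x => G1 x - G2 (- x) + g 0 * x) => x.
have H3 : is_derive x 1 (fun x : R => G2 (- x)) ((g (- Num.max (- x) 0) - g 0) * (-1)).
  have H := H2 (- x).
  have Hn : is_derive x 1 (fun x : R => - x) (-1) by exact: is_deriveN.
  exact: (@is_derive1_comp R G2 (fun x : R => - x) x _ _ H Hn).
have H4 : is_derive x 1 (fun x : R => g 0 * x) (g 0).
  by have := is_deriveZ (g 0) (is_derive_id x (1 : R)); rewrite [g 0 *: _]mulr1.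
apply: is_derive_eq (is_deriveD (is_deriveB (H1 x) H3) H4) _.
have [x0|x0] := leP x 0.
  by rewrite max_l ?oppr_ge0// opprK; ring.
by rewrite max_r ?oppr_le0 ?(ltW x0)// oppr0; ring.
Qed.

End primitives.

(** * A radial solution of [Delta i = c i] *)

Section bessel.
Context {R : realType} (d : nat).
Hypothesis d0 : (0 < d)%N.
Variable c : R.
Hypothesis c0 : 0 < c.

(** Taylor coefficients of [G], where [i rho = G (rho ^+ 2)]: in the variable [q = rho ^+ 2] the
    equation [Delta i = c i] reads [4 q G'' + 2 d G' = c G], which has no singular coefficient and
    determines [G] from [G 0 = 1]. *)
Fixpoint bessel_coeff (n : nat) : R :=
  if n is m.+1 then c * bessel_coeff m / (m.+1%:R * (4 * m%:R + 2 * d%:R)) else 1.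

Local Notation a := bessel_coeff.

Let den_ge1 (m : nat) : 1 <= 4 * m%:R + 2 * d%:R :> R.
Proof.
have : 1 <= d%:R :> R by rewrite ler1n.
by have : 0 <= m%:R :> R by []; lra.
Qed.

Lemma bessel_coeff_gt0 n : 0 < a n.
Proof.
elim: n => //= n IH; rewrite divr_gt0 ?mulr_gt0//.
exact: lt_le_trans (den_ge1 n).
Qed.

Let rec n : n.+1%:R * a n.+1 * (4 * n%:R + 2 * d%:R) = c * a n.
Proof.
rewrite [a n.+1]/= mulrAC mulrC divfK// mulf_neq0 ?pnatr_eq0//.
by rewrite gt_eqF// (lt_le_trans _ (den_ge1 n)).
Qed.

Let le1 n : n.+1%:R * a n.+1 <= c * a n.
Proof.
rewrite -(rec n) ler_peMr//; apply: mulr_ge0 => //; exact/ltW/bessel_coeff_gt0.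
Qed.

Let a_le n : a n <= c ^+ n / n`!%:R.
Proof.
elim: n => [|n IH]; first by rewrite expr0 fact0 divr1.
have n1 : 0 < n.+1%:R :> R by rewrite ltr0n.
rewrite -(ler_pM2l n1); apply: (le_trans (le1 n)).
rewrite factS natrM invfM exprS.
rewrite (_ : _ * (_ * _ * _) = n.+1%:R * (n.+1%:R^-1 * (c * (c ^+ n / n`!%:R)))); last by ring.
by rewrite mulVKf ?gt_eqF// ler_pM2l.
Qed.

(** The coefficients of [G] and of its first three formal derivatives are all dominated by multiples
    of [c ^+ n / n!], so each series converges on the whole line. *)
Let conv (f : nat -> R) (C q : R) : (forall n, `|f n| <= C * (c ^+ n / n`!%:R)) ->
  cvgn (pseries f q).
Proof.
move=> fC; apply: normed_cvg; apply: series_le_cvg.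
- by move=> n; exact: normr_ge0.
- by move=> n; instantiate (1 := fun n => C * exp_coeff (c * `|q|) n); rewrite mulr_ge0//;
    [have := fC 0; rewrite fact0 divr1 expr0 mulr1; exact: le_trans|
     rewrite /exp_coeff/= divr_ge0// exprn_ge0// mulr_ge0// ltW].
- move=> n /=; rewrite normrM normrX; apply: (le_trans (ler_wpM2r _ (fC n))).
    exact: exprn_ge0.
  by rewrite /exp_coeff/= exprMn le_eqVlt; apply/orP; left; apply/eqP; ring.
- by apply: is_cvg_seriesZ; exact: is_cvg_series_exp_coeff.
Qed.

Let d1 := pseries_diffs a.
Let d2 := pseries_diffs d1.

Let b0 n : `|a n| <= 1 * (c ^+ n / n`!%:R).
Proof. by rewrite mul1r ger0_norm// ltW ?bessel_coeff_gt0. Qed.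

Let b1 n : 0 <= d1 n <= c * (c ^+ n / n`!%:R).
Proof.
rewrite /d1/pseries_diffs mulr_ge0 ?(ltW (bessel_coeff_gt0 _))//=.
by rewrite (le_trans (le1 n))// ler_pM2l.
Qed.

Let b2 n : 0 <= d2 n <= c ^+ 2 * (c ^+ n / n`!%:R).
Proof.
have /andP[p1 _] := b1 n.+1.
rewrite /d2/pseries_diffs mulr_ge0//=.
have -> : d1 n.+1 = n.+2%:R * a n.+2 by [].
apply: le_trans (_ : n.+1%:R * (c * a n.+1) <= _); first by rewrite ler_wpM2l.
rewrite mulrCA expr2 -mulrA ler_pM2l// (le_trans (le1 n))// ler_pM2l//.
Qed.

Let b3 n : `|pseries_diffs d2 n| <= c ^+ 3 * (c ^+ n / n`!%:R).
Proof.
have /andP[p2 _] := b2 n.+1; have /andP[p1 _] := b1 n.+2.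
rewrite /pseries_diffs ger0_norm; last exact: mulr_ge0.
have -> : d2 n.+1 = n.+2%:R * (n.+3%:R * a n.+3) by [].
have np (m : nat) : 0 <= m%:R :> R by [].
apply: le_trans (ler_wpM2l (np _) (ler_wpM2l (np _) (le1 n.+2))) _.
rewrite [n.+2%:R * _]mulrCA; apply: le_trans (ler_wpM2l (np _) (ler_wpM2l (ltW c0) (le1 n.+1))) _.
rewrite mulrCA (mulrCA n.+1%:R) exprS expr2 -!mulrA.
apply: (ler_wpM2l (ltW c0)); apply: (ler_wpM2l (ltW c0)); apply: (le_trans (le1 n)).
exact: (ler_wpM2l (ltW c0)).
Qed.

Let G q : R := limn (pseries a q).
Let G1 q : R := limn (pseries d1 q).
Let G2 q : R := limn (pseries d2 q).

Let cv0 q : cvgn (pseries a q). Proof. exact: conv b0. Qed.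
Let cv1 q : cvgn (pseries d1 q).
Proof. by apply: (@conv _ c) => n; have /andP[p q1] := b1 n; rewrite ger0_norm. Qed.
Let cv2 q : cvgn (pseries d2 q).
Proof. by apply: (@conv _ (c ^+ 2)) => n; have /andP[p q1] := b2 n; rewrite ger0_norm. Qed.
Let cv3 q : cvgn (pseries (pseries_diffs d2) q). Proof. exact: conv b3. Qed.

Let inside (q : R) : `|q| < `| `|q| + 1|.
Proof. by rewrite ltr_normr ltrDl ltr01. Qed.

Let dG (q : R) : is_derive q 1 G (G1 q).
Proof. exact: (@pseries_snd_diffs R a (`|q| + 1) q (@cv0 _) (@cv1 _) (@cv2 _) (inside q)). Qed.

Let dG1 (q : R) : is_derive q 1 G1 (G2 q).
Proof. exact: (@pseries_snd_diffs R d1 (`|q| + 1) q (@cv1 _) (@cv2 _) (@cv3 _) (inside q)). Qed.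

Let G_ge1 q : 0 <= q -> 1 <= G q.
Proof.
move=> q0; apply: limr_ge; first exact: cv0.
exists 1%N => // n /= n1; rewrite /pseries/= /series/= (@big_cat_nat _ _ _ 1)//= big_nat1.
rewrite expr0 mulr1 lerDl; apply: sumr_ge0 => i _; rewrite mulr_ge0 ?exprn_ge0//.
exact/ltW/bessel_coeff_gt0.
Qed.

Let ode q : 4 * q * G2 q + 2 * d%:R * G1 q = c * G q.
Proof.
have H2 := @pseries_diffs_equiv R d1 q (@cv2 q).
have H1 : pseries d1 q @ \oo --> G1 q by exact: cv1.
have H0 : pseries a q @ \oo --> G q by exact: cv0.
pose s n : R := 4 * q * series (fun i : nat => i%:R * d1 i * q ^+ i.-1) n
  + 2 * d%:R * pseries d1 q n.
have L : s @ \oo --> 4 * q * G2 q + 2 * d%:R * G1 q.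
  by apply: cvgD; [exact: cvgM (cvg_cst _) H2|exact: cvgM (cvg_cst _) H1].
have Rr : (fun n => c * pseries a q n) @ \oo --> c * G q by exact: cvgM (cvg_cst _) H0.
suff E : s = fun n => c * pseries a q n by rewrite -E in Rr; exact: (cvg_unique (@Rhausdorff R) L Rr).
apply/funext => n; rewrite /s /pseries /series/= !mulr_sumr -big_split/=; apply: eq_bigr => i _.
rewrite [c * (_ * _)]mulrA -(rec i) /d1 /pseries_diffs.
by case: i => [|i]; rewrite ?expr0 ?exprS /=; ring.
Qed.

(* [i] is a radial solution of [Delta i = c i], a modified Bessel function up to a power. *)
Lemma bessel_exists : exists i di : R -> R,
  [/\ forall rho : R, is_derive rho 1 i (di rho), continuous di, di 0 = 0, forall rho, 1 <= i rho &
      forall rho : R, is_derive rho 1 (fun rho => @sphere_weight R d rho * di rho)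
                        (c * @sphere_weight R d rho * i rho)].
Proof.
have sq (rho : R) : is_derive rho 1 (fun rho : R => rho ^+ 2) (2 * rho).
  have := @is_deriveX R R^o id 2 rho 1 1 (is_derive_id _ _).
  by rewrite exprfctE /= expr1 [_%:A]mulr1.
have dGsq (H H' : R -> R) (rho : R) : (forall q : R, is_derive q 1 H (H' q)) ->
    is_derive rho 1 (fun rho => H (rho ^+ 2)) (H' (rho ^+ 2) * (2 * rho)).
  move=> dH; exact: (@is_derive1_comp R H (fun rho : R => rho ^+ 2) rho _ _ (dH _) (sq rho)).
exists (fun rho => G (rho ^+ 2)), (fun rho => G1 (rho ^+ 2) * (2 * rho)); split.
- by move=> rho; exact: dGsq.
- apply: continuous_mul; last by apply: continuous_scale => x; exact: cvg_id.
  move=> x; apply: differentiable_continuous; apply/derivable1_diffP.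
  by have [] := dGsq _ _ x dG1.
- by rewrite mulr0 mulr0.
- by move=> rho; apply: G_ge1; exact: sqr_ge0.
move=> rho.
have wE s : @sphere_weight R d s * s = d%:R * (omega R d * s ^+ d).
  by rewrite /sphere_weight -!mulrA -exprSr prednK//; ring.
rewrite (_ : (fun _ => _) = fun rho => (2 * d%:R) * ((omega R d * rho ^+ d) * G1 (rho ^+ 2))); last first.
  apply/funext => s; rewrite (_ : _ * _ = 2 * G1 (s ^+ 2) * (@sphere_weight R d s * s)); last by ring.
  by rewrite wE; ring.
have := is_deriveZ (2 * d%:R) (is_deriveM (@is_derive_ball_volume R d rho) (dGsq _ _ rho dG1)).
move=> /is_derive_eq; apply.
rewrite (_ : c * _ * _ = @sphere_weight R d rho * (c * G (rho ^+ 2))); last by ring.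
rewrite -ode -[LHS]/(2 * d%:R * (omega R d * rho ^+ d * (G2 (rho ^+ 2) * (2 * rho))
  + G1 (rho ^+ 2) * sphere_weight rho)).
transitivity (4 * rho * G2 (rho ^+ 2) * (d%:R * (omega R d * rho ^+ d))
  + 2 * d%:R * G1 (rho ^+ 2) * @sphere_weight R d rho); first by ring.
by rewrite -wE; ring.
Qed.

End bessel.

(** * Construction of [v] and the maximum principle for [U - V] *)

Section radial_comparison.
Context {R : realType} {d : nat}.
Hypothesis d0 : (0 < d)%N.
Variables (x0 : 'rV[R]_d) (r c : R).
Hypotheses (r0 : 0 < r) (c0 : 0 < c).
Variables F u : R -> R.
Hypotheses (cF : continuous F) (cu : continuous u).
Hypotheses (F_anti : forall s t, s <= t -> F t <= F s).
Local Notation w := (@sphere_weight R d).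

Let mean_value (f df : R -> R) (a b : R) : a < b ->
  (forall x : R, a < x < b -> is_derive x 1 f (df x)) -> continuous f ->
  exists2 x, a < x < b & f b - f a = df x * (b - a).
Proof.
move=> ab df' cf; have [x] := @MVT R f df a b ab (fun x xab => df' x xab) (continuous_subspaceT cf).
by rewrite in_itv/= => xab E; exists x.
Qed.

Let near_left (p : R) (P : R -> Prop) : (\forall x \near p, P x) ->
  exists2 e : R, 0 < e & forall x, `|x - p| < e -> P x.
Proof.
move=> /nbhs_ballP[e /= e0 eP]; exists e => // x xp; apply: eP.
by rewrite -ball_normE/= distrC.
Qed.

Let cont_lt (f : R -> R) (p M : R) : continuous f -> f p < M ->
  exists2 e : R, 0 < e & forall x, `|x - p| < e -> f x < M.
Proof. by move=> cf fM; apply: near_left; have /cvgr_lt H := @cf p; exact: H. Qed.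

Let cont_gt (f : R -> R) (p M : R) : continuous f -> M < f p ->
  exists2 e : R, 0 < e & forall x, `|x - p| < e -> M < f x.
Proof. by move=> cf fM; apply: near_left; have /cvgr_gt H := @cf p; exact: H. Qed.

Let eq_derive_const (f g df : R -> R) (a b : R) : continuous f -> continuous g -> f a = g a ->
  (forall x : R, a < x < b -> is_derive x 1 f (df x)) ->
  (forall x : R, a < x < b -> is_derive x 1 g (df x)) -> forall x, a <= x <= b -> f x = g x.
Proof.
move=> cf cg E df1 dg1 x /andP[]; rewrite le_eqVlt => /predU1P[<-//|ax] xb.
have [|s _] := @mean_value (fun y => f y - g y) (fun=> 0) a x ax _ (continuous_sub cf cg).
  move=> y /andP[y1 y2]; rewrite -(subrr (df y)).
  by apply: is_deriveB; [apply: df1|apply: dg1]; rewrite y1 (lt_le_trans y2).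
by rewrite E subrr subr0 mul0r => /eqP; rewrite subr_eq0 => /eqP.
Qed.

Let radial_int_sub (f g : R -> R) (k s : R) : continuous f -> continuous g ->
  radial_int x0 (fun t => f t - k * g t) s = radial_int x0 f s - k * radial_int x0 g s.
Proof.
move=> cf cg; have m : measurable (eball x0 s) by exact: measurable_eball.
rewrite /radial_int -RintegralZl//; last exact: radial_integrable.
rewrite -RintegralB//; first exact: radial_integrable.
have ck : continuous (fun t => k * g t) by exact: continuous_scale.
exact: (radial_integrable x0 ck).
Qed.

Let w_gt0 s : 0 < s -> 0 < w s. Proof. exact: sphere_weight_gt0. Qed.

Let w_le s t : 0 <= s -> s <= t -> w s <= w t.
Proof.
have om0 : 0 < omega R d by exact: omega_gt0.
move=> s0 st; rewrite /sphere_weight ler_wpM2l ?(ltW om0)// ler_wpM2l//.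
by rewrite lerXn2r ?nnegrE// (le_trans s0).
Qed.

Section profile.
Variables i di : R -> R.
Hypotheses (hi : forall s : R, is_derive s 1 i (di s)) (cdi : continuous di) (di0 : di 0 = 0).
Hypothesis i1 : forall s, 1 <= i s.
Hypothesis hwdi : forall s : R, is_derive s 1 (fun s => w s * di s) (c * w s * i s).

Let i_gt0 s : 0 < i s. Proof. exact: lt_le_trans (i1 s). Qed.

Let ci : continuous i.
Proof. by move=> s; apply: differentiable_continuous; apply/derivable1_diffP; have [] := hi s. Qed.

Let cFi : continuous (fun s => F s * i s). Proof. exact: continuous_mul. Qed.

Let K := radial_int x0 (fun s => F s * i s).

Let cK : continuous K. Proof. exact: radial_int_continuous. Qed.

Let K_le0 s : s <= 0 -> K s = 0. Proof. exact: radial_int_le0. Qed.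

Let dK (s : R) : 0 < s -> is_derive s 1 K (w s * (F s * i s)).
Proof. by move=> s0; exact: (is_derive_radial_int d0 x0 cFi). Qed.

(** Reduction of order. For [v = i y], the equation [L v = F] becomes [(w i^2 y')' = - w F i], hence
    [y' = - kap]. Here [v] is thus explicit once a primitive of [kap] is known. *)
Let kap s := K s / (w s * i s ^+ 2).

(** [K t] is at most a constant times the volume of the ball, hence a constant times [t * w t], so
    [kap t = O(t)] at 0; for [t <= 0] it is 0 because [K] is. *)
Let kap_cont : continuous kap.
Proof.
have [C C0 KC] : exists2 C, 0 < C & forall t, t <= 1 -> `|kap t| <= C * Num.max t 0.
  have [N N0 FN] := radial_bounded cFi 1.
  exists (N + 1); first by rewrite ltr_wpDl.
  move=> t t1; have [t0|t0] := leP t 0; first by rewrite /kap K_le0// mul0r normr0 mulr0.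
  have H : forall s, 0 <= s <= t -> `|F s * i s - 0| <= N.
    by move=> s /andP[s0 st]; rewrite subr0; apply: FN; rewrite s0 (le_trans st).
  have := radial_int_diff d0 x0 cFi (lexx 0) (ltW t0) H.
  rewrite -[radial_int _ _ t]/(K t) -[radial_int _ _ 0]/(K 0) (K_le0 (lexx 0)) subr0 mul0r subr0.
  rewrite expr0n (gtn_eqF d0) mulr0 subr0 => KN.
  have wi0 : 0 < w t * i t ^+ 2 by rewrite mulr_gt0 ?exprn_gt0 ?w_gt0.
  rewrite /kap normrM normfV (gtr0_norm wi0) ler_pdivrMr//; apply: (le_trans KN).
  have wt : omega R d * t ^+ d <= t * w t.
    rewrite /sphere_weight [leRHS](_ : _ = d%:R * (omega R d * (t * t ^+ d.-1))); last by ring.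
    rewrite -exprS prednK// ler_peMl ?ler1n//; apply: mulr_ge0; last exact: exprn_ge0 (ltW t0).
    exact/ltW/omega_gt0.
  have wt0 : 0 <= t * w t by rewrite mulr_ge0// ltW// w_gt0.
  apply: le_trans (_ : N * (t * w t) <= _); first by rewrite ler_wpM2l.
  apply: le_trans (_ : (N + 1) * (t * w t) <= _); first by rewrite ler_wpM2r// lerDl.
  rewrite -[leRHS]mulrA; apply: ler_wpM2l; [exact: addr_ge0|].
  by rewrite [leRHS]mulrA; apply: ler_peMr => //; exact: exprn_ege1.
move=> s; have [s0|s0] := leP s 0; last first.
  have cd : continuous (fun s => w s * i s ^+ 2).
    by apply: continuous_mul; [exact: sphere_weight_continuous|exact: continuous_pow].
  apply: cvgM; first exact: cK.
  by apply: cvgV; [rewrite gt_eqF// mulr_gt0 ?exprn_gt0 ?w_gt0|exact: cd].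
apply/cvgrPdist_le => e e0; rewrite [kap s]/kap K_le0// mul0r.
near=> t; rewrite sub0r normrN; have t1 : t < Num.min 1 (e / C).
  near: t; apply: (cvgr_lt s); first exact: cvg_id.
  by rewrite (le_lt_trans s0)// lt_min ltr01 divr_gt0.
move: t1; rewrite lt_min => /andP[t1 te]; apply: (le_trans (KC _ (ltW t1))).
rewrite -ler_pdivlMl// mulrC ge_max (ltW te)/= ltW// divr_gt0//.
Unshelve. all: by end_near. Qed.

(* [r1] is the first zero of the integral [K] of [F i] over balls, where [i] is the Bessel solution:
   there both [v] and its derivative vanish, so that [v] extended by 0 is in H^2_0 of the ball. *)
Lemma profile_aux : exists (v : R -> R) (r1 : R),
  let J := radial_int x0 (fun s => F s - c * v s) in
  [/\ 0 <= r1 <= r, continuous v, forall s, r1 <= s -> v s = 0,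
    forall s : R, 0 < s < r1 -> is_derive s 1 v (- (J s / w s)) &
    [/\ forall s, 0 <= s -> 0 <= v s, forall s, 0 <= s <= r1 -> 0 <= J s,
      r1 < r -> J r1 = 0 & forall s, r1 < s -> s <= r -> F s <= 0]].
Proof.
pose S := [set s | 0 <= s <= r /\ forall t, 0 <= t <= s -> 0 <= K t].
have S0 : S 0.
  by split; [rewrite lexx ltW|move=> t /andP[t1 t2]; rewrite K_le0].
have hS : has_sup S by split; [exists 0|exists r => s [/andP[]]].
pose r1 := sup S.
have r10 : 0 <= r1 by exact: (ub_le_sup (proj2 hS)).
have r1r : r1 <= r by apply: sup_le_ub; [exists 0|move=> s [/andP[]]].
have Klt t : 0 <= t -> t < r1 -> 0 <= K t.
  move=> t0 tr; have [s [_ Ks] ts] := sup_gt (proj1 hS) tr.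
  by apply: Ks; rewrite t0 ltW.
have Kr1 : 0 <= K r1.
  rewrite leNgt; apply/negP => Kn; have [e e0 He] := cont_lt cK Kn.
  move: r10; rewrite le_eqVlt => /predU1P[E|r1p]; first by move: Kn; rewrite -E K_le0// ltxx.
  pose t := Num.max 0 (r1 - e / 2).
  have t1 : t < r1 by rewrite gt_max r1p ltrBlDr ltrDl divr_gt0.
  have t0 : 0 <= t by rewrite le_max lexx.
  have := Klt t t0 t1; rewrite leNgt He// ltr_norml.
  have : r1 - e / 2 <= t by rewrite le_max lexx orbT.
  by move=> H; apply/andP; split; lra.
have Kge s : 0 <= s <= r1 -> 0 <= K s.
  by move=> /andP[s0]; rewrite le_eqVlt => /predU1P[->//|]; exact: Klt.
have Kr1_eq : r1 < r -> K r1 = 0.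
  move=> r1r'; apply/eqP; rewrite eq_le Kr1 andbT leNgt; apply/negP => Kp.
  have [e e0 He] := cont_gt cK Kp.
  pose s := Num.min r (r1 + e / 2).
  have s1 : r1 < s by rewrite lt_min r1r' ltrDl divr_gt0.
  have : S s.
    split; first by rewrite (le_trans r10 (ltW s1)) ge_min lexx.
    move=> t /andP[t0 ts]; have [tr|tr] := leP t r1; first by apply: Kge; rewrite t0.
    have : s <= r1 + e / 2 by rewrite ge_min lexx orbT.
    by move=> H; apply/ltW/He; rewrite ltr_norml; apply/andP; split; lra.
  by move/(ub_le_sup (proj2 hS)); rewrite leNgt s1.
(* If [F s > 0], then [F > 0] on [[0, s]] by monotonicity, so [K >= 0] there and [s] would belong to
   [S], beyond its supremum. *)
have F_le0 s : r1 < s -> s <= r -> F s <= 0.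
  move=> r1s sr; rewrite leNgt; apply/negP => Fs.
  have : S s.
    split; first by rewrite (le_trans r10 (ltW r1s)).
    move=> t /andP[t0 ts]; apply: Rintegral_ge0 => x; rewrite eballE/= => xt.
    by rewrite mulr_ge0 ?(ltW (i_gt0 _))// (le_trans (ltW Fs))// F_anti// (le_trans (ltW xt)).
  by move/(ub_le_sup (proj2 hS)); rewrite leNgt r1s.
have [P hP] := primitive_exists kap_cont.
have cP : continuous P.
  by move=> s; apply: differentiable_continuous; apply/derivable1_diffP; have [] := hP s.
have cPP : continuous (fun s => P r1 - P s).
  by apply: continuous_sub => //; exact: cst_continuous.
pose v0 s := i s * (P r1 - P s).
have cv0 : continuous v0 by exact: continuous_mul.
have dPP (s : R) : is_derive s 1 (fun s => P r1 - P s) (- kap s).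
  by have := is_deriveB (is_derive_cst (P r1) s 1) (hP s); rewrite sub0r.
have dv0 (s : R) : is_derive s 1 v0 (di s * (P r1 - P s) - i s * kap s).
  apply: is_derive_eq (is_deriveM (hi s) (dPP s)) _.
  by rewrite /GRing.scale/=; ring.
pose v s := v0 (Num.min s r1).
have cv : continuous v.
  apply: continuous_compr => // s.
  exact: (@continuous_min _ _ id (cst r1) s (@cvg_id _ _) (@cst_continuous _ _ _ _)).
have v_out s : r1 <= s -> v s = 0 by move=> rs; rewrite /v min_r// /v0 subrr mulr0.
have v_in s : s <= r1 -> v s = v0 s by move=> sr; rewrite /v min_l.
pose J := radial_int x0 (fun s => F s - c * v s).
have cFv : continuous (fun s => F s - c * v s).
  by apply: continuous_sub => //; exact: continuous_scale.
have cJ : continuous J by exact: radial_int_continuous.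
have dJ (s : R) : 0 < s -> is_derive s 1 J (w s * (F s - c * v s)).
  by move=> s0; exact: (is_derive_radial_int d0 x0 cFv).
(* [J0] is [- w v0']. Its agreement with [J] is the equation [L v = F] integrated over balls, so no
   second derivative of [v] is needed. *)
pose J0 s := K s * (i s)^-1 - (w s * di s) * (P r1 - P s).
have JE s : 0 <= s <= r1 -> J s = J0 s.
  apply: (@eq_derive_const J J0 (fun s => w s * (F s - c * v s))) => //.
  - apply: continuous_sub; apply: continuous_mul => //.
      by move=> t; apply: cvgV; [rewrite gt_eqF|exact: ci].
    by apply: continuous_mul => //; exact: sphere_weight_continuous.
  - by rewrite /J radial_int_le0// /J0 K_le0// di0 mulr0 !mul0r subr0.
  - by move=> t /andP[t0 _]; exact: dJ.
  - move=> t /andP[t0 tr]; have it0 : i t != 0 by rewrite gt_eqF.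
    have wt0 : w t != 0 by rewrite gt_eqF// w_gt0.
    have dV : is_derive t 1 (fun t => (i t)^-1) (- (i t) ^- 2 * di t).
      exact: (is_deriveV it0 (hi t)).
    apply: is_derive_eq (is_deriveB (is_deriveM (dK t0) dV) (is_deriveM (hwdi t) (dPP t))) _.
    rewrite (v_in t (ltW tr)) /v0 /kap /GRing.scale/=; field.
    by rewrite it0 wt0.
have dv (s : R) : 0 < s -> s < r1 -> is_derive s 1 v (- (J s / w s)).
  move=> s0 sr; have it0 : i s != 0 by rewrite gt_eqF.
  have wt0 : w s != 0 by rewrite gt_eqF// w_gt0.
  have near_vv : {near s, v0 =1 v}.
    near=> t; rewrite v_in//; apply/ltW; near: t; apply: (cvgr_lt s) => //; exact: cvg_id.
  have [dv1 dv2] := dv0 s; apply: DeriveDef; first exact: near_eq_derivable near_vv dv1.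
  rewrite -(@near_eq_derive _ _ _ v0 v s 1 near_vv) dv2 JE ?(ltW s0) ?(ltW sr)// /J0 /kap.
  by field; rewrite it0 wt0.
exists v, r1; rewrite -/J; split.
- by rewrite r10.
- exact: cv.
- exact: v_out.
- by move=> s /andP[]; exact: dv.
have v_ge0 s : 0 <= s -> 0 <= v s.
  move=> s0; have [rs|sr] := leP r1 s; first by rewrite v_out.
  rewrite (v_in _ (ltW sr)) mulr_ge0 ?(ltW (i_gt0 _))//.
  have [t /andP[t1 t2] ->] := @mean_value P kap s r1 sr (fun t _ => hP t) cP.
  apply: mulr_ge0; last by rewrite subr_ge0 ltW.
  have t0 := le_lt_trans s0 t1.
  by rewrite divr_ge0 ?Kge ?(ltW t0) ?(ltW t2)// mulr_ge0 ?exprn_ge0// ltW// w_gt0.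
have Jr1 : J r1 = K r1 / i r1 by rewrite JE ?r10 ?lexx// /J0 subrr mulr0 subr0.
split => //; last by move=> /Kr1_eq E; rewrite Jr1 E mul0r.
(* A negative minimum [p] of [J] would be interior, with [F p = c v p]. Right after [p], [J < 0]
   makes [v] increase while [F] does not, so [J' = w (F - c v) < 0], against minimality. *)
move=> s /andP[s0 sr]; rewrite leNgt; apply/negP => Jsn.
have [p] := @EVT_min R J 0 r1 r10 (continuous_subspaceT cJ).
rewrite in_itv/= => /andP[p0 pr] pmin.
have pmin' t : 0 <= t -> t <= r1 -> J p <= J t by move=> t0 t1; apply: pmin; rewrite in_itv/= t0.
have Jp : J p < 0 by exact: le_lt_trans (pmin' s s0 sr) Jsn.
have p0' : 0 < p.
  by rewrite lt_neqAle p0 andbT; apply/eqP => E; move: Jp; rewrite -E /J radial_int_le0// ltxx.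
have pr' : p < r1.
  rewrite lt_neqAle pr andbT; apply/eqP => E; move: Jp; rewrite E Jr1 ltNge divr_ge0//.
  exact: ltW.
have Fp : F p - c * v p = 0.
  have [_ D1] := dJ p p0'.
  have [|||_ D2] := @derive1_at_min R J 0 r1 p r10.
  - by move=> t; rewrite in_itv/= => /andP[t0 _]; have [] := dJ t t0.
  - by rewrite in_itv/= p0'.
  - by move=> t; rewrite in_itv/= => /andP[t0 t1]; rewrite pmin' ?ltW.
  by move: D1; rewrite D2 => /esym/eqP; rewrite mulf_eq0 gt_eqF ?w_gt0//= => /eqP.
have [e e0 He] := cont_lt cJ Jp.
pose t := Num.min r1 (p + e / 2).
have pt : p < t by rewrite lt_min pr' ltrDl divr_gt0.
have tr : t <= r1 by rewrite ge_min lexx.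
have te : t <= p + e / 2 by rewrite ge_min lexx orbT.
have [|q /andP[q1 q2] E] := @mean_value J (fun s => w s * (F s - c * v s)) p t pt _ cJ.
  by move=> x /andP[x1 _]; apply: dJ; exact: lt_trans x1.
have q0 := lt_trans p0' q1.
have vq : v p < v q.
  have [|y /andP[y1 y2] E'] := @mean_value v (fun s => - (J s / w s)) p q q1 _ cv.
    by move=> x /andP[x1 x2]; apply: dv; [exact: lt_trans x1|exact: lt_le_trans (lt_trans x2 q2) tr].
  rewrite -subr_gt0 E' mulr_gt0 ?subr_gt0// oppr_gt0 pmulr_llt0 ?invr_gt0 ?w_gt0//.
    apply: He; rewrite ltr_norml; apply/andP; split; lra.
  exact: lt_trans y1.
have := pmin' t (ltW (lt_trans p0' pt)) tr; rewrite leNgt => /negP; apply.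
rewrite -subr_lt0 E pmulr_llt0 ?subr_gt0// pmulr_rlt0 ?w_gt0//.
have := F_anti (ltW q1); have : c * v p < c * v q by rewrite ltr_pM2l.
lra.
Unshelve. all: by end_near. Qed.

End profile.

Lemma profile_exists : exists (v : R -> R) (r1 : R),
  let J := radial_int x0 (fun s => F s - c * v s) in
  [/\ 0 <= r1 <= r, continuous v, forall s, r1 <= s -> v s = 0,
    forall s : R, 0 < s < r1 -> is_derive s 1 v (- (J s / w s)) &
    [/\ forall s, 0 <= s -> 0 <= v s, forall s, 0 <= s <= r1 -> 0 <= J s,
      r1 < r -> J r1 = 0 & forall s, r1 < s -> s <= r -> F s <= 0]].
Proof.
have [i [di [h1 h2 h3 h4 h5]]] := bessel_exists d0 c0.
exact: (profile_aux h1 h2 h3 h4 h5).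
Qed.

Hypothesis u_out : forall s, r <= s -> u s = 0.
Local Notation Phi := (radial_int x0 F).
Local Notation U := (radial_int x0 u).
Hypothesis hr : Phi r <= c * U r.
Hypothesis hL : forall s1 s2 K, 0 < s1 -> s1 < s2 -> s2 <= r -> 0 <= K ->
  (forall s, s1 <= s -> s <= s2 -> Phi s - c * U s <= K) ->
  (u s1 - u s2) * w s1 ^+ 2 <= (omega R d * s2 ^+ d - omega R d * s1 ^+ d) * K.

(* At the first point where [U - V] attains a positive maximum, the inequality [hL] and the
   equation for [v] force [u <= v] on the left, hence [U - V] is maximal there as well. *)
Lemma radial_comparison : exists (v : R -> R) (r1 : R),
  let J := radial_int x0 (fun s => F s - c * v s) in
  [/\ 0 <= r1 <= r, continuous v, forall s, r1 <= s -> v s = 0,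
    forall s : R, 0 < s < r1 -> is_derive s 1 v (- (J s / w s)) &
    [/\ J r1 = 0, forall s, 0 <= s -> 0 <= v s & forall s, 0 <= s <= r -> U s <= radial_int x0 v s]].
Proof.
have [v [r1 /= [/andP[r10 r1r] cv v_out dv [v_ge0 J_ge0 Jr1 F_le0]]]] := profile_exists.
set J := radial_int x0 (fun s => F s - c * v s) in dv J_ge0 Jr1 *.
pose V := radial_int x0 v.
have cFv : continuous (fun s => F s - c * v s).
  by apply: continuous_sub => //; exact: continuous_scale.
have cJ : continuous J by exact: radial_int_continuous.
have JE s : J s = Phi s - c * V s by exact: radial_int_sub.
have dJ (s : R) : 0 < s -> is_derive s 1 J (w s * (F s - c * v s)).
  by move=> s0; exact: (is_derive_radial_int d0 x0 cFv).
have v_anti s t : 0 <= s -> s <= t -> v t <= v s.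
  move=> s0; rewrite le_eqVlt => /predU1P[->//|st].
  have [tr|tr] := leP r1 t; first by rewrite (v_out t)// v_ge0.
  have [|x /andP[x1 x2] E] := @mean_value v (fun s => - (J s / w s)) s t st _ cv.
    by move=> x /andP[x1 x2]; apply: dv; rewrite (le_lt_trans s0 x1) (lt_trans x2).
  have x0' := le_lt_trans s0 x1.
  rewrite -subr_le0 E mulr_le0_ge0 ?subr_ge0 ?(ltW st)// oppr_le0 divr_ge0 ?(ltW (w_gt0 _))//.
  by rewrite J_ge0// (ltW x0') (ltW (lt_trans x2 tr)).
(* Beyond [r1], [v = 0] and [F <= 0], so [J] does not increase from [J r1 = 0]. *)
have J_le0 s : r1 < s -> s <= r -> J s <= 0.
  move=> rs sr; have [|x /andP[x1 x2] E] := @mean_value J (fun s => w s * (F s - c * v s)) r1 s rs _ cJ.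
    by move=> x /andP[x1 _]; apply: dJ; exact: le_lt_trans x1.
  rewrite (Jr1 (lt_le_trans rs sr)) subr0 in E.
  rewrite E mulr_le0_ge0 ?subr_ge0 ?(ltW rs)//.
  have wx : 0 < w x by rewrite w_gt0// (le_lt_trans r10).
  by rewrite pmulr_rle0// v_out ?(ltW x1)// mulr0 subr0 F_le0// ltW// (lt_le_trans x2).
have cU : continuous U by exact: radial_int_continuous.
have cV : continuous V by exact: radial_int_continuous.
have cD : continuous (fun s => U s - V s) by exact: continuous_sub.
have dD (s : R) : 0 < s -> is_derive s 1 (fun s => U s - V s) (w s * (u s - v s)).
  move=> s0; rewrite mulrBr; apply: is_deriveB; exact: is_derive_radial_int.
suff UV s : 0 <= s <= r -> U s <= V s.
  exists v, r1; split => //; first by rewrite r10.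
  (* If [r1 = r], the condition [J r = 0] was not imposed on [v]. It follows from the comparison:
     [Phi r <= c U r <= c V r] gives [J r <= 0], and [J r >= 0] is known. *)
  split => //; have [/Jr1//|rr1] := ltP r1 r.
  have E : r1 = r by apply/eqP; rewrite eq_le r1r.
  rewrite -/J; apply/eqP; rewrite eq_le J_ge0 ?r10 ?lexx// andbT E JE.
  have : c * U r <= c * V r by rewrite ler_pM2l// UV// lexx ltW.
  by have := hr; lra.
move=> srng; rewrite leNgt; apply/negP => VU.
have [pm] := @EVT_max R (fun s => U s - V s) 0 r (ltW r0) (continuous_subspaceT cD).
rewrite in_itv/= => /andP[pm0 pmr] pmax; set m := U pm - V pm in pmax.
have m0 : 0 < m by rewrite (lt_le_trans _ (pmax s _)) ?subr_gt0// in_itv.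
have le_m t : 0 <= t -> t <= r -> U t - V t <= m by move=> t0 t1; apply: pmax; rewrite in_itv/= t0.
pose T := [set s | 0 <= s <= r /\ U s - V s = m].
have hT : has_inf T by split; [exists pm; split => //; rewrite pm0|exists 0 => t [/andP[]]].
pose p := inf T.
have p0 : 0 <= p by apply: lb_le_inf; [exact: (proj1 hT)|move=> t [/andP[]]].
have pr : p <= r.
  by apply: (le_trans _ pmr); apply: (ge_inf (proj2 hT)); split => //; rewrite pm0.
have Dp : U p - V p = m.
  apply/eqP; rewrite eq_le le_m//= leNgt; apply/negP => Dm; have [e e0 He] := cont_lt cD Dm.
  have [|t [/andP[t0 t1] tm] tp] := @inf_lt _ T (p + e) (proj1 hT); first by rewrite ltrDl.
  have pt : p <= t by apply: (ge_inf (proj2 hT)); split => //; rewrite t0.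
  have := He t; rewrite tm ltxx => H; suff : false by []; apply: H.
  by rewrite ger0_norm ?subr_ge0// ltrBlDl.
have p0' : 0 < p.
  rewrite lt_neqAle p0 andbT; apply/eqP => E; move: m0.
  by rewrite -Dp -E /V !radial_int_le0// subrr ltxx.
(* At an interior maximum the derivative [w (u - v)] vanishes; at [r] both functions are 0. *)
have ep : u p = v p.
  move: pr; rewrite le_eqVlt => /predU1P[->|pr']; first by rewrite u_out// v_out.
  have [_ D1] := dD p p0'.
  have [|||_ D2] := @derive1_at_max R (fun s => U s - V s) 0 r p (ltW r0).
  - by move=> t; rewrite in_itv/= => /andP[t0 _]; have [] := dD t t0.
  - by rewrite in_itv/= p0'.
  - by move=> t; rewrite in_itv/= => /andP[t0 t1]; rewrite Dp le_m ?ltW.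
  by move: D1; rewrite D2 => /esym/eqP; rewrite mulf_eq0 gt_eqF ?w_gt0//= subr_eq0 => /eqP.
have cJD : continuous (fun s => J s - c * (U s - V s)).
  by apply: continuous_sub => //; exact: continuous_scale.
have hE s' : Phi s' - c * U s' = J s' - c * (U s' - V s') by rewrite JE; ring.
have [e e0 He] : exists2 e : R, 0 < e & forall x, p - e < x -> 0 < x -> x < p -> u x <= v x.
  (* [Phi - c U = J - c (U - V)] equals [J p - c m] at [p]. Half of [c m > 0] is given up to stay
     below [M0] near [p]; the other half is the margin by which [u] will decrease more slowly than
     [v]. *)
  pose M0 := J p - c * m / 2.
  have cm : 0 < c * m by rewrite mulr_gt0.
  have [e1 e10 He1] : exists2 e : R, 0 < e & forall x, `|x - p| < e -> J x - c * (U x - V x) < M0.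
    by apply: cont_lt => //; rewrite Dp /M0; lra.
  have hM K x : 0 <= K -> M0 <= K -> p - e1 < x -> 0 < x -> x < p ->
      (u x - u p) * w x ^+ 2 <= (omega R d * p ^+ d - omega R d * x ^+ d) * K.
    move=> K0 MK x1 x2 x3; apply: hL => // t t1 t2; rewrite hE (le_trans _ MK)// ltW//.
    by apply: He1; rewrite ler0_norm ?subr_le0//; lra.
  (* If [J p <= 0], [hL] applies with [K = 0], so to the left of [p] one has [u <= u p = v p <= v],
     [v] being nonincreasing. *)
  have [Jp|Jp] := leP (J p) 0.
    exists e1 => // x x1 x2 x3; have := hM 0 x (lexx 0) _ x1 x2 x3; rewrite mulr0.
    rewrite pmulr_lle0 ?exprn_gt0 ?w_gt0// subr_le0 => H.
    have := H ltac:(lra); rewrite ep subr_le0 => /le_trans; apply.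
    by rewrite v_anti// ltW.
  have pr1 : p <= r1 by rewrite leNgt; apply/negP => /J_le0/(_ pr); rewrite leNgt Jp.
  (* To the left of [p], [u] falls at a rate of about [M / w p] at most and [v] at a rate of at
     least [L / w p]. [L] is the midpoint of [M] and [J p], and the radius [e3] absorbs the
     variation of [w]. *)
  pose M := Num.max 0 M0.
  have MJ : M < J p by rewrite gt_max Jp /M0; lra.
  have M0' : 0 <= M by rewrite le_max lexx.
  pose L := (M + J p) / 2.
  have L0 : 0 < L by rewrite /L; lra.
  have wp := w_gt0 p0'.
  have [e2 e20 He2] : exists2 e : R, 0 < e & forall x, `|x - p| < e -> L < J x.
    by apply: cont_gt => //; rewrite /L; lra.
  have [e3 e30 He3] : exists2 e : R, 0 < e & forall x, `|x - p| < e -> M * w p ^+ 2 < L * w x ^+ 2.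
    apply: (@cont_gt (fun x => L * w x ^+ 2)).
      by apply: continuous_scale; apply: continuous_pow; exact: sphere_weight_continuous.
    by rewrite ltr_pM2r ?exprn_gt0// /L; lra.
  exists (Num.min e1 (Num.min e2 e3)); first by rewrite !lt_min e10 e20 e30.
  move=> x x1 x2 x3.
  have [h1 h2 h3] : [/\ p - e1 < x, p - e2 < x & p - e3 < x].
    by split; apply: le_lt_trans x1; rewrite lerB// !ge_min lexx ?orbT.
  suff : v p + (u x - u p) <= v x by rewrite ep; lra.
  have wx := w_gt0 x2.
  have H1 := hM M x M0' _ h1 x2 x3.
  have H2 : omega R d * p ^+ d - omega R d * x ^+ d <= w p * (p - x).
    have [||y /andP[y1 y2] ->] := @mean_value (fun s => omega R d * s ^+ d) w x p x3 _ _.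
    - by move=> y _; exact: is_derive_ball_volume.
    - by apply: continuous_scale; exact: exprn_continuous.
    by rewrite ler_wpM2r ?subr_ge0 ?(ltW x3)// w_le// ltW// (lt_trans x2).
  have H3 : L / w p * (p - x) <= v x - v p.
    have [|y /andP[y1 y2] E] := @mean_value v (fun s => - (J s / w s)) x p x3 _ cv.
      by move=> y /andP[y1 y2]; apply: dv; rewrite (lt_trans x2 y1) (lt_le_trans y2).
    have -> : v x - v p = J y / w y * (p - x) by rewrite -[v x - v p]opprB E; ring.
    rewrite ler_wpM2r ?subr_ge0 ?(ltW x3)//.
    have wy : 0 < w y by rewrite w_gt0// (lt_trans x2).
    rewrite ler_pdivrMr// mulrAC ler_pdivlMr//.
    apply: le_trans (_ : L * w p <= _); first by rewrite ler_wpM2l ?(ltW L0)// w_le// ltW// (lt_trans x2).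
    rewrite ler_wpM2r ?(ltW wp)// ltW// He2// ler0_norm ?subr_le0 ?(ltW y2)//; lra.
  suff H4 : u x - u p <= L / w p * (p - x) by lra.
  have px : 0 < p - x by rewrite subr_gt0.
  rewrite mulrAC ler_pdivlMr// -(ler_pM2r (exprn_gt0 2 wx)).
  have H5 := He3 x ltac:(rewrite ler0_norm ?subr_le0 ?(ltW x3)//; lra).
  rewrite mulrAC; apply: (le_trans (ler_wpM2r (ltW wp) (H1 _))); first by rewrite le_max lexx orbT.
  apply: le_trans (_ : w p * (p - x) * M * w p <= _).
    by rewrite ler_wpM2r ?(ltW wp)// ler_wpM2r.
  rewrite (_ : _ * _ = (p - x) * (M * w p ^+ 2)); last by ring.
  by rewrite (_ : _ * w x ^+ 2 = (p - x) * (L * w x ^+ 2)) ?ler_pM2l ?ltW//; ring.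
(* Where [u <= v], [U - V] is nonincreasing, so it already equals [m] at [x < p], against the choice
   of [p] as the first maximum point. *)
pose x := Num.max (p / 2) (p - e / 2).
have x0' : 0 < x by rewrite lt_max divr_gt0.
have xp : x < p by rewrite gt_max ltrBlDr ltrDl divr_gt0// andbT ltr_pdivrMr// mulr_natr mulr2n ltrDl.
have xe : p - e < x.
  by rewrite lt_max; apply/orP; right; lra.
have [|y /andP[y1 y2] E] := @mean_value (fun s => U s - V s) (fun s => w s * (u s - v s)) x p xp _ cD.
  by move=> y /andP[y1 _]; apply: dD; exact: lt_trans y1.
have Dx : U x - V x = m.
  apply/eqP; rewrite eq_le (le_m _ (ltW x0') (ltW (lt_le_trans xp pr)))/= -Dp -subr_le0 E.
  have y0 := lt_trans x0' y1.
  rewrite mulr_le0_ge0 ?subr_ge0 ?(ltW xp)// pmulr_rle0 ?w_gt0// subr_le0 He//.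
  exact: lt_trans y1.
have : p <= x by apply: (ge_inf (proj2 hT)); split => //; rewrite (ltW x0') ltW// (lt_le_trans xp).
by rewrite leNgt xp.
Qed.

End radial_comparison.

(** * Radial test functions *)

Section smooth_functions.
Context {R : realType}.

(** The polynomial factor makes the family closed under differentiation: the derivative acts as [P]
    to [X^2 (P - P')]. *)
Definition flat (P : {poly R}) (x : R) : R := if 0 < x then P.[x^-1] * expR (- x^-1) else 0.

(** [expR y] is the [m + 1]-st power of [expR (y / (m + 1))], which is at least [y / (m + 1)]. *)
Let pow_exp_bound (m : nat) : exists C : R, forall y, 1 <= y -> y ^+ m * expR (- y) <= C.
Proof.
exists (m.+1%:R ^+ m.+1) => y y1; have y0 : 0 < y by exact: lt_le_trans y1.
have m0 : 0 < m.+1%:R :> R by rewrite ltr0n.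
apply: le_trans (_ : y ^+ m.+1 * expR (- y) <= _).
  by rewrite ler_wpM2r ?expR_ge0// ler_weXn2l.
rewrite expRN ler_pdivrMr ?expR_gt0//.
have -> : expR y = expR (y / m.+1%:R) ^+ m.+1.
  by rewrite -expRM_natl mulrC divfK// gt_eqF.
rewrite -exprMn lerXn2r ?nnegrE ?mulr_ge0 ?expR_ge0 ?(ltW y0)//.
rewrite -ler_pdivrMl// mulrC (le_trans _ (expR_ge1Dx _))//.
by rewrite lerDr.
Qed.

Let poly_exp_bound (P : {poly R}) m :
  exists C : R, forall y, 1 <= y -> `|P.[y]| * (y ^+ m * expR (- y)) <= C.
Proof.
elim/poly_ind: P m => [|P k IH] m.
  by exists 0 => y _; rewrite horner0 normr0 mul0r.
have [C HC] := IH m.+1; have [D HD] := pow_exp_bound m; exists (C + `|k| * D) => y y1.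
have y0 : 0 < y by exact: lt_le_trans y1.
rewrite hornerMXaddC; apply: le_trans (_ : (`|P.[y]| * y + `|k|) * (y ^+ m * expR (- y)) <= _).
  rewrite ler_wpM2r ?mulr_ge0 ?exprn_ge0 ?expR_ge0 ?(ltW y0)//.
  by rewrite (le_trans (ler_normD _ _))// normrM (gtr0_norm y0).
rewrite mulrDl lerD//; last by rewrite ler_wpM2l ?HD.
by apply: le_trans (HC y y1); rewrite exprS !mulrA.
Qed.

Lemma is_derive_flat P (x : R) : is_derive x 1 (flat P) (flat ('X^2 * (P - P^`())) x).
Proof.
have [x0|x0|->] := ltgtP x 0.
- have near_eq : {near x, cst 0 =1 flat P}.
    near=> y; rewrite /flat ltNge ltW//; near: y; have /cvgr_lt H := @cvg_id _ (nbhs x); exact: H.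
  have [h1 h2] := is_derive_cst (0 : R) x (1 : R).
  apply: DeriveDef; first exact: near_eq_derivable near_eq h1.
  by rewrite -(@near_eq_derive _ _ _ (cst 0) (flat P) x 1 near_eq) h2 /flat ltNge ltW.
- have near_eq : {near x, (fun y => P.[y^-1] * expR (- y^-1)) =1 flat P}.
    near=> y; rewrite /flat ifT//; near: y; have /cvgr_gt H := @cvg_id _ (nbhs x); exact: H.
  have xn0 : x != 0 by rewrite gt_eqF.
  have dV : is_derive x 1 (fun y : R => y^-1) (- x ^- 2).
    by have := is_deriveV xn0 (is_derive_id x (1 : R)); rewrite [_ *: 1]mulr1.
  have dP : is_derive (x^-1) 1 (horner P) (P^`().[x^-1]).
    apply: DeriveDef; first exact: derivable_horner.
    by rewrite -derive1E -derivE.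
  have d1 : is_derive x 1 (fun y : R => P.[y^-1]) (P^`().[x^-1] * - x ^- 2).
    exact: (@is_derive1_comp R (horner P) (fun y : R => y^-1) x _ _ dP dV).
  have dN : is_derive x 1 (fun y : R => - y^-1) (x ^- 2).
    by have := is_deriveN dV; rewrite opprK.
  have d2 : is_derive x 1 (fun y : R => expR (- y^-1)) (expR (- x^-1) * x ^- 2).
    exact: (@is_derive1_comp R expR (fun y : R => - y^-1) x _ _ (is_derive_expR _) dN).
  have [h1 h2] := is_deriveM d1 d2.
  apply: DeriveDef; first exact: near_eq_derivable near_eq h1.
  rewrite -(@near_eq_derive _ _ _ _ (flat P) x 1 near_eq) h2 /flat x0 /GRing.scale/= !hornerE/=.
  rewrite exprVn; ring.
(* At 0, [poly_exp_bound] with exponent 2 and [y = h^-1] gives [|flat P h| <= C h ^+ 2]. *)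
rewrite /flat ltxx; apply: is_derive_eps => e e0.
have [C HC] := poly_exp_bound P 2.
have C0 : 0 <= C by rewrite (le_trans _ (HC 1 _))// !mulr_ge0// expR_ge0.
have C1 : 0 < C + 1 by rewrite ltr_wpDl.
exists (Num.min 1 (e / (C + 1))); first by rewrite lt_min ltr01 divr_gt0.
move=> h; rewrite lt_min => /andP[h1 h2]; rewrite add0r /flat ltxx subr0 mul0r subr0.
have [h0|h0] := ltP 0 h; last by rewrite normr0 mulr_ge0// ltW.
rewrite gtr0_norm// in h1 h2 *; have y1 : 1 <= h^-1 by rewrite invf_ge1// ltW.
have H := HC _ y1; rewrite normrM (gtr0_norm (expR_gt0 _)).
apply: le_trans (_ : C * h ^+ 2 <= _).
  by rewrite -ler_pdivrMr ?exprn_gt0// -exprVn -mulrA [expR _ * _]mulrC.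
rewrite expr2 mulrA ler_wpM2r ?(ltW h0)//.
apply: le_trans (_ : (C + 1) * h <= _); first by rewrite ler_wpM2r ?(ltW h0)// lerDl.
by rewrite -ler_pdivlMl// mulrC ltW.
Unshelve. all: by end_near. Qed.

(** A class given by generators and stable under differentiation, so that infinite differentiability
    never has to be proved order by order. Closure under primitives provides the step function and
    the double integrations of [radial_inequality]. *)
Inductive smooth1 : (R -> R) -> Prop :=
| smooth1_flat P : smooth1 (flat P)
| smooth1_cst k : smooth1 (fun=> k)
| smooth1_add f g : smooth1 f -> smooth1 g -> smooth1 (fun x => f x + g x)
| smooth1_mul f g : smooth1 f -> smooth1 g -> smooth1 (fun x => f x * g x)
| smooth1_affine a b f : smooth1 f -> smooth1 (fun x => f (a * x + b))
| smooth1_primitive G g : smooth1 g -> (forall x : R, is_derive x 1 G (g x)) -> smooth1 G.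

Lemma smooth1_derive f : smooth1 f -> exists2 g, smooth1 g & forall x : R, is_derive x 1 f (g x).
Proof.
elim=> {f}[P|k|f g sf [f' sf' df] sg [g' sg' dg]|f g sf [f' sf' df] sg [g' sg' dg]|a b f sf [f' sf' df]|G g sg [g' sg' dg] dG].
- by exists (flat ('X^2 * (P - P^`()))) => [|x]; [exact: smooth1_flat|exact: is_derive_flat].
- by exists (fun=> 0); [exact: smooth1_cst|move=> x; exact: is_derive_cst].
- by exists (fun x => f' x + g' x); [exact: smooth1_add|move=> x; exact: is_deriveD].
- exists (fun x => f x * g' x + g x * f' x).
    by apply: smooth1_add; exact: smooth1_mul.
  by move=> x; apply: is_derive_eq (is_deriveM (df x) (dg x)) _.
- exists (fun x => f' (a * x + b) * a).
    by apply: smooth1_mul; [exact: smooth1_affine|exact: smooth1_cst].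
  move=> x; have da : is_derive x 1 (fun x : R => a * x + b) a.
    have := is_deriveD (is_deriveZ a (is_derive_id x (1 : R))) (is_derive_cst b x (1 : R)).
    by rewrite addr0 [_ *: 1]mulr1.
  exact: (@is_derive1_comp R f (fun x : R => a * x + b) x _ _ (df _) da).
- by exists g.
Qed.

Lemma smooth1_continuous f : smooth1 f -> continuous f.
Proof.
move=> /smooth1_derive[g _ fg] x; apply: differentiable_continuous; apply/derivable1_diffP.
by have [] := fg x.
Qed.

(** The normalised primitive of a bump supported in [[0, 1]]. Its derivative is returned as well,
    for the cut-offs of [profile_inequality]. *)
Lemma smooth1_step : exists2 theta, smooth1 theta &
  [/\ forall x, x <= 0 -> theta x = 0, forall x, 1 <= x -> theta x = 1,
      forall x, 0 <= theta x <= 1, {homo theta : x y / x <= y} &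
      exists2 dtheta, continuous dtheta & (forall x : R, is_derive x 1 theta (dtheta x)) /\
        forall x, x <= 0 \/ 1 <= x -> dtheta x = 0].
Proof.
pose g x := flat 1 x * flat 1 (-1 * x + 1).
have sg : smooth1 g by apply: smooth1_mul; [|apply: smooth1_affine]; exact: smooth1_flat.
have flat_ge0 x : 0 <= flat 1 x by rewrite /flat; case: ifP; rewrite // hornerC mul1r expR_ge0.
have flat_gt0 x : 0 < x -> 0 < flat 1 x by rewrite /flat => ->; rewrite hornerC mul1r expR_gt0.
have flat_le0 x : x <= 0 -> flat 1 x = 0 by rewrite /flat ltNge => ->.
have g_ge0 x : 0 <= g x by exact: mulr_ge0.
have [G dG] := primitive_exists (smooth1_continuous sg).
have sG : smooth1 G := smooth1_primitive sg dG.
have cG := smooth1_continuous sG.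
have mv x y : x < y -> exists2 z, x < z < y & G y - G x = g z * (y - x).
  move=> xy; have [z] := @MVT R G g x y xy (fun z _ => dG z) (continuous_subspaceT cG).
  by rewrite in_itv/= => z1 z2; exists z.
have G_homo : {homo G : x y / x <= y}.
  move=> x y; rewrite le_eqVlt => /predU1P[->//|/[dup] xy /mv[z _ E]].
  by rewrite -subr_ge0 E mulr_ge0// subr_ge0 ltW.
have G0 x : x <= 0 -> G x = G 0.
  rewrite le_eqVlt => /predU1P[->//|/mv[z /andP[_ z0] E]].
  by apply/esym/eqP; rewrite -subr_eq0 E /g flat_le0 ?(ltW z0)// !mul0r.
have G1 x : 1 <= x -> G x = G 1.
  rewrite le_eqVlt => /predU1P[->//|/mv[z /andP[z1 _] E]].
  by apply/eqP; rewrite -subr_eq0 E /g (flat_le0 (_ + _)) ?mulr0 ?mul0r// mulN1r addrC subr_le0 ltW.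
have G01 : 0 < G 1 - G 0.
  have [z /andP[z0 z1] ->] := mv 0 1 ltr01.
  by rewrite subr0 mulr1 mulr_gt0// flat_gt0// mulN1r addrC subr_gt0.
exists (fun x => (G 1 - G 0)^-1 * (G x + - G 0)).
  by apply: smooth1_mul; [exact: smooth1_cst|apply: smooth1_add => //; exact: smooth1_cst].
split.
- by move=> x /G0 ->; rewrite subrr mulr0.
- by move=> x /G1 ->; rewrite mulVf// gt_eqF.
- move=> x; rewrite mulrC; apply/andP; split.
    rewrite divr_ge0 ?(ltW G01)// subr_ge0; have [/G0 ->//|x0] := leP x 0.
    by apply: G_homo; exact: ltW.
  rewrite ler_pdivrMr// mul1r lerD2r; have [/G1 ->//|x1] := leP 1 x.
  by apply: G_homo; exact: ltW.
- by move=> x y xy; rewrite ler_wpM2l ?invr_ge0 ?(ltW G01)// lerD2r G_homo.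
- exists (fun x => (G 1 - G 0)^-1 * g x).
    by apply: continuous_scale; exact: smooth1_continuous.
  split=> [x|x H].
    have := is_deriveZ (G 1 - G 0)^-1 (is_deriveD (dG x) (is_derive_cst (- G 0) x (1 : R))).
    by rewrite addr0.
  rewrite /g; case: H => H; first by rewrite flat_le0 ?mul0r ?mulr0.
  by rewrite (flat_le0 (_ + _)) ?mulr0// mulN1r addrC subr_le0.
Qed.

Lemma smooth1_sum (I : Type) (s : seq I) (f : I -> R -> R) : (forall i, smooth1 (f i)) ->
  smooth1 (fun x => \sum_(i <- s) f i x).
Proof.
move=> sf; elim: s => [|i s IH].
  by rewrite (_ : (fun _ => _) = fun=> 0); [exact: smooth1_cst|apply/funext => x; rewrite big_nil].
rewrite (_ : (fun _ => _) = fun x => f i x + \sum_(i <- s) f i x); first exact: smooth1_add.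
by apply/funext => x; rewrite big_cons.
Qed.

Lemma uniform_continuous_segment (k : R -> R) (M e : R) : continuous k -> 0 < e ->
  exists2 r : R, 0 < r & forall s t, `|s| <= M -> `|t - s| < r -> `|k s - k t| < e.
Proof.
move=> ck e0; have cw : continuous (fun x : 'rV[R]_1 => k (x ord0 ord0)).
  by apply: continuous_compr => // x; exact: coord_continuous.
have [q q0 H] := uniform_continuous_cube M cw e0; exists q => // s t sM ts.
have := H (const_mx s) (const_mx t); rewrite !mxE; apply.
  by move=> i; rewrite mxE.
rewrite -(ltr_pXn2r (n := 2)) ?nnegrE ?enorm_ge0 ?(ltW q0)// sqr_enorm big_ord1 !mxE.
by rewrite -[_ ^+ 2 in ltLHS]real_normK ?num_real// ltr_pXn2r ?nnegrE ?(ltW q0).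
Qed.

(* The approximation is the interpolation of [k] at the points [j / n] by the partition of unity
   [theta (n q - j + 1) - theta (n q - j)], whose sum over [j] telescopes. *)
Lemma smooth1_approx (k : R -> R) (a b b' e : R) : continuous k -> 0 < a -> b < b' ->
  (forall q, q <= a -> k q = 0) -> (forall q, b <= q -> k q = 0) -> 0 < e ->
  exists2 k', smooth1 k' & (forall q, 0 <= q -> `|k' q - k q| <= e) /\ forall q, b' <= q -> k' q = 0.
Proof.
move=> ck a0 bb' ka kb e0; have [th sth [th0 th1 th01 th_homo _]] := smooth1_step.
have [rr rr0 Hr] := uniform_continuous_segment (`|b'| + 1) ck e0.
(* [1 / n] is below the modulus of continuity [rr], below 1, and below [b' - b]: the nodes close to
   a point [q >= b'] then lie beyond [b], where [k = 0]. *)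
have [n n1 [n2 n3]] : exists2 n : nat, (0 < n)%N & n%:R^-1 < rr /\ n%:R^-1 < Num.min 1 (b' - b).
  have m0 : 0 < Num.min rr (Num.min 1 (b' - b)) by rewrite !lt_min rr0 ltr01 subr_gt0.
  exists (Num.bound (Num.min rr (Num.min 1 (b' - b)))^-1).
    by rewrite -(ltr0n R) (le_lt_trans _ (archi_boundP _)) ?invr_ge0 ?(ltW m0).
  have H : (Num.bound (Num.min rr (Num.min 1 (b' - b)))^-1)%:R^-1 < Num.min rr (Num.min 1 (b' - b)) :> R.
    by rewrite -[ltRHS]invrK ltf_pV2 ?posrE ?invr_gt0 ?archi_boundP ?invr_ge0 ?(ltW m0)// (le_lt_trans _ (archi_boundP _)) ?invr_ge0 ?(ltW m0).
  by move: H; rewrite lt_min => /andP[].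
have n0 : 0 < n%:R :> R by rewrite ltr0n.
(* With [N > n |b'| + 1] nodes the telescoping sum is 1 at every [q] of [[0, b')]. *)
pose N := Num.bound (n%:R * `|b'| + 1 : R).
have NP : n%:R * `|b'| + 1 < N%:R :> R.
  by apply: archi_boundP; rewrite addr_ge0// mulr_ge0// ltW.
pose chi (j : nat) (q : R) := th (n%:R * q + (1 - j%:R)) + -1 * th (n%:R * q + - j%:R).
have schi j : smooth1 (chi j).
  apply: smooth1_add; first exact: (@smooth1_affine n%:R).
  by apply: smooth1_mul; [exact: smooth1_cst|exact: (@smooth1_affine n%:R)].
have chi_ge0 j q : 0 <= chi j q.
  by rewrite /chi mulN1r subr_ge0; apply: th_homo; lra.
have chi_supp j q : chi j q != 0 -> `|q - j%:R / n%:R| < n%:R^-1.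
  move=> H; have H1 : -1 < n%:R * q - j%:R.
    rewrite ltNge; apply/negP => H1; move/eqP: H; apply; rewrite /chi !th0 ?mulr0 ?addr0//; lra.
  have H2 : n%:R * q - j%:R < 1.
    rewrite ltNge; apply/negP => H2; move/eqP: H; apply; rewrite /chi !th1 ?mulr1 ?subrr//; lra.
  rewrite (_ : q - _ = n%:R^-1 * (n%:R * q - j%:R)); last by field; rewrite gt_eqF.
  by rewrite normrM gtr0_norm ?invr_gt0// gtr_pMr ?invr_gt0// ltr_norml H1.
have tele (m : nat) q : \sum_(j < m) chi j q = th (n%:R * q + 1) - th (n%:R * q + (1 - m%:R)).
  elim: m => [|m IH]; first by rewrite big_ord0 subr0 subrr.
  rewrite big_ord_recr/= IH /chi mulN1r.
  have -> : n%:R * q + (1 - m.+1%:R) = n%:R * q - m%:R by rewrite -natr1; ring.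
  ring.
exists (fun q => \sum_(j <- enum 'I_N) k (j%:R / n%:R) * chi j q).
  apply: smooth1_sum => j; apply: smooth1_mul => //; exact: smooth1_cst.
have nz q : b' <= q -> \sum_(j <- enum 'I_N) k (j%:R / n%:R) * chi j q = 0.
  move=> bq; rewrite big1_seq// => j _; have [->|H] := eqVneq (chi j q) 0; first by rewrite mulr0.
  rewrite kb ?mul0r//; have := chi_supp j q H; rewrite ltr_norml => /andP[_ H'].
  by move: n3; rewrite lt_min => /andP[_]; lra.
split => // q q0; have [bq|qb] := leP b' q; first by rewrite nz// kb ?subrr ?normr0 ?ltW// (lt_le_trans bb').
have qb' : q < `|b'| by rewrite (lt_le_trans qb)// ler_norm.
have S1 : \sum_(j < N) chi j q = 1.
  rewrite tele th1 ?th0 ?subr0//.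
    have : n%:R * q <= n%:R * `|b'| by rewrite ler_pM2l// ltW.
    by move: NP; lra.
  by rewrite lerDr mulr_ge0// ltW.
rewrite big_enum/= -[k q]mulr1 -[X in k q * X]S1 mulr_sumr -sumrB.
apply: (le_trans (ler_norm_sum _ _ _)); rewrite -[e]mulr1 -[X in _ <= e * X]S1 mulr_sumr.
apply: ler_sum => j _; rewrite -mulrBl normrM (ger0_norm (chi_ge0 j q)).
have [->|H] := eqVneq (chi j q) 0; first by rewrite !mulr0.
rewrite ler_wpM2r// distrC ltW// Hr//; first by rewrite ger0_norm//; lra.
by rewrite distrC (lt_trans (chi_supp j q H)).
Qed.

End smooth_functions.

Section smooth_several_variables.
Context {R : realType} {d : nat}.

(** Like [smooth1], generated by constructors and stable under partial derivatives: [smooth] follows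
    by induction on the list of directions. *)
Inductive smoothV : ('rV[R]_d -> R) -> Prop :=
| smoothV_coord i : smoothV (fun x => x ord0 i)
| smoothV_cst k : smoothV (fun=> k)
| smoothV_add f g : smoothV f -> smoothV g -> smoothV (fun x => f x + g x)
| smoothV_mul f g : smoothV f -> smoothV g -> smoothV (fun x => f x * g x)
| smoothV_comp (f : R -> R) g : smooth1 f -> smoothV g -> smoothV (fun x => f (g x)).

Lemma partial_line i (f : 'rV[R]_d -> R) x (l : R) : differentiable f x ->
  is_derive (0 : R) 1 (fun t : R => f (x + t *: delta_mx ord0 i)) l -> partial i f x = l.
Proof.
move=> df [_ <-]; have df' : differentiable f (x + 0 *: delta_mx ord0 i) by rewrite scale0r addr0.
by have [_ ->] := derive_line df'; rewrite scale0r addr0.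
Qed.

Lemma partial_coord i j : partial i (fun x : 'rV[R]_d => x ord0 j) = fun=> (j == i)%:R.
Proof.
apply/funext => x; apply: partial_line; first exact: differentiable_coord.
rewrite (_ : (fun _ => _) = fun t : R => t * (j == i)%:R + x ord0 j); last first.
  by apply/funext => t; rewrite !mxE eqxx/= addrC.
have := is_deriveD (is_deriveM (is_derive_id (0 : R) (1 : R)) (is_derive_cst ((j == i)%:R : R) (0 : R) (1 : R)))
  (is_derive_cst (x ord0 j) (0 : R) (1 : R)).
by move=> /is_derive_eq; apply; rewrite /GRing.scale/= mulr0 add0r addr0 mulr1.
Qed.

Lemma smoothV_partial f : smoothV f ->
  (forall x, differentiable f x) /\ forall i, smoothV (partial i f).
Proof.
elim=> {f}[i|k|f g sf [df pf] sg [dg pg]|f g sf [df pf] sg [dg pg]|f g sf sg [dg pg]].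
- split; first by move=> x; exact: differentiable_coord.
  by move=> j; rewrite partial_coord; exact: smoothV_cst.
- split; first by move=> x; exact: differentiable_cst.
  by move=> j; rewrite (_ : partial j _ = fun=> 0); [exact: smoothV_cst|apply/funext => x; exact: partial_cst].
- split; first by move=> x; exact: differentiable_add.
  move=> i; rewrite (_ : partial i _ = fun x => partial i f x + partial i g x); first exact: smoothV_add.
  by apply/funext => x; rewrite partial_add.
- split; first by move=> x; exact: differentiable_mul.
  move=> i; rewrite (_ : partial i _ = fun x => f x * partial i g x + g x * partial i f x).
    by apply: smoothV_add; exact: smoothV_mul.
  by apply/funext => x; rewrite partial_mul.
- have [f' sf' df] := smooth1_derive sf.
  split; first by move=> x; exact: (differentiable_compr (df (g x)) (dg x)).
  move=> i; rewrite (_ : partial i _ = fun x => f' (g x) * partial i g x).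
    by apply: smoothV_mul => //; exact: smoothV_comp.
  by apply/funext => x; rewrite (partial_comp i (df (g x)) (dg x)).
Qed.

Lemma smoothV_smooth f : smoothV f -> smooth f.
Proof.
move=> sf s; suff /smoothV_partial[] : smoothV (foldr (@partial R d) f s) by [].
by elim: s => //= i s /smoothV_partial[_]; apply.
Qed.

Lemma smoothV_sum (I : Type) (s : seq I) (f : I -> 'rV[R]_d -> R) : (forall i, smoothV (f i)) ->
  smoothV (fun x => \sum_(i <- s) f i x).
Proof.
move=> sf; elim: s => [|i s IH].
  by rewrite (_ : (fun _ => _) = fun=> 0); [exact: smoothV_cst|apply/funext => x; rewrite big_nil].
rewrite (_ : (fun _ => _) = fun x => f i x + \sum_(i <- s) f i x); first exact: smoothV_add.
by apply/funext => x; rewrite big_cons.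
Qed.

Variable c : 'rV[R]_d.

(** The squared distance is smooth at the centre, unlike the distance, so radial test functions are
    written as functions of it. It is expanded into sums and products for [smoothV]. *)
Definition sqdist (x : 'rV[R]_d) : R := \sum_i (x ord0 i + - c ord0 i) * (x ord0 i + - c ord0 i).

Lemma sqdistE x : sqdist x = enorm (x - c) ^+ 2.
Proof. by rewrite sqr_enorm; apply: eq_bigr => i _; rewrite !mxE expr2. Qed.

Lemma smoothV_sqdist : smoothV sqdist.
Proof.
apply: smoothV_sum => i; apply: smoothV_mul; apply: smoothV_add;
  by [exact: smoothV_coord|exact: smoothV_cst].
Qed.

Lemma partial_sqdist i x : partial i sqdist x = 2 * (x ord0 i + - c ord0 i).
Proof.
apply: partial_line; first by have [+ _] := smoothV_partial smoothV_sqdist; apply.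
have -> : (fun t : R => sqdist (x + t *: delta_mx ord0 i))
    = fun t => sqdist x + t * (t + 2 * (x ord0 i + - c ord0 i)).
  apply/funext => t; rewrite /sqdist (bigD1 i)//= (bigD1 i (P := xpredT))//= !mxE !eqxx/= mulr1.
  rewrite (eq_bigr (fun j => (x ord0 j + - c ord0 j) * (x ord0 j + - c ord0 j))); last first.
    by move=> j ji; rewrite !mxE (negPf ji) andbF mulr0 addr0.
  ring.
have h1 : is_derive (0 : R) 1 (fun t : R => t + 2 * (x ord0 i + - c ord0 i)) 1.
  by have := is_deriveD (is_derive_id (0 : R) (1 : R)) (is_derive_cst (2 * (x ord0 i + - c ord0 i)) (0 : R) (1 : R));
    rewrite addr0.
have := is_deriveD (is_derive_cst (sqdist x) (0 : R) (1 : R)) (is_deriveM (is_derive_id (0 : R) (1 : R)) h1).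
by move=> /is_derive_eq; apply; rewrite /GRing.scale/= mul0r !add0r mulr1.
Qed.

Lemma lap_radial (eta eta' eta'' : R -> R) x :
  (forall q : R, is_derive q 1 eta (eta' q)) -> (forall q : R, is_derive q 1 eta' (eta'' q)) ->
  lap (fun x => eta (sqdist x)) x = 4 * sqdist x * eta'' (sqdist x) + 2 * d%:R * eta' (sqdist x).
Proof.
move=> h1 h2; have [ds _] := smoothV_partial smoothV_sqdist.
have p1 i : partial i (fun x => eta (sqdist x)) = fun x => eta' (sqdist x) * (2 * (x ord0 i + - c ord0 i)).
  by apply/funext => y; rewrite (partial_comp i (h1 _) (ds y)) partial_sqdist.
have dl i y : differentiable (fun x : 'rV[R]_d => 2 * (x ord0 i + - c ord0 i)) y.
  apply: differentiable_mul; first exact: differentiable_cst.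
  by apply: differentiable_add; [exact: differentiable_coord|exact: differentiable_cst].
have pl i y : partial i (fun x : 'rV[R]_d => 2 * (x ord0 i + - c ord0 i)) y = 2.
  rewrite partial_mul; last 2 first.
  - exact: differentiable_cst.
  - by apply: differentiable_add; [exact: differentiable_coord|exact: differentiable_cst].
  rewrite partial_add; last 2 first.
  - exact: differentiable_coord.
  - exact: differentiable_cst.
  by rewrite !partial_cst partial_coord eqxx addr0 mulr0 addr0 mulr1.
rewrite /lap (eq_bigr (fun i => 4 * eta'' (sqdist x) * ((x ord0 i + - c ord0 i) * (x ord0 i + - c ord0 i)) + 2 * eta' (sqdist x))).
  rewrite big_split/= -mulr_sumr -/(sqdist x) sumr_const card_ord -mulr_natr; ring.
move=> i _; rewrite p1 partial_mul//; last exact: (differentiable_compr (h2 _) (ds x)).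
by rewrite pl (partial_comp i (h2 _) (ds x)) partial_sqdist; ring.
Qed.

Lemma radial_test_function (r b : R) (eta : R -> R) : 0 < r -> smooth1 eta -> b < r ^+ 2 ->
  (forall q, b <= q -> eta q = 0) -> test_function (eball c r) (fun x => eta (sqdist x)).
Proof.
move=> r0 seta br eta0.
have csq : continuous sqdist.
  have [ds _] := smoothV_partial smoothV_sqdist; move=> x; exact: differentiable_continuous.
have sub : closure [set x | eta (sqdist x) != 0] `<=` [set x | sqdist x <= b].
  rewrite [X in _ `<=` X](_ : _ = closure [set x | sqdist x <= b]); last first.
    apply/closure_id; rewrite (_ : mkset _ = sqdist @^-1` [set y | y <= b]) //.
    by apply: closed_comp; [move=> x _; exact: csq|exact: closed_le].
  apply: closure_subset => x /= H; rewrite leNgt; apply/negP => /ltW /eta0 H0.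
  by rewrite H0 eqxx in H.
have inB x : sqdist x <= b -> enorm (x - c) < r.
  move=> H; rewrite -(ltr_pXn2r (n := 2)) ?nnegrE ?enorm_ge0 ?(ltW r0)//.
  by rewrite -sqdistE (le_lt_trans H).
split.
- by apply: smoothV_smooth; apply: smoothV_comp => //; exact: smoothV_sqdist.
- apply: (subclosed_compact _ (@compact_cube R d (r + enorm c))); first exact: closed_closure.
  move=> x /sub/inB H i; rewrite (le_trans (ler_coord_enorm x i))// -[x](subrK c).
  by rewrite (le_trans (enormD _ _))// lerD2r ltW.
- by move=> x /sub/inB; rewrite eballE.
Qed.

End smooth_several_variables.

(** * From test functions on the ball to radial profiles *)

Section radial_test_functions.
Context {R : realType} {d : nat}.
Variables (x0 : 'rV[R]_d) (r c Lam : R).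
Hypothesis r0 : 0 < r.
Local Notation B := (eball x0 r).
Hypothesis HB : forall psi, test_function B psi ->
  Lam * \int[vol]_(x in B) psi x ^+ 2 <= \int[vol]_(x in B) (- lap psi x + c * psi x) ^+ 2.

Let mB : measurable B. Proof. exact: measurable_eball. Qed.
Let finB : (vol B < +oo)%E. Proof. exact: vol_eball_fin. Qed.

(** The limit is only assumed measurable: in [profile_inequality] it may jump across the sphere of
    radius [r1]. *)
Lemma Rintegral_sq_limit (D : set 'rV[R]_d) (f_ : (('rV[R]_d) -> R)^nat) (f : 'rV[R]_d -> R) (M : R) :
  measurable D -> (vol D < +oo)%E ->
  (forall n, continuous (f_ n)) -> measurable_fun setT f -> 0 <= M ->
  {ae vol, forall x, D x -> f_ ^~ x @ \oo --> f x} -> (forall n x, D x -> `|f_ n x| <= M) ->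
  (\int[vol]_(x in D) f_ n x ^+ 2) @[n --> \oo] --> \int[vol]_(x in D) f x ^+ 2.
Proof.
move=> mD finD cf mf M0 H1 H2; apply: (@bounded_convergence _ _ _ _ D mD finD _ _ (M ^+ 2)).
- move=> n; apply: measurable_funTS; apply: continuous_measurable_rV.
  exact: continuous_pow.
- by apply: measurable_funTS; apply: measurable_funX.
- by apply: filterS H1 => x H Dx; rewrite !expr2; apply: cvgM; exact: H.
- by move=> n x Dx; rewrite normrX lerXn2r ?nnegrE// H2.
Qed.

Lemma primitive_vanishing (g : R -> R) (b : R) : continuous g -> (forall q, b <= q -> g q = 0) ->
  exists G : R -> R, (forall q : R, is_derive q 1 G (g q)) /\ forall q, b <= q -> G q = 0.
Proof.
move=> cg g0; have [G dG] := primitive_exists cg.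
have cG : continuous G.
  by move=> q; apply: differentiable_continuous; apply/derivable1_diffP; have [] := dG q.
exists (fun q => G q + - G b).
split; first by move=> q; have := is_deriveD (dG q) (is_derive_cst (- G b) q (1 : R)); rewrite addr0.
move=> q; rewrite le_eqVlt => /predU1P[->|bq]; first by rewrite subrr.
have [z] := @MVT R G g b q bq (fun z _ => dG z) (continuous_subspaceT cG).
by rewrite in_itv/= => /andP[/ltW z1 _]; rewrite g0// mul0r.
Qed.

Lemma smooth1_primitive_vanishing (g : R -> R) (b : R) : smooth1 g -> (forall q, b <= q -> g q = 0) ->
  exists2 G, smooth1 G & (forall q : R, is_derive q 1 G (g q)) /\ forall q, b <= q -> G q = 0.
Proof.
move=> sg g0; have [G [dG G0]] := primitive_vanishing (smooth1_continuous sg) g0.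
by exists G; first exact: smooth1_primitive dG.
Qed.

Lemma derive_compare (f g f' g' : R -> R) (b E : R) : continuous f -> continuous g -> 0 <= E ->
  (forall q : R, 0 < q < b -> is_derive q 1 f (f' q)) -> (forall q : R, 0 < q < b -> is_derive q 1 g (g' q)) ->
  (forall q, 0 < q < b -> `|f' q - g' q| <= E) -> f b = g b ->
  forall q, 0 <= q <= b -> `|f q - g q| <= E * b.
Proof.
move=> cf cg E0 df dg H fgb q /andP[q0]; rewrite le_eqVlt => /predU1P[qb|qb].
  by rewrite qb fgb subrr normr0 mulr_ge0// -qb.
have [||z] := @MVT R (fun q => f q - g q) (fun q => f' q - g' q) q b qb.
- move=> z; rewrite in_itv/= => /andP[z1 z2]; have zr : 0 < z < b by rewrite (le_lt_trans q0 z1).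
  by apply: is_deriveB; [exact: df|exact: dg].
- by apply: continuous_subspaceT; exact: continuous_sub.
rewrite in_itv/= fgb subrr sub0r => /andP[z1 z2] E'; rewrite -normrN E' normrM.
rewrite ler_pM ?H ?(le_lt_trans q0 z1)//= ger0_norm ?subr_ge0 ?(ltW qb)// gerBl//.
Qed.

Lemma continuous_vanishing_left (f : R -> R) (a : R) : 0 < a -> (forall s, s <= a -> f s = 0) ->
  (forall s, 0 < s -> {for s, continuous f}) -> continuous f.
Proof.
move=> a0 fa H s; have [s0|s0] := ltP 0 s; first exact: H.
apply/cvgrPdist_le => e e0; rewrite fa ?(le_trans s0 (ltW a0))//.
near=> t; rewrite fa ?subrr ?normr0 ?(ltW e0)//; apply/ltW; near: t.
have /cvgr_lt G := @cvg_id _ (nbhs s); exact: G (le_lt_trans s0 a0).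
Unshelve. all: by end_near. Qed.

(** In the variable [q], the squared distance, the profile has a continuous second derivative [k]
    vanishing outside [[a ^+ 2, b ^+ 2]]. A smooth approximation of [k], integrated twice from the
    outer end, gives test functions whose profiles converge uniformly with two derivatives, so [HB]
    passes to the limit. That [z] vanishes near 0 removes the singularity of the square root. *)
Lemma radial_inequality (v z dz : R -> R) (a b : R) : 0 < a -> 0 < b -> b < r ->
  (forall s, s <= a -> z s = 0) -> (forall s, s <= a -> dz s = 0) ->
  (forall s, b <= s -> z s = 0) -> (forall s, b <= s -> dz s = 0) -> (forall s, b <= s -> v s = 0) ->
  continuous v -> continuous dz ->
  (forall s : R, is_derive s 1 z (dz s)) -> (forall s : R, 0 < s -> is_derive s 1 v (z s)) ->
  Lam * \int[vol]_(x in B) v (enorm (x - x0)) ^+ 2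
  <= \int[vol]_(x in B) (- (dz (enorm (x - x0)) + (d%:R - 1) * (z (enorm (x - x0)) / enorm (x - x0)))
       + c * v (enorm (x - x0))) ^+ 2.
Proof.
move=> a0 b0 br za dza zb dzb vb cv cdz hz hv.
have cz : continuous z by move=> s; apply: differentiable_continuous; apply/derivable1_diffP; have [] := hz s.
have csq : continuous (@Num.sqrt R) by exact: sqrt_continuous.
have sq_le (q t : R) : 0 <= t -> q <= t ^+ 2 -> Num.sqrt q <= t.
  by move=> t0 H; rewrite -[t]ger0_norm// -sqrtr_sqr ler_wsqrtr.
have sq_ge (q t : R) : 0 <= t -> t ^+ 2 <= q -> t <= Num.sqrt q.
  by move=> t0 H; rewrite -[t]ger0_norm// -sqrtr_sqr ler_wsqrtr.
have czs : continuous (fun q => z (Num.sqrt q)) by exact: continuous_compr.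
have cdzs : continuous (fun q => dz (Num.sqrt q)) by exact: continuous_compr.
(* [p] and [k] are the first and second derivatives in [q] of [v (Num.sqrt q)]. *)
pose p q := z (Num.sqrt q) * (2 * Num.sqrt q)^-1.
pose k q := dz (Num.sqrt q) * (4 * q)^-1 - z (Num.sqrt q) * (4 * (q * Num.sqrt q))^-1.
have a20 : 0 < a ^+ 2 by rewrite exprn_gt0.
have cp : continuous p.
  apply: (continuous_vanishing_left a20) => [s sa|s s0].
    by rewrite /p za ?mul0r// sq_le// ltW.
  apply: cvgM; first exact: czs.
  apply: cvgV; first by rewrite mulf_neq0// gt_eqF// sqrtr_gt0.
  exact: (continuous_scale csq).
have ck : continuous k.
  apply: (continuous_vanishing_left a20) => [s sa|s s0].
    by rewrite /k za ?dza ?mul0r ?subrr// sq_le// ltW.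
  have cid : continuous (fun q : R => q) by move=> q; exact: cvg_id.
  apply: cvgB; apply: cvgM; [exact: cdzs| |exact: czs|].
    apply: cvgV; first by rewrite mulf_neq0// gt_eqF.
    exact: (continuous_scale cid).
  apply: cvgV; first by rewrite mulf_neq0// gt_eqF// mulr_gt0// sqrtr_gt0.
  exact: (continuous_scale (continuous_mul cid csq)).
(* The smooth approximation of [k] may spill beyond [b ^+ 2], but its support must stop before
   [r ^+ 2] for the test functions to have compact support in the open ball. *)
pose b1 := (b ^+ 2 + r ^+ 2) / 2.
have b2r2 : b ^+ 2 < r ^+ 2 by rewrite ltrXn2r ?nnegrE ?ltW.
have b20 : 0 < b ^+ 2 by rewrite exprn_gt0.
have bb1 : b ^+ 2 < b1 by rewrite /b1; lra.
have b1r : b1 < r ^+ 2 by rewrite /b1; lra.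
have b10 : 0 < b1 by rewrite /b1; lra.
have kb q : b ^+ 2 <= q -> k q = 0 by move=> /(sq_ge q b (ltW b0)) H; rewrite /k zb ?dzb// !mul0r subrr.
have ka q : q <= a ^+ 2 -> k q = 0 by move=> /(sq_le q a (ltW a0)) H; rewrite /k za ?dza// !mul0r subrr.
have pb q : b ^+ 2 <= q -> p q = 0 by move=> /(sq_ge q b (ltW b0)) H; rewrite /p zb// mul0r.
have dp (q : R) : 0 < q < b1 -> is_derive q 1 p (k q).
  move=> /andP[q0 _]; have s0 : 0 < Num.sqrt q by rewrite sqrtr_gt0.
  have ds := is_derive1_sqrt q0.
  have d1 : is_derive q 1 (fun q => z (Num.sqrt q)) (dz (Num.sqrt q) * (2 * Num.sqrt q)^-1).
    exact: (@is_derive1_comp R z (@Num.sqrt R) q _ _ (hz _) ds).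
  have d2 : is_derive q 1 (fun q => 2 * Num.sqrt q) (2 * (2 * Num.sqrt q)^-1) by exact: is_deriveZ.
  have n2 : 2 * Num.sqrt q != 0 by rewrite mulf_neq0// gt_eqF.
  have d3 := @is_deriveV R (fun q : R => 2 * Num.sqrt q) q _ _ n2 d2.
  have := is_deriveM d1 d3; move=> /is_derive_eq; apply.
  rewrite /GRing.scale/= /k (_ : 4 * (q * Num.sqrt q) = 4 * Num.sqrt q ^+ 3); last by rewrite exprSr sqr_sqrtr ?(ltW q0).
  rewrite (_ : 4 * q = 4 * Num.sqrt q ^+ 2); last by rewrite sqr_sqrtr ?(ltW q0).
  by field; rewrite gt_eqF.
have dv (q : R) : 0 < q < b1 -> is_derive q 1 (fun q => v (Num.sqrt q)) (p q).
  move=> /andP[q0 _]; have s0 : 0 < Num.sqrt q by rewrite sqrtr_gt0.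
  exact: (@is_derive1_comp R v (@Num.sqrt R) q _ _ (hv _ s0) (is_derive1_sqrt q0)).
have cvs : continuous (fun q => v (Num.sqrt q)) by exact: continuous_compr.
have app n : exists g : R -> R, [/\ smooth1 g, (forall q, 0 <= q -> `|g q - k q| <= n.+1%:R^-1) &
    forall q, b1 <= q -> g q = 0].
  have e0 : 0 < n.+1%:R^-1 :> R by rewrite invr_gt0.
  by have [g sg [H1 H2]] := smooth1_approx ck a20 bb1 ka kb e0; exists g.
have [g gP] := choice app.
have app1 n : exists G : R -> R, [/\ smooth1 G, (forall q : R, is_derive q 1 G (g n q)) & forall q, b1 <= q -> G q = 0].
  by have [sg _ g0] := gP n; have [G sG [H1 H2]] := smooth1_primitive_vanishing sg g0; exists G.
have [G GP] := choice app1.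
have app2 n : exists H : R -> R, [/\ smooth1 H, (forall q : R, is_derive q 1 H (G n q)) & forall q, b1 <= q -> H q = 0].
  by have [sg _ g0] := GP n; have [G' sG [H1 H2]] := smooth1_primitive_vanishing sg g0; exists G'.
have [H HP] := choice app2.
have e_ge0 n : 0 <= n.+1%:R^-1 :> R by rewrite invr_ge0.
have est1 n q : 0 <= q -> `|G n q - p q| <= n.+1%:R^-1 * b1.
  move=> q0; have [sG dG G0] := GP n; have [sg gk _] := gP n.
  have [qb|/ltW bq] := leP q b1; last first.
    by rewrite (G0 _ bq) (pb _ (le_trans (ltW bb1) bq)) subrr normr0 mulr_ge0// ltW.
  apply: (derive_compare (smooth1_continuous sG) cp (e_ge0 n) (fun q _ => dG q) dp); last by rewrite q0.
    by move=> t /andP[t0 _]; apply: gk; exact: ltW.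
  by rewrite G0// pb// ltW.
have est2 n q : 0 <= q -> `|H n q - v (Num.sqrt q)| <= n.+1%:R^-1 * b1 * b1.
  move=> q0; have [sH dH H0] := HP n.
  have vz t : b1 <= t -> v (Num.sqrt t) = 0.
    by move=> bt; rewrite vb// sq_ge// ?(ltW b0)// (le_trans (ltW bb1)).
  have [qb|/ltW bq] := leP q b1; last first.
    rewrite (H0 _ bq) (vz _ bq) subrr normr0.
    by apply: mulr_ge0; [apply: mulr_ge0; [exact: e_ge0|exact: ltW]|exact: ltW].
  have E0 : 0 <= n.+1%:R^-1 * b1 by rewrite mulr_ge0// ltW.
  apply: (derive_compare (smooth1_continuous sH) cvs E0 (fun q _ => dH q) dv); last by rewrite q0.
    by move=> t /andP[t0 _]; apply: est1; exact: ltW.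
  by rewrite H0// vz.
have inv_cvg : (fun n : nat => n.+1%:R^-1 : R) @ \oo --> (0 : R) by exact: cvg_harmonic.
pose psi n (x : 'rV[R]_d) := H n (sqdist x0 x).
pose Lpsi n (x : 'rV[R]_d) := - (4 * sqdist x0 x * g n (sqdist x0 x) + 2 * d%:R * G n (sqdist x0 x)) + c * psi n x.
pose lim1 (x : 'rV[R]_d) := v (enorm (x - x0)).
pose lim2 (x : 'rV[R]_d) := - (4 * sqdist x0 x * k (sqdist x0 x) + 2 * d%:R * p (sqdist x0 x)) + c * lim1 x.
have sqd_ge0 (x : 'rV[R]_d) : 0 <= sqdist x0 x by rewrite sqdistE sqr_ge0.
have ssq (x : 'rV[R]_d) : Num.sqrt (sqdist x0 x) = enorm (x - x0).
  by rewrite sqdistE sqrtr_sqr ger0_norm// enorm_ge0.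
have csqd : continuous (@sqdist R d x0).
  have [ds _] := smoothV_partial (smoothV_sqdist x0); move=> x; exact: differentiable_continuous.
have cpsi n : continuous (psi n).
  by have [sH _ _] := HP n; apply: continuous_compr => //; exact: smooth1_continuous.
have cL n : continuous (Lpsi n).
  have [sg _ _] := gP n; have [sG _ _] := GP n.
  have c1 : continuous (fun x : 'rV[R]_d => g n (sqdist x0 x)).
    by apply: continuous_compr => //; exact: smooth1_continuous.
  have c2 : continuous (fun x : 'rV[R]_d => G n (sqdist x0 x)).
    by apply: continuous_compr => //; exact: smooth1_continuous.
  apply: continuous_add; last exact: continuous_scale.
  apply: (@continuous_compr _ _ (fun y => - y)); first exact: opp_continuous.
  apply: continuous_add; last exact: continuous_scale.
  by apply: continuous_mul => //; exact: continuous_scale.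
have clim1 : continuous lim1 by exact: radial_continuous.
have clim2 : continuous lim2.
  apply: continuous_add; last exact: continuous_scale.
  apply: (@continuous_compr _ _ (fun y => - y)); first exact: opp_continuous.
  apply: continuous_add; last by apply: continuous_scale; exact: continuous_compr.
  by apply: continuous_mul; [exact: continuous_scale|exact: continuous_compr].
have bounded_cube (f : 'rV[R]_d -> R) : continuous f -> exists2 N, 0 <= N & forall x, B x -> `|f x| <= N.
  move=> cf; have [|y0 [_ HH]] := @compact_bounded R _ (f @` cube d (r + enorm x0)).
    by apply: continuous_compact; [exact: continuous_subspaceT|exact: compact_cube].
  exists (`|y0| + 1); first by rewrite addr_ge0.
  move=> x; rewrite eballE/= => xr; apply: HH; first by rewrite (le_lt_trans (ler_norm _))// ltrDl.
  exists x => // i; rewrite (le_trans (ler_coord_enorm x i))// -[x](subrK x0).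
  by rewrite (le_trans (enormD _ _))// lerD2r ltW.
have d1 n x : B x -> `|psi n x - lim1 x| <= n.+1%:R^-1 * (b1 * b1).
  by move=> Bx; rewrite /psi /lim1 -ssq mulrA est2.
have d2 n x : B x -> `|Lpsi n x - lim2 x| <= n.+1%:R^-1 * (4 * r ^+ 2 + 2 * d%:R * b1 + `|c| * (b1 * b1)).
  move=> Bx; have e1 := d1 n x Bx; have e2 := est1 n _ (sqd_ge0 x).
  have [_ /(_ _ (sqd_ge0 x)) e3 _] := gP n.
  have qr : sqdist x0 x <= r ^+ 2.
    by move: Bx; rewrite eballE/= sqdistE => Bx; rewrite lerXn2r ?nnegrE ?enorm_ge0 ?ltW.
  rewrite (_ : Lpsi n x - lim2 x = - (4 * sqdist x0 x * (g n (sqdist x0 x) - k (sqdist x0 x)))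
     + (- (2 * d%:R * (G n (sqdist x0 x) - p (sqdist x0 x))) + c * (psi n x - lim1 x))); last first.
    by rewrite /Lpsi /lim2; ring.
  have p4 : 0 <= 4 * sqdist x0 x by rewrite mulr_ge0.
  have p2 : 0 <= 2 * d%:R :> R by rewrite mulr_ge0.
  rewrite -(addrA (4 * r ^+ 2)) [leRHS]mulrDr; apply: (le_trans (ler_normD _ _)); apply: lerD.
    rewrite normrN normrM (ger0_norm p4) [leLHS]mulrC; apply: ler_pM => //.
    by rewrite ler_pM2l.
  rewrite [leRHS]mulrDr; apply: (le_trans (ler_normD _ _)); apply: lerD.
    rewrite normrN normrM (ger0_norm p2) [leRHS]mulrCA; exact: ler_wpM2l.
  by rewrite normrM [leRHS]mulrCA; apply: ler_wpM2l.
have to_lim (f_ : nat -> 'rV[R]_d -> R) (f : 'rV[R]_d -> R) (C : R) : 0 <= C ->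
    (forall n, continuous (f_ n)) -> continuous f ->
    (forall n x, B x -> `|f_ n x - f x| <= n.+1%:R^-1 * C) ->
    (\int[vol]_(x in B) f_ n x ^+ 2) @[n --> \oo] --> \int[vol]_(x in B) f x ^+ 2.
  move=> C0 cf_ cf Hf; have C1 : 0 < C + 1 by lra.
  have [N N0 fN] := bounded_cube f cf.
  apply: (@Rintegral_sq_limit B f_ f (N + C)) => //.
  - exact: continuous_measurable_rV.
  - by rewrite addr_ge0.
  - apply: aeW => x Bx; apply/cvgrPdist_le => e e0; near=> n.
    rewrite distrC (le_trans (Hf n x Bx))//.
    apply: le_trans (_ : n.+1%:R^-1 * (C + 1) <= _); first by rewrite ler_wpM2l// lerDl.
    rewrite -ler_pdivlMr//; near: n.
    have /cvgr_le G' := inv_cvg; by apply: G'; rewrite divr_gt0.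
  - move=> n x Bx; rewrite -[f_ n x](subrK (f x)) addrC (le_trans (ler_normD _ _))// lerD ?fN//.
    by rewrite (le_trans (Hf n x Bx))// ler_piMl// invf_le1// ler1n.
have C20 : 0 <= 4 * r ^+ 2 + 2 * d%:R * b1 + `|c| * (b1 * b1).
  have b1' := ltW b10; apply: addr_ge0; first apply: addr_ge0.
  - by apply: mulr_ge0 => //; exact: sqr_ge0.
  - by apply: mulr_ge0 => //; exact: mulr_ge0.
  - by apply: mulr_ge0 => //; exact: mulr_ge0.
have L1 := to_lim psi lim1 (b1 * b1) (mulr_ge0 (ltW b10) (ltW b10)) cpsi clim1 d1.
have L2 := to_lim Lpsi lim2 _ C20 cL clim2 d2.
have -> : \int[vol]_(x in B) (- (dz (enorm (x - x0)) + (d%:R - 1) * (z (enorm (x - x0)) / enorm (x - x0)))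
       + c * v (enorm (x - x0))) ^+ 2 = \int[vol]_(x in B) lim2 x ^+ 2.
  apply: eq_Rintegral => x _; congr (_ ^+ 2); rewrite /lim2; congr (- _ + _).
  rewrite /k /p ssq sqdistE; have := enorm_ge0 (x - x0); rewrite le_eqVlt => /predU1P[<-|s0].
    by rewrite za ?dza ?(ltW a0)// !mul0r !mulr0 subrr mulr0 addr0.
  by field; rewrite gt_eqF.
apply: (ler_cvg_to (cvgM (cvg_cst Lam) L1) L2); apply: nearW => n.
have [sH dH H0] := HP n; have [sG dG _] := GP n.
have tst := radial_test_function x0 r0 sH b1r H0.
apply: (le_trans (HB tst)); rewrite le_eqVlt; apply/orP; left; apply/eqP.
by apply: eq_Rintegral => x _; rewrite (lap_radial x0 x dH dG).
Unshelve. all: by end_near. Qed.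

Lemma derive_vanishing_left (f f' : R -> R) (a : R) : 0 < a -> (forall s, s <= a -> f s = 0) ->
  (forall s, s <= a -> f' s = 0) -> (forall s : R, 0 < s -> is_derive s 1 f (f' s)) ->
  forall s : R, is_derive s 1 f (f' s).
Proof.
move=> a0 fa fa' H s; have [s0|s0] := ltP 0 s; first exact: H.
have near_eq : {near s, cst 0 =1 f}.
  near=> t; rewrite fa//; apply/ltW; near: t.
  have /cvgr_lt G := @cvg_id _ (nbhs s); exact: G (le_lt_trans s0 a0).
have [h1 h2] := is_derive_cst (0 : R) s (1 : R).
apply: DeriveDef; first exact: near_eq_derivable near_eq h1.
by rewrite -(@near_eq_derive _ _ _ (cst 0) f s 1 near_eq) h2 fa' ?(le_trans s0 (ltW a0)).
Unshelve. all: by end_near. Qed.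

End radial_test_functions.

Section profile_inequality.
Context {R : realType} {d : nat}.
Hypothesis d0 : (0 < d)%N.

Let set1_box (x : 'rV[R]_d) : [set x] = [set y : 'rV[R]_d | forall i, [set x ord0 i] (y ord0 i)].
Proof. by apply/seteqP; split => [y -> //|y H]; apply/rowP => i; exact: H. Qed.

Lemma measurable_set1_rV (x : 'rV[R]_d) : measurable [set x].
Proof.
by rewrite set1_box; apply: (@measurable_box R d (fun i => [set x ord0 i])) => i; exact: measurable_set1.
Qed.

Lemma vol_set1 (x : 'rV[R]_d) : vol [set x] = 0%E.
Proof.
rewrite set1_box (@vol_box R d (fun i => [set x ord0 i])) => [|i]; last exact: measurable_set1.
by case: d d0 x => // d' _ x; rewrite big_ord_recl lebesgue_measure_set1 mul0e.
Qed.

Lemma enorm_gt0 (x y : 'rV[R]_d) : x <> y -> 0 < enorm (x - y).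
Proof.
move=> xy; rewrite lt_neqAle enorm_ge0 andbT; apply/eqP => E; apply: xy.
apply/rowP => i; have := ler_coord_enorm (x - y) i; rewrite -E normr_le0 !mxE subr_eq0.
by move=> /eqP.
Qed.

Variables (x0 : 'rV[R]_d) (r c Lam : R).
Hypothesis r0 : 0 < r.
Local Notation B := (eball x0 r).
Local Notation w := (@sphere_weight R d).
Hypothesis HB : forall psi, test_function B psi ->
  Lam * \int[vol]_(x in B) psi x ^+ 2 <= \int[vol]_(x in B) (- lap psi x + c * psi x) ^+ 2.

Let mB : measurable B. Proof. exact: measurable_eball. Qed.
Let finB : (vol B < +oo)%E. Proof. exact: vol_eball_fin. Qed.

Let om0 : 0 < omega R d. Proof. exact: omega_gt0. Qed.

Let w_gt0 s : 0 < s -> 0 < w s. Proof. exact: sphere_weight_gt0. Qed.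

Let is_derive_weight (s : R) : 0 < s -> is_derive s 1 w ((d%:R - 1) * (w s / s)).
Proof.
move=> s0; have H := @is_deriveX R R id d.-1 s 1 1 (is_derive_id s 1).
have := is_deriveZ (omega R d * d%:R) H; rewrite exprfctE => H'.
rewrite (_ : sphere_weight = fun x : R => (omega R d * d%:R) * x ^+ d.-1); last first.
  by apply/funext => x; rewrite /sphere_weight mulrA.
apply: is_derive_eq H' _; rewrite /sphere_weight /GRing.scale/= mulr1.
have -> : d%:R - 1 = d.-1%:R :> R by rewrite -{1}(prednK d0) -natr1 addrK.
case: (d.-1) => [|m]; first by rewrite !mul0r !mulr0.
by rewrite /= exprS; field; rewrite gt_eqF.
Qed.

Let ball_le_weight s : 0 <= s -> omega R d * s ^+ d <= s * w s.
Proof.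
move=> s0; rewrite /sphere_weight [leRHS](_ : _ = d%:R * (omega R d * (s * s ^+ d.-1))); last by ring.
rewrite -exprS prednK// ler_peMl ?ler1n//; apply: mulr_ge0; [exact: ltW|exact: exprn_ge0].
Qed.

(** The derivative [Z = - J / w] of [v] vanishes at 0 and at [r1], but the second derivative may
    jump at [r1]. Cutting off [Z] near both ends gives profiles [V n] fit for [radial_inequality].
    Since [|Z|] is at most a constant times the distance to either end, the terms [Z * dcut n] stay
    bounded and tend to 0 pointwise; at [r1] this is where [J r1 = 0] is needed. The limit of
    [L (V n)] is [F] inside radius [r1] and 0 outside. *)
Lemma profile_inequality (F v : R -> R) (r1 : R) :
  let J := radial_int x0 (fun s => F s - c * v s) in
  0 < r1 -> r1 <= r -> continuous F -> continuous v -> (forall s, r1 <= s -> v s = 0) ->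
  (forall s : R, 0 < s < r1 -> is_derive s 1 v (- (J s / w s))) -> J r1 = 0 ->
  Lam * \int[vol]_(x in B) v (enorm (x - x0)) ^+ 2 <= \int[vol]_(x in B) F (enorm (x - x0)) ^+ 2.
Proof.
move=> J r10 r1r cF cv v_out dv Jr1.
have cFv : continuous (fun s => F s - c * v s).
  by apply: continuous_sub => //; exact: continuous_scale.
have dJ (s : R) : 0 < s -> is_derive s 1 J (w s * (F s - c * v s)).
  by move=> s0; exact: (is_derive_radial_int d0 x0 cFv).
have [N N0 FN] := radial_bounded cFv r.
pose Z s := - (J s / w s).
pose G s := - (F s - c * v s) - (d%:R - 1) * (Z s / s).
have dZ (s : R) : 0 < s -> is_derive s 1 Z (G s).
  move=> s0; have ws := w_gt0 s0; have wn : w s != 0 by rewrite gt_eqF.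
  have dwV := @is_deriveV R w s _ _ wn (is_derive_weight s0).
  have := is_deriveN (is_deriveM (dJ s s0) dwV); move=> /is_derive_eq; apply.
  by rewrite /G /Z /GRing.scale/=; field; rewrite wn gt_eqF.
have Jbound s t : 0 <= s -> s <= t -> t <= r ->
    `|J t - J s| <= N * (omega R d * t ^+ d - omega R d * s ^+ d).
  move=> s0 st tr; have H u : s <= u <= t -> `|F u - c * v u - 0| <= N.
    by move=> /andP[u1 u2]; rewrite subr0; apply: FN; rewrite (le_trans s0 u1) (le_trans u2).
  by have := radial_int_diff d0 x0 cFv s0 st H; rewrite mul0r subr0.
have J0 : J 0 = 0 by rewrite /J radial_int_le0.
have Zs s : 0 < s -> s <= r1 -> `|Z s| <= N * s.
  move=> s0 sr; rewrite /Z normrN normrM normfV (gtr0_norm (w_gt0 s0)) ler_pdivrMr ?w_gt0//.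
  have := Jbound 0 s (lexx 0) (ltW s0) (le_trans sr r1r).
  rewrite J0 subr0 expr0n (gtn_eqF d0) mulr0 subr0 => /le_trans; apply.
  by rewrite -mulrA ler_wpM2l// ball_le_weight// ltW.
have h0 : 0 < r1 / 2 by rewrite divr_gt0.
have w_le s t : 0 <= s -> s <= t -> w s <= w t.
  move=> s0 st; rewrite /sphere_weight ler_wpM2l ?(ltW om0)// ler_wpM2l//.
  by rewrite lerXn2r ?nnegrE// (le_trans s0).
(* The ratio bounds [w r1 / w s] for [s >= r1 / 2], where [|Z s|] is compared with [r1 - s]. For
   [s <= r1 / 2] that comparison follows from [|Z s| <= N s], as [s <= r1 - s]. *)
pose C := N * (w r1 / w (r1 / 2)).
have NC : N <= C by rewrite ler_peMr// ler_pdivlMr ?w_gt0// mul1r w_le ?(ltW h0)//; lra.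
have C0 : 0 <= C by exact: le_trans NC.
have ZC1 s : 0 < s -> s <= r1 -> `|Z s| <= C * s.
  by move=> s0 sr; rewrite (le_trans (Zs s s0 sr))// ler_wpM2r// ltW.
have ZC2 s : 0 < s -> s <= r1 -> `|Z s| <= C * (r1 - s).
  move=> s0 sr; have [sh|hs] := leP s (r1 / 2).
    rewrite (le_trans (Zs s s0 sr))//; apply: le_trans (_ : C * s <= _).
      by rewrite ler_wpM2r// ltW.
    by rewrite ler_wpM2l//; lra.
  rewrite /Z normrN normrM normfV (gtr0_norm (w_gt0 s0)) ler_pdivrMr ?w_gt0//.
  have := Jbound s r1 (ltW s0) sr r1r; rewrite Jr1 sub0r normrN => /le_trans; apply.
  have -> : C * (r1 - s) * w s = N * (w r1 * ((r1 - s) * (w s / w (r1 / 2)))) by rewrite /C; ring.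
  rewrite ler_wpM2l//.
  have H : omega R d * r1 ^+ d - omega R d * s ^+ d <= w r1 * (r1 - s).
    have [||y] := @MVT_segment R (fun s => omega R d * s ^+ d) w s r1 sr.
    - by move=> y _; exact: is_derive_ball_volume.
    - by apply: continuous_subspaceT; apply: continuous_scale; exact: exprn_continuous.
    rewrite in_itv/= => /andP[y1 y2] ->; rewrite ler_wpM2r ?subr_ge0// w_le//.
    exact: (le_trans (ltW s0) y1).
  apply: (le_trans H); apply: ler_wpM2l; first exact/ltW/w_gt0.
  by rewrite ler_peMr ?subr_ge0// ler_pdivlMr ?w_gt0// mul1r w_le// ltW.
clearbody C.
have [th sth [th0 th1 th01 _ [dth cdth [hth dth0]]]] := @smooth1_step R.
have cth := smooth1_continuous sth.
have [T T0 dthT] : exists2 T, 0 <= T & forall x, `|dth x| <= T.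
  have [T T0 HT] := radial_bounded cdth 1; exists T => // x.
  have [x1|x1] := leP x 0; first by rewrite dth0 ?normr0//; left.
  have [x2|x2] := leP 1 x; first by rewrite dth0 ?normr0//; right.
  by apply: HT; rewrite !ltW.
(* As [dl n <= r1 / 4], the transition layers from [dl n] to [2 * dl n] and from [r1 - 2 * dl n] to
   [r1 - dl n] do not overlap. *)
pose dl (n : nat) : R := r1 / 4 * n.+1%:R^-1.
have dl0 n : 0 < dl n by rewrite mulr_gt0 ?invr_gt0// divr_gt0.
have dl1 n : dl n <= r1 / 4.
  by rewrite ler_piMr ?divr_ge0 ?(ltW r10)// invf_le1// ler1n.
pose lo n s := (dl n)^-1 * s + -1.
pose hi n s := - (dl n)^-1 * s + (r1 / dl n - 1).
have hiE n s : hi n s = (r1 - s) / dl n - 1 by rewrite /hi; ring.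
have loE n s : lo n s = s / dl n - 1 by rewrite /lo; ring.
pose cut n s := th (lo n s) * th (hi n s).
pose dcut n s := th (lo n s) * (dth (hi n s) * - (dl n)^-1) + th (hi n s) * (dth (lo n s) * (dl n)^-1).
have lo0 n s : s <= dl n -> lo n s <= 0.
  by move=> H; rewrite loE subr_le0 ler_pdivrMr// mul1r.
have hi0 n s : r1 - dl n <= s -> hi n s <= 0.
  by move=> H; rewrite hiE subr_le0 ler_pdivrMr// mul1r; lra.
have lo1 n s : 2 * dl n <= s -> 1 <= lo n s.
  by move=> H; rewrite loE lerBrDr ler_pdivlMr//; lra.
have hi1 n s : s <= r1 - 2 * dl n -> 1 <= hi n s.
  by move=> H; rewrite hiE lerBrDr ler_pdivlMr//; lra.
have daff (a b s : R) : is_derive s 1 (fun s => a * s + b) a.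
  have := is_deriveD (is_deriveZ a (is_derive_id s (1 : R))) (is_derive_cst b s (1 : R)).
  by rewrite addr0 [_ *: 1]mulr1.
have dcutP n (s : R) : is_derive s 1 (cut n) (dcut n s).
  have d1 : is_derive s 1 (fun s => th (lo n s)) (dth (lo n s) * (dl n)^-1).
    exact: (@is_derive1_comp R th (lo n) s _ _ (hth _) (daff _ _ s)).
  have d2 : is_derive s 1 (fun s => th (hi n s)) (dth (hi n s) * - (dl n)^-1).
    exact: (@is_derive1_comp R th (hi n) s _ _ (hth _) (daff _ _ s)).
  exact: is_deriveM d1 d2.
have caff (a b : R) : continuous (fun s => a * s + b).
  by move=> s; apply: differentiable_continuous; apply/derivable1_diffP; have [] := daff a b s.
have ccut n : continuous (cut n).
  by apply: continuous_mul; apply: continuous_compr => //; exact: caff.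
have cdcut n : continuous (dcut n).
  apply: continuous_add; apply: continuous_mul.
  - by apply: continuous_compr => //; exact: caff.
  - apply: continuous_mul; last exact: cst_continuous.
    by apply: continuous_compr => //; exact: caff.
  - by apply: continuous_compr => //; exact: caff.
  - apply: continuous_mul; last exact: cst_continuous.
    by apply: continuous_compr => //; exact: caff.
have cut0 n s : s <= dl n \/ r1 - dl n <= s -> cut n s = 0.
  by rewrite /cut; case=> [/lo0/th0 ->|/hi0/th0 ->]; rewrite ?mul0r ?mulr0.
have dcut0 n s : s <= dl n \/ r1 - dl n <= s -> dcut n s = 0.
  rewrite /dcut; case=> [/lo0 H|/hi0 H].
    by rewrite th0// (dth0 (lo n s)) ?mul0r ?mulr0 ?addr0//; left.
  by rewrite (th0 (hi n s))// (dth0 (hi n s)) ?mul0r ?mulr0 ?addr0//; left.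
have cut1 n s : 2 * dl n <= s -> s <= r1 - 2 * dl n -> cut n s = 1 /\ dcut n s = 0.
  move=> /lo1 H1 /hi1 H2; rewrite /cut /dcut !th1// mul1r (dth0 (lo n s)) ?(dth0 (hi n s)); [|by right..].
  by rewrite !mul0r mulr0 addr0.
have cut01 n s : 0 <= cut n s <= 1.
  have /andP[a1 a2] := th01 (lo n s); have /andP[b1 b2] := th01 (hi n s).
  by rewrite mulr_ge0//= mulr_ile1.
have Zd n s : 0 < s -> s <= r1 -> s <= 2 * dl n \/ r1 - 2 * dl n <= s -> `|Z s| <= C * (2 * dl n).
  move=> s0 sr; case=> H; first by rewrite (le_trans (ZC1 s s0 sr))// ler_wpM2l.
  by rewrite (le_trans (ZC2 s s0 sr))// ler_wpM2l//; lra.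
(* The derivative is cut off rather than [v]: its primitive [V n] is constant near 0 and zero near
   [r1], and only one derivative of the cut-off appears in [L (V n)]. *)
pose z n s := Z s * cut n s.
pose dz n s := G s * cut n s + Z s * dcut n s.
have z0 n s : s <= dl n \/ r1 - dl n <= s -> z n s = 0 by move=> H; rewrite /z cut0// mulr0.
have dz0 n s : s <= dl n \/ r1 - dl n <= s -> dz n s = 0.
  by move=> H; rewrite /dz cut0// dcut0// !mulr0 addr0.
have hz n : forall s : R, is_derive s 1 (z n) (dz n s).
  apply: (derive_vanishing_left (dl0 n)) => [s H|s H|s s0]; [by apply: z0; left|by apply: dz0; left|].
  have := is_deriveM (dZ s s0) (dcutP n s); move=> /is_derive_eq; apply.
  by rewrite /dz /GRing.scale/=; ring.
have cz n : continuous (z n).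
  by move=> s; apply: differentiable_continuous; apply/derivable1_diffP; have [] := hz n s.
have cdz n : continuous (dz n).
  apply: (continuous_vanishing_left (dl0 n)) => [s H|s s0]; first by apply: dz0; left.
  have cZ : {for s, continuous Z}.
    by apply: differentiable_continuous; apply/derivable1_diffP; have [] := dZ s s0.
  apply: cvgD; apply: cvgM; [|exact: ccut|exact: cZ|exact: cdcut].
  apply: cvgB; first by apply: cvgN; exact: cFv.
  apply: cvgM; first exact: cvg_cst.
  by apply: cvgM; [exact: cZ|apply: cvgV; [rewrite gt_eqF|exact: cvg_id]].
have app n : exists V : R -> R, (forall q : R, is_derive q 1 V (z n q)) /\ forall q, r1 - dl n <= q -> V q = 0.
  by apply: primitive_vanishing => // q H; apply: z0; right.
have [V VP] := choice app.
have cV n : continuous (V n).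
  move=> q; apply: differentiable_continuous; apply/derivable1_diffP; have [H _] := VP n.
  by have [] := H q.
have est n s : 0 <= s -> `|V n s - v s| <= C * (2 * dl n) * r1.
  move=> s0; have [dV V0] := VP n; have dn0 := dl0 n.
  have E0 : 0 <= C * (2 * dl n) by rewrite mulr_ge0// mulr_ge0// ltW.
  have Vr : V n r1 = v r1 by rewrite V0 ?v_out//; lra.
  have [sr|/ltW rs] := leP s r1; last first.
    have H : r1 - dl n <= s by lra.
    rewrite (V0 s H) (v_out s rs) subrr normr0; exact: mulr_ge0 E0 (ltW r10).
  apply: (derive_compare (cV n) cv E0 (fun q _ => dV q) dv) => //; last by rewrite s0.
  move=> q /andP[q0 qr]; rewrite /z -[X in _ - X]mulr1 -mulrBr normrM -[leRHS]mulr1.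
  have [q1|q1] := leP (2 * dl n) q; last first.
    apply: ler_pM => //; first by apply: Zd; [|exact: ltW|left; exact: ltW].
    by rewrite ler_norml; have /andP[] := cut01 n q; move=> ? ?; apply/andP; split; lra.
  have [q2|q2] := leP q (r1 - 2 * dl n).
    by have [-> _] := cut1 n q q1 q2; rewrite subrr normr0 mulr0 mulr1.
  apply: ler_pM => //; first by apply: Zd; [|exact: ltW|right; exact: ltW].
  by rewrite ler_norml; have /andP[] := cut01 n q; move=> ? ?; apply/andP; split; lra.
have ineq n : Lam * \int[vol]_(x in B) V n (enorm (x - x0)) ^+ 2
  <= \int[vol]_(x in B) (- (dz n (enorm (x - x0)) + (d%:R - 1) * (z n (enorm (x - x0)) / enorm (x - x0)))
       + c * V n (enorm (x - x0))) ^+ 2.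
  have [dV V0] := VP n; have dn0 := dl0 n; have dn1 := dl1 n.
  apply: (@radial_inequality R d x0 r c Lam r0 HB (V n) (z n) (dz n) (dl n) (r1 - dl n)) => //.
  - lra.
  - lra.
  - by move=> s H; apply: z0; left.
  - by move=> s H; apply: dz0; left.
  - by move=> s H; apply: z0; right.
  - by move=> s H; apply: dz0; right.
pose LV n s := - (dz n s + (d%:R - 1) * (z n s / s)) + c * V n s.
have cLV n : continuous (LV n).
  apply: continuous_add; last exact: continuous_scale.
  apply: (@continuous_compr _ _ (fun y => - y)); first exact: opp_continuous.
  apply: continuous_add => //; apply: continuous_scale.
  apply: (continuous_vanishing_left (dl0 n)) => [s H|s s0]; first by rewrite z0 ?mul0r//; left.
  by apply: cvgM; [exact: cz|apply: cvgV; [rewrite gt_eqF|exact: cvg_id]].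
have LVE n s : 0 < s -> LV n s = (F s - c * v s) * cut n s - Z s * dcut n s + c * V n s.
  by move=> s0; rewrite /LV /dz /z /G; ring.
have [Mv Mv0 vM] := radial_bounded cv r.
have E1 n : C * (2 * dl n) * r1 <= C * r1 * r1.
  by rewrite ler_wpM2r ?(ltW r10)// ler_wpM2l//; have := dl1 n; lra.
have E1' : 0 <= C * r1 * r1 by rewrite !mulr_ge0 ?(ltW r10).
have Vb n s : 0 <= s <= r -> `|V n s| <= Mv + C * r1 * r1.
  move=> /andP[s0 sr]; rewrite -[V n s](subrK (v s)) addrC (le_trans (ler_normD _ _))//.
  by rewrite lerD ?vM ?s0// (le_trans (est n s s0)).
(* In the layers [|Z| <= C * (2 * dl n)], which compensates the factor [(dl n)^-1] of [dcut n]. *)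
have Zdcut n s : 0 < s -> `|Z s * dcut n s| <= C * 4 * T.
  move=> s0; have CT : 0 <= C * 4 * T by rewrite !mulr_ge0.
  have [sr|/ltW rs] := leP s r1; last first.
    by rewrite dcut0 ?mulr0 ?normr0//; right; have := dl0 n; lra.
  have dn0 := dl0 n.
  have key t : s <= 2 * dl n \/ r1 - 2 * dl n <= s -> `|t| <= 1 -> forall y, `|Z s * (t * (y * (dl n)^-1))| <= C * 2 * `|y|.
    move=> H t1 y; rewrite !normrM normfV (gtr0_norm dn0).
    apply: le_trans (_ : C * (2 * dl n) * (1 * (`|y| / dl n)) <= _).
      have yd : 0 <= `|y| / dl n by apply: divr_ge0 => //; exact: ltW.
      by apply: ler_pM; [exact: normr_ge0|exact: mulr_ge0|exact: Zd|exact: ler_wpM2r].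
    by rewrite le_eqVlt; apply/orP; left; apply/eqP; field; rewrite gt_eqF.
  have nth x : `|th x| <= 1 by have /andP[? ?] := th01 x; rewrite ger0_norm.
  rewrite /dcut mulrDr (le_trans (ler_normD _ _))//.
  have -> : C * 4 * T = C * 2 * T + C * 2 * T by ring.
  have C2 : 0 <= C * 2 by rewrite mulr_ge0.
  apply: lerD.
    have [H|H] := leP s (r1 - 2 * dl n).
      by rewrite (dth0 (hi n s)) ?mul0r ?mulr0 ?normr0 ?mulr_ge0//; right; exact: hi1.
    rewrite mulrN -mulNr (le_trans (key _ _ (nth _) _))//; first by right; exact: ltW.
    by rewrite normrN ler_wpM2l.
  have [H|H] := leP (2 * dl n) s.
    by rewrite (dth0 (lo n s)) ?mul0r ?mulr0 ?normr0 ?mulr_ge0//; right; exact: lo1.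
  rewrite (le_trans (key _ _ (nth _) _))//; first by left; exact: ltW.
  by rewrite ler_wpM2l.
have LVb n s : 0 <= s <= r -> `|LV n s| <= N + C * 4 * T + `|c| * (Mv + C * r1 * r1).
  move=> /[dup] srng /andP[]; rewrite le_eqVlt => /predU1P[<-|s0] sr.
    rewrite /LV z0 ?dz0 ?mul0r ?mulr0 ?addr0 ?oppr0 ?add0r; [|by left; exact: ltW..].
    rewrite normrM (le_trans (ler_wpM2l _ (Vb n 0 _)))// ?lexx ?(ltW r0)//.
    by rewrite lerDr addr_ge0// !mulr_ge0.
  rewrite LVE// (le_trans (ler_normD _ _))// lerD//.
    rewrite (le_trans (ler_normB _ _))// lerD ?Zdcut// normrM -[N]mulr1.
    by apply: ler_pM => //; [exact: FN|have /andP[? ?] := cut01 n s; rewrite ger0_norm].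
  by rewrite normrM ler_wpM2l// Vb.
have dl_cvg : dl @ \oo --> (0 : R).
  rewrite -[0](mulr0 (r1 / 4)); apply: cvgM; [exact: cvg_cst|exact: cvg_harmonic].
have V_cvg s : 0 <= s -> V ^~ s @ \oo --> v s.
  move=> s0; apply/cvgrPdist_le => e e0.
  have K0 : 0 < C * 2 * r1 + 1 by rewrite ltr_wpDl// !mulr_ge0// ltW.
  near=> n; rewrite distrC (le_trans (est n s s0))//.
  have dn0 := dl0 n; apply: le_trans (_ : (C * 2 * r1 + 1) * dl n <= _); first by lra.
  rewrite -ler_pdivlMl// mulrC; near: n.
  have /cvgr_le H := dl_cvg; apply: H; exact: divr_gt0.
have LV_cvg s : 0 < s -> LV ^~ s @ \oo --> (if s < r1 then F s else 0).
  move=> s0; have [sr|rs] := ltP s r1; last first.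
    apply: cvg_near_cst; apply: nearW => n; have dn0 := dl0 n; have [_ V0] := VP n.
    by rewrite LVE// cut0 ?dcut0 ?V0 ?mulr0 ?subrr ?addr0//; [lra|right; lra|right; lra].
  rewrite -[F s](subrK (c * v s)).
  have : (fun n => F s - c * v s + c * V n s) @ \oo --> F s - c * v s + c * v s.
    apply: cvgD; first exact: cvg_cst.
    by apply: cvgM; [exact: cvg_cst|exact: V_cvg (ltW s0)].
  apply: cvg_trans; apply: near_eq_cvg; near=> n.
  have H1 : 2 * dl n <= s.
    rewrite -ler_pdivlMl//; near: n; have /cvgr_le H := dl_cvg; apply: H.
    by rewrite mulr_gt0// invr_gt0.
  have H2 : s <= r1 - 2 * dl n.
    rewrite lerBrDr -lerBrDl -ler_pdivlMl//; near: n; have /cvgr_le H := dl_cvg; apply: H.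
    by rewrite mulr_gt0 ?invr_gt0// subr_gt0.
  by have [C1 C2] := cut1 n s H1 H2; rewrite LVE// C1 C2 mulr1 mulr0 subr0.
have inB (x : 'rV[R]_d) : B x -> 0 <= enorm (x - x0) <= r.
  by rewrite eballE/= enorm_ge0 => /ltW.
have L1 : \int[vol]_(x in B) V n (enorm (x - x0)) ^+ 2 @[n --> \oo]
    --> \int[vol]_(x in B) v (enorm (x - x0)) ^+ 2.
  apply: (@Rintegral_sq_limit R d B (fun n x => V n (enorm (x - x0))) _ (Mv + C * r1 * r1)) => //.
  - by move=> n; exact: radial_continuous.
  - by apply: continuous_measurable_rV; exact: radial_continuous.
  - exact: addr_ge0.
  - by apply: aeW => x Bx; apply: V_cvg; exact: enorm_ge0.
  - by move=> n x /inB; exact: Vb.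
pose f1 (x : 'rV[R]_d) := F (enorm (x - x0)) * \1_(eball x0 r1) x.
have mf1 : measurable_fun setT f1.
  apply: measurable_funM; first by apply: continuous_measurable_rV; exact: radial_continuous.
  by apply: measurable_indic; exact: measurable_eball.
have M0 : 0 <= N + C * 4 * T + `|c| * (Mv + C * r1 * r1).
  by apply: addr_ge0; [rewrite addr_ge0// !mulr_ge0|rewrite mulr_ge0// addr_ge0].
have L2 : \int[vol]_(x in B) LV n (enorm (x - x0)) ^+ 2 @[n --> \oo] --> \int[vol]_(x in B) f1 x ^+ 2.
  apply: (@Rintegral_sq_limit R d B (fun n x => LV n (enorm (x - x0))) f1
    (N + C * 4 * T + `|c| * (Mv + C * r1 * r1))) => //.
  - by move=> n; exact: radial_continuous.
  (* The centre is excluded: there [LV n] is [c * V n], which need not tend to [F]. A point is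
     negligible because [0 < d]. *)
  - exists [set x0]; split; [exact: measurable_set1_rV|exact: vol_set1|].
    move=> x /= H; apply: contrapT => xx0; apply: H => Bx.
    have s0 : 0 < enorm (x - x0) by exact: enorm_gt0.
    have := LV_cvg _ s0; rewrite /f1 indicE.
    case: ifPn => [sr|sr].
      by rewrite mem_set ?mulr1// eballE.
    by rewrite memNset ?mulr0// eballE/=; exact/negP.
  - by move=> n x /inB; exact: LVb.
apply: le_trans (ler_cvg_to (cvgM (cvg_cst Lam) L1) L2 (nearW _ ineq)) _.
have iF : vol.-integrable B (EFin \o (fun x => F (enorm (x - x0)) ^+ 2)).
  apply: (radial_integrable x0 (g := fun s => F s ^+ 2)); exact: continuous_pow.
have pw x : f1 x ^+ 2 <= F (enorm (x - x0)) ^+ 2.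
  rewrite /f1 exprMn ler_piMr ?sqr_ge0// indicE; case: (_ \in _); by rewrite ?expr1n ?expr0n.
apply: le_Rintegral => //; apply: (le_integrable mB _ _ iF).
  by apply/measurable_EFinP; apply: measurable_funTS; apply: measurable_funX.
by move=> x _ /=; rewrite lee_fin !ger0_norm ?sqr_ge0.
Unshelve. all: by end_near. Qed.

End profile_inequality.

(** * The inequality for the positive part of a test function *)

Section positive_part_inequality.
Context {R : realType} {d : nat}.
Hypothesis d0 : (0 < d)%N.
Variables (Omega : set 'rV[R]_d) (r : R).
Hypotheses (r0 : 0 < r) (oO : open Omega) (vO : vol Omega = (omega R d * r ^+ d)%:E).
Variables (x0 : 'rV[R]_d) (c Lam : R).
Hypotheses (c0 : 0 < c) (Lam0 : 0 <= Lam).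
Local Notation B := (eball x0 r).
Hypothesis HB : forall psi, test_function B psi ->
  Lam * \int[vol]_(x in B) psi x ^+ 2 <= \int[vol]_(x in B) (- lap psi x + c * psi x) ^+ 2.
Variables (phi : 'rV[R]_d -> R) (M : R).
Hypotheses (C2phi : C2 phi) (phiM : forall x, ~ cube d M x -> phi x = 0).
Hypothesis phi0 : forall x, ~ Omega x -> phi x = 0.
Hypothesis lap0 : forall x, ~ Omega x -> lap phi x = 0.

Let mO : measurable Omega. Proof. exact: open_measurable_rV. Qed.
Let finO : (vol Omega < +oo)%E. Proof. by rewrite vO ltry. Qed.
Let cphi : continuous phi. Proof. by apply: C1_continuous; have [] := C2phi. Qed.
Let clap : continuous (lap phi). Proof. exact: lap_continuous. Qed.

Let om0 : 0 < omega R d. Proof. exact: omega_gt0. Qed.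

Let Omega_neq0 : exists y, Omega y.
Proof.
apply: contrapT => /forallNP nO; have O0 : Omega = set0 by apply/seteqP; split => // x /nO.
move: vO; rewrite O0 measure0 => -[] /esym/eqP.
by rewrite gt_eqF// mulr_gt0// exprn_gt0.
Qed.

Lemma clamp_homo s t : s <= t -> clamp r s <= clamp r t.
Proof.
by move=> st; rewrite /clamp ge_max le_max lexx/= le_max; apply/orP; right;
  rewrite le_min ge_min ge_min st lexx orbT.
Qed.

Let u x := Num.max (phi x) 0.
Let f x := - lap phi x + c * phi x.

Let cu : continuous u.
Proof.
by move=> x; apply: (@continuous_max _ _ phi (cst 0) x (@cphi x) (@cst_continuous _ _ _ _)).
Qed.

Let cf : continuous f.
Proof.
rewrite (_ : f = fun x => c * phi x - lap phi x); last by apply/funext => x; rewrite /f addrC.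
by apply: continuous_sub => //; exact: continuous_scale.
Qed.

(** A sum of derivatives of compactly supported functions. It expresses the vanishing of the normal
    derivative at the boundary and is the source of [hr]. *)
Let integral_lap : \int[vol]_(x in Omega) lap phi x = 0.
Proof.
rewrite -(@Rintegral_support _ _ Omega setT)// /lap.
have iP i : vol.-integrable [set: 'rV[R]_d] (EFin \o partial i (partial i phi)).
  have [_ /(_ i)[_ cpp]] := C2phi.
  by apply: (integrable_cont_compact (cpp i) (M := M)); apply: partial_out; exact: partial_out.
rewrite Rintegral_sum// big1// => i _; have [_ /(_ i) C1p] := C2phi.
by apply: (Rintegral_partial i C1p (M := M)); exact: partial_out.
Qed.

Lemma positive_part_inequality :
  Lam * \int[vol]_(x in Omega) Num.max (phi x) 0 ^+ 2
  <= \int[vol]_(x in Omega) (- lap phi x + c * phi x) ^+ 2.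
Proof.
have fM x : ~ cube d M x -> f x = 0.
  by move=> nx; rewrite /f phiM// (lap_out phiM nx) mulr0 oppr0 addr0.
have [N N0 fN] := cont_compact_bounded cf fM.
have [P P0 phiP] := cont_compact_bounded cphi phiM.
have f0 x : ~ Omega x -> f x = 0.
  by move=> nx; rewrite /f phi0// lap0// mulr0 oppr0 addr0.
(* The exact infimum, not merely a lower bound: otherwise the rearrangement, which equals [a] at
   [r], could jump there. *)
pose a := inf (f @` Omega).
have hf : has_inf (f @` Omega).
  split; first by have [y Oy] := Omega_neq0; exists (f y), y.
  by exists (- N) => _ [x _ <-]; have := fN x; rewrite ler_norml => /andP[].
have fa x : Omega x -> a <= f x by move=> Ox; apply: (ge_inf (proj2 hf)); exists x.
have fa_inf k : a < k -> k <= 0 -> exists2 y, Omega y & f y < k.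
  by move=> ak _; have [_ [y Oy <-] yk] := inf_lt (proj1 hf) ak; exists y.
have fN' x : f x <= N by rewrite (le_trans (ler_norm _)).
have phiP' x : phi x <= P by rewrite (le_trans (ler_norm _)).
have u_ge0 x : Omega x -> 0 <= u x by move=> _; rewrite le_max lexx orbT.
have uP x : u x <= P by rewrite ge_max phiP' P0.
have u0 x : ~ Omega x -> u x = 0 by move=> nx; rewrite /u phi0// max_r.
have ua_inf k : 0 < k -> k <= 0 -> exists2 y, Omega y & u y < k.
  by move=> k0; rewrite leNgt k0.
pose F s := rearr Omega f a (clamp r s).
pose us s := rearr Omega u 0 (clamp r s).
have cF : continuous F := rearr_continuous d0 x0 r0 oO vO cf fN' f0 fa_inf.
have cus : continuous us := rearr_continuous d0 x0 r0 oO vO cu uP u0 ua_inf.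
have F_anti s t : s <= t -> F t <= F s.
  by move=> st; apply: (rearr_anti oO vO a cf fN'); [exact: clamp_ge0|exact: clamp_homo].
have us_ge0 s : 0 <= us s by apply: (rearr_ge Omega 0 uP); exact: clamp_ge0.
have us_out s : r <= s -> us s = 0.
  by move=> rs; rewrite /us /clamp min_r// max_r ?(ltW r0)// (rearr_end r0 oO vO 0 cu uP).
have ballF s x : s <= r -> eball x0 s x -> F (enorm (x - x0)) = schwarz Omega x0 f a x.
  by move=> sr; rewrite eballE/= => xs; rewrite /F clamp_in ?enorm_ge0// (le_trans (ltW xs)).
have ballu s x : s <= r -> eball x0 s x -> us (enorm (x - x0)) = schwarz Omega x0 u 0 x.
  by move=> sr; rewrite eballE/= => xs; rewrite /us clamp_in ?enorm_ge0// (le_trans (ltW xs)).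
have intf (h : R -> R) : measurable_fun setT h ->
    \int[vol]_(x in Omega) h (f x) = \int[vol]_(x in B) h (F (enorm (x - x0))).
  move=> mh; rewrite (schwarz_integral d0 x0 r0 oO vO cf fa fN' mh).
  by apply: eq_Rintegral => x; rewrite inE => /(ballF r x (lexx r)) ->.
have intu (h : R -> R) : measurable_fun setT h ->
    \int[vol]_(x in Omega) h (u x) = \int[vol]_(x in B) h (us (enorm (x - x0))).
  move=> mh; rewrite (schwarz_integral d0 x0 r0 oO vO cu u_ge0 uP mh).
  by apply: eq_Rintegral => x; rewrite inE => /(ballu r x (lexx r)) ->.
have mid : measurable_fun [set: R] (fun y : R => y) by exact: measurable_id.
have msq : measurable_fun [set: R] (fun y : R => y ^+ 2).
  by apply: continuous_measurable_fun; exact: exprn_continuous.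
have intO (g : 'rV[R]_d -> R) : continuous g -> (forall x, ~ cube d M x -> g x = 0) ->
    vol.-integrable Omega (EFin \o g).
  move=> cg g0; have := integrable_cont_compact cg g0.
  by apply: integrableS => //.
have hr : radial_int x0 F r <= c * radial_int x0 us r.
  rewrite /radial_int -(intf (fun y => y) mid) -(intu (fun y => y) mid).
  have -> : \int[vol]_(x in Omega) f x = c * \int[vol]_(x in Omega) phi x.
    have -> : \int[vol]_(x in Omega) f x = \int[vol]_(x in Omega) (c * phi x - lap phi x).
      by apply: eq_Rintegral => x _; rewrite /f addrC.
    rewrite RintegralB// ?integral_lap ?subr0 ?RintegralZl//; first exact: intO.
    - apply: intO; first exact: continuous_scale.
      by move=> x nx; rewrite phiM// mulr0.
    - by apply: intO => // x nx; exact: lap_out nx.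
  rewrite ler_pM2l//; apply: le_Rintegral => //; first exact: intO.
    by apply: intO => // x nx; rewrite /u phiM// max_r.
  by move=> x _; rewrite le_max lexx.
have hL := @talenti_comparison R d d0 Omega r r0 oO vO phi M C2phi phiM phi0 x0 c a N P fa fN' phiP'.
have [v [r1 /= [/andP[r10 r1r] cv v_out dv [Jr1 v_ge0 UV]]]] :=
  radial_comparison d0 r0 c0 cF cus F_anti us_out hr hL.
have mB : measurable B by exact: measurable_eball.
have finB : (vol B < +oo)%E by exact: vol_eball_fin.
have iB (g : R -> R) : continuous g -> vol.-integrable B (EFin \o (fun x => g (enorm (x - x0)))).
  by move=> cg; exact: radial_integrable.
pose I1 := \int[vol]_(x in B) us (enorm (x - x0)) ^+ 2.
pose I2 := \int[vol]_(x in B) (us (enorm (x - x0)) * v (enorm (x - x0))).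
pose I3 := \int[vol]_(x in B) v (enorm (x - x0)) ^+ 2.
(* [us] is integrated by layers: inside [B] its superlevel sets are balls, over which the integral
   of [us - v] is at most 0. Division by [P + 1] brings [us] into [[0, 1]], as [Rintegral_mul_le]
   requires. *)
have H1 : I1 <= I2.
  have usP s : us s <= P.
    rewrite (le_trans (rearr_le oO vO 0 cu uP (clamp_ge0 r s)))// ge_max P0//=.
  have Q0 : 0 < P + 1 by lra.
  have E : I1 - I2 = (P + 1) * \int[vol]_(x in B)
      ((us (enorm (x - x0)) - v (enorm (x - x0))) * ((P + 1)^-1 * us (enorm (x - x0)))).
    rewrite -RintegralZl//; last first.
      apply: (iB (fun s => (us s - v s) * ((P + 1)^-1 * us s))).
      by apply: continuous_mul; [exact: continuous_sub|exact: continuous_scale].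
    rewrite -RintegralB//; last 2 first.
    - by apply: (iB (fun s => us s ^+ 2)); exact: continuous_pow.
    - by apply: (iB (fun s => us s * v s)); exact: continuous_mul.
    by apply: eq_Rintegral => x _; field; rewrite gt_eqF.
  rewrite -subr_le0 E pmulr_rle0//; apply: Rintegral_mul_le => //.
  - apply: measurable_funTS; apply: continuous_measurable_rV.
    by apply: continuous_scale; exact: radial_continuous.
  - by apply: (iB (fun s => us s - v s)); exact: continuous_sub.
  - move=> x _; rewrite mulr_ge0 ?invr_ge0 ?(ltW Q0)//= mulrC ler_pdivrMr// mul1r.
    by rewrite (le_trans (usP _))// lerDl.
  move=> t /andP[t0 _].
  have -> : B `&` [set x | t < (P + 1)^-1 * us (enorm (x - x0))] = eball x0 (radius Omega u (t * (P + 1))).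
    rewrite -(schwarz_level d0 x0 r0 oO vO cu u_ge0 uP (t * (P + 1))); apply/seteqP.
    have E2 x : B x -> (t < (P + 1)^-1 * us (enorm (x - x0))) = (t * (P + 1) < schwarz Omega x0 u 0 x).
      by move=> Bx; rewrite (ballu r)// [X in _ < X]mulrC ltr_pdivlMr.
    by split => x [Bx /=] H; split => //=; move: H; rewrite E2.
  have rs0 := (radiusP d0 Omega u (t * (P + 1))).1.
  have rsr := radius_le d0 r0 oO vO cu (t * (P + 1)).
  have := UV (radius Omega u (t * (P + 1))); rewrite rs0 rsr => /(_ isT) H.
  have mE : measurable (eball x0 (radius Omega u (t * (P + 1)))) by exact: measurable_eball.
  by rewrite (RintegralB mE) ?subr_le0; [exact: H|exact: radial_integrable|exact: radial_integrable].
have H2 : I1 <= I3.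
  have : 0 <= I1 - 2 * I2 + I3.
    rewrite /I1 /I2 /I3 -RintegralZl//; last first.
      by apply: (iB (fun s => us s * v s)); exact: continuous_mul.
    have i1 : vol.-integrable B (EFin \o (fun x => us (enorm (x - x0)) ^+ 2)).
      by apply: (iB (fun s => us s ^+ 2)); exact: continuous_pow.
    have i2 : vol.-integrable B (EFin \o (fun x => 2 * (us (enorm (x - x0)) * v (enorm (x - x0))))).
      by apply: (iB (fun s => 2 * (us s * v s))); apply: continuous_scale; exact: continuous_mul.
    have i3 : vol.-integrable B (EFin \o (fun x => v (enorm (x - x0)) ^+ 2)).
      by apply: (iB (fun s => v s ^+ 2)); exact: continuous_pow.
    have i12 : vol.-integrable B (EFin \o (fun x => us (enorm (x - x0)) ^+ 2 - 2 * (us (enorm (x - x0)) * v (enorm (x - x0))))).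
      by have := integrableB mB i1 i2; apply: eq_integrable.
    rewrite -RintegralB// -RintegralD//; apply: Rintegral_ge0 => x _.
    rewrite (_ : _ + _ = (us (enorm (x - x0)) - v (enorm (x - x0))) ^+ 2); last by ring.
    exact: sqr_ge0.
  by move: H1; lra.
rewrite (intu (fun y => y ^+ 2) msq) (intf (fun y => y ^+ 2) msq) -/I1.
apply: (le_trans (ler_wpM2l Lam0 H2)).
(* If [r1 = 0], then [v = 0] on the ball and the left side is 0; [profile_inequality] covers
   [r1 > 0]. *)
move: r10; rewrite le_eqVlt => /predU1P[r1E|r1_gt0]; last first.
  exact: (profile_inequality d0 r0 HB r1_gt0 r1r cF cv v_out dv Jr1).
have -> : I3 = 0.
  rewrite /I3 (@eq_Rintegral _ _ _ vol B (fun=> 0)) ?Rintegral_cst ?mul0r// => x _.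
  by rewrite v_out ?expr0n// -r1E enorm_ge0.
by rewrite mulr0; apply: Rintegral_ge0 => x _; exact: sqr_ge0.
Qed.

End positive_part_inequality.

(** * Weak derivatives and test functions *)

Section square_integrable.
Context {R : realType} {d : nat}.
Variable Omega : set 'rV[R]_d.
Hypotheses (mO : measurable Omega) (finO : (vol Omega < +oo)%E).
Implicit Types u v f g : 'rV[R]_d -> R.

Let patch_sqr u : (fun x => (u \_ Omega) x ^+ 2) = (fun x => u x ^+ 2) \_ Omega.
Proof. by apply/funext => x; rewrite !patchE; case: ifP => //; rewrite expr0n. Qed.

Let EFin_patch f : EFin \o (f \_ Omega) = (EFin \o f) \_ Omega.
Proof. by apply/funext => x /=; rewrite !patchE; case: ifP. Qed.

Lemma L2P u : L2 Omega u <->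
  measurable_fun Omega u /\ vol.-integrable Omega (EFin \o (fun x => u x ^+ 2)).
Proof.
split=> [L2u|[mu iu]].
  split.
    by move: L2u => /andP[]; rewrite inE/= => mu _; apply/(measurable_restrictT _ mO).
  have := Lfun2_integrable_sqr L2u.
  by move=> H; apply/(integrable_mkcond _ mO); rewrite -EFin_patch -patch_sqr.
apply/andP; split; first by rewrite inE/=; apply/(measurable_restrictT _ mO).
rewrite inE/= /finite_norm unlock poweR_lty//.
move/(integrable_mkcond _ mO): iu; rewrite -EFin_patch -patch_sqr => /integrableP[_].
rewrite (eq_integral (fun x => (`|(u \_ Omega) x| `^ 2)%:E)) => [|x _]; last first.
  by rewrite /= normrX powR_mulrn.
by rewrite (eq_integral (fun x => (`|(EFin \o u \_ Omega) x| `^ 2)%E)).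
Qed.

Lemma L2_bounded u (M : R) : measurable_fun Omega u -> (forall x, Omega x -> `|u x| <= M) -> L2 Omega u.
Proof.
move=> mu uM; apply/L2P; split => //; apply: (bounded_integrable mO finO (M := M ^+ 2)).
  exact: measurable_funX.
move=> x Ox; rewrite normrX lerXn2r ?nnegrE ?uM//; exact: le_trans (uM x Ox).
Qed.

Lemma L2_sub u v : L2 Omega u -> L2 Omega v -> L2 Omega (fun x => u x - v x).
Proof.
move=> /L2P[mu iu] /L2P[mv iv]; apply/L2P; split; first exact: measurable_funB.
apply: (le_integrable mO _ _ (integrableD mO (integrableZl mO 2 iu) (integrableZl mO 2 iv))).
  by apply/measurable_EFinP; apply: measurable_funX; exact: measurable_funB.
move=> x _ /=; rewrite lee_fin ger0_norm ?sqr_ge0//.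
have := ler_norm (2 * u x ^+ 2 + 2 * v x ^+ 2); have := sqr_ge0 (u x + v x); lra.
Qed.

Lemma L2_mul_integrable u v : L2 Omega u -> L2 Omega v -> vol.-integrable Omega (EFin \o (fun x => u x * v x)).
Proof.
move=> /L2P[mu iu] /L2P[mv iv]; apply: (le_integrable mO _ _ (integrableD mO iu iv)).
  by apply/measurable_EFinP; exact: measurable_funM.
move=> x _ /=; rewrite lee_fin ler_norml.
have := ler_norm (u x ^+ 2 + v x ^+ 2); have := sqr_ge0 (u x + v x).
have := sqr_ge0 (u x - v x); have := sqr_ge0 (u x); have := sqr_ge0 (v x).
by move=> *; apply/andP; split; lra.
Qed.

Lemma L2_integrable u : L2 Omega u -> vol.-integrable Omega (EFin \o u).
Proof.
move=> L2u; have L21 : L2 Omega (fun=> 1) by apply: (@L2_bounded _ 1) => // x _; rewrite normr1.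
by have := L2_mul_integrable L2u L21; apply: eq_integrable => // x _ /=; rewrite mulr1.
Qed.

Lemma Rintegral_ae f g : measurable_fun Omega f -> measurable_fun Omega g ->
  {ae vol, forall x, Omega x -> f x = g x} ->
  \int[vol]_(x in Omega) f x = \int[vol]_(x in Omega) g x.
Proof.
move=> mf mg fg; congr fine; apply: ae_eq_integral => //; [exact/measurable_EFinP|exact/measurable_EFinP|].
by apply: filterS fg => x H Dx; rewrite H.
Qed.

(** Young's inequality with a free parameter: the factor of the main term can be brought close to 1,
    at the price of a large but fixed factor in front of the error. *)
Lemma Rintegral_sq_le f g (e : R) : 0 < e -> L2 Omega f -> L2 Omega g ->
  \int[vol]_(x in Omega) f x ^+ 2 <= (1 + e) * \int[vol]_(x in Omega) g x ^+ 2
    + (1 + e^-1) * \int[vol]_(x in Omega) (f x - g x) ^+ 2.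
Proof.
move=> e0 L2f L2g; have /L2P[mf i1] := L2f; have /L2P[mg i2] := L2g.
have /L2P[mfg i3] := L2_sub L2f L2g.
have j2 : vol.-integrable Omega (EFin \o (fun x => (1 + e) * g x ^+ 2)).
  by have := integrableZl mO (1 + e) i2; apply: eq_integrable.
have j3 : vol.-integrable Omega (EFin \o (fun x => (1 + e^-1) * (f x - g x) ^+ 2)).
  by have := integrableZl mO (1 + e^-1) i3; apply: eq_integrable.
have j4 : vol.-integrable Omega (EFin \o (fun x => (1 + e) * g x ^+ 2 + (1 + e^-1) * (f x - g x) ^+ 2)).
  by have := integrableD mO j2 j3; apply: eq_integrable.
rewrite -!RintegralZl// -RintegralD//; apply: le_Rintegral => // x _.
rewrite -subr_ge0 (_ : _ - _ = e^-1 * (e * g x - (f x - g x)) ^+ 2); last by field; rewrite gt_eqF.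
by rewrite mulr_ge0 ?sqr_ge0 ?invr_ge0 ?ltW.
Qed.

End square_integrable.

Section test_functions.
Context {R : realType} {d : nat}.
Variable Omega : set 'rV[R]_d.
Hypotheses (oO : open Omega) (finO : (vol Omega < +oo)%E).
Implicit Types phi psi : 'rV[R]_d -> R.

Let mO : measurable Omega. Proof. exact: open_measurable_rV. Qed.

Lemma smooth_partial i phi : smooth phi -> smooth (partial i phi).
Proof. by move=> sphi s x; have := sphi (rcons s i) x; rewrite foldr_rcons. Qed.

Lemma smooth_C2 phi : smooth phi -> C2 phi.
Proof.
move=> sphi; have C1s psi : smooth psi -> C1 psi.
  move=> spsi; split; first exact: (spsi [::]).
  by move=> i x; apply: differentiable_continuous; exact: (spsi [:: i] x).
by split=> [|i]; apply: C1s => //; exact: smooth_partial.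
Qed.

Lemma test_support phi : test_function Omega phi -> exists M, forall x, ~ cube d M x -> phi x = 0.
Proof.
move=> [_ cpt _]; have [|M [_ H]] := compact_bounded _ : bounded_set (closure [set x | phi x != 0]).
  exact: cpt.
exists (`|M| + 1) => x nx; apply/eqP; rewrite -[_ == _]negbK; apply/negP => px; apply: nx => i.
have Mx : `|x| <= `|M| + 1.
  apply: H; last exact: subset_closure.
  by rewrite (le_lt_trans (ler_norm _))// ltrDl.
apply: le_trans Mx; rewrite [`|x|]mx_normrE.
exact: (le_bigmax _ (fun ij : 'I_1 * 'I_d => `|x ij.1 ij.2|) (ord0, i)).
Qed.

Lemma test_out phi x : test_function Omega phi -> ~ Omega x -> phi x = 0.
Proof.
move=> [_ _ sub] nx; apply/eqP; rewrite -[_ == _]negbK; apply/negP => px; apply: nx.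
by apply: sub; exact: subset_closure.
Qed.

Lemma test_partial i phi : test_function Omega phi -> test_function Omega (partial i phi).
Proof.
move=> [sphi cpt sub].
have S : closure [set x | partial i phi x != 0] `<=` closure [set x | phi x != 0].
  rewrite [X in _ `<=` X](_ : _ = closure (closure [set x | phi x != 0])); last first.
    exact/closure_id/closed_closure.
  apply: closure_subset => x /= px; apply: contrapT => nx.
  have nbx : \forall y \near x, phi y = cst 0 y.
    have : nbhs x (~` closure [set x | phi x != 0]).
      by apply: open_nbhs_nbhs; split => //; apply: closed_openC; exact: closed_closure.
    apply: filterS => y ny; apply/eqP; rewrite -[_ == _]negbK; apply/negP => py; apply: ny.
    exact: subset_closure.
  by move/eqP: px; apply; rewrite /partial (near_eq_derive _ nbx) derive_cst.
split; first exact: smooth_partial.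
- by apply: subclosed_compact cpt S; exact: closed_closure.
- exact: subset_trans sub.
Qed.

Lemma test_continuous phi : test_function Omega phi -> continuous phi.
Proof. by move=> [/smooth_C2[C1p _] _ _]; exact: C1_continuous. Qed.

Lemma test_measurable phi : test_function Omega phi -> measurable_fun Omega phi.
Proof. by move=> /test_continuous cp; apply: measurable_funTS; exact: continuous_measurable_rV. Qed.

Lemma test_bounded phi : test_function Omega phi -> exists2 N, 0 <= N & forall x, `|phi x| <= N.
Proof.
move=> tp; have [M phiM] := test_support tp.
exact: cont_compact_bounded (test_continuous tp) phiM.
Qed.

Lemma test_L2 phi : test_function Omega phi -> L2 Omega phi.
Proof.
move=> tp; have [N _ pN] := test_bounded tp; apply: (L2_bounded mO finO (M := N)) => //.
exact: test_measurable.
Qed.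

Lemma is_wpartial_test i phi : test_function Omega phi -> is_wpartial Omega i phi (partial i phi).
Proof.
move=> tp; split; first by apply: test_L2; exact: test_partial.
move=> psi tpsi; have [[dp cpp] _] := smooth_C2 (let: And3 h _ _ := tp in h).
have [[dpsi cppsi] _] := smooth_C2 (let: And3 h _ _ := tpsi in h).
have [M pM] := test_support tp.
have pE : partial i (fun x => phi x * psi x) = fun x => phi x * partial i psi x + psi x * partial i phi x.
  by apply/funext => x; rewrite partial_mul.
have C1w : C1 (fun x => phi x * psi x).
  split; first by move=> x; exact: differentiable_mul.
  move=> j; rewrite (_ : partial j _ = fun x => phi x * partial j psi x + psi x * partial j phi x); last first.
    by apply/funext => x; rewrite partial_mul.
  apply: continuous_add; apply: continuous_mul; [exact: test_continuous tp|exact: cppsi|exact: test_continuous tpsi|exact: cpp].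
have := Rintegral_partial i C1w (M := M); rewrite pE.
rewrite (@Rintegral_support _ _ Omega setT)//; last first.
  by move=> x nx; rewrite (test_out tp nx) (test_out tpsi nx) !mul0r addr0.
have L2p := test_L2 tp; have L2psi := test_L2 tpsi.
have L2dp := test_L2 (test_partial i tp); have L2dpsi := test_L2 (test_partial i tpsi).
rewrite RintegralD//; [|exact: L2_mul_integrable|exact: L2_mul_integrable].
move=> /(_ _)/eqP; rewrite addr_eq0 => H.
rewrite (eqP (H _)); last by move=> x nx; rewrite pM// mul0r.
by congr (- _); apply: eq_Rintegral => x _; rewrite mulrC.
Qed.

End test_functions.

(** * The fundamental lemma of the calculus of variations *)

Section fundamental_lemma.
Context {R : realType} {d : nat}.
Variable Omega : set 'rV[R]_d.
Hypotheses (oO : open Omega) (finO : (vol Omega < +oo)%E).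

Let mO : measurable Omega. Proof. exact: open_measurable_rV. Qed.

Let obox (a b : 'rV[R]_d) : set 'rV[R]_d := [set x | forall i, a ord0 i < x ord0 i < b ord0 i].
Let cbox (a b : 'rV[R]_d) : set 'rV[R]_d :=
  [set x | forall i, `[a ord0 i, b ord0 i]%classic (x ord0 i)].

Let compact_cbox a b : compact (cbox a b).
Proof.
by apply: (@rV_compact _ _ (fun i => `[a ord0 i, b ord0 i]%classic)) => i; exact: segment_compact.
Qed.

Let closed_cbox a b : closed (cbox a b).
Proof. by apply: compact_closed; [exact: norm_hausdorff|exact: compact_cbox]. Qed.

Let obox_cbox a b : obox a b `<=` cbox a b.
Proof. by move=> x H i; have /andP[h1 h2] := H i; rewrite /= in_itv/= !ltW. Qed.

Let measurable_obox a b : measurable (obox a b).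
Proof.
rewrite (_ : obox a b = [set x | forall i, `]a ord0 i, b ord0 i[%classic (x ord0 i)]).
  by apply: (@measurable_box R d (fun i => `]a ord0 i, b ord0 i[%classic)) => i; exact: measurable_itv.
by apply/seteqP; split => x H i; have := H i; rewrite /= in_itv.
Qed.

Lemma smoothV_prod (I : Type) (s : seq I) (f : I -> 'rV[R]_d -> R) : (forall i, smoothV (f i)) ->
  smoothV (fun x => \prod_(i <- s) f i x).
Proof.
move=> sf; elim: s => [|i s IH].
  by rewrite (_ : (fun _ => _) = fun=> 1); [exact: smoothV_cst|apply/funext => x; rewrite big_nil].
rewrite (_ : (fun _ => _) = fun x => f i x * \prod_(i <- s) f i x); first exact: smoothV_mul.
by apply/funext => x; rewrite big_cons.
Qed.

(** Products of one-dimensional steps compressed by the factor [n]. Each factor vanishes beyond its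
    face of the box, so the supports stay in the closed box, and for [n] large all factors equal 1
    at a given interior point. *)
Let box_test a b : cbox a b `<=` Omega -> exists psi : nat -> 'rV[R]_d -> R,
  [/\ forall n, test_function Omega (psi n), forall n x, 0 <= psi n x <= 1 &
      forall x, (psi ^~ x) @ \oo --> (\1_(obox a b) x : R)].
Proof.
move=> abO; have [th sth [th0 th1 th01 _ _]] := @smooth1_step R.
pose fac (n : nat) i (x : 'rV[R]_d) :=
  th (n%:R * x ord0 i + - (n%:R * a ord0 i)) * th (- n%:R * x ord0 i + n%:R * b ord0 i).
pose psi n x := \prod_(i <- enum 'I_d) fac n i x.
have fac01 n i x : 0 <= fac n i x <= 1.
  have /andP[h1 h2] := th01 (n%:R * x ord0 i + - (n%:R * a ord0 i)).
  have /andP[h3 h4] := th01 (- n%:R * x ord0 i + n%:R * b ord0 i).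
  by rewrite mulr_ge0//= mulr_ile1.
have psi01 n x : 0 <= psi n x <= 1.
  rewrite /psi; elim: (enum 'I_d) => [|i s /andP[h1 h2]]; first by rewrite big_nil ler01 lexx.
  by have /andP[h3 h4] := fac01 n i x; rewrite big_cons mulr_ge0//= mulr_ile1.
have psi_out n x : ~ obox a b x -> psi n x = 0.
  move=> /existsNP[i nx]; have fi : fac n i x = 0.
    have [h|h] := leP (x ord0 i) (a ord0 i).
      by rewrite /fac th0 ?mul0r// -mulrBr mulr_ge0_le0// subr_le0.
    have [h'|h'] := leP (b ord0 i) (x ord0 i).
      rewrite /fac (th0 (_ + n%:R * b ord0 i)) ?mulr0// mulNr addrC -mulrBr mulr_ge0_le0// subr_le0//.
    by exfalso; apply: nx; rewrite h h'.
  by rewrite /psi (bigD1_seq i) ?mem_enum ?enum_uniq//= fi mul0r.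
exists psi; split => //.
- move=> n; have sub : closure [set x | psi n x != 0] `<=` cbox a b.
    rewrite [X in _ `<=` X](_ : _ = closure (cbox a b)); last by apply/closure_id; exact: closed_cbox.
    apply: closure_subset => x /= px; apply: obox_cbox; apply: contrapT => /psi_out px0.
    by rewrite px0 eqxx in px.
  split; last exact: subset_trans abO.
    apply: smoothV_smooth; apply: smoothV_prod => i; apply: smoothV_mul.
      by apply: (@smoothV_comp _ _ (fun y => th (n%:R * y + - (n%:R * a ord0 i))));
        [exact: smooth1_affine|exact: smoothV_coord].
    by apply: (@smoothV_comp _ _ (fun y => th (- n%:R * y + n%:R * b ord0 i)));
      [exact: smooth1_affine|exact: smoothV_coord].
  by apply: (@subclosed_compact _ _ (cbox a b)) => //; exact: closed_closure.
move=> x; rewrite indicE; have [/set_mem bx|nx] := boolP (x \in obox a b); last first.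
  apply: cvg_near_cst; apply: nearW => n; apply: psi_out => bx; move/negP: nx; apply; exact: mem_set.
pose m : R := \sum_i ((x ord0 i - a ord0 i)^-1 + (b ord0 i - x ord0 i)^-1).
apply: cvg_near_cst; near=> n; rewrite /psi big1_seq// => i _.
have /andP[ax xb] := bx i; have ax' : 0 < x ord0 i - a ord0 i by rewrite subr_gt0.
have xb' : 0 < b ord0 i - x ord0 i by rewrite subr_gt0.
have mn : m <= n%:R by near: n; exact: nbhs_infty_ger.
have m1 : (x ord0 i - a ord0 i)^-1 + (b ord0 i - x ord0 i)^-1 <= m.
  rewrite /m (bigD1 i)//= lerDl; apply: sumr_ge0 => j _.
  by have /andP[? ?] := bx j; rewrite addr_ge0// invr_ge0 subr_ge0 ltW.
have i1 : 0 <= (x ord0 i - a ord0 i)^-1 by rewrite invr_ge0 ltW.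
have i2 : 0 <= (b ord0 i - x ord0 i)^-1 by rewrite invr_ge0 ltW.
rewrite /fac !th1 ?mulr1// ?mulNr -?mulrBr.
  by rewrite addrC -mulrBr -ler_pdivrMr// mul1r; lra.
by rewrite -ler_pdivrMr// mul1r; lra.
Unshelve. all: by end_near. Qed.

Variable g : 'rV[R]_d -> R.
Hypotheses (L2g : L2 Omega g)
  (Hg : forall psi, test_function Omega psi -> \int[vol]_(x in Omega) (g x * psi x) = 0).

Let ig : vol.-integrable Omega (EFin \o g). Proof. exact: L2_integrable. Qed.

Let integral_obox a b : cbox a b `<=` Omega -> (\int[vol]_(x in obox a b) (g x)%:E = 0)%E.
Proof.
move=> abO; have [psi [tpsi psi01 psi_cvg]] := box_test abO.
have mg : measurable_fun Omega g by have /(L2P mO)[] := L2g.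
have bO : obox a b `<=` Omega by exact: subset_trans (@obox_cbox a b) abO.
have [|||||_ _ H] := @dominated_convergence _ _ _ vol _ mO (fun n x => (g x * psi n x)%:E)
    (fun x => (g x * \1_(obox a b) x)%:E) (fun x => `|g x|%:E).
- move=> n; apply/measurable_EFinP; apply: measurable_funM => //; exact: test_measurable.
- by apply/measurable_EFinP; apply: measurable_funM => //.
- apply: aeW => x _; apply/cvg_EFin; first exact: nearW.
  by apply: cvgM; [exact: cvg_cst|exact: psi_cvg].
- exact: integrable_abse ig.
- apply: aeW => x n _ /=; rewrite lee_fin normrM ler_piMr//.
  by have /andP[h1 h2] := psi01 n x; rewrite ger0_norm.
have E0 : (fun n => \int[vol]_(x in Omega) (g x * psi n x)%:E)%E = fun=> 0%E.
  apply/funext => n; have := Hg (tpsi n); rewrite /Rintegral => E.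
  by rewrite -(fineK (integrable_fin_num mO (L2_mul_integrable mO L2g (test_L2 oO finO (tpsi n))))) E.
rewrite E0 in H; have E1 := cvg_lim (@ereal_hausdorff R) H; rewrite lim_cst// in E1.
rewrite [RHS]E1 -[in LHS](setIidr bO) integral_mkcondr; apply: eq_integral => x _.
by rewrite patchE indicE; case: ifP; rewrite ?mulr1 ?mulr0.
Qed.

(** Products of upper rays and full lines form a pi-system generating the Borel sets, and they meet
    an open box in an open box. *)
Let rays : set (set 'rV[R]_d) := fun A => exists C : 'I_d -> set R,
  (forall i, C i = setT \/ exists t : R, C i = `]t, +oo[%classic) /\
  A = [set x : 'rV[R]_d | forall i, C i (x ord0 i)].

Let setI_rays : setI_closed rays.
Proof.
move=> _ _ [C [HC ->]] [D [HD ->]]; exists (fun i => C i `&` D i); split; last first.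
  apply/seteqP; split => [x [H1 H2] i|x H]; first by split; [exact: H1|exact: H2].
  by split => i; have [] := H i.
move=> i; have [->|[s ->]] := HC i; have [->|[t ->]] := HD i.
- by left; rewrite setIT.
- by right; exists t; rewrite setTI.
- by right; exists s; rewrite setIT.
- right; exists (Num.max s t); apply/seteqP.
  by split => y /=; rewrite !in_itv/= !andbT gt_max => /andP.
Qed.

Let measurable_rays A : measurable A -> <<s rays >> A.
Proof.
move=> mA; pose T1 := g_sigma_algebraType rays.
have mid : measurable_fun [set: T1] (fun x : T1 => x : 'rV[R]_d).
  apply: measurable_fun_coordP => i; apply: (measurability _ (RGenOInfty.measurableE R)) => //.
  move=> _ [_ [t ->] <-]; rewrite setTI; apply: sub_sigma_algebra.
  exists (fun j => if j == i then `]t, +oo[%classic else setT); split.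
    by move=> j; case: ifP => _; [right; exists t|left].
  apply/seteqP; split => x /=; last by move=> /(_ i); rewrite eqxx.
  by move=> H j; case: ifP => // /eqP ->.
by have := mid measurableT A mA; rewrite setTI.
Qed.

(** The sets [A] such that [g] has integral 0 over [A] intersected with the box form a Dynkin system
    containing [rays], hence all Borel sets. *)
Let zero_obox a b : cbox a b `<=` Omega -> {ae vol, forall x, obox a b x -> g x = 0}.
Proof.
move=> abO; have bO : obox a b `<=` Omega by exact: subset_trans (@obox_cbox a b) abO.
have mb := measurable_obox a b.
have ib : vol.-integrable (obox a b) (EFin \o g) by exact: integrableS ig.
pose L := [set A | measurable A /\ (\int[vol]_(x in A `&` obox a b) (g x)%:E = 0)%E].
have iA A : measurable A -> vol.-integrable (A `&` obox a b) (EFin \o g).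
  by move=> mA; apply: (integrableS mb _ _ ib); [exact: measurableI|move=> x []].
have dL : dynkin L.
  split.
  - by split; [exact: measurableT|rewrite setTI; exact: integral_obox].
  - move=> A [mA A0]; split; first exact: measurableC.
    have := integral_obox abO.
    have {1}-> : obox a b = (A `&` obox a b) `|` (~` A `&` obox a b).
      by rewrite -setIUl setUv setTI.
    rewrite integral_setU//.
    + by rewrite A0 add0e.
    + exact: measurableI.
    + by apply: measurableI => //; exact: measurableC.
    + rewrite -setIUl setUv setTI; have /integrableP[] := ib => + _; exact.
    + by apply/disj_setPS => x [[Ax _] [nAx _]].
  - move=> F tF HF; have mF n : measurable (F n) by have [] := HF n.
    split; first exact: bigcup_measurable.
    rewrite setI_bigcupl integral_bigcup.
    + by apply: eseries0 => n _ _; have [_] := HF n.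
    + by apply: trivIset_setIr.
    + by move=> n; exact: measurableI.
    + rewrite -setI_bigcupl; apply: iA; exact: bigcup_measurable.
have raysL : rays `<=` L.
  move=> _ [C [HC ->]]; split.
    apply: (@measurable_box R d C) => i; have [->|[t ->]] := HC i => //.
  (* Intersecting with a ray only raises the lower end in that coordinate; the resulting box may be
     empty. *)
  have /choice[a' Ha'] : forall i, exists t : R, a ord0 i <= t /\
      forall y, (C i y /\ a ord0 i < y < b ord0 i) <-> t < y < b ord0 i.
    move=> i; have [->|[t ->]] := HC i.
      by exists (a ord0 i); split => // y; split => [[]|].
    exists (Num.max (a ord0 i) t); rewrite le_max lexx; split => // y.
    rewrite /= in_itv/= andbT gt_max; split => [[-> /andP[-> ->]]//|/andP[/andP[-> ->] ->]].
    by [].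
  pose av : 'rV[R]_d := \row_i a' i.
  rewrite (_ : _ `&` _ = obox av b).
    apply: integral_obox; apply: subset_trans abO => x H i.
    have := H i; rewrite /= !in_itv/= mxE => /andP[h1 ->]; rewrite andbT.
    by rewrite (le_trans _ h1)//; have [] := Ha' i.
  apply/seteqP; split => [x [h1 h2] i|x h].
    by rewrite mxE; apply/(proj2 (Ha' i)); split; [exact: h1|exact: h2].
  by split => i; have := h i; rewrite mxE => /(proj2 (Ha' i))[].
have mL : forall A, measurable A -> L A.
  move=> A /measurable_rays; rewrite -(setI_closed_g_dynkin_g_sigma_algebra setI_rays).
  by apply: smallest_sub.
have := @integral_ae_eq _ _ _ vol _ mb (cst 0%E) (EFin \o g) ib (measurable_cst _).
move=> H; apply: filterS (H _).
  by move=> x Hx bx; have /= := Hx bx => -[].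
move=> E Eb mE; rewrite integral0; have [_] := mL _ mE.
by rewrite (setIidl Eb).
Qed.

(** [Omega] is covered by the countably many open boxes with rational centre and half-width
    [1 / (n + 1)] whose closed box lies in [Omega], so the null sets of [zero_obox] add up to a null
    set. *)
Lemma fundamental_lemma : {ae vol, forall x, Omega x -> g x = 0}.
Proof.
pose lo (p : 'rV[rat]_d * nat) : 'rV[R]_d := \row_i (ratr (p.1 ord0 i) - p.2.+1%:R^-1).
pose hi (p : 'rV[rat]_d * nat) : 'rV[R]_d := \row_i (ratr (p.1 ord0 i) + p.2.+1%:R^-1).
pose good p := cbox (lo p) (hi p) `<=` Omega.
have H k : {ae vol, forall x, (if unpickle k is Some p then good p /\ obox (lo p) (hi p) x else False) -> g x = 0}.
  case: unpickle => [p|]; last by apply: aeW => x.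
  have [gp|ngp] := pselect (good p); last by apply: aeW => x [].
  by apply: filterS (zero_obox gp) => x Hx [_]; exact: Hx.
have := ae_foralln H; apply: filterS => x Hx Ox.
have /nbhs_ballP[e /= e0 xeO] := open_nbhs_nbhs (conj oO Ox).
have [n ne] : exists n, n.+1%:R^-1 < e / 2.
  have e20 : 0 < e / 2 by rewrite divr_gt0.
  have [N _ /(_ _ (leqnn _))] := near_infty_natSinv_lt (PosNum e20).
  by exists N.
have n0 : 0 < n.+1%:R^-1 :> R by rewrite invr_gt0.
have /choice[q qP] : forall i, exists q : rat, x ord0 i - n.+1%:R^-1 < ratr q < x ord0 i + n.+1%:R^-1.
  move=> i; have [|q] := @rat_in_itvoo R (x ord0 i - n.+1%:R^-1) (x ord0 i + n.+1%:R^-1).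
    by rewrite ltrBlDr -addrA ltrDl addr_gt0.
  by rewrite in_itv/=; exists q.
pose p := (\row_i q i, n) : 'rV[rat]_d * nat.
apply: (Hx (pickle p)); rewrite pickleK; split.
  move=> y Hy; apply: xeO; split => // i j; rewrite ord1 /ball/=.
  have := Hy j; rewrite /= in_itv/= !mxE /p/= ?mxE => /andP[h1 h2]; have /andP[h3 h4] := qP j.
  have aux (N Q X Y : R) : N < e / 2 -> Q - N <= Y -> Y <= Q + N -> X - N < Q -> Q < X + N -> `|X - Y| < e.
    by move=> *; rewrite ltr_norml; apply/andP; split; lra.
  exact: aux ne h1 h2 h3 h4.
by move=> i; have /andP[h3 h4] := qP i; rewrite !mxE /p/= ?mxE ltrBlDr h4 -ltrBlDr h3.
Qed.

End fundamental_lemma.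

(** * Weak derivatives of test functions, Rayleigh quotients and energies *)

Section weak_derivatives.
Context {R : realType} {d : nat}.
Variable Omega : set 'rV[R]_d.
Hypotheses (oO : open Omega) (finO : (vol Omega < +oo)%E).
Implicit Types u v g h phi psi : 'rV[R]_d -> R.

Let mO : measurable Omega. Proof. exact: open_measurable_rV. Qed.

Let L2m u : L2 Omega u -> measurable_fun Omega u.
Proof. by move=> /(L2P mO)[]. Qed.

(** [wpartial] picks an arbitrary representative; this lemma is what relates it, almost everywhere,
    to classical derivatives and to differences. *)
Lemma wpartial_unique i u g h : is_wpartial Omega i u g -> is_wpartial Omega i u h ->
  {ae vol, forall x, Omega x -> g x = h x}.
Proof.
move=> [L2g Hg] [L2h Hh]; have := fundamental_lemma oO finO (L2_sub mO L2g L2h).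
move=> H; apply: filterS (H _) => [x Hx Ox|psi tpsi].
  by apply/eqP; rewrite -subr_eq0 Hx.
have L2psi := test_L2 oO finO tpsi.
rewrite (@eq_Rintegral _ _ _ vol Omega (fun x => g x * psi x - h x * psi x)); last first.
  by move=> x _; rewrite mulrBl.
rewrite RintegralB//; [|exact: L2_mul_integrable|exact: L2_mul_integrable].
by have := Hg _ tpsi; rewrite (Hh _ tpsi) => /oppr_inj ->; rewrite subrr.
Qed.

Lemma wpartialP i u : has_wpartial Omega i u -> is_wpartial Omega i u (wpartial Omega i u).
Proof. by move=> [g Hg]; apply: (@getPex _ [set g | is_wpartial Omega i u g]); exists g. Qed.

Lemma is_wpartial_congr i u v g : measurable_fun Omega u -> measurable_fun Omega v ->
  {ae vol, forall x, Omega x -> u x = v x} -> is_wpartial Omega i u g -> is_wpartial Omega i v g.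
Proof.
move=> mu mv uv [L2g Hg]; split => // psi tpsi; rewrite -Hg//.
have mpsi := test_measurable (test_partial i tpsi).
apply: Rintegral_ae => //; [exact: measurable_funM|exact: measurable_funM|].
by apply: filterS uv => x H Ox; rewrite H.
Qed.

Lemma is_wpartial_sub i u v g h : L2 Omega u -> L2 Omega v -> is_wpartial Omega i u g ->
  is_wpartial Omega i v h -> is_wpartial Omega i (fun x => u x - v x) (fun x => g x - h x).
Proof.
move=> L2u L2v [L2g Hg] [L2h Hh]; split; first exact: L2_sub.
move=> psi tpsi; have L2psi := test_L2 oO finO tpsi.
have L2dpsi := test_L2 oO finO (test_partial i tpsi).
rewrite (@eq_Rintegral _ _ _ vol Omega (fun x => u x * partial i psi x - v x * partial i psi x)); last first.
  by move=> x _; rewrite mulrBl.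
rewrite RintegralB//; [|exact: L2_mul_integrable|exact: L2_mul_integrable].
rewrite [in RHS](@eq_Rintegral _ _ _ vol Omega (fun x => g x * psi x - h x * psi x)); last first.
  by move=> x _; rewrite mulrBl.
rewrite RintegralB//; [|exact: L2_mul_integrable|exact: L2_mul_integrable].
by rewrite Hg// Hh//; ring.
Qed.

(** [v] is only almost everywhere equal to the difference, because for second derivatives it will be
    a first weak derivative of [u - phi], itself known only up to a null set. *)
Lemma wpartial_sub_test i u v g phi : L2 Omega u -> is_wpartial Omega i u g -> test_function Omega phi ->
  measurable_fun Omega v -> {ae vol, forall x, Omega x -> v x = u x - phi x} ->
  is_wpartial Omega i v (fun x => g x - partial i phi x) /\
  {ae vol, forall x, Omega x -> wpartial Omega i v x = g x - partial i phi x}.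
Proof.
move=> L2u Hg tphi mv vE; have L2phi := test_L2 oO finO tphi.
have H : is_wpartial Omega i v (fun x => g x - partial i phi x).
  apply: (is_wpartial_congr _ _ _ (is_wpartial_sub L2u L2phi Hg (is_wpartial_test oO finO i tphi))) => //.
    exact: L2m (L2_sub mO L2u L2phi).
  by apply: filterS vE => x Hx Ox; rewrite Hx.
split => //; apply: (wpartial_unique (i := i) (u := v)) => //; apply: wpartialP; by exists (fun x => g x - partial i phi x).
Qed.

Section difference.
Variables u phi : 'rV[R]_d -> R.
Hypotheses (H2u : H2 Omega u) (tphi : test_function Omega phi).

Let L2u : L2 Omega u. Proof. by have [] := H2u. Qed.
Let L2phi : L2 Omega phi. Proof. exact: test_L2 tphi. Qed.
Let Hu i : is_wpartial Omega i u (wpartial Omega i u).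
Proof. by apply: wpartialP; have [] := H2u. Qed.
Let Huu i j : is_wpartial Omega j (wpartial Omega i u) (wpartial Omega j (wpartial Omega i u)).
Proof. by apply: wpartialP; have [_ _] := H2u. Qed.

Let D1 i : is_wpartial Omega i (u \- phi) (fun x => wpartial Omega i u x - partial i phi x) /\
  {ae vol, forall x, Omega x -> wpartial Omega i (u \- phi) x = wpartial Omega i u x - partial i phi x}.
Proof.
apply: (wpartial_sub_test L2u (Hu i) tphi); last exact: aeW.
exact: (L2m (L2_sub mO L2u L2phi)).
Qed.

Let mD1 i : measurable_fun Omega (wpartial Omega i (u \- phi)).
Proof. by apply: L2m; have [L _] := wpartialP (ex_intro _ _ (D1 i).1). Qed.

Let D2 i j : is_wpartial Omega j (wpartial Omega i (u \- phi))
    (fun x => wpartial Omega j (wpartial Omega i u) x - partial j (partial i phi) x) /\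
  {ae vol, forall x, Omega x -> wpartial Omega j (wpartial Omega i (u \- phi)) x
    = wpartial Omega j (wpartial Omega i u) x - partial j (partial i phi) x}.
Proof.
have [L2ui _] := Hu i.
exact: (wpartial_sub_test L2ui (Huu i j) (test_partial i tphi) (mD1 i) (D1 i).2).
Qed.

Lemma H2norm_sub_test : H2norm Omega (u \- phi) = Num.sqrt
  (\int[vol]_(x in Omega) (u x - phi x) ^+ 2
   + \sum_i \int[vol]_(x in Omega) (wpartial Omega i u x - partial i phi x) ^+ 2
   + \sum_i \sum_j \int[vol]_(x in Omega)
        (wpartial Omega j (wpartial Omega i u) x - partial j (partial i phi) x) ^+ 2).
Proof.
rewrite /H2norm; congr (Num.sqrt (_ + _ + _)).
  apply: eq_bigr => i _; apply: Rintegral_ae => //; [exact: measurable_funX| |].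
    by apply: measurable_funX; apply: L2m; have [] := (D1 i).1.
  by apply: filterS (D1 i).2 => x H Ox; rewrite H.
apply: eq_bigr => i _; apply: eq_bigr => j _; apply: Rintegral_ae => //.
- by apply: measurable_funX; apply: L2m; have [] := wpartialP (ex_intro _ _ (D2 i j).1).
- by apply: measurable_funX; apply: L2m; have [] := (D2 i j).1.
by apply: filterS (D2 i j).2 => x H Ox; rewrite H.
Qed.

End difference.

Lemma test_wpartial i phi : test_function Omega phi ->
  {ae vol, forall x, Omega x -> wpartial Omega i phi x = partial i phi x}.
Proof.
move=> tphi; have H := is_wpartial_test oO finO i tphi.
by apply: (wpartial_unique (i := i) (u := phi)) => //; apply: wpartialP; exists (partial i phi).
Qed.

Lemma is_wpartial_test2 i j phi : test_function Omega phi ->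
  is_wpartial Omega j (wpartial Omega i phi) (partial j (partial i phi)).
Proof.
move=> tphi; have tp := test_partial i tphi.
apply: is_wpartial_congr (is_wpartial_test oO finO j tp).
- exact: test_measurable tp.
- by apply: L2m; have [] := wpartialP (ex_intro _ _ (is_wpartial_test oO finO i tphi)).
- by apply: filterS (test_wpartial i tphi) => x H Ox; rewrite H.
Qed.

Lemma test_wpartial2 i j phi : test_function Omega phi ->
  {ae vol, forall x, Omega x -> wpartial Omega j (wpartial Omega i phi) x = partial j (partial i phi) x}.
Proof.
move=> tphi; have H := is_wpartial_test2 i j tphi.
by apply: (wpartial_unique (i := j) (u := wpartial Omega i phi)) => //; apply: wpartialP; eexists; exact: H.
Qed.

Lemma test_H2 phi : test_function Omega phi -> H2 Omega phi.
Proof.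
move=> tphi; split; first exact: test_L2 tphi.
- by move=> i; exists (partial i phi); exact: is_wpartial_test.
- by move=> i j; eexists; exact: is_wpartial_test2.
Qed.

Let Rintegral_ae0 (f : 'rV[R]_d -> R) : measurable_fun Omega f -> {ae vol, forall x, Omega x -> f x = 0} ->
  \int[vol]_(x in Omega) f x = 0.
Proof.
move=> mf f0; rewrite (Rintegral_ae mO mf (g := fun=> 0))//.
by rewrite Rintegral_cst// mul0r.
Qed.

Lemma test_H20 phi : test_function Omega phi -> H20 Omega phi.
Proof.
move=> tphi; have H2p := test_H2 tphi; split => // e e0; exists phi => //.
have [L2p /(_ _)/wpartialP Hp /(_ _ _)/wpartialP Hpp] := H2p.
rewrite H2norm_sub_test// (_ : _ + _ = 0) ?sqrtr0//.
rewrite Rintegral_ae0 ?add0r; last 2 first.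
- by apply: measurable_funX; exact: L2m (L2_sub mO L2p L2p).
- by apply: aeW => x _; rewrite subrr expr0n.
rewrite -[RHS](addr0 0); congr (_ + _).
  apply: big1 => i _; have [L2w _] := Hp i; have tp := test_partial i tphi.
  apply: Rintegral_ae0.
    by apply: measurable_funX; exact: (L2m (L2_sub mO L2w (test_L2 oO finO tp))).
  by apply: filterS (test_wpartial i tphi) => x H Ox; rewrite H// subrr expr0n.
apply: big1 => i _; apply: big1 => j _; have [L2w _] := Hpp j i.
have tp := test_partial j (test_partial i tphi); apply: Rintegral_ae0.
  by apply: measurable_funX; exact: (L2m (L2_sub mO L2w (test_L2 oO finO tp))).
by apply: filterS (test_wpartial2 i j tphi) => x H Ox; rewrite H// subrr expr0n.
Qed.

Let measurable_sumO (I : Type) (s : seq I) (f : I -> 'rV[R]_d -> R) :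
  (forall i, measurable_fun Omega (f i)) -> measurable_fun Omega (fun x => \sum_(i <- s) f i x).
Proof. by move=> mf; exact: measurable_sum. Qed.

Lemma measurable_wlaplacian u : H2 Omega u -> measurable_fun Omega (wlaplacian Omega u).
Proof.
move=> [_ _ H]; apply: measurable_sumO => i; apply: L2m.
by have [] := wpartialP (H i i).
Qed.

Lemma rayleigh_test tau phi : test_function Omega phi ->
  rayleigh Omega tau phi = (\int[vol]_(x in Omega) lap phi x ^+ 2
    + tau * \int[vol]_(x in Omega) \sum_i partial i phi x ^+ 2) / \int[vol]_(x in Omega) phi x ^+ 2.
Proof.
move=> tphi; have H2p := test_H2 tphi.
have mp i : measurable_fun Omega (partial i phi) by exact: test_measurable (test_partial i tphi).
have mw i : measurable_fun Omega (wpartial Omega i phi).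
  by apply: L2m; have [_ /(_ i)/wpartialP[]] := H2p.
congr ((_ + tau * _) / _).
  apply: Rintegral_ae => //.
  - by apply: measurable_funX; exact: measurable_wlaplacian.
  - apply: measurable_funX; apply: measurable_sumO => i.
    exact: test_measurable (test_partial i (test_partial i tphi)).
  have : {ae vol, forall x i, Omega x ->
      wpartial Omega i (wpartial Omega i phi) x = partial i (partial i phi) x}.
    by apply: filter_forall => i; exact: test_wpartial2.
  apply: filterS => x H Ox; congr (_ ^+ 2); apply: eq_bigr => i _; exact: H.
apply: Rintegral_ae => //.
- by apply: measurable_sumO => i; exact: measurable_funM.
- by apply: measurable_sumO => i; exact: measurable_funX.
have : {ae vol, forall x i, Omega x -> wpartial Omega i phi x = partial i phi x}.
  by apply: filter_forall => i; exact: test_wpartial.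
apply: filterS => x H Ox; apply: eq_bigr => i _; rewrite expr2; congr (_ * _); exact: H.
Qed.

Lemma rayleigh_ge0 tau v : 0 <= tau -> 0 <= rayleigh Omega tau v.
Proof.
move=> tau0; apply: divr_ge0; last by apply: Rintegral_ge0 => x _; exact: sqr_ge0.
apply: addr_ge0; first by apply: Rintegral_ge0 => x _; exact: sqr_ge0.
apply: mulr_ge0 => //; apply: Rintegral_ge0 => x _; apply: sumr_ge0 => i _.
by rewrite -expr2 sqr_ge0.
Qed.

Lemma first_eigenvalue_ge0 tau : 0 <= tau -> 0 <= first_eigenvalue Omega tau.
Proof.
move=> tau0; rewrite /first_eigenvalue; set S := (X in inf X).
(* The infimum of the empty set is 0 by convention. *)
have [->|S0] := eqVneq S set0; first by rewrite inf0.
apply: lb_le_inf; first exact/set0P.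
by move=> _ [v _ <-]; exact: rayleigh_ge0.
Qed.

Lemma first_eigenvalue_test tau phi : 0 <= tau -> test_function Omega phi ->
  first_eigenvalue Omega tau * \int[vol]_(x in Omega) phi x ^+ 2
  <= \int[vol]_(x in Omega) lap phi x ^+ 2
    + tau * \int[vol]_(x in Omega) \sum_i partial i phi x ^+ 2.
Proof.
move=> tau0 tphi; set I0 := \int[vol]_(x in Omega) phi x ^+ 2.
set N := _ + tau * _.
have N0 : 0 <= N.
  apply: addr_ge0; first by apply: Rintegral_ge0 => x _; exact: sqr_ge0.
  by apply: mulr_ge0 => //; apply: Rintegral_ge0 => x _; apply: sumr_ge0 => i _; exact: sqr_ge0.
have : 0 <= I0 by apply: Rintegral_ge0 => x _; exact: sqr_ge0.
rewrite le_eqVlt => /predU1P[<-|I0p]; first by rewrite mulr0.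
rewrite -ler_pdivlMr// -rayleigh_test//; apply: ge_inf.
  by exists 0 => _ [v _ <-]; exact: rayleigh_ge0.
exists phi => //; split; first exact: test_H20.
move=> z; move: I0p; rewrite /I0 Rintegral_ae0 ?ltxx//.
  by apply: measurable_funX; exact: test_measurable tphi.
by apply: filterS z => x H Ox; rewrite H// expr0n.
Qed.

Lemma test_energy (c : R) phi : test_function Omega phi ->
  \int[vol]_(x in Omega) (- lap phi x + c * phi x) ^+ 2
  = \int[vol]_(x in Omega) lap phi x ^+ 2
    + 2 * c * \int[vol]_(x in Omega) \sum_i partial i phi x ^+ 2
    + c ^+ 2 * \int[vol]_(x in Omega) phi x ^+ 2.
Proof.
move=> tphi; have [sphi _ _] := tphi; have C2phi := smooth_C2 sphi.
have [M phiM] := test_support tphi.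
have L2phi := test_L2 oO finO tphi.
have lap0 x : ~ Omega x -> lap phi x = 0.
  move=> nx; rewrite /lap big1// => i _; exact: test_out (test_partial i (test_partial i tphi)) nx.
have part0 i x : ~ Omega x -> partial i phi x = 0 by exact: test_out (test_partial i tphi).
have mlap : measurable_fun Omega (lap phi).
  by apply: measurable_funTS; apply: continuous_measurable_rV; exact: lap_continuous.
have L2lap : L2 Omega (lap phi).
  have [N _ lN] := cont_compact_bounded (lap_continuous C2phi) (lap_out phiM).
  by apply: (L2_bounded mO finO (M := N)).
(* Green's identity with [b] the identity turns the cross term of the square into the gradient
   term. *)
have green : \int[vol]_(x in Omega) \sum_i partial i phi x ^+ 2 = - \int[vol]_(x in Omega) (lap phi x * phi x).
  have hid (y : R) : is_derive y 1 (fun y : R => y) 1 by exact: is_derive_id.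
  have := green_identity C2phi phiM (b := fun y => y) erefl hid (fun y => @cst_continuous R R 1 y).
  have toO (f : 'rV[R]_d -> R) : (forall x, ~ Omega x -> f x = 0) -> (forall x, ~ cube d M x -> f x = 0) ->
      \int[vol]_(x in cube d M) f x = \int[vol]_(x in Omega) f x.
    by move=> f1 f2; rewrite -(Rintegral_support (E := setT) _ f2)// (Rintegral_support (D := Omega) _ f1).
  rewrite toO => [|x nx|x nx]; last 2 first.
  - rewrite sqr_enorm big1 ?mulr0// => i _; rewrite mxE part0// expr0n//.
  - rewrite sqr_enorm big1 ?mulr0// => i _; rewrite mxE (partial_out i phiM nx) expr0n//.
  rewrite toO => [|x nx|x nx]; last 2 first.
  - by rewrite lap0// oppr0 mul0r.
  - by rewrite (phiM _ nx) mulr0.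
  rewrite (@eq_Rintegral _ _ _ vol Omega (fun x => \sum_i partial i phi x ^+ 2)) => [->|x _]; last first.
    by rewrite mul1r sqr_enorm; apply: eq_bigr => i _; rewrite mxE.
  rewrite -mulN1r -RintegralZl//; last exact: L2_mul_integrable.
  by apply: eq_Rintegral => x _; ring.
have /(L2P mO)[_ i0] := L2phi; have /(L2P mO)[_ i2] := L2lap.
have i1 := L2_mul_integrable mO L2lap L2phi.
have j1 : vol.-integrable Omega (EFin \o (fun x => - (2 * c) * (lap phi x * phi x))).
  by have := integrableZl mO (- (2 * c)) i1; apply: eq_integrable.
have j0 : vol.-integrable Omega (EFin \o (fun x => c ^+ 2 * phi x ^+ 2)).
  by have := integrableZl mO (c ^+ 2) i0; apply: eq_integrable.
have j3 : vol.-integrable Omega (EFin \o (fun x => lap phi x ^+ 2 + - (2 * c) * (lap phi x * phi x))).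
  by have := integrableD mO i2 j1; apply: eq_integrable.
rewrite green (@eq_Rintegral _ _ _ vol Omega (fun x => lap phi x ^+ 2 + - (2 * c) * (lap phi x * phi x) + c ^+ 2 * phi x ^+ 2)).
  by rewrite RintegralD// RintegralD// !RintegralZl//; ring.
by move=> x _; ring.
Qed.

Lemma partial_opp i phi : (forall x, differentiable phi x) ->
  partial i (fun x => - phi x) = fun x => - partial i phi x.
Proof.
by move=> dp; apply/funext => x; rewrite /partial (@deriveN _ _ _ phi)//; exact: diff_derivable.
Qed.

Lemma test_opp phi : test_function Omega phi -> test_function Omega (fun x => - phi x).
Proof.
move=> [sphi cpt sub].
have E : [set x | - phi x != 0] = [set x | phi x != 0].
  by apply/seteqP; split => x /=; rewrite oppr_eq0.
split; rewrite ?E// => s x.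
have -> : foldr (@partial R d) (fun x => - phi x) s = fun x => - foldr (@partial R d) phi s x.
  elim: s => //= i s ->; apply: partial_opp; exact: sphi.
exact: differentiableN.
Qed.

Lemma lap_opp phi x : smooth phi -> lap (fun x => - phi x) x = - lap phi x.
Proof.
move=> sphi; rewrite /lap -sumrN; apply: eq_bigr => i _.
rewrite partial_opp; last exact: (sphi [::]).
by rewrite partial_opp//; exact: (sphi [:: i]).
Qed.

End weak_derivatives.

(** * Passage to the limit *)

Section real_estimates.
Context {R : realType}.
Implicit Types a b e A X Y K Lam : R.

(** [K a] may blow up as [a] tends to 0, so [e] is sent to 0 first, with [a] fixed. *)
Lemma le_limit_approx A Y (K : R -> R) : 0 <= Y -> (forall a, 0 < a -> 0 <= K a) ->
  (forall a e, 0 < a -> 0 < e -> A <= (1 + a) ^+ 2 * Y + e * K a) -> A <= Y.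
Proof.
move=> Y0 K0 H; apply/ler_addgt0Pr => e e0.
(* As [a <= 1], the excess of [(1 + a) ^+ 2 * Y] over [Y] is at most [3 a Y <= e / 2]; the other
   half of [e] is for the term with [K a]. *)
pose a : R := Num.min 1 (e / (6 * (Y + 1))).
have Y1 : 0 < 6 * (Y + 1) by lra.
have a0 : 0 < a by rewrite lt_min ltr01 divr_gt0.
have a1 : a <= 1 by rewrite ge_min lexx.
have aY : a * (6 * (Y + 1)) <= e by rewrite -ler_pdivlMr// ge_min lexx orbT.
have K1 : 0 < 2 * (K a + 1) by have := K0 a a0; lra.
have := H a (e / (2 * (K a + 1))) a0 (divr_gt0 e0 K1).
have : e / (2 * (K a + 1)) * K a <= e / 2.
  rewrite -mulrA ler_pM2l// invfM -mulrA ler_piMr ?invr_ge0//.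
  by rewrite ler_pdivrMl; have := K0 a a0; lra.
have : a ^+ 2 * Y <= a * Y by rewrite ler_wpM2r// expr2 ler_piMr// ltW.
move=> h1 h2 h3; apply: (le_trans h3).
have -> : (1 + a) ^+ 2 * Y = Y + 2 * (a * Y) + a ^+ 2 * Y by ring.
by nra.
Qed.

(** The arithmetic of [H20_inequality]. [X0], [X1], [X2] are the integrals for the limit function,
    [P], [F], [G], [L] those for the approximating test function, [a] and [b] the two factors of
    [Rintegral_sq_le], [e] the approximation error, and [D] the dimension, which enters through the
    sums over coordinates. *)
Lemma energy_combine Lam tau k a b e D X0 X1 X2 P F G L :
  0 <= Lam -> 0 <= tau -> 0 <= a ->
  Lam * P <= L + tau * G + k ^+ 2 * F ->
  X0 <= a * P + b * e -> F <= a * X0 + b * e ->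
  G <= a * X1 + b * (D * e) -> L <= a * X2 + b * (D * (D * e)) ->
  Lam * X0 <= a ^+ 2 * (X2 + tau * X1 + k ^+ 2 * X0)
    + e * (a * b * (D ^+ 2 + tau * D + k ^+ 2) + Lam * b).
Proof.
move=> Lam0 tau0 a0 HP HX HF HG HL.
have h1 := ler_wpM2l Lam0 HX.
have h2 := ler_wpM2l (sqr_ge0 k) HF.
have h3 := ler_wpM2l tau0 HG.
have h4 : Lam * P <= a * X2 + b * (D * (D * e)) + tau * (a * X1 + b * (D * e)) + k ^+ 2 * (a * X0 + b * e) by lra.
have h5 := ler_wpM2l a0 h4.
have -> : a ^+ 2 * (X2 + tau * X1 + k ^+ 2 * X0) + e * (a * b * (D ^+ 2 + tau * D + k ^+ 2) + Lam * b)
  = a * (a * X2 + b * (D * (D * e)) + tau * (a * X1 + b * (D * e)) + k ^+ 2 * (a * X0 + b * e)) + Lam * (b * e).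
  by ring.
apply: le_trans h1 _; rewrite mulrDr; apply: lerD => //.
by rewrite mulrCA.
Qed.

Lemma sqr_sign (s : R) : s = 1 \/ s = -1 -> s ^+ 2 = 1.
Proof. by case=> ->; ring. Qed.

Lemma sqr_sum_le d (a : 'I_d -> R) : (\sum_i a i) ^+ 2 <= d%:R * \sum_i a i ^+ 2.
Proof.
set S := \sum_i a i; set A := \sum_i a i ^+ 2.
have A0 : 0 <= A by apply: sumr_ge0 => i _; exact: sqr_ge0.
have one : \sum_(i < d) (1 : R) ^+ 2 = d%:R by rewrite expr1n sumr_const card_ord.
have H1 := CS_sum a (fun=> 1); have H2 := CS_sum (fun i => - a i) (fun=> 1).
have SE : `|S| <= Num.sqrt (d%:R * A).
  rewrite mulrC sqrtrM// ler_norml lerNl; apply/andP; split.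
    move: H2; rewrite one (eq_bigr (fun i => - a i)) => [|i _]; last by rewrite mulr1.
    by rewrite sumrN; under [in X in _ <= X]eq_bigr do rewrite sqrrN.
  by move: H1; rewrite one (eq_bigr a) => [//|i _]; rewrite mulr1.
rewrite -(real_normK (num_real S)) -[leRHS]sqr_sqrtr ?mulr_ge0//.
by rewrite lerXn2r ?nnegrE ?sqrtr_ge0.
Qed.

End real_estimates.

Section approximation.
Context {R : realType} {d : nat}.
Variable Omega : set 'rV[R]_d.
Hypotheses (oO : open Omega) (finO : (vol Omega < +oo)%E).
Implicit Types u v f g phi : 'rV[R]_d -> R.

Let mO : measurable Omega. Proof. exact: open_measurable_rV. Qed.

Let sqr_int f : L2 Omega f -> vol.-integrable Omega (EFin \o (fun x => f x ^+ 2)).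
Proof. by move=> /(L2P mO)[]. Qed.

Let L2m f : L2 Omega f -> measurable_fun Omega f.
Proof. by move=> /(L2P mO)[]. Qed.

Lemma L2_sum (f : 'I_d -> 'rV[R]_d -> R) : (forall i, L2 Omega (f i)) ->
  L2 Omega (fun x => \sum_i f i x).
Proof.
move=> L2f; have i1 : vol.-integrable Omega (EFin \o (fun x => d%:R * \sum_i f i x ^+ 2)).
  have := integrableZl mO d%:R (integrable_sum mO (index_enum _) (P := xpredT) (fun i _ => sqr_int (L2f i))).
  by apply: eq_integrable => // x _ /=; rewrite sumEFin.
have mf : measurable_fun Omega (fun x => \sum_i f i x).
  by apply: measurable_sum => i; exact: L2m.
apply/(L2P mO); split => //; apply: (le_integrable mO _ _ i1).
  by apply/measurable_EFinP; exact: measurable_funX.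
move=> x _ /=; rewrite lee_fin ger0_norm ?sqr_ge0//.
by apply: le_trans (sqr_sum_le _) _; exact: ler_norm.
Qed.

Lemma Rintegral_sqr_sum_le (f : 'I_d -> 'rV[R]_d -> R) (e : R) : (forall i, L2 Omega (f i)) ->
  (forall i, \int[vol]_(x in Omega) f i x ^+ 2 <= e) ->
  \int[vol]_(x in Omega) (\sum_i f i x) ^+ 2 <= d%:R * (d%:R * e).
Proof.
move=> L2f fe; have L2s := L2_sum L2f.
have i1 : vol.-integrable Omega (EFin \o (fun x => \sum_i f i x ^+ 2)).
  have := integrable_sum mO (index_enum _) (P := xpredT) (fun i _ => sqr_int (L2f i)).
  by apply: eq_integrable => // x _ /=; rewrite sumEFin.
apply: (@le_trans _ _ (d%:R * \int[vol]_(x in Omega) \sum_i f i x ^+ 2)).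
  rewrite -RintegralZl//; apply: le_Rintegral => //; first exact: sqr_int.
    by have := integrableZl mO d%:R i1; apply: eq_integrable.
  by move=> x _; exact: sqr_sum_le.
rewrite ler_wpM2l// Rintegral_sum//; last by move=> i; exact: sqr_int.
by rewrite -[d in d%:R * e]card_ord mulr_natl -sumr_const; apply: ler_sum => i _.
Qed.

Lemma H20_approx u (e : R) : 0 < e -> H20 Omega u -> exists2 phi, test_function Omega phi &
  [/\ \int[vol]_(x in Omega) (u x - phi x) ^+ 2 <= e,
      forall i, \int[vol]_(x in Omega) (wpartial Omega i u x - partial i phi x) ^+ 2 <= e
    & forall i, \int[vol]_(x in Omega)
        (wpartial Omega i (wpartial Omega i u) x - partial i (partial i phi) x) ^+ 2 <= e].
Proof.
move=> e0 [H2u app]; have [|phi tphi] := app (Num.sqrt e); first by rewrite sqrtr_gt0.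
rewrite (H2norm_sub_test oO finO H2u tphi) ltr_sqrt// => He; exists phi => //.
have ge0 f : 0 <= \int[vol]_(x in Omega) f x ^+ 2 by apply: Rintegral_ge0 => x _; exact: sqr_ge0.
set A := Rintegral _ _ _ in He; set C := \sum_i _ in He.
set B := \sum_i _ in He.
have A0 : 0 <= A by exact: ge0.
have B0 : 0 <= B by apply: sumr_ge0 => i _; exact: ge0.
have C0 : 0 <= C by apply: sumr_ge0 => i _; apply: sumr_ge0 => j _; exact: ge0.
have sum_ge (F : 'I_d -> R) i : (forall j, 0 <= F j) -> F i <= \sum_j F j.
  by move=> F0; rewrite (bigD1 i)//= lerDl; apply: sumr_ge0 => j _.
split=> [|i|i]; first by rewrite -/A; lra.
  apply: (@le_trans _ _ B); last by lra.
  exact: (sum_ge (fun i => \int[vol]_(x in Omega) (wpartial Omega i u x - partial i phi x) ^+ 2)).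
apply: (@le_trans _ _ C); last by lra.
pose F i j := \int[vol]_(x in Omega)
  (wpartial Omega j (wpartial Omega i u) x - partial j (partial i phi) x) ^+ 2.
apply: (@le_trans _ _ (\sum_j F i j)); first by apply: (sum_ge (F i)) => j; exact: ge0.
apply: (sum_ge (fun i => \sum_j F i j)) => j; apply: sumr_ge0 => k _; exact: ge0.
Qed.

Lemma max0_lip (a b : R) : (Num.max a 0 - Num.max b 0) ^+ 2 <= (a - b) ^+ 2.
Proof. have sa := sqr_ge0 a; have sb := sqr_ge0 b.
rewrite /Num.max; case: (ltP a 0) => ha; case: (ltP b 0) => hb.
- by rewrite subrr expr0n sqr_ge0.
- by have := mulr_le0_ge0 (ltW ha) hb; lra.
- by have := mulr_ge0_le0 ha (ltW hb); lra.
- by []. Qed.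

Lemma L2_max0 (s : R) f : L2 Omega f -> (s = 1 \/ s = -1) -> L2 Omega (fun x => Num.max (s * f x) 0).
Proof.
move=> L2f s1; have mf := L2m L2f.
have mm : measurable_fun Omega (fun x => Num.max (s * f x) 0).
  by apply: measurable_maxr => //; exact: measurable_funM.
apply/(L2P mO); split => //; apply: (le_integrable mO _ _ (sqr_int L2f)).
  by apply/measurable_EFinP; exact: measurable_funX.
move=> x _ /=; rewrite lee_fin !ger0_norm ?sqr_ge0//.
have := max0_lip (s * f x) 0; rewrite [Num.max 0 0]maxxx !subr0 exprMn.
by rewrite (sqr_sign s1) mul1r.
Qed.

Section comparison.
Variables (u : 'rV[R]_d -> R) (s Lam tau k : R).
Hypotheses (H20u : H20 Omega u) (s1 : s = 1 \/ s = -1) (Lam0 : 0 <= Lam) (tau0 : 0 <= tau).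
Hypothesis us : {ae vol, forall x, Omega x -> 0 <= s * u x}.
Hypothesis test_ineq : forall phi, test_function Omega phi ->
  Lam * \int[vol]_(x in Omega) Num.max (s * phi x) 0 ^+ 2
  <= \int[vol]_(x in Omega) lap phi x ^+ 2
     + tau * \int[vol]_(x in Omega) \sum_i partial i phi x ^+ 2
     + k ^+ 2 * \int[vol]_(x in Omega) phi x ^+ 2.

Let H2u : H2 Omega u. Proof. by have [] := H20u. Qed.
Let L2u : L2 Omega u. Proof. by have [] := H2u. Qed.
Let L2w i : L2 Omega (wpartial Omega i u).
Proof. by have [_ H _] := H2u; have [] := wpartialP (H i). Qed.
Let L2ww i : L2 Omega (wpartial Omega i (wpartial Omega i u)).
Proof. by have [_ _ H] := H2u; have [] := wpartialP (H i i). Qed.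

Let ge0 f : 0 <= \int[vol]_(x in Omega) f x ^+ 2.
Proof. by apply: Rintegral_ge0 => x _; exact: sqr_ge0. Qed.

Let gradE (f : 'I_d -> 'rV[R]_d -> R) : (forall i, L2 Omega (f i)) ->
  \int[vol]_(x in Omega) \sum_i f i x ^+ 2 = \sum_i \int[vol]_(x in Omega) f i x ^+ 2.
Proof. by move=> L2f; rewrite Rintegral_sum// => i; exact: sqr_int. Qed.

Lemma H20_inequality :
  Lam * \int[vol]_(x in Omega) u x ^+ 2
  <= \int[vol]_(x in Omega) wlaplacian Omega u x ^+ 2
     + tau * \int[vol]_(x in Omega) \sum_i wpartial Omega i u x ^+ 2
     + k ^+ 2 * \int[vol]_(x in Omega) u x ^+ 2.
Proof.
set X0 := \int[vol]_(x in Omega) u x ^+ 2; set X2 := \int[vol]_(x in Omega) _ ^+ 2.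
set X1 := \int[vol]_(x in Omega) \sum_i _.
have X10 : 0 <= X1 by rewrite /X1 gradE//; apply: sumr_ge0.
pose b a : R := 1 + a^-1.
have b0 a : 0 < a -> 0 <= b a by move=> a0; rewrite addr_ge0 ?invr_ge0 ?ltW.
pose K a : R := (1 + a) * b a * (d%:R ^+ 2 + tau * d%:R + k ^+ 2) + Lam * b a.
apply: (le_limit_approx (K := K)) => [|a a0|a e a0 e0].
- exact: (addr_ge0 (addr_ge0 (ge0 _) (mulr_ge0 tau0 X10)) (mulr_ge0 (sqr_ge0 k) (ge0 u))).
- have ba := b0 a a0; rewrite /K; clearbody b.
  apply: addr_ge0; apply: mulr_ge0 => //; first by apply: mulr_ge0 => //; lra.
  by rewrite !addr_ge0 ?sqr_ge0 ?mulr_ge0.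
have [phi tphi [E0 E1 E2]] := H20_approx e0 H20u.
have L2phi := test_L2 oO finO tphi.
have L2p i : L2 Omega (partial i phi) by exact: test_L2 (test_partial i tphi).
have L2pp i : L2 Omega (partial i (partial i phi)).
  exact: test_L2 (test_partial i (test_partial i tphi)).
have sym f g : \int[vol]_(x in Omega) (f x - g x) ^+ 2 = \int[vol]_(x in Omega) (g x - f x) ^+ 2.
  by apply: eq_Rintegral => x _; rewrite -sqrrN opprB.
have ba := b0 a a0; have a1 : 0 <= 1 + a by lra.
apply: (energy_combine (P := \int[vol]_(x in Omega) Num.max (s * phi x) 0 ^+ 2)
  (F := \int[vol]_(x in Omega) phi x ^+ 2) (G := \int[vol]_(x in Omega) \sum_i partial i phi x ^+ 2)
  (L := \int[vol]_(x in Omega) lap phi x ^+ 2)) => //; first exact: test_ineq.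
- have L2mu := L2_max0 L2u s1; have L2mp := L2_max0 L2phi s1.
  (* Since [s u >= 0], [u ^+ 2] is the square of the positive part of [s u]; taking positive parts
     is 1-Lipschitz and does not increase the approximation error. *)
  rewrite /X0 (@Rintegral_ae _ _ _ mO _ (fun x => Num.max (s * u x) 0 ^+ 2)); last 3 first.
  + exact: measurable_funX (L2m L2u).
  + exact: measurable_funX (L2m L2mu).
  + apply: filterS us => x H Ox; rewrite max_l ?H// exprMn.
    by rewrite (sqr_sign s1) mul1r.
  apply: le_trans (Rintegral_sq_le mO a0 L2mu L2mp) _.
  rewrite lerD2l ler_wpM2l//; apply: le_trans E0.
  apply: le_Rintegral => //; [exact: sqr_int (L2_sub mO L2mu L2mp)|exact: sqr_int (L2_sub mO L2u L2phi)|].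
  move=> x _; apply: le_trans (max0_lip _ _) _; rewrite -mulrBr exprMn.
  by rewrite (sqr_sign s1) mul1r.
- apply: le_trans (Rintegral_sq_le mO a0 L2phi L2u) _.
  by rewrite lerD2l ler_wpM2l// sym.
- rewrite /X1 !gradE//.
  have -> : d%:R * e = \sum_(i < d) e by rewrite sumr_const card_ord mulr_natl.
  rewrite !mulr_sumr -big_split/=; apply: ler_sum => i _.
  apply: le_trans (Rintegral_sq_le mO a0 (L2p i) (L2w i)) _.
  by rewrite lerD2l ler_wpM2l// sym.
- apply: le_trans (Rintegral_sq_le mO a0 (L2_sum L2pp) (L2_sum L2ww)) _.
  rewrite lerD2l ler_wpM2l//.
  rewrite (@eq_Rintegral _ _ _ vol Omega (fun x => (\sum_i (partial i (partial i phi) x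
      - wpartial Omega i (wpartial Omega i u) x)) ^+ 2)) => [|x _]; last by rewrite sumrB.
  apply: Rintegral_sqr_sum_le => i; first exact: L2_sub.
  by rewrite sym.
Qed.

End comparison.

Lemma Rintegral_sqr_eq0 u : L2 Omega u -> \int[vol]_(x in Omega) u x ^+ 2 = 0 -> ae_zero Omega u.
Proof.
move=> L2u I0; have iu := sqr_int L2u; have mu := measurable_int _ iu.
have : ae_eq vol Omega (EFin \o (fun x => u x ^+ 2)) (cst 0%E).
  apply/ae_eq_integral_abs => //.
  rewrite (eq_integral (EFin \o (fun x => u x ^+ 2))) => [|x _]; last by rewrite /= ger0_norm ?sqr_ge0.
  by rewrite -[LHS]fineK ?integrable_fin_num//; congr EFin.
apply: filterS => x H Ox; move: (H Ox) => /= [] /eqP; rewrite expf_eq0/= => /eqP; exact.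
Qed.

End approximation.

Lemma positive_part_test (R : realType) (d : nat) (d_gt0 : (0 < d)%N) (Omega : set 'rV[R]_d)
    (c : 'rV[R]_d) (r tau tau' s : R) (phi : 'rV[R]_d -> R) : open Omega -> (vol Omega < +oo)%E ->
  0 < r -> vol (eball c r) = vol Omega -> 0 <= tau -> tau < tau' -> s = 1 \/ s = -1 ->
  test_function Omega phi ->
  (first_eigenvalue (eball c r) tau + (tau' / 2) ^+ 2)
    * \int[vol]_(x in Omega) Num.max (s * phi x) 0 ^+ 2
  <= \int[vol]_(x in Omega) lap phi x ^+ 2
     + tau' * \int[vol]_(x in Omega) \sum_i partial i phi x ^+ 2
     + (tau' / 2) ^+ 2 * \int[vol]_(x in Omega) phi x ^+ 2.
Proof.
move=> oO finO r0 volB tau0 tau'0 s1 tphi.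
have finB : (vol (eball c r) < +oo)%E by rewrite volB.
have oB : open (eball c r) by exact: open_eball.
have vO : vol Omega = (omega R d * r ^+ d)%:E by rewrite -volB vol_eball// ltW.
have k0 : 0 < tau' / 2 by lra.
have twok : 2 * (tau' / 2) = tau' by field.
set Lam := _ + _; have Lam0 : 0 <= Lam by rewrite addr_ge0 ?sqr_ge0// first_eigenvalue_ge0.
have HB psi : test_function (eball c r) psi -> Lam * \int[vol]_(x in eball c r) psi x ^+ 2
    <= \int[vol]_(x in eball c r) (- lap psi x + tau' / 2 * psi x) ^+ 2.
  move=> tpsi; rewrite (test_energy oB finB)// twok /Lam mulrDl lerD2r.
  apply: le_trans (first_eigenvalue_test oB finB tau0 tpsi) _.
  (* The eigenvalue is taken at [tau] and the energy at [tau']: passing from one to the other only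
     enlarges the gradient term. *)
  rewrite lerD2l; apply: ler_wpM2r; last exact: ltW.
  apply: Rintegral_ge0 => x _.
  by apply: sumr_ge0 => i _; exact: sqr_ge0.
have main psi : test_function Omega psi -> Lam * \int[vol]_(x in Omega) Num.max (psi x) 0 ^+ 2
    <= \int[vol]_(x in Omega) (- lap psi x + tau' / 2 * psi x) ^+ 2.
  move=> tpsi; have [spsi _ _] := tpsi; have [M psiM] := test_support tpsi.
  apply: (positive_part_inequality d_gt0 r0 oO vO k0 Lam0 HB (smooth_C2 spsi) psiM) => x nx.
    exact: test_out tpsi nx.
  by rewrite /lap big1// => i _; exact: test_out (test_partial i (test_partial i tpsi)) nx.
have energy := test_energy oO finO (tau' / 2) tphi; rewrite twok in energy.
rewrite -energy; case: s1 => ->.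
  rewrite (@eq_Rintegral _ _ _ vol Omega (fun x => Num.max (phi x) 0 ^+ 2)) => [|x _]; last by rewrite mul1r.
  exact: main.
(* For [s = -1] the inequality is applied to [- phi], which has the same energy as [phi]. *)
rewrite (@eq_Rintegral _ _ _ vol Omega (fun x => Num.max (- phi x) 0 ^+ 2)) => [|x _]; last by rewrite mulN1r.
apply: le_trans (main _ (test_opp tphi)) _; rewrite le_eqVlt; apply/orP; left; apply/eqP.
have [sphi _ _] := tphi.
by apply: eq_Rintegral => x _; rewrite lap_opp// mulrN -opprD sqrrN.
Qed.

Theorem theorem1 (R : realType) (d : nat) (d_gt0 : (0 < d)%N)
    (tau : R) (tau_ge0 : 0 <= tau)
    (Omega : set 'rV[R]_d) (openO : open Omega)
    (finO : (vol Omega < +oo)%E)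
    (hu : exists u : 'rV[R]_d -> R,
        is_eigenfunction Omega tau (first_eigenvalue Omega tau) u
        /\ no_sign_change Omega u)
    (c : 'rV[R]_d) (r : R) (r_gt0 : 0 < r)
    (volB : vol (eball c r) = vol Omega) :
  first_eigenvalue Omega tau >= first_eigenvalue (eball c r) tau.
Proof.
have [u [[H20u nz eig] nosign]] := hu; have [[L2u _ _] _] := H20u.
have [s s1 us] : exists2 s : R, s = 1 \/ s = -1 & {ae vol, forall x, Omega x -> 0 <= s * u x}.
  case: nosign => us; [exists 1; first by left|exists (-1); first by right].
    by apply: filterS us => x H Ox; rewrite mul1r H.
  by apply: filterS us => x H Ox; rewrite mulN1r oppr_ge0 H.
have GB0 : 0 <= first_eigenvalue (eball c r) tau by exact: first_eigenvalue_ge0.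
set X0 := \int[vol]_(x in Omega) u x ^+ 2.
set X1 := \int[vol]_(x in Omega) \sum_i wpartial Omega i u x ^+ 2.
set X2 := \int[vol]_(x in Omega) wlaplacian Omega u x ^+ 2.
have X1_ge0 : 0 <= X1.
  by apply: Rintegral_ge0 => x _; apply: sumr_ge0 => i _; exact: sqr_ge0.
have X0_gt0 : 0 < X0.
  rewrite lt_neqAle Rintegral_ge0 ?andbT => [|x _]; last exact: sqr_ge0.
  by rewrite eq_sym; apply/eqP => /(Rintegral_sqr_eq0 openO L2u).
have eigE : X2 + tau * X1 = first_eigenvalue Omega tau * X0.
  rewrite -(eig u H20u).
  by congr (_ + _ * _); apply: eq_Rintegral => x _.
rewrite -(ler_pM2r X0_gt0) -eigE; apply/ler_addgt0Pr => e e0.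
(* The excess [(tau' - tau) * X1] is then at most [e]; the 1 covers the case [X1 = 0]. *)
pose tau' := tau + e / (X1 + 1).
have tau'_gt : tau < tau' by rewrite ltrDl divr_gt0//; lra.
have tau'_ge0 : 0 <= tau' by lra.
have := @H20_inequality _ _ _ openO finO u s (first_eigenvalue (eball c r) tau + (tau' / 2) ^+ 2)
  tau' (tau' / 2) H20u s1 (addr_ge0 GB0 (sqr_ge0 _)) tau'_ge0 us
  (fun phi => @positive_part_test _ _ d_gt0 _ _ _ _ _ _ _ openO finO r_gt0 volB tau_ge0 tau'_gt s1).
rewrite -/X0 -/X1 -/X2 mulrDl lerD2r => /le_trans; apply.
rewrite -addrA lerD2l /tau' mulrDl lerD2l mulrAC ler_pdivrMr; last by lra.
by apply: ler_wpM2l; [exact: ltW|lra].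
Qed.
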